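(* Let $V$ be the rank one fermion vertex operator superalgebra with generating fermion $\psi$ and let $g=1$ or $g=\sigma$ (the parity automorphism), with $\theta=1$ for $g=1$ and $\theta=-1$ for $g=\sigma$. For $a=1,\dots,n$ let $\Psi[-\mathbf k^{(a)}]=\psi[-k^{(a)}_1]\cdots\psi[-k^{(a)}_{m_a}]\mathbf 1$ be square bracket Fock vectors, $\mathbf k^{(a)}=k_1^{(a)},\dots,k_{m_a}^{(a)}$ with integers $1\le k^{(a)}_1<\dots<k^{(a)}_{m_a}$. Then the $n$-point function $F_V(g;(\Psi[-\mathbf k^{(1)}],z_1),\dots,(\Psi[-\mathbf k^{(n)}],z_n);\tau)$ vanishes if $\sum_am_a$ is odd, and if $\sum_am_a$ is even it is given by $$F_V(g;(\Psi[-\mathbf k^{(1)}],z_1),\dots,(\Psi[-\mathbf k^{(n)}],z_n);\tau)=\mathrm{Pf}(\mathbf M)\,Z_V(g,\tau),$$ where $\mathbf M$ is the antisymmetric block matrix $$\mathbf M=\left(\begin{array}{cccc}\mathbf C^{(11)}&\mathbf D^{(12)}&\cdots&\mathbf D^{(1n)}\\ \mathbf D^{(21)}&\mathbf C^{(22)}&&\\ \vdots&&\ddots&\\ \mathbf D^{(n1)}&\cdots&&\mathbf C^{(nn)}\end{array}\right)$$ with $$\mathbf C^{(aa)}(i,j)=C\!\left[\begin{array}{c}\theta\\-1\end{array}\right](k^{(a)}_i,k^{(a)}_j,\tau)\quad(1\le i,j\le m_a),$$ $$\mathbf D^{(ab)}(i,j)=D\!\left[\begin{array}{c}\theta\\-1\end{array}\right](k^{(a)}_i,k^{(b)}_j,\tau,z_a-z_b)\quad(1\le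 i\le m_a,\ 1\le j\le m_b).$$ Moreover this $n$-point function is analytic in the $z_i$ and converges absolutely and uniformly on compact subsets of the domain $|q|<|q_{z_{ij}}|<1$ for all $i>j$, where $z_{ij}=z_i-z_j$ and $q_{z}=e^{z}$.
   Context: The rank one fermion VOSA $V=V(H,\mathbb Z+\frac12)$, $H=\mathbb C\psi$, is generated by an odd vector $\psi$ with $Y(\psi,z)=\sum_{n\in\mathbb Z}\psi(n)z^{-n-1}$, $\psi(m)\psi(n)+\psi(n)\psi(m)=\delta_{m+n+1,0}$, $\psi(k)\mathbf 1=0$ for $k\ge0$, with basis $\psi(-k_1)\cdots\psi(-k_m)\mathbf 1$, $1\le k_1<\dots<k_m$. The conformal vector is $\omega=\frac12\psi(-2)\psi(-1)\mathbf 1$, central charge $\frac12$; the basis vector has $L(0)$-weight $\sum_i(k_i-\frac12)$. $\sigma a=(-1)^{p(a)}a$; $\mathrm{STr}_V(X)=\mathrm{Tr}_{V_{\bar0}}(X)-\mathrm{Tr}_{V_{\bar1}}(X)$. Square bracket modes: $Y[v,z]=\sum_{n\in\mathbb Z}v[n]z^{-n-1}=Y(e^{zL(0)}v,e^z-1)$. With $\tau$ in the upper half plane, $q=e^{2\pi i\tau}$, $q_i=e^{z_i}$, $$F_V(g;(v_1,z_1),\dots,(v_n,z_n);\tau)=\mathrm{STr}_V\!\left(g\,Y(q_1^{L(0)}v_1,q_1)\cdots Y(q_n^{L(0)}v_n,q_n)\,q^{L(0)-1/48}\right),\qquad Z_V(g,\tau)=\mathrm{STr}_V(g\,q^{L(0)-1/48}),$$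 where $q_i^{L(0)}=\exp(z_iL(0))$. Twisted functions: for $(\theta,\phi)\in U(1)\times U(1)$, $(\theta,\phi)\ne(1,1)$, $\phi=e^{2\pi i\lambda}$ with $0\le\lambda<1$, and $k\ge 1$, $$P_k\!\left[\begin{array}{c}\theta\\ \phi\end{array}\right](z,\tau)=\frac{(-1)^k}{(k-1)!}\sum_{n\in\mathbb Z+\lambda}\frac{n^{k-1}e^{nz}}{1-\theta^{-1}q^n}\quad(|q|<|e^z|<1),$$ continued meromorphically in $z$ ($q^n=e^{2\pi in\tau}$, $0^0=1$), and for $n\ge1$ $$E_n\!\left[\begin{array}{c}\theta\\ \phi\end{array}\right](\tau)=-\frac{B_n(\lambda)}{n!}+\frac1{(n-1)!}\sum_{r\ge0}\frac{(r+\lambda)^{n-1}\theta^{-1}q^{r+\lambda}}{1-\theta^{-1}q^{r+\lambda}}+\frac{(-1)^n}{(n-1)!}\sum_{r\ge1}\frac{(r-\lambda)^{n-1}\theta q^{r-\lambda}}{1-\theta q^{r-\lambda}},$$ with $B_n(\lambda)$ defined by $\frac{e^{\lambda z}}{e^z-1}=\frac1z+\sum_{n\ge1}\frac{B_n(\lambda)}{n!}z^{n-1}$. For $k,l\ge1$, $$C\!\left[\begin{array}{c}\theta\\ \phi\end{array}\right](k,l,\tau)=(-1)^l\binom{k+l-2}{k-1}E_{k+l-1}\!\left[\begin{array}{c}\theta\\ \phi\end{array}\right](\tau),\qquad D\!\left[\begin{array}{c}\theta\\ \phi\end{array}\right](k,l,\tau,z)=(-1)^{k+1}\binom{k+l-2}{k-1}P_{k+l-1}\!\left[\begin{array}{c}\theta\\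 \phi\end{array}\right](z,\tau).$$ Pfaffian of an antisymmetric $2m\times2m$ matrix: $\mathrm{Pf}(\mathbf M)=\sum_\Pi\varepsilon_{i_1j_1\dots i_mj_m}M(i_1,j_1)\cdots M(i_m,j_m)$, summed over partitions of $\{1,\dots,2m\}$ into pairs with $i_k<j_k$, $i_1<\dots<i_m$, $\varepsilon$ the Levi-Civita symbol. *)

(* Defs.v *)
From HB Require Import structures.
From mathcomp Require Import all_boot all_order all_algebra.
From mathcomp Require Import all_fingroup.
From mathcomp Require Import all_classical all_reals all_analysis.
From mathcomp Require Import complex finmap.
From mathcomp Require Import showcase.summability.

Set Implicit Arguments.
Unset Strict Implicit.
Unset Printing Implicit Defensive.
Import Order.TTheory GRing.Theory Num.Theory numFieldNormedType.Exports.

Local Open Scope classical_set_scope.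
Local Open Scope complex_scope.
Local Open Scope ring_scope.

(* The topology and the norm of R[i] come from its numFieldType structure; the
   norm and the bounds [0 < e] below are R[i]-valued, and [0 < e] forces e to be
   real. *)
HB.instance Definition _ (R : realType) := NormedModule.copy R[i] R[i]^o.

Section ComplexAnalysis.
Variable R : realType.
Implicit Types (z tau : R[i]).

Definition cexp z : R[i] :=
  (expR (complex.Re z))%:C * (cos (complex.Im z) +i* sin (complex.Im z)).

(* [qpow tau x] is q ^ x = exp (2 pi i x tau). *)
Definition qpow tau (x : R) : R[i] := cexp ((0 +i* (2 * pi * x)) * tau).

(* Pole orders are exact and removable singularities are removed, so that a
   meromorphic function is determined off its poles by its values on any
   nonempty open set; its value at a pole is arbitrary. *)
Definition meromorphic_at (f : R[i] -> R[i]) z0 : Prop :=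
  exists (N : nat) (a : R[i]^nat),
    (if N == 0%N then f z0 = a 0%N else a 0%N != 0) /\
    \forall z \near z0^',
      series (fun k => a k * (z - z0) ^+ k) @ \oo --> (z - z0) ^+ N * f z.

Definition meromorphic (f : R[i] -> R[i]) : Prop :=
  forall z0, meromorphic_at f z0.

Definition monomial (n : nat) (h : 'rV[R[i]]_n) (al : {ffun 'I_n -> nat}) : R[i] :=
  \prod_(i < n) h 0 i ^+ al i.

(* Joint analyticity in n complex variables: near z0, f is the unordered sum of
   a power series in z - z0 indexed by the exponents. *)
Definition analytic_at (n : nat) (f : 'rV[R[i]]_n -> R[i]) (z0 : 'rV[R[i]]_n) :=
  exists a : {ffun 'I_n -> nat} -> R[i],
    \forall z \near z0,
      partial_sum (fun al => a al * monomial (z - z0) al) @ totally --> f z.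

(* Uniform Cauchy criterion for the unordered sums of absolute values. *)
Definition abs_unif_summable_on (I : choiceType) (T : Type)
    (t : T -> I -> R[i]) (D : set T) : Prop :=
  forall e : R[i], 0 < e -> exists A : {fset I}, forall B : {fset I},
    [disjoint A & B]%fset -> forall x, D x -> partial_sum (fun i => `|t x i|) B < e.

End ComplexAnalysis.

Section LaurentCoefficients.
Variable R : realType.

Definition binz (m : int) (j : nat) : R[i] :=
  (\prod_(i < j) (m%:~R - i%:R)) / j`!%:R.

(* Formal power series in one variable are given by their coefficients. *)
Definition fps_mul (a b : R[i]^nat) : R[i]^nat :=
  fun k => \sum_(i < k.+1) a i * b (k - i)%N.

Definition fps_pow (a : R[i]^nat) (j : nat) : R[i]^nat :=
  iter j (fps_mul a) (fun k => (k == 0%N)%:R).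

(* [expm1_coef w N k] is the coefficient of x ^ k in
   e ^ (w x) ((e ^ x - 1) / x) ^ N, i.e. that of x ^ (N + k) in
   e ^ (w x) (e ^ x - 1) ^ N; the N-th power is expanded by the binomial series
   in (e ^ x - 1) / x - 1 = \sum_(k >= 1) x ^ k / (k + 1)!. *)
Definition expm1_coef (w : R[i]) (N : int) : R[i]^nat :=
  let u : R[i]^nat := fun k => if k == 0%N then 0 else (k.+1)`!%:R^-1 in
  fps_mul (fun k => w ^+ k / k`!%:R)
          (fun k => \sum_(j < k.+1) binz N j * fps_pow u j k).

(* e ^ (lam x) / (e ^ x - 1) = \sum_(n >= 0) B_n(lam) / n! x ^ (n - 1). *)
Definition bernoulli (n : nat) (lam : R[i]) : R[i] :=
  n`!%:R * expm1_coef lam (-1) n.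

End LaurentCoefficients.

Section TwistedFunctions.
Variable R : realType.
Implicit Types (theta phi tau z : R[i]).

Definition twist phi : R :=
  xget 0 [set l : R | 0 <= l < 1 /\ phi = cexp (0 +i* (2 * pi * l))].

Definition Pseries theta phi (k : nat) tau z : R[i] :=
  let lam := twist phi in
  (-1) ^+ k / (k.-1)`!%:R *
  sum (fun m : int => let x : R := m%:~R + lam in
    x%:C ^+ k.-1 * cexp (x%:C * z) / (1 - theta^-1 * qpow tau x)).

Definition Ptwisted theta phi (k : nat) tau : R[i] -> R[i] :=
  xget (fun=> 0) [set f : R[i] -> R[i] | meromorphic f /\
    forall z, `|qpow tau 1| < `|cexp z| < 1 -> f z = Pseries theta phi k tau z].

Definition Etwisted theta phi (n : nat) tau : R[i] :=
  let lam := twist phi in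
  - bernoulli n lam%:C / n`!%:R
  + (n.-1)`!%:R^-1 * limn (series (fun r : nat => let x : R := r%:R + lam in
      x%:C ^+ n.-1 * theta^-1 * qpow tau x / (1 - theta^-1 * qpow tau x)))
  + (-1) ^+ n / (n.-1)`!%:R * limn (series (fun r : nat =>
      let x : R := r.+1%:R - lam in
      x%:C ^+ n.-1 * theta * qpow tau x / (1 - theta * qpow tau x))).

Definition Ctwisted theta phi (k l : nat) tau : R[i] :=
  (-1) ^+ l * 'C(k + l - 2, k.-1)%:R * Etwisted theta phi (k + l).-1 tau.

Definition Dtwisted theta phi (k l : nat) tau z : R[i] :=
  (-1) ^+ k.+1 * 'C(k + l - 2, k.-1)%:R * Ptwisted theta phi (k + l).-1 tau z.

End TwistedFunctions.

(* A partition into pairs i_1 < j_1, ..., i_m < j_m with i_1 < ... < i_m is the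
   permutation listing i_1, j_1, ..., i_m, j_m.  Only meaningful for N even. *)
Definition Pfaffian (K : pzRingType) (N : nat) (M : 'M[K]_N) : K :=
  \sum_(s : 'S_N | [forall i : 'I_N, forall j : 'I_N,
      ~~ odd i && ((j == i.+1 :> nat) || (j == i.+2 :> nat)) ==> (s i < s j)%N])
    (-1) ^+ s * \prod_(i < N) \prod_(j < N | ~~ odd i && (j == i.+1 :> nat))
      M (s i) (s j).

Definition pf_matrix (R : realType) (n : nat) (theta phi : R[i])
    (k : 'I_n -> seq nat) (z : 'rV[R[i]]_n) (tau : R[i]) :
    'M[R[i]]_(\sum_(a < n) size (k a)) :=
  \mxblock_(a < n, b < n)
    \matrix_(i < size (k a), j < size (k b))
      if a == b then Ctwisted theta phi (nth 0%N (k a) i) (nth 0%N (k b) j) tau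
      else Dtwisted theta phi (nth 0%N (k a) i) (nth 0%N (k b) j) tau
             (z 0 a - z 0 b).

(* In the data of a vertex operator superalgebra over R[i], the superspace
   structure is given by the parity involution [sigma], V_p being its (-1) ^ p
   eigenspace, and [mode a n] is a(n) in Y(a, z) = \sum_n a(n) z ^ (- n - 1). *)
Record vosa_data (R : realType) := VosaData {
  vosa_sort :> lmodType R[i];
  sigma : vosa_sort -> vosa_sort;
  mode : vosa_sort -> int -> vosa_sort -> vosa_sort;
  vacuum : vosa_sort;
  omega : vosa_sort;
  charge : R[i]
}.
Arguments sigma {R} _ _.
Arguments mode {R _} _ _ _.
Arguments vacuum {R} _.
Arguments omega {R} _.
Arguments charge {R} _.

Section VOSA.
Variables (R : realType) (V : vosa_data R).
Implicit Types (a b u v w : V) (c : R[i]) (m n k : int) (p : bool).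

Definition parity p v : Prop := sigma V v = (-1) ^+ p *: v.

Definition L n v : V := mode (omega V) (n + 1) v.

(* The sums in [jacobi], which is the Jacobi identity in Borcherds' component
   form, are finitely supported by [truncation]. *)
Record is_vosa : Prop := IsVosa {
  sigma_linear : forall c u v, sigma V (c *: u + v) = c *: sigma V u + sigma V v;
  sigmaK : forall v, sigma V (sigma V v) = v;
  mode_linearl : forall c a b n v,
    mode (c *: a + b) n v = c *: mode a n v + mode b n v;
  mode_linearr : forall c a n v w,
    mode a n (c *: v + w) = c *: mode a n v + mode a n w;
  mode_parity : forall p p' a n v,
    parity p a -> parity p' v -> parity (p (+) p') (mode a n v);
  vacuum_parity : parity false (vacuum V);
  omega_parity : parity false (omega V);
  truncation : forall a v, exists N : int, forall n, N <= n -> mode a n v = 0;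
  vacuum_mode : forall n v, mode (vacuum V) n v = (n == -1)%:R *: v;
  creation : forall a, mode a (-1) (vacuum V) = a /\
    forall n, 0 <= n -> mode a n (vacuum V) = 0;
  jacobi : forall p p' a b v m n k, parity p a -> parity p' b ->
    \sum_(j \in [set: nat])
      binz R m j *: mode (mode a (n + j%:Z) b) (m + k - j%:Z) v
    = \sum_(j \in [set: nat]) ((-1) ^+ j * binz R n j) *:
        (mode a (m + n - j%:Z) (mode b (k + j%:Z) v)
         - ((-1) ^+ (p && p') * (-1) ^ n) *:
             mode b (n + k - j%:Z) (mode a (m + j%:Z) v));
  virasoro : forall m n v,
    L m (L n v) - L n (L m v) = (m - n)%:~R *: L (m + n) v
      + ((m + n == 0)%:R * (m ^+ 3 - m)%:~R / 12%:R * charge V) *: v;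
  translation : forall a n v,
    mode (L (-1) a) n v = - n%:~R *: mode a (n - 1) v;
  grading : forall v, exists s : seq (int * V),
    (forall x, x \in s -> L 0 x.2 = (x.1%:~R / 2) *: x.2) /\
    v = \sum_(x <- s) x.2;
  grading_bounded : exists N : int, forall n v,
    L 0 v = (n%:~R / 2) *: v -> n < N -> v = 0;
  grading_finite : forall n, exists s : seq V, forall v,
    L 0 v = (n%:~R / 2) *: v ->
    exists x : nat -> R[i], v = \sum_(i < size s) x i *: s`_i
}.

End VOSA.

Section Fermion.
Variables (R : realType) (V : vosa_data R) (psi : V).

Definition fock (k : seq nat) : V :=
  foldr (fun i v => mode psi (- i%:Z) v) (vacuum V) k.

Definition fock_index : choiceType := {k : seq nat | path ltn 0%N k}.

Definition is_fock_coord (v : V) (c : fock_index -> R[i]) : Prop :=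
  finite_set [set k | c k != 0] /\
  v = \sum_(k \in [set: fock_index]) c k *: fock (val k).

Definition fock_weight (k : seq nat) : R := \sum_(i <- k) (i%:R - 2^-1).

Record rank_one_fermion : Prop := RankOneFermion {
  fermion_vosa : is_vosa V;
  psi_odd : parity true psi;
  psi_anticomm : forall (m n : int) v,
    mode psi m (mode psi n v) + mode psi n (mode psi m v) = (m + n + 1 == 0)%:R *: v;
  psi_vacuum : forall m : int, 0 <= m -> mode psi m (vacuum V) = 0;
  fock_basis : forall v, exists! c, is_fock_coord v c;
  fermion_omega : omega V = 2^-1 *: mode psi (-2) (mode psi (-1) (vacuum V));
  fermion_charge : charge V = 2^-1;
  fock_L0 : forall k : fock_index,
    L 0 (fock (val k)) = (fock_weight (val k))%:C *: fock (val k)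
}.

Definition fock_coord (v : V) : fock_index -> R[i] :=
  xget (fun=> 0) [set c | is_fock_coord v c].

(* exp (x L(0)) *)
Definition expL0 (x : R[i]) (v : V) : V :=
  \sum_(k \in [set: fock_index])
    (fock_coord v k * cexp (x * (fock_weight (val k))%:C)) *: fock (val k).

(* The coefficient v[n] of x ^ (- n - 1) in Y(e ^ (x L(0)) v, e ^ x - 1), the
   summation index j being m - n for the mode m of the Fock components of v. *)
Definition sqmode (v : V) (n : int) (u : V) : V :=
  \sum_(k \in [set: fock_index]) fock_coord v k *:
    \sum_(j \in [set: nat])
      expm1_coef (fock_weight (val k))%:C (- (n + j%:Z) - 1) j *:
        mode (fock (val k)) (n + j%:Z) u.

Definition sqfock (k : seq nat) : V :=
  foldr (fun i v => sqmode psi (- i%:Z) v) (vacuum V) k.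

(* The contribution of the basis vector k to STr_V (X q ^ (L(0) - 1/48)). *)
Definition str_term (X : V -> V) (tau : R[i]) (k : fock_index) : R[i] :=
  (-1) ^+ size (val k) * fock_coord (X (fock (val k))) k
  * qpow tau (fock_weight (val k) - 48%:R^-1).

Definition Zfun (g : V -> V) (tau : R[i]) : R[i] := sum (str_term g tau).

(* The n-point function is the sum over the modes (m_1, ..., m_n) of the n
   vertex operators and over the basis vectors of V. *)
Definition npoint_term (n : nat) (g : V -> V) (v : 'I_n -> V)
    (z : 'rV[R[i]]_n) (tau : R[i]) (x : {ffun 'I_n -> int} * fock_index) : R[i] :=
  str_term
    (fun u => g (foldr (fun a w => mode (expL0 (z 0 a) (v a)) (x.1 a) w) u (enum 'I_n)))
    tau x.2
  * \prod_(a < n) cexp (z 0 a) ^ (- x.1 a - 1).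

Definition npoint (n : nat) (g : V -> V) (v : 'I_n -> V)
    (z : 'rV[R[i]]_n) (tau : R[i]) : R[i] := sum (npoint_term g v z tau).

End Fermion.

Definition npoint_domain (R : realType) (n : nat) (z : 'rV[R[i]]_n) (tau : R[i]) :
    Prop :=
  0 < complex.Im tau /\ forall i j : 'I_n, (j < i)%N ->
    `|qpow tau 1| < `|cexp (z 0 i - z 0 j)| < 1.

(* Main.v *)
Require Import Defs.
From mathcomp Require Import all_boot all_order all_algebra all_fingroup.
From mathcomp Require Import all_classical all_reals all_analysis.
From mathcomp Require Import complex finmap ring lra zify.
From mathcomp Require Import showcase.summability.

Set Implicit Arguments.
Unset Strict Implicit.
Unset Printing Implicit Defensive.
Import Order.TTheory GRing.Theory Num.Theory numFieldNormedType.Exports.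

Local Open Scope classical_set_scope.
Local Open Scope complex_scope.
Local Open Scope ring_scope.

(** Toggling an index, a mode of psi maps a Fock basis vector to a multiple of another one, so
    the iterate formula bounds the vertex operators of Fock vectors between weighted l1-norms and
    the traces converge absolutely in the given domain.  Writing the first vector as psi[-k] v
    and moving the modes of psi around the trace, by their anticommutators with the other vectors
    and the cyclicity of the trace, gives a recursion which removes two fermions at a time: the
    expansion of the Pfaffian along its first row.  Its coefficients are Lambert series; those of
    two different vectors are the values of P_k in one annulus, and P_k is continued by
    quasi-periodicity from an explicit rational function of e^z plus convergent tails, the
    identity theorem along a segment showing that no other continuation exists.  Finally the
    terms of the n-point function are exponentials in the z_i, hence dominated near a point by
    their values at finitely many shifted points, which gives uniform convergence and power
    series. *)

(** * Unordered sums *)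

(** The sign of the supertrace and the eigenvalue of [g] on a basis vector with s fermions combine
    to (-theta)^s, and theta^2 = 1, so both choices of [g] are one trace. Moving psi(m) once around
    it costs the factor -theta q^(-(m + 1/2)); the resulting linear equation is solvable for every m
    because |q^(m + 1/2)| is never 1, and its solution carries the denominators 1 - theta q^n with n
    in Z + 1/2. This is the origin of phi = -1, that is lambda = 1/2. The obstacle is that psi[-k] v
    is a finite combination of vectors psi(n) v, whereas the vertex operator of psi(n) v is an
    infinite sum of products of modes, and this sum must be exchanged with the trace. Operators are
    therefore bounded from one radius to another, summed over all their modes. The creating modes in
    psi[-k] produce the Lambert series; the annihilating ones meet only fermions of the same vector
    and produce the Bernoulli term of E. Square bracket modes keep the coefficients simple: in the
    coordinate e^x - 1 the binomial sums collapse to powers of m + 1/2. *)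

Section ComplexNorm.
Variable R : realType.
Implicit Types x y : R[i].

(** The norm of [R[i]] takes values in [R[i]]; the estimates need a modulus in the ordered field
    [R], where [lra], [expR] and extended real sums apply. *)
Definition nc x : R := complex.Re `|x|.

Lemma ncE x : `|x| = (nc x)%:C.
Proof. by rewrite /nc RRe_real// normr_real. Qed.

Lemma nc0 : nc 0 = 0. Proof. by rewrite /nc normr0. Qed.
Lemma nc1 : nc 1 = 1. Proof. by rewrite /nc normr1. Qed.
Lemma ncM x y : nc (x * y) = nc x * nc y.
Proof. by apply: complexI; rewrite rmorphM/= -!ncE normrM. Qed.
Lemma ncN x : nc (- x) = nc x. Proof. by rewrite /nc normrN. Qed.
Lemma nc_ge0 x : 0 <= nc x. Proof. by rewrite -ler0c -ncE. Qed.
Lemma le_ncD x y : nc (x + y) <= nc x + nc y.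
Proof. by rewrite -lecR rmorphD/= -!ncE ler_normD. Qed.
Lemma le_ncB x y : nc (x - y) <= nc x + nc y.
Proof. by rewrite -(ncN y); apply: le_ncD. Qed.
Lemma nc_eq0 x : (nc x == 0) = (x == 0).
Proof.
by rewrite -(normr_eq0 x) ncE; apply/eqP/eqP => [->//|[]].
Qed.
Lemma nc_gt0 x : (0 < nc x) = (x != 0).
Proof. by rewrite lt0r nc_ge0 nc_eq0 andbT. Qed.
Lemma ncX x n : nc (x ^+ n) = nc x ^+ n.
Proof. by elim: n => [|n IH]; rewrite ?expr0 ?nc1// !exprS ncM IH. Qed.
Lemma ncV x : nc x^-1 = (nc x)^-1.
Proof. by apply: complexI; rewrite -ncE normfV ncE fmorphV. Qed.
Lemma nc_real (a : R) : nc a%:C = `|a|.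
Proof. by rewrite /nc normc_def/= expr0n addr0 sqrtr_sqr. Qed.
Lemma nc_nat n : nc n%:R = n%:R.
Proof. by rewrite /nc normr_nat -(rmorph_nat (real_complex R)). Qed.
Lemma nc_sign n : nc ((-1) ^+ n) = 1. Proof. by rewrite /nc normr_sign. Qed.
Lemma le_nc_sum (I : Type) (r : seq I) (F : I -> R[i]) :
  nc (\sum_(i <- r) F i) <= \sum_(i <- r) nc (F i).
Proof.
elim: r => [|a r IH]; first by rewrite !big_nil nc0.
by rewrite !big_cons (le_trans (le_ncD _ _))// lerD2l.
Qed.
Lemma nc_Re_le x : `|complex.Re x| <= nc x.
Proof.
by rewrite /nc normc_def/= -sqrtr_sqr ler_wsqrtr// lerDl sqr_ge0.
Qed.
Lemma nc_Im_le x : `|complex.Im x| <= nc x.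
Proof.
by rewrite /nc normc_def/= -sqrtr_sqr ler_wsqrtr// lerDr sqr_ge0.
Qed.
End ComplexNorm.

Section NonnegSums.
Variable R : realType.
Implicit Types (I J : choiceType).
Local Open Scope ereal_scope.

(** Summing over the whole type, with the value +oo allowed, makes Tonelli and reindexing
    unconditional; summability is checked only at the end, as finiteness. *)
Definition es I (a : I -> \bar R) : \bar R := \esum_(i in [set: I]) a i.

Lemma es_ge0 I (a : I -> \bar R) : (forall i, 0 <= a i) -> 0 <= es a.
Proof. by move=> a0; apply: esum_ge0. Qed.

Lemma es_ub I (a : I -> \bar R) M :
  (forall A : {fset I}, \sum_(i <- A) a i <= M) -> es a <= M.
Proof.
move=> h; apply: ge_ereal_sup => _ [A [finA _] <-].
by rewrite fsbig_finite//; apply: h.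
Qed.

Lemma es_fset I (a : I -> \bar R) (A : {fset I}) : \sum_(i <- A) a i <= es a.
Proof.
apply: esum_ge; exists [set` A]; first by split.
by rewrite -fsbig_seq.
Qed.

Lemma es_term I (a : I -> \bar R) i : a i <= es a.
Proof. by have := es_fset a [fset i]%fset; rewrite big_seq_fset1. Qed.

Lemma le_es I (a b : I -> \bar R) : (forall i, a i <= b i) -> es a <= es b.
Proof. by move=> h; apply: le_esum. Qed.

Lemma eq_es I (a b : I -> \bar R) : a =1 b -> es a = es b.
Proof. by move=> h; apply: eq_esum. Qed.

Lemma es_D I (a b : I -> \bar R) : (forall i, 0 <= a i) -> (forall i, 0 <= b i) ->
  es (fun i => a i + b i) = es a + es b.
Proof. by move=> a0 b0; apply: esumD. Qed.

Lemma es_pair I J (a : I -> J -> \bar R) : (forall i j, 0 <= a i j) ->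
  es (fun x : I * J => a x.1 x.2) = es (fun i => es (a i)).
Proof.
move=> a0; rewrite /es esum_esum//; apply: congr2 => //.
by apply/seteqP; split.
Qed.

Lemma es_bij I J (f : I -> J) (a : J -> \bar R) :
  bijective f -> es (fun i => a (f i)) = es a.
Proof.
move=> [g fK gK]; rewrite /es (@reindex_esum _ _ _ [set: I] _ f)//.
split => //; first by move=> x y _ _ /(congr1 g); rewrite !fK.
by move=> y _; exists (g y).
Qed.

Lemma es_inj I J (f : I -> J) (a : J -> \bar R) : (forall j, 0 <= a j) ->
  injective f -> es (fun i => a (f i)) <= es a.
Proof.
move=> a0 fi; rewrite /es -(esum_image [set: I] f a)/=; last first.
  by move=> x y _ _ /fi.
rewrite (esum_mkcond (f @` _)); apply: le_esum => j _.
by case: ifP.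
Qed.

Lemma es_inj_eq I J (f : I -> J) (a : J -> \bar R) : (forall j, 0 <= a j) ->
  injective f -> (forall j, (exists i, f i = j) \/ a j = 0) ->
  es (fun i => a (f i)) = es a.
Proof.
move=> a0 fi h; rewrite /es -(esum_image [set: I] f a)/=; last first.
  by move=> x y _ _ /fi.
rewrite (esum_mkcond (f @` _)); apply: eq_esum => j _.
case: ifPn => // /negP nj; case: (h j) => // -[i fij]; case: nj.
by apply/mem_set; exists i.
Qed.

Lemma es_exch I J (a : I -> J -> \bar R) : (forall i j, 0 <= a i j) ->
  es (fun i => es (a i)) = es (fun j => es (fun i => a i j)).
Proof.
move=> a0; rewrite -!es_pair//.
rewrite -(@es_bij (J * I)%type (I * J)%type (fun x => (x.2, x.1)))//.
by exists (fun x => (x.2, x.1)); case.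
Qed.

Lemma es_Zl I (c : R) (a : I -> \bar R) : (0 <= c)%R -> (forall i, 0 <= a i) ->
  es (fun i => c%:E * a i) = c%:E * es a.
Proof.
have le (d : R) (b : I -> \bar R) : (0 <= d)%R -> (forall i, 0 <= b i) ->
    es (fun i => d%:E * b i) <= d%:E * es b.
  move=> d0 b0; apply: es_ub => A; rewrite -ge0_sume_distrr//.
  by rewrite lee_pmul// ?sume_ge0// es_fset.
move=> c0 a0; apply/eqP; rewrite eq_le le//=.
have [->|cn0] := eqVneq c 0%R.
  by rewrite mul0e es_ge0// => i; rewrite mul0e.
have ci : (0 <= c^-1)%R by rewrite invr_ge0.
have ca i : 0 <= c%:E * a i by rewrite mule_ge0.
have := le c^-1%R (fun i => c%:E * a i) ci ca.
under eq_es do rewrite muleA -EFinM mulVf// mul1e.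
move=> h; have : c%:E * es a <= c%:E * (c^-1%:E * es (fun i => c%:E * a i)).
  by rewrite lee_pmul// es_ge0.
by rewrite muleA -EFinM divff// mul1e.
Qed.

Lemma es_sum I J (r : seq J) (a : I -> J -> \bar R) : (forall i j, 0 <= a i j) ->
  es (fun i => \sum_(j <- r) a i j) = \sum_(j <- r) es (fun i => a i j).
Proof. by move=> a0; rewrite /es esum_sum. Qed.

Lemma es_single I (i0 : I) (a : I -> \bar R) : 0 <= a i0 ->
  (forall i, i != i0 -> a i = 0) -> es a = a i0.
Proof.
move=> a0 h; have a1 i : 0 <= a i.
  by have [->//|/h->] := eqVneq i i0.
apply/eqP; rewrite eq_le es_term andbT; apply: es_ub => A.
have [iA|iA] := boolP (i0 \in A).
  rewrite (big_fsetD1 i0)//= big_seq big1 ?adde0// => i.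
  by rewrite !inE => /andP[/h].
rewrite big_seq big1// => i iAA; apply: h; apply: contraNneq iA => <-//.
Qed.

End NonnegSums.

Section ComplexSums.
Variable R : realType.
Implicit Types (I J : choiceType).
Notation C := (R[i]).

(** Convergence along the finite subsets with real bounds and no filter; [hs_cvg] translates it into
    the limit of [partial_sum] that defines [sum]. *)
Definition hs I (u : I -> C) (s : C) := forall e : R, 0 < e ->
  exists A : {fset I}, forall B : {fset I}, (A `<=` B)%fset ->
    nc (\sum_(i <- B) u i - s) <= e.

Definition asum I (u : I -> C) : \bar R := es (fun i => (nc (u i))%:E).
Definition summ I (u : I -> C) := (asum u < +oo)%E.

Lemma asum_ge0 I (u : I -> C) : (0 <= asum u)%E.
Proof. by apply: es_ge0 => i; rewrite lee_fin nc_ge0. Qed.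

Lemma summ_le I (u v : I -> C) : (forall i, nc (u i) <= nc (v i)) ->
  summ v -> summ u.
Proof.
by move=> h; apply: le_lt_trans; apply: le_es => i; rewrite lee_fin.
Qed.

Lemma summ_eq I (u v : I -> C) : u =1 v -> summ v -> summ u.
Proof. by move=> h; apply: summ_le => i; rewrite h. Qed.

Lemma asum_fset I (u : I -> C) (A : {fset I}) :
  ((\sum_(i <- A) nc (u i))%:E <= asum u)%E.
Proof. by rewrite -sumEFin; apply: es_fset. Qed.

Lemma asumZ I (c : C) (u : I -> C) :
  asum (fun i => c * u i) = ((nc c)%:E * asum u)%E.
Proof.
rewrite /asum -es_Zl ?nc_ge0//; last by move=> i; rewrite lee_fin nc_ge0.
by apply: eq_es => i; rewrite ncM EFinM.
Qed.

Lemma asumN I (u : I -> C) : asum (fun i => - u i) = asum u.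
Proof. by apply: eq_es => i; rewrite ncN. Qed.

Lemma asumD I (u v : I -> C) : (asum (fun i => (u i + v i)%R) <= asum u + asum v)%E.
Proof.
rewrite /asum -es_D; [|by move=> i; rewrite lee_fin nc_ge0..].
by apply: le_es => i; rewrite -EFinD lee_fin le_ncD.
Qed.

Lemma summZ I (c : C) (u : I -> C) : summ u -> summ (fun i => c * u i).
Proof.
move=> h; rewrite /summ asumZ lte_mul_pinfty// ?lee_fin ?nc_ge0//.
Qed.

Lemma summD I (u v : I -> C) : summ u -> summ v -> summ (fun i => u i + v i).
Proof. by move=> hu hv; apply: le_lt_trans (asumD _ _) _; rewrite lte_add_pinfty. Qed.

Lemma summN I (u : I -> C) : summ u -> summ (fun i => - u i).
Proof. by rewrite /summ asumN. Qed.

Lemma summ0 I : summ (fun _ : I => 0 : C).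
Proof. by rewrite /summ /asum /es esum1 ?ltey// => i _; rewrite nc0. Qed.

Lemma summ_fin I (u : I -> C) : summ u -> asum u \is a fin_num.
Proof. by move=> h; rewrite ge0_fin_numE ?asum_ge0. Qed.

Lemma summ_tail I (u : I -> C) (e : R) : summ u -> 0 < e ->
  exists A : {fset I}, forall B : {fset I}, [disjoint A & B]%fset ->
    \sum_(i <- B) nc (u i) <= e.
Proof.
move=> hu e0; have fu := summ_fin hu.
have [_ [F [finF _] <-]] := ub_ereal_sup_adherent e0 fu.
rewrite fsbig_finite//=; move: (fset_set F) => A hF; exists A => B dB.
have := asum_fset u (A `|` B)%fset.
rewrite -(fineK fu) lee_fin => h1.
have {}hF : (asum u - e%:E < \sum_(x <- A) (nc (u x))%:E)%E := hF.
move: hF; rewrite -(fineK fu) sumEFin -EFinB lte_fin => hF.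
move: h1; rewrite (big_fsetID _ (mem (A)))/=.
rewrite (_ : [fset x | x in (A `|` B) & x \in A]%fset = A);
  last by apply/fsetP => x; rewrite !inE; case: (x \in A); rewrite ?andbF.
rewrite (_ : [fset x | x in (A `|` B) & x \notin A]%fset = B);
  last first.
  apply/fsetP => x; rewrite !inE; case xF: (x \in A) => //=.
    by apply/esym/negP => xB; move/fdisjointP: dB => /(_ x xF)/negP[].
  by rewrite andbT.
lra.
Qed.

Lemma hs_eq I (u v : I -> C) s : u =1 v -> hs u s -> hs v s.
Proof. by move=> /funext->. Qed.

Lemma hsD I (u v : I -> C) s t : hs u s -> hs v t -> hs (fun i => u i + v i) (s + t).
Proof.
move=> hu hv e e0; have e2 : 0 < e / 2 by rewrite divr_gt0.
have [A hA] := hu _ e2; have [B hB] := hv _ e2; exists (A `|` B)%fset => D.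
rewrite fsubUset => /andP[/hA hAD /hB hBD]; rewrite big_split/=.
rewrite opprD addrACA (le_trans (le_ncD _ _))//; lra.
Qed.

Lemma hsZ I (c : C) (u : I -> C) s : hs u s -> hs (fun i => c * u i) (c * s).
Proof.
move=> hu e e0; have c1 : 0 < nc c + 1 by rewrite ltr_wpDl ?nc_ge0.
have [A hA] := hu (e / (nc c + 1)) (divr_gt0 e0 c1); exists A => B /hA h.
rewrite -mulr_sumr -mulrBr ncM; apply: (@le_trans _ _ ((nc c + 1) * (e / (nc c + 1)))).
  by rewrite ler_pM ?nc_ge0// lerDl.
by rewrite mulrCA divff ?mulr1// gt_eqF.
Qed.

Lemma hsN I (u : I -> C) s : hs u s -> hs (fun i => - u i) (- s).
Proof.
move=> /(hsZ (-1)); rewrite mulN1r; apply: hs_eq => i; exact: mulN1r.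
Qed.

Lemma hs_nneg I (f : I -> R) (M : R) : (forall i, 0 <= f i) ->
  (forall A : {fset I}, \sum_(i <- A) f i <= M) -> exists s : C, hs (fun i => (f i)%:C) s.
Proof.
move=> f0 fM; pose S := [set x | exists A : {fset I}, x = \sum_(i <- A) f i].
have hS : has_sup S.
  split; first by exists (\sum_(i <- fset0) f i); exists fset0.
  by exists M => _ [A ->].
exists (sup S)%:C => e e0; have [_ [A ->] hA] := sup_adherent e0 hS.
exists A => B AB; rewrite -rmorph_sum -rmorphB nc_real/=.
have h1 : \sum_(i <- B) f i <= sup S by apply: sup_upper_bound => //; exists B.
have h2 : \sum_(i <- A) f i <= \sum_(i <- B) f i.
  rewrite [X in _ <= X](big_fsetID _ (mem A))/=.
  rewrite (_ : [fset x | x in B & x \in A]%fset = A) ?lerDl ?sumr_ge0//.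
  apply/fsetP => x; rewrite !inE andbC; case xA: (x \in A) => //=.
  by rewrite (fsubsetP AB).
rewrite ler_norml; apply/andP; split; lra.
Qed.

Lemma summ_hs I (u : I -> C) : summ u -> exists s, hs u s.
Proof.
move=> hu; pose M := fine (asum u).
have hM (A : {fset I}) : \sum_(i <- A) nc (u i) <= M.
  by rewrite -lee_fin fineK ?asum_fset// summ_fin.
have part (g : C -> R) : (forall x, `|g x| <= nc x) ->
    exists s, hs (fun i => (g (u i))%:C) s.
  (* [g + nc] is nonnegative because [|g| <= nc], so both it and [nc] have bounded increasing
     partial sums; the part [g] is their difference. *)
  move=> hg; have [s1 h1] : exists s, hs (fun i => (g (u i) + nc (u i))%:C) s.
    apply: (@hs_nneg _ _ (M + M)) => [i|A].
      by have := hg (u i); rewrite ler_norml => /andP[]; lra.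
    rewrite big_split/= lerD// (le_trans _ (hM A))// ler_sum// => i _.
    by rewrite (le_trans (ler_norm _)).
  have [s2 h2] : exists s, hs (fun i => (nc (u i))%:C) s.
    by apply: (@hs_nneg _ _ M) => // i; apply: nc_ge0.
  exists (s1 - s2); apply: hs_eq (hsD h1 (hsN h2)) => i.
  by rewrite rmorphD/= addrK.
have [s1 h1] := part _ (@nc_Re_le R); have [s2 h2] := part _ (@nc_Im_le R).
exists (s1 + 'i%C * s2); apply: hs_eq (hsD h1 (hsZ 'i%C h2)) => i.
by rewrite -complexE.
Qed.

Lemma hs_cvg I (u : I -> C) s : hs u s -> partial_sum u @ totally --> s.
Proof.
move=> hu; apply/(@cvgrPdist_le _ _ _ totally totally_filter) => e e0.
have e0' : 0 < complex.Re e by move: e0; rewrite ltcE => /andP[].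
have [A hA] := hu _ e0'; exists A => // B /= /hA; rewrite distrC.
rewrite /partial_sum -(big_seq_fsetE _ _ predT)/= ncE => h.
rewrite lecE/= (ger0_Im (ltW e0)) eqxx/=; exact: h.
Qed.

Lemma hs_sum I (u : I -> C) s : hs u s -> sum u = s.
Proof.
by move=> /hs_cvg h; apply: (@cvg_lim _ _ _ _ totally_filter) => //; apply: norm_hausdorff.
Qed.

Lemma summ_sumP I (u : I -> C) : summ u -> hs u (sum u).
Proof. by move=> /summ_hs[s h]; rewrite (hs_sum h). Qed.

Lemma eq_sum I (u v : I -> C) : u =1 v -> sum u = sum v.
Proof. by move=> /funext->. Qed.

Lemma sumD I (u v : I -> C) : summ u -> summ v ->
  sum (fun i => u i + v i) = sum u + sum v.
Proof. by move=> /summ_sumP hu /summ_sumP hv; apply/hs_sum/hsD. Qed.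

Lemma sumZ I (c : C) (u : I -> C) : summ u -> sum (fun i => c * u i) = c * sum u.
Proof. by move=> /summ_sumP hu; apply/hs_sum/hsZ. Qed.

Lemma sumN I (u : I -> C) : summ u -> sum (fun i => - u i) = - sum u.
Proof. by move=> /summ_sumP hu; apply/hs_sum/hsN. Qed.

Lemma hs0 I : hs (fun _ : I => 0 : C) 0.
Proof. by move=> e e0; exists fset0 => B _; rewrite big1// subr0 nc0 ltW. Qed.

Lemma sum0 I (u : I -> C) : (forall i, u i = 0) -> sum u = 0.
Proof. by move=> h; apply: hs_sum; apply: hs_eq (hs0 I). Qed.

Lemma hs_sumr I (T : Type) (r : seq T) (u : T -> I -> C) (s : T -> C) :
  (forall t, hs (u t) (s t)) -> hs (fun i => \sum_(t <- r) u t i) (\sum_(t <- r) s t).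
Proof.
move=> h; elim: r => [|t r IH].
  by rewrite big_nil; apply: hs_eq (hs0 I) => i; rewrite big_nil.
by rewrite big_cons; apply: hs_eq (hsD (h t) IH) => i; rewrite big_cons.
Qed.

Lemma sum_sumr I (T : Type) (r : seq T) (u : T -> I -> C) :
  (forall t, summ (u t)) ->
  sum (fun i => \sum_(t <- r) u t i) = \sum_(t <- r) sum (u t).
Proof. by move=> h; apply/hs_sum/hs_sumr => t; apply: summ_sumP. Qed.

Lemma hs_finsupp I (u : I -> C) (A : {fset I}) :
  (forall i, i \notin A -> u i = 0) -> hs u (\sum_(i <- A) u i).
Proof.
move=> h e e0; exists A => B AB; rewrite [X in X - _](big_fsetID _ (mem A))/=.
rewrite (_ : [fset x | x in B & x \in A]%fset = A); last first.
  apply/fsetP => x; rewrite !inE andbC; case xA: (x \in A) => //=.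
  by rewrite (fsubsetP AB).
rewrite addrAC subrr add0r big_seq big1 ?nc0 ?ltW// => i.
by rewrite !inE => /andP[_ /h].
Qed.

Lemma sum_single I (i0 : I) (u : I -> C) : (forall i, i != i0 -> u i = 0) ->
  sum u = u i0.
Proof.
move=> h; have -> : u i0 = \sum_(i <- [fset i0]%fset) u i by rewrite big_seq_fset1.
apply/hs_sum/hs_finsupp => i.
by rewrite !inE => /h.
Qed.

Lemma hs_norm I (u : I -> C) s : hs u s -> summ u -> ((nc s)%:E <= asum u)%E.
Proof.
move=> hu su; rewrite -(fineK (summ_fin su)) lee_fin.
apply/ler_addgt0Pr => e e0; have [A /(_ A (fsubset_refl _)) hA] := hu _ e0.
have h : \sum_(i <- A) nc (u i) <= fine (asum u).
  by rewrite -lee_fin fineK ?asum_fset// summ_fin.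
rewrite (_ : s = \sum_(i <- A) u i - (\sum_(i <- A) u i - s)); last first.
  by rewrite opprB addrC subrK.
by rewrite (le_trans (le_ncB _ _))// lerD// (le_trans (le_nc_sum _ _)).
Qed.

Lemma sum_norm I (u : I -> C) : summ u -> ((nc (sum u))%:E <= asum u)%E.
Proof. by move=> h; apply: hs_norm => //; apply: summ_sumP. Qed.

(** Indices outside the image of [f] contribute nothing, so the sum over a finite set [B] of
    preimages equals the sum over [A] enlarged by the image of [B]. *)
Lemma hs_inj I J (f : I -> J) (u : J -> C) s : injective f ->
  (forall j, (exists i, f i = j) \/ u j = 0) -> hs u s -> hs (fun i => u (f i)) s.
Proof.
move=> fi h hu e e0; have [A hA] := hu _ e0.
have finA : finite_set (f @^-1` [set` A]).
  by apply: finite_preimage; [move=> x y _ _ /fi|].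
exists (fset_set (f @^-1` [set` A])) => B AB.
have := hA _ (fsubsetUl A (f @` B)%fset).
rewrite (big_fsetID _ (mem (f @` B)%fset))/=.
rewrite (_ : [fset x | x in (A `|` f @` B) & x \in (f @` B)%fset]%fset = (f @` B)%fset);
  last by apply/fsetP => x; rewrite !inE; case: (x \in (f @` B)%fset); rewrite ?orbT ?andbF.
rewrite [X in _ + X - _]big_seq [X in _ + X - _]big1 ?addr0; last first.
  move=> j; rewrite !inE andbC; case jB: (j \in (f @` B)%fset) => //=.
  rewrite orbF => jA; case: (h j) => // -[i fij]; exfalso.
  suff : j \in (f @` B)%fset by rewrite jB.
  rewrite -fij in_imfset//= (fsubsetP AB)// in_fset_set//.
  by apply/mem_set; rewrite /= fij.
by rewrite big_imfset//= => x y _ _ /fi.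
Qed.

Lemma sum_inj I J (f : I -> J) (u : J -> C) : injective f ->
  (forall j, (exists i, f i = j) \/ u j = 0) -> summ u -> sum (fun i => u (f i)) = sum u.
Proof. by move=> fi h hu; apply/hs_sum/hs_inj => //; apply: summ_sumP. Qed.

Lemma summ_inj I J (f : I -> J) (u : J -> C) : injective f -> summ u ->
  summ (fun i => u (f i)).
Proof.
move=> fi; apply: le_lt_trans; apply: (@es_inj _ _ _ f (fun j => (nc (u j))%:E)) => // j.
by rewrite lee_fin nc_ge0.
Qed.

Lemma summ_injV I J (f : I -> J) (u : J -> C) : injective f ->
  (forall j, (exists i, f i = j) \/ u j = 0) -> summ (fun i => u (f i)) -> summ u.
Proof.
move=> fi h; rewrite /summ /asum.
rewrite (@es_inj_eq _ _ _ f (fun j => (nc (u j))%:E))// => [j|j].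
  by rewrite lee_fin nc_ge0.
by case: (h j) => [|->]; [left|right; rewrite nc0].
Qed.

Lemma sum_bij I J (f : I -> J) (u : J -> C) : bijective f -> summ u ->
  sum (fun i => u (f i)) = sum u.
Proof.
move=> bf; apply: sum_inj; first exact: bij_inj.
by move=> j; left; case: bf => g _ gK; exists (g j).
Qed.

Lemma summ_bij I J (f : I -> J) (u : J -> C) : bijective f ->
  summ (fun i => u (f i)) <-> summ u.
Proof.
move=> bf; split; last exact/summ_inj/bij_inj.
apply: summ_injV; first exact: bij_inj.
by move=> j; left; case: bf => g _ gK; exists (g j).
Qed.

Lemma asum_pair I J (u : I * J -> C) :
  asum u = es (fun i => asum (fun j => u (i, j))).
Proof.
rewrite /asum -(es_pair (a := fun i j => (nc (u (i, j)))%:E)).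
  by apply: eq_es => -[].
by move=> i j; rewrite lee_fin nc_ge0.
Qed.

Lemma summ_row I J (u : I * J -> C) i : summ u -> summ (fun j => u (i, j)).
Proof.
rewrite /summ asum_pair; apply: le_lt_trans.
exact: (@es_term _ _ (fun i => asum (fun j => u (i, j)))).
Qed.

(** The sum over a finite rectangle is compared both with the total sum and with a finite sum of
    rows: [D'] is so large that the rectangle contains the approximating set [A] and that the chosen
    rows are already approximated on it. *)
Lemma hs_fubini I J (u : I * J -> C) : summ u ->
  hs (fun i => sum (fun j => u (i, j))) (sum u).
Proof.
move=> hu e e0; have e2 : 0 < e / 2 by rewrite divr_gt0.
have [A hA] := summ_sumP hu e2.
exists [fset x.1 | x in A]%fset => B AB.
have hB : hs (fun j => \sum_(i <- B) u (i, j)) (\sum_(i <- B) sum (fun j => u (i, j))).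
  by apply: hs_sumr => i; apply/summ_sumP/summ_row.
have [D hD] := hB _ e2; set D' := (D `|` [fset x.2 | x in A])%fset.
have := hD _ (fsubsetUl D [fset x.2 | x in A]%fset).
have : (A `<=` B `*` D')%fset.
  apply/fsubsetP => -[x y] xyA; rewrite in_fsetM/=; apply/andP; split.
    by apply: (fsubsetP AB); apply/imfsetP; exists (x, y).
  by rewrite !inE; apply/orP; right; apply/imfsetP; exists (x, y).
move=> /hA; rewrite -/D'.
have -> : \sum_(i <- (B `*` D')%fset) u i = \sum_(j <- D') \sum_(i <- B) u (i, j).
  rewrite exchange_big/= big_imfset2//=.
  by move=> [a b] [c d] _ _ /= [-> ->].
set x := \sum_(j <- D') _; set y := \sum_(i <- B) _ => h1 h2.
rewrite (_ : y - sum u = (x - sum u) - (x - y)); last by rewrite opprB [RHS]addrC addrA subrK.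
rewrite (le_trans (le_ncB _ _))//; lra.
Qed.

Lemma sum_fubini I J (u : I * J -> C) : summ u ->
  sum u = sum (fun i => sum (fun j => u (i, j))).
Proof. by move=> /hs_fubini/hs_sum. Qed.

Lemma summ_fubini I J (u : I * J -> C) : summ u ->
  summ (fun i => sum (fun j => u (i, j))).
Proof.
move=> hu; apply: (le_lt_trans _ hu); rewrite asum_pair; apply: le_es => i.
have h := sum_norm (summ_row i hu).
exact: h.
Qed.

Lemma summ_swap I J (u : I * J -> C) : summ u -> summ (fun x : J * I => u (x.2, x.1)).
Proof. by apply: summ_inj => -[a b] [c d] []/= -> ->. Qed.

Lemma sum_swap I J (u : I * J -> C) : summ u ->
  sum (fun x : J * I => u (x.2, x.1)) = sum u.
Proof.
apply: (@sum_bij _ _ (fun x : J * I => (x.2, x.1))).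
by exists (fun x => (x.2, x.1)); case.
Qed.

Lemma sum_exch I J (u : I -> J -> C) : summ (fun x : I * J => u x.1 x.2) ->
  sum (fun i => sum (fun j => u i j)) = sum (fun j => sum (fun i => u i j)).
Proof.
move=> h; rewrite -(sum_fubini (u := fun x => u x.1 x.2))//.
rewrite -(sum_swap h) -(sum_fubini (u := fun x => u x.2 x.1))//.
exact: (summ_swap h).
Qed.

Lemma summ_prod I J (u : I -> C) (v : J -> C) : summ u -> summ v ->
  summ (fun x : I * J => u x.1 * v x.2).
Proof.
move=> hu hv; rewrite /summ asum_pair.
have -> : es (fun i => asum (fun j => u i * v j)) = ((fine (asum v))%:E * asum u)%E.
  rewrite -es_Zl ?fine_ge0 ?asum_ge0//; last by move=> i; rewrite lee_fin nc_ge0.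
  by apply: eq_es => i; rewrite asumZ fineK ?summ_fin// muleC.
by rewrite lte_mul_pinfty// ?lee_fin ?fine_ge0 ?asum_ge0.
Qed.

Lemma sum_prod I J (u : I -> C) (v : J -> C) : summ u -> summ v ->
  sum (fun x : I * J => u x.1 * v x.2) = sum u * sum v.
Proof.
move=> hu hv; rewrite (sum_fubini (summ_prod hu hv))/= [RHS]mulrC -sumZ//.
by apply: eq_sum => i; rewrite sumZ// mulrC.
Qed.

End ComplexSums.

(** * Coefficients of [e ^ (w x) (e ^ x - 1) ^ N] *)

Section PowerSeriesCoefficients.
Variable R : realType.
Notation C := (R[i]).
Implicit Types (a b c : C^nat) (w : C) (N m : int).

Lemma fps_mulE n a b k : (k < n)%N ->
  fps_mul a b k = ((\poly_(i < n) a i) * (\poly_(i < n) b i))`_k.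
Proof.
move=> kn; rewrite coefM; apply: eq_bigr => i _; rewrite !coef_poly.
have h1 : (i < n)%N by apply: leq_ltn_trans kn; rewrite -ltnS.
have h2 : (k - i < n)%N by apply: leq_ltn_trans kn; apply: leq_subr.
by rewrite h1 h2.
Qed.

Lemma fps_mulC a b : fps_mul a b = fps_mul b a.
Proof. by apply/funext => k; rewrite !(@fps_mulE k.+1)// mulrC. Qed.

Lemma fps_mulA a b c : fps_mul a (fps_mul b c) = fps_mul (fps_mul a b) c.
Proof.
apply/funext => k; pose P a := \poly_(i < k.+1) a i.
transitivity ((P a * (P b * P c))`_k).
  rewrite coefM; apply: eq_bigr => i _; rewrite coef_poly ltn_ord.
  by rewrite (@fps_mulE k.+1)// ltnS leq_subr.
rewrite mulrA coefM; apply: eq_bigr => i _; rewrite coef_poly ltnS leq_subr.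
by rewrite (@fps_mulE k.+1).
Qed.

Lemma fps_mulDr a b c k :
  fps_mul c (fun k => a k + b k) k = fps_mul c a k + fps_mul c b k.
Proof. by rewrite -big_split; apply: eq_bigr => i _; rewrite mulrDr. Qed.

Lemma fps_mulZl w a c k : fps_mul (fun k => w * a k) c k = w * fps_mul a c k.
Proof. by rewrite /fps_mul mulr_sumr; apply: eq_bigr => i _; rewrite mulrA. Qed.

Lemma fps_mulZr w a c k : fps_mul c (fun k => w * a k) k = w * fps_mul c a k.
Proof. by rewrite fps_mulC fps_mulZl fps_mulC. Qed.

Definition fps1 : C^nat := fun k => (k == 0%N)%:R.

Lemma fps_mul1 a k : fps_mul fps1 a k = a k.
Proof.
rewrite /fps_mul big_ord_recl/= big1 ?addr0 ?mul1r ?subn0// => i _.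
by rewrite /fps1 mul0r.
Qed.

Lemma fps_mulr1 a k : fps_mul a fps1 k = a k.
Proof. by rewrite fps_mulC fps_mul1. Qed.

Definition fpsX a : C^nat := fun k => if k is k'.+1 then a k' else 0.

Lemma fpsX_mul a b k : fps_mul (fpsX a) b k.+1 = fps_mul a b k.
Proof. by rewrite /fps_mul big_ord_recl/= mul0r add0r. Qed.

(** The Euler operator x d/dx, a derivation that does not shift the degree. *)
Definition fpsD a : C^nat := fun k => k%:R * a k.

Lemma fpsD_mul a b k : fpsD (fps_mul a b) k = fps_mul (fpsD a) b k + fps_mul a (fpsD b) k.
Proof.
rewrite /fpsD -big_split mulr_sumr; apply: eq_bigr => i _ /=.
have -> : k%:R = i%:R + (k - i)%:R :> C by rewrite -natrD subnKC// -ltnS.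
by ring.
Qed.

Lemma binz0 m : binz R m 0 = 1.
Proof. by rewrite /binz big_ord0 fact0 divr1. Qed.

Lemma binzSr m j : j.+1%:R * binz R m j.+1 = (m%:~R - j%:R) * binz R m j.
Proof.
rewrite /binz big_ord_recr/= factS natrM.
have h1 : j`!%:R != 0 :> C by rewrite pnatr_eq0 -lt0n fact_gt0.
have h2 : j.+1%:R != 0 :> C by rewrite pnatr_eq0.
by move: (j`!%:R : C) (j.+1%:R : C) h1 h2 => x y h1 h2; field; rewrite h1 h2.
Qed.

Lemma binzSl m j : j.+1%:R * binz R m j.+1 = m%:~R * binz R (m - 1) j.
Proof.
rewrite /binz big_ord_recl/= factS natrM subr0.
have -> : \prod_(i < j) (m%:~R - (bump 0 i)%:R) = \prod_(i < j) ((m - 1)%:~R - i%:R) :> C.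
  by apply: eq_bigr => i _; rewrite /bump/= add1n -natr1 rmorphB/= opprD addrCA addrC -addrA addrC.
have h1 : j`!%:R != 0 :> C by rewrite pnatr_eq0 -lt0n fact_gt0.
have h2 : j.+1%:R != 0 :> C by rewrite pnatr_eq0.
by move: (j`!%:R : C) (j.+1%:R : C) h1 h2 => x y h1 h2; field; rewrite h1 h2.
Qed.

Lemma binz_pascal m j : binz R m j.+1 = binz R (m - 1) j.+1 + binz R (m - 1) j.
Proof.
have h2 : j.+1%:R != 0 :> C by rewrite pnatr_eq0.
apply: (mulfI h2); rewrite mulrDr binzSl binzSr -mulrDl; congr (_ * _).
by rewrite rmorphB/= -natr1; ring.
Qed.

Lemma binz_nat0 j : binz R 0 j = (j == 0%N)%:R.
Proof.
case: j => [|j]; first by rewrite binz0.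
by rewrite /binz big_ord_recl/= subr0 !mul0r.
Qed.

Lemma binz_nat (p j : nat) : binz R p%:Z j = 'C(p, j)%:R.
Proof.
elim: j => [|j IH]; first by rewrite binz0 bin0.
have h2 : j.+1%:R != 0 :> C by rewrite pnatr_eq0.
apply: (mulfI h2); rewrite binzSr IH -[RHS]natrM mul_bin_left.
have [jp|jp] := leqP j p; first by rewrite natrM natrB.
by rewrite bin_small// mulr0 muln0.
Qed.

(** With U = (e^x - 1) / x, the series U - 1, U, e^(w x) and U^N have the coefficients [expu],
    [expU], [expE w] and [expS N]. *)
Definition expu : C^nat := fun k => if k == 0%N then 0 else (k.+1)`!%:R^-1.
Definition expU : C^nat := fun k => (k.+1)`!%:R^-1.
Definition expE w : C^nat := fun k => w ^+ k / k`!%:R.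
Definition expS N : C^nat := fun k => \sum_(j < k.+1) binz R N j * fps_pow expu j k.

Lemma expm1E w N : expm1_coef w N = fps_mul (expE w) (expS N).
Proof. by []. Qed.

Lemma expUE k : expU k = fps1 k + expu k.
Proof.
rewrite /expU /fps1 /expu; case: k => [|k] /=; last by rewrite add0r.
by rewrite addr0 (_ : 1`! = 1%N)// invr1.
Qed.

Lemma fps_powS a j : fps_pow a j.+1 = fps_mul a (fps_pow a j).
Proof. by []. Qed.

Lemma expu_pow_small j k : (k < j)%N -> fps_pow expu j k = 0.
Proof.
elim: j k => // j IH k kj; rewrite fps_powS /fps_mul big1// => -[[|i] /= ik] _.
  by rewrite /expu/= mul0r.
by rewrite IH ?mulr0//; lia.
Qed.

Lemma expS_wide N n k : (k < n)%N ->
  expS N k = \sum_(j < n) binz R N j * fps_pow expu j k.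
Proof.
move=> kn; rewrite /expS (big_ord_widen n (fun j => binz R N j * fps_pow expu j k))//.
rewrite big_mkcond; apply: eq_bigr => j _; case: ifPn => //.
by rewrite -leqNgt => jk; rewrite expu_pow_small ?mulr0.
Qed.

Lemma expS_mul N a k :
  fps_mul (expS N) a k = \sum_(j < k.+1) binz R N j * fps_mul (fps_pow expu j) a k.
Proof.
rewrite /fps_mul; under eq_bigr => i _ do
  rewrite (@expS_wide N k.+1 i (ltn_ord i)) mulr_suml.
rewrite exchange_big/=; apply: eq_bigr => j _; rewrite mulr_sumr.
by apply: eq_bigr => i _; rewrite mulrA.
Qed.

(** Pascal's rule for [binz] is U^N = U^(N-1) (1 + (U - 1)), read off in powers of U - 1. *)
Lemma expS_U N k : expS N k = fps_mul (expS (N - 1)) expU k.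
Proof.
have -> : fps_mul (expS (N - 1)) expU k
    = expS (N - 1) k + fps_mul (expS (N - 1)) expu k.
  rewrite -(fps_mulr1 (expS (N - 1)) k) -fps_mulDr; congr fps_mul.
  by apply/funext => i; rewrite expUE.
rewrite (@expS_wide N k.+2)// (@expS_wide (N - 1) k.+2)// expS_mul.
rewrite big_ord_recl [X in _ = X + _]big_ord_recl /= !binz0 -addrA -big_split/=.
congr (_ + _); apply: eq_bigr => j _; rewrite /bump/= add1n binz_pascal mulrDl.
by congr (_ + _ * _); rewrite [in RHS]fps_mulC.
Qed.

Lemma expu_powD j k : fpsD (fps_pow expu j.+1) k =
  j.+1%:R * fps_mul (fps_pow expu j) (fpsD expu) k.
Proof.
elim: j k => [|j IH] k.
  rewrite mul1r fps_mul1 /fpsD fps_powS; congr (_ * _).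
  exact: fps_mulr1.
rewrite fps_powS fpsD_mul fps_mulC.
have -> : fpsD (fps_pow expu j.+1) =
    (fun k => j.+1%:R * fps_mul (fps_pow expu j) (fpsD expu) k) by apply/funext.
rewrite fps_mulZr fps_mulA -fps_powS -[j.+2%:R]natr1 mulrDl mul1r addrC.
by [].
Qed.

Lemma expSD N k : fpsD (expS N) k = N%:~R * fps_mul (expS (N - 1)) (fpsD expu) k.
Proof.
rewrite /fpsD (@expS_wide N k.+2)// big_ord_recl/= mulrDr.
have -> : k%:R * (binz R N 0 * (k == 0%N)%:R) = 0.
  by case: k => [|k]; rewrite ?mul0r// mulr0 mulr0.
rewrite add0r expS_mul !mulr_sumr; apply: eq_bigr => j _.
rewrite /bump/= add1n mulrCA -/(fpsD (fps_pow expu j.+1) k) expu_powD.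
by rewrite mulrA [X in X * _]mulrC binzSl -!mulrA.
Qed.

Lemma expED w k : fpsD (expE w) k = w * fpsX (expE w) k.
Proof.
case: k => [|k]; rewrite /fpsD /expE/= ?mul0r ?mulr0//.
rewrite factS natrM exprS.
have h1 : k`!%:R != 0 :> C by rewrite pnatr_eq0 -lt0n fact_gt0.
have h2 : k.+1%:R != 0 :> C by rewrite pnatr_eq0.
by move: (k`!%:R : C) (k.+1%:R : C) h1 h2 => x y h1 h2; field; rewrite h1 h2.
Qed.

Lemma expuD k : fpsD expu k = fpsX expU k - expu k.
Proof.
case: k => [|k]; rewrite /fpsD /expu /expU/= ?mul0r ?subr0//.
rewrite factS natrM.
have h1 : (k.+1)`!%:R != 0 :> C by rewrite pnatr_eq0 -lt0n fact_gt0.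
have h2 : k.+2%:R != 0 :> C by rewrite pnatr_eq0.
have h3 : k.+1%:R = k.+2%:R - 1 :> C by rewrite -[k.+2%:R]natr1 addrK.
by rewrite h3; move: ((k.+1)`!%:R : C) (k.+2%:R : C) h1 h2 => x y h1 h2; field; rewrite h1 h2.
Qed.

(** For F_N = e^(w x) (e^x - 1)^N one has F_N' = (w + N) F_N + N F_(N-1); this is the coefficient of
    x^(N+k). *)
Lemma expm1_rec w N k :
  (N%:~R + k.+1%:R) * expm1_coef w N k.+1 =
  (w + N%:~R) * expm1_coef w N k + N%:~R * expm1_coef w (N - 1) k.+1.
Proof.
have hS j : fpsD (expS N) j = N%:~R * (fpsX (expS N) j + expS (N - 1) j - expS N j).
  rewrite expSD; congr (_ * _).
  have -> : fpsD expu = (fun j => fpsX expU j + - 1 * expu j).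
    by apply/funext => i; rewrite expuD mulN1r.
  rewrite fps_mulDr fps_mulZr mulN1r -[X in _ - X]addr0.
  have -> : fps_mul (expS (N - 1)) (fpsX expU) j = fpsX (expS N) j.
    rewrite fps_mulC; case: j => [|j]; first by rewrite /fps_mul big_ord1 mul0r.
    by rewrite fpsX_mul fps_mulC -expS_U.
  rewrite (expS_U N) -(fps_mulr1 (expS (N - 1)) j) -addrA; congr (_ + _).
  rewrite (_ : expU = (fun k => fps1 k + expu k)); last by apply/funext => i; exact: expUE.
  by rewrite fps_mulDr addr0 opprD addrA subrr add0r.
rewrite mulrDl -[k.+1%:R * _]/(fpsD (expm1_coef w N) k.+1) expm1E fpsD_mul.
have -> : fpsD (expE w) = (fun j => w * fpsX (expE w) j) by apply/funext => j; exact: expED.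
rewrite fps_mulZl fpsX_mul.
have -> : fpsD (expS N) = (fun j => N%:~R * (fpsX (expS N) j + (expS (N - 1) j + -1 * expS N j))).
  by apply/funext => j; rewrite hS mulN1r addrA.
rewrite fps_mulZr fps_mulDr [fps_mul _ (fpsX _)]fps_mulC fpsX_mul [fps_mul (expS N) _]fps_mulC.
by rewrite fps_mulDr fps_mulZr !expm1E; ring.
Qed.

Lemma expm1_0 w N : expm1_coef w N 0 = 1.
Proof.
rewrite expm1E /fps_mul big_ord1 /expS big_ord1 binz0 /expE/= expr0 fact0.
by rewrite divr1 !mul1r.
Qed.

(** Both sides are the coefficient of x^K in e^(w x) (1 + (e^x - 1))^m = e^((w+m) x). Induction on K
    through [expm1_rec] avoids composing power series. *)
Lemma expm1_sum_binz w m K :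
  \sum_(p < K.+1) binz R m p * expm1_coef w p%:Z (K - p)%N = (w + m%:~R) ^+ K / K`!%:R.
Proof.
elim: K => [|K IH]; first by rewrite big_ord1 binz0 expm1_0 expr0 fact0 mul1r divr1.
have h1 : K`!%:R != 0 :> C by rewrite pnatr_eq0 -lt0n fact_gt0.
have h2 : K.+1%:R != 0 :> C by rewrite pnatr_eq0.
apply: (mulfI h2).
have -> : K.+1%:R * ((w + m%:~R) ^+ K.+1 / (K.+1)`!%:R)
    = (w + m%:~R) * ((w + m%:~R) ^+ K / K`!%:R) :> C.
  by rewrite exprS factS natrM; move: (K`!%:R : C) (K.+1%:R : C) h1 h2 => x y h1 h2; field; rewrite h1 h2.
rewrite -IH mulr_sumr mulr_sumr.
have step (p : nat) : (p <= K)%N -> K.+1%:R * (binz R m p * expm1_coef w p%:Z (K.+1 - p)%N) =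
    (w + p%:R) * (binz R m p * expm1_coef w p%:Z (K - p)%N)
    + p%:R * binz R m p * expm1_coef w (p%:Z - 1) (K.+1 - p)%N.
  move=> pK; rewrite subSn//; have := expm1_rec w p%:Z (K - p)%N.
  have -> : (p%:Z)%:~R + (K - p)%N.+1%:R = K.+1%:R :> C.
    by rewrite -[(p%:Z)%:~R]/(p%:R) -natrD; congr (_%:R); lia.
  by rewrite -[(p%:Z)%:~R]/(p%:R) => h; rewrite mulrCA h; ring.
rewrite big_ord_recr/= subnn expm1_0 mulr1.
under eq_bigr => p _ do rewrite step ?(leq_ord p)//.
rewrite big_split/= -addrA.
have -> : \sum_(i < K.+1) i%:R * binz R m i * expm1_coef w (i%:Z - 1) (K.+1 - i)%N +
    K.+1%:R * binz R m K.+1 =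
  \sum_(i < K.+1) (m%:~R - i%:R) * (binz R m i * expm1_coef w i%:Z (K - i)%N).
  rewrite big_ord_recl/= !mul0r add0r [RHS]big_ord_recr/= subnn expm1_0 mulr1 binzSr.
  congr (_ + _); apply: eq_bigr => i _; rewrite /bump/= add1n binzSr subSS -mulrA.
  by congr (_ * (_ * expm1_coef w _ _)); lia.
by rewrite -big_split; apply: eq_bigr => i _ /=; ring.
Qed.

Let h : C := 2^-1.

(** The coefficient of x^(k-1) y^l in e^((x+y)/2) / (e^x - e^y), expanded as a geometric series in
    (e^y - 1) / (e^x - 1). This function is e^(u/2) / (e^u - 1) at u = x - y. *)
Definition expm1_pair (k l : nat) : C :=
  \sum_(p < l.+1) expm1_coef h (- (p.+1%:Z)) (p + k)%N * expm1_coef h p%:Z (l - p)%N.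

(** The generating function depends on x - y only, so its y-derivative is minus its x-derivative. *)
Lemma expm1_pair_rec k l : l.+1%:R * expm1_pair k l.+1 = - (k%:R * expm1_pair k.+1 l).
Proof.
rewrite /expm1_pair !mulr_sumr.
have step (p : nat) : (p <= l)%N -> l.+1%:R * (expm1_coef h (- (p.+1%:Z)) (p + k)%N *
    expm1_coef h p%:Z (l.+1 - p)%N) =
    (h + p%:R) * (expm1_coef h (- (p.+1%:Z)) (p + k)%N * expm1_coef h p%:Z (l - p)%N)
    + p%:R * expm1_coef h (- (p.+1%:Z)) (p + k)%N * expm1_coef h (p%:Z - 1) (l.+1 - p)%N.
  move=> pl; rewrite subSn//; have := expm1_rec h p%:Z (l - p)%N.
  have -> : (p%:Z)%:~R + (l - p)%N.+1%:R = l.+1%:R :> C.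
    by rewrite -[(p%:Z)%:~R]/(p%:R) -natrD; congr (_%:R); lia.
  by rewrite -[(p%:Z)%:~R]/(p%:R) => e; rewrite mulrCA e; ring.
rewrite big_ord_recr/= subnn expm1_0 mulr1.
under eq_bigr => p _ do rewrite step ?(leq_ord p)//.
rewrite big_split/= -addrA.
have -> : \sum_(i < l.+1) i%:R * expm1_coef h (- (i.+1%:Z)) (i + k)%N *
      expm1_coef h (i%:Z - 1) (l.+1 - i)%N +
    l.+1%:R * expm1_coef h (- (l.+2%:Z)) (l.+1 + k)%N =
  \sum_(i < l.+1) i.+1%:R * expm1_coef h (- (i.+2%:Z)) (i + k.+1)%N *
      expm1_coef h i%:Z (l - i)%N.
  rewrite big_ord_recl/= !mul0r add0r [RHS]big_ord_recr/= subnn expm1_0 mulr1.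
  rewrite addnS addSn; congr (_ + _); apply: eq_bigr => i _; rewrite /bump/= add1n subSS.
  rewrite addSn addnS; congr (_ * expm1_coef h _ _); lia.
rewrite -big_split -sumrN; apply: eq_bigr => p _ /=.
have := expm1_rec h (- (p.+1%:Z)) (p + k)%N.
have -> : (- (p.+1%:Z))%:~R + (p + k)%N.+1%:R = k%:R :> C.
  by rewrite rmorphN/= -[(p.+1%:Z)%:~R]/(p.+1%:R) -addSn natrD addrA addNr add0r.
have -> : - p.+1%:Z - 1 = - p.+2%:Z by lia.
rewrite rmorphN/= -[(p.+1%:Z)%:~R]/(p.+1%:R) -addnS => e.
rewrite [in RHS]mulrA e -natr1.
have -> : h + (- (p%:R + 1)) = - (h + p%:R).
  have -> : 1 = h + h by rewrite /h; field.
  by ring.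
by ring.
Qed.

Lemma expm1_pairE k l : (0 < k)%N ->
  expm1_pair k l = (-1) ^+ l * 'C((k + l).-1, l)%:R * expm1_coef h (-1) (k + l)%N.
Proof.
elim: l k => [|l IH] k k0.
  rewrite /expm1_pair big_ord1 subnn add0n addn0 expm1_0 mulr1 bin0 expr0.
  by rewrite !mul1r.
have h2 : l.+1%:R != 0 :> C by rewrite pnatr_eq0.
apply: (mulfI h2); rewrite expm1_pair_rec IH// addSnnS.
have e : k%:R * 'C((k + l.+1).-1, l)%:R = l.+1%:R * 'C((k + l.+1).-1, l.+1)%:R :> C.
  by rewrite -!natrM mul_bin_left; congr (_ * _)%N%:R; lia.
transitivity (- ((-1) ^+ l * (k%:R * 'C((k + l.+1).-1, l)%:R)
  * expm1_coef h (-1) (k + l.+1)%N)); first by ring.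
by rewrite e exprS; ring.
Qed.

Lemma expE_mul w w' k : fps_mul (expE w) (expE w') k = expE (w + w') k.
Proof.
rewrite /expE [w + w']addrC exprDn mulr_suml; apply: eq_bigr => i _.
have /(congr1 (fun n => n%:R : C)) := bin_fact (leq_ord i); rewrite !natrM => e.
have h1 : i`!%:R != 0 :> C by rewrite pnatr_eq0 -lt0n fact_gt0.
have h2 : (k - i)`!%:R != 0 :> C by rewrite pnatr_eq0 -lt0n fact_gt0.
have h3 : k`!%:R != 0 :> C by rewrite pnatr_eq0 -lt0n fact_gt0.
rewrite -mulr_natr -e; have h4 : 'C(k, i)%:R != 0 :> C.
  by rewrite pnatr_eq0 -lt0n bin_gt0 leq_ord.
by field; rewrite h1 h2 h4.
Qed.

(** The coefficients are those of the even function x / (2 sinh (x/2)): its inverse [H], the series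
    of 2 sinh (x/2) / x, has no odd terms, and the relation between a series and its inverse
    propagates this by induction. *)
Lemma expm1_half_odd n : odd n -> expm1_coef h (-1) n = 0.
Proof.
pose H := fps_mul (expE (- h)) expU.
have HE k : H k = (h ^+ k.+1 - (- h) ^+ k.+1) / (k.+1)`!%:R.
  have := expE_mul (- h) 1 k.+1; rewrite /fps_mul big_ord_recr/= subnn.
  have -> : - h + 1 = h by rewrite /h; field.
  have E1 i : expE 1 i = i`!%:R^-1 by rewrite /expE expr1n mul1r.
  rewrite E1 fact0 invr1 mulr1 mulrBl -!/(expE _ _) => <-.
  rewrite /H /fps_mul addrK; apply: eq_bigr => i _; rewrite /expU E1.
  by rewrite subSn// -ltnS.
have Hodd k : odd k -> H k = 0.
  by move=> k1; rewrite HE exprNn -signr_odd/= k1 expr0 mul1r subrr mul0r.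
have H0 : H 0%N = 1 by rewrite HE !expr1 (_ : 1`! = 1%N)// /h; field.
have BH : fps_mul (expm1_coef h (-1)) H = fps1.
  rewrite expm1E -fps_mulA [fps_mul (expS _) _]fps_mulC /H -fps_mulA.
  have -> : fps_mul expU (expS (-1)) = fps1.
    apply/funext => k; rewrite fps_mulC; have := expS_U 0 k.
    rewrite sub0r => <-; rewrite /expS big_ord_recl/= binz_nat0 mul1r big1 ?addr0//.
    by move=> i _; rewrite binz_nat0 mul0r.
  apply/funext => k; rewrite fps_mulA fps_mulr1 expE_mul subrr /expE /fps1.
  by case: k => [|k]; rewrite ?expr0 ?fact0 ?divr1// expr0n mul0r.
elim/ltn_ind: n => n IH on; have := congr1 (fun f => f n) BH.
rewrite /fps_mul big_ord_recr/= subnn H0 mulr1 big1 ?add0r => [->|i _].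
  by case: n on {IH}.
have [oi|oi] := boolP (odd i); first by rewrite IH ?mul0r.
by rewrite Hodd ?mulr0// oddB ?on ?(negbTE oi)//; apply: ltnW.
Qed.

End PowerSeriesCoefficients.

(** * The Fock basis *)

Section Toggle.
Implicit Types (k : seq nat) (r p : nat).

(* [psi(-r)] and [psi(r - 1)] both toggle the index [r] of a Fock basis vector. *)
Fixpoint tog r k : seq nat := match k with
  | [::] => [:: r]
  | a :: k' => if (r < a)%N then r :: k else if r == a then k' else a :: tog r k'
  end.

Lemma tog_path r k p : path ltn p k -> (p < r)%N -> path ltn p (tog r k).
Proof.
elim: k p => [|a k IH] p /=; first by move=> _ ->.
move=> /andP[pa ak] pr; case: ltngtP => [ra|ar|ra] /=; first by rewrite pr ra.
  by rewrite pa IH.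
by apply: (path_le ltn_trans pa).
Qed.

Lemma path_notin r k p : path ltn p k -> (r <= p)%N -> r \notin k.
Proof.
elim: k p => [|a k IH] p //= /andP[pa ak] rp; rewrite inE negb_or (IH a)//; last first.
  by rewrite ltnW// (leq_ltn_trans rp).
by rewrite andbT neq_ltn (leq_ltn_trans rp).
Qed.

Lemma togK r k p : path ltn p k -> (p < r)%N -> tog r (tog r k) = k.
Proof.
elim: k p => [|a k IH] p /=; first by rewrite ltnn eqxx.
move=> /andP[pa ak] pr; case: ltngtP => [ra|ar|ra] /=.
- by rewrite ltnn eqxx.
- by rewrite ltnNge ltnW//= gtn_eqF// (IH a).
subst r; case: k ak {IH} => [|b k]//= /andP[ab _]; by rewrite ab.
Qed.

Lemma size_tog r k : odd (size (tog r k)) = ~~ odd (size k).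
Proof.
by elim: k => [|a k IH]//=; case: ltngtP => //= _; rewrite ?IH// negbK.
Qed.

Lemma sum_tog (S : zmodType) (f : nat -> S) r k p : path ltn p k -> (p < r)%N ->
  \sum_(i <- tog r k) f i = \sum_(i <- k) f i + f r *~ (if r \in k then - 1 else 1).
Proof.
elim: k p => [|a k IH] p /=; first by rewrite big_seq1 big_nil add0r mulr1z.
move=> /andP[pa ak] pr; rewrite inE; case: ltngtP => [ra|ar|ra] /=.
- by rewrite (negbTE (path_notin ak (ltnW ra))) !big_cons mulr1z addrC.
- by rewrite !big_cons (IH a)// addrA.
by rewrite ra big_cons mulrN1z addrAC subrr add0r.
Qed.

Lemma fock_pos k i : path ltn 0 k -> i \in k -> (0 < i)%N.
Proof.
move=> pk ik; rewrite lt0n; apply: contraTneq ik => ->.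
exact: path_notin pk _.
Qed.

(** The shift by one makes [r] the common value of [midx] for psi(r) and psi(-r-1), the two modes
    that toggle the entry r + 1. *)
Definition togI (r : nat) (k : fock_index) : fock_index :=
  exist _ (tog r.+1 (val k)) (tog_path (valP k) (ltn0Sn r)).

Lemma togIK r : involutive (togI r).
Proof. by move=> k; apply: val_inj; apply: (togK (valP k)). Qed.

Lemma togI_bij r : bijective (togI r).
Proof. by exists (togI r); apply: togIK. Qed.

Definition fock0 : fock_index := exist _ [::] isT.

End Toggle.

Section FockBasis.
Variables (R : realType) (V : vosa_data R) (psi : V).
Hypothesis fermion : rank_one_fermion psi.
Notation C := (R[i]).
Notation psim := (mode psi).
Notation fk k := (fock psi (val k)).
Notation coord := (fock_coord psi).
Implicit Types (u v w : V) (m n : int) (k : fock_index).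

Let vosa := fermion_vosa fermion.

Lemma modeDl a b n v : mode (a + b) n v = mode a n v + mode b n v :> V.
Proof. by rewrite -{1}(scale1r a) (mode_linearl vosa) scale1r. Qed.
Lemma mode0l n v : mode 0 n v = 0 :> V.
Proof. by rewrite -{1}[0](subrr (0 : V)) -{1}scaleN1r addrC (mode_linearl vosa) scaleN1r addNr. Qed.
Lemma modeZl c a n v : mode (c *: a) n v = c *: mode a n v :> V.
Proof. by rewrite -{1}[c *: a]addr0 (mode_linearl vosa) mode0l addr0. Qed.
Lemma modeDr a n v w : mode a n (v + w) = mode a n v + mode a n w :> V.
Proof. by rewrite -{1}(scale1r v) (mode_linearr vosa) scale1r. Qed.
Lemma mode0r a n : mode a n 0 = 0 :> V.
Proof. by rewrite -{1}[0](subrr (0 : V)) -{1}scaleN1r addrC (mode_linearr vosa) scaleN1r addNr. Qed.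
Lemma modeZr c a n v : mode a n (c *: v) = c *: mode a n v :> V.
Proof. by rewrite -{1}[c *: v]addr0 (mode_linearr vosa) mode0r addr0. Qed.
Lemma mode_suml (I : Type) (s : seq I) (F : I -> V) n v :
  mode (\sum_(i <- s) F i) n v = \sum_(i <- s) mode (F i) n v.
Proof.
elim: s => [|i s IH]; first by rewrite !big_nil mode0l.
by rewrite !big_cons modeDl IH.
Qed.
Lemma mode_sumr (I : Type) (s : seq I) a n (F : I -> V) :
  mode a n (\sum_(i <- s) F i) = \sum_(i <- s) mode a n (F i).
Proof.
elim: s => [|i s IH]; first by rewrite !big_nil mode0r.
by rewrite !big_cons modeDr IH.
Qed.

Lemma coordP v : is_fock_coord psi v (coord v).
Proof.
have [c [cP _]] := fock_basis fermion v.
exact: (@xgetPex _ _ [set c | is_fock_coord psi v c]) (ex_intro _ c cP).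
Qed.

Lemma coord_unique v c : is_fock_coord psi v c -> coord v = c.
Proof.
have [c' [c'P uc]] := fock_basis fermion v => cP.
by rewrite -(uc _ cP) -(uc _ (coordP v)).
Qed.

Lemma coordE v : exists s : {fset fock_index},
  (forall k, k \notin s -> coord v k = 0) /\ v = \sum_(k <- s) coord v k *: fk k.
Proof.
have [fs vE] := coordP v; pose s := fset_set [set k | coord v k != 0].
have h k : k \notin s -> coord v k = 0.
  rewrite in_fset_set// => /negP kn; apply/eqP/negPn/negP => ck; apply: kn.
  exact/mem_set.
exists s; split => //; rewrite {1}vE (@fsbigTE _ _ _ _ s)// => k /h ->.
by rewrite scale0r.
Qed.

Lemma coord_fset v (c : fock_index -> C) (s : {fset fock_index}) :
  (forall k, k \notin s -> c k = 0) -> v = \sum_(k <- s) c k *: fk k -> coord v = c.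
Proof.
move=> h vE; apply: coord_unique; split.
  apply: (sub_finite_set _ (finite_fset s)) => k /=.
  by apply: contraR => /h/eqP.
by rewrite vE (@fsbigTE _ _ _ _ s)// => k /h ->; rewrite scale0r.
Qed.

Lemma sum_fset_widen (s t : {fset fock_index}) (c : fock_index -> C) :
  (s `<=` t)%fset -> (forall k, k \notin s -> c k = 0) ->
  \sum_(k <- t) c k *: fk k = \sum_(k <- s) c k *: fk k.
Proof.
move=> st h; rewrite (big_fsetID _ (mem s))/=.
rewrite (_ : [fset x | x in t & x \in s]%fset = s); last first.
  apply/fsetP => x; rewrite !inE andbC; case xs: (x \in s) => //=.
  by rewrite (fsubsetP st).
rewrite [X in _ + X]big_seq [X in _ + X]big1 ?addr0// => k; rewrite !inE => /andP[_ /h ->].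
by rewrite scale0r.
Qed.

Lemma coordL a v w k : coord (a *: v + w) k = a * coord v k + coord w k.
Proof.
have [s [hs vE]] := coordE v; have [t [ht wE]] := coordE w.
suff -> : coord (a *: v + w) = fun k => a * coord v k + coord w k by [].
apply: (@coord_fset _ _ (s `|` t)%fset).
  by move=> l; rewrite inE negb_or => /andP[/hs -> /ht ->]; rewrite mulr0 addr0.
under eq_bigr do rewrite scalerDl -scalerA; rewrite big_split -scaler_sumr/=.
by rewrite (sum_fset_widen (fsubsetUl s t) hs) (sum_fset_widen (fsubsetUr s t) ht) -vE -wE.
Qed.

Lemma coord0 k : coord 0 k = 0.
Proof. by have := coordL (-1) 0 0 k; rewrite scaler0 addr0 mulN1r addNr. Qed.
Lemma coordZ a v k : coord (a *: v) k = a * coord v k.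
Proof. by rewrite -[a *: v]addr0 coordL coord0 addr0. Qed.
Lemma coordD v w k : coord (v + w) k = coord v k + coord w k.
Proof. by rewrite -{1}(scale1r v) coordL mul1r. Qed.
Lemma coord_sum (I : Type) (s : seq I) (F : I -> V) k :
  coord (\sum_(i <- s) F i) k = \sum_(i <- s) coord (F i) k.
Proof.
elim: s => [|i s IH]; first by rewrite !big_nil coord0.
by rewrite !big_cons coordD IH.
Qed.

Lemma coord_fk k l : coord (fk k) l = (k == l)%:R.
Proof.
rewrite (@coord_fset _ (fun l => (k == l)%:R) [fset k]%fset)// => [j|].
  by rewrite inE eq_sym => /negbTE ->.
by rewrite big_seq_fset1 eqxx scale1r.
Qed.

Lemma coord_ext v w : coord v =1 coord w -> v = w.
Proof.
move=> h; have [s [hs vE]] := coordE v; have [t [ht wE]] := coordE w.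
have ht' k : k \notin t -> coord v k = 0 by move=> /ht <-; rewrite h.
rewrite vE wE -(sum_fset_widen (fsubsetUl s t) hs) -(sum_fset_widen (fsubsetUr s t) ht).
by apply: eq_bigr => k _; rewrite h.
Qed.

Lemma fock_ind (P : V -> Prop) : P 0 -> (forall c k v, P v -> P (c *: fk k + v)) ->
  forall v, P v.
Proof.
move=> P0 PS v; have [s [_ ->]] := coordE v.
elim: (X in \sum_(_ <- X) _) => [|k r IH]; first by rewrite big_nil.
by rewrite big_cons; apply: PS.
Qed.

(* [emode m k] is the coefficient of [fk (togI (midx m) k)] in [psi(m) fk k]. *)
Definition esgn (r : nat) k : C := (-1) ^+ count (fun i => (i < r)%N) (val k).

Definition midx m : nat := match m with Posz i => i | Negz i => i end.
Definition mann m : bool := match m with Posz i => true | Negz i => false end.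
Definition emode m k : C :=
  if mann m == ((midx m).+1 \in val k) then esgn (midx m).+1 k else 0.

Lemma psi_sq0 m w : m + m + 1 != 0 -> psim m (psim m w) = 0.
Proof.
move=> hm; have := psi_anticomm fermion m m w; rewrite (negbTE hm) scale0r.
rewrite -mulr2n -scaler_nat => /eqP; rewrite scaler_eq0 => /orP[|/eqP//].
by rewrite pnatr_eq0.
Qed.

Lemma psi_swap m n w : psim m (psim n w) = (m + n + 1 == 0)%:R *: w - psim n (psim m w).
Proof. by rewrite -(psi_anticomm fermion) addrK. Qed.

Lemma path_count0 (s : seq nat) r p : path ltn p s -> (r <= p)%N ->
  count (fun i => (i < r)%N) s = 0%N.
Proof.
elim: s p => [|a s IH] p //= /andP[pa as_] rp.
have ra : (r <= a)%N by rewrite ltnW// (leq_ltn_trans rp).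
by rewrite ltnNge ra (IH a).
Qed.

(** Entries below the toggled index are passed with one sign each. At that index an annihilating
    mode meets its partner, with anticommutator 1, and a creating mode meets itself, with square 0.
    If the index is absent, creation inserts it before the larger entries, while annihilation passes
    them all and kills the vacuum. *)
Lemma psi_fock_aux m (s : seq nat) p : path ltn p s -> (p <= midx m)%N ->
  psim m (fock psi s) = if mann m == ((midx m).+1 \in s) then
    (-1) ^+ count (fun i => (i < (midx m).+1)%N) s *: fock psi (tog (midx m).+1 s) else 0.
Proof.
elim: s p => [|a s IH] p.
  case: m => i _ _ /=; first by rewrite (psi_vacuum fermion).
  by rewrite expr0 scale1r NegzE.
move=> /= /andP[pa as_] pm.
have {}IH := IH p (path_le ltn_trans pa as_) pm.
have am : (m + (- a%:Z) + 1 == 0) = mann m && ((midx m).+1 == a).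
  by case: m pm {IH} => i pm /=; lia.
rewrite inE; case: (ltngtP (midx m).+1 a) => [ra|ar|ra] /=.
- have am' : ((midx m).+1 \in s) = false.
    by apply/negbTE/(path_notin as_)/ltnW.
  move: IH; rewrite am' !eqbF_neg (path_count0 as_ (ltnW ra)) expr0 !scale1r.
  case E : (mann m) => /= IH.
    by rewrite psi_swap am E (ltn_eqF ra)/= scale0r sub0r IH mode0r oppr0.
  by case: m E pm {IH am ra am'} => //= i _ _; rewrite NegzE.
- rewrite psi_swap am (gtn_eqF ar) andbF scale0r sub0r IH.
  by case: ifP => _; rewrite ?mode0r ?oppr0// modeZr exprS mulN1r scaleNr.
have am' : ((midx m).+1 \in s) = false.
  by apply/negbTE/(path_notin as_); rewrite ra.
rewrite (path_count0 as_) ?ra// expr0 scale1r; move: IH.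
rewrite am' !eqbF_neg !eqb_id; case E : (mann m) => /= IH.
  by rewrite psi_swap am E ra eqxx/= IH mode0r subr0 scale1r.
have -> : - a%:Z = m by case: m E ra {pm IH am am'} => //= i _ <-; rewrite NegzE.
by rewrite psi_sq0//; case: m E {ra pm IH am am'} => //= i _; lia.
Qed.

Lemma psi_fock m k : psim m (fk k) = emode m k *: fk (togI (midx m) k).
Proof.
rewrite (psi_fock_aux (valP k) (leq0n _)) /emode /=.
by case: ifP => _ //; rewrite scale0r.
Qed.

Lemma coord_psi m v k :
  coord (psim m v) k = emode m (togI (midx m) k) * coord v (togI (midx m) k).
Proof.
elim/fock_ind: v k => [|c l v IH] k; first by rewrite mode0r !coord0 mulr0.
rewrite modeDr modeZr psi_fock !coordL IH coordZ !coord_fk mulrDr; congr (_ + _).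
rewrite [l == _](_ : _ = (togI (midx m) l == k)); last first.
  by rewrite -(inj_eq (can_inj (togIK (midx m)))) togIK.
have [<-|_] := eqVneq (togI (midx m) l) k; last by rewrite !mulr0.
by rewrite togIK !mulr1 mulrC.
Qed.

Lemma nc_emode m k : nc (emode m k) <= 1.
Proof. by rewrite /emode; case: ifP => _; rewrite ?nc0// /esgn nc_sign. Qed.

(** Twice the L(0)-weight, so that the norms below are weighted by natural powers. *)
Definition wt2 k : nat := \sum_(i <- val k) (i.*2).-1.

Lemma fock_weightE k : fock_weight R (val k) = (wt2 k)%:R / 2.
Proof.
rewrite /fock_weight /wt2 natr_sum mulr_suml big_seq [RHS]big_seq.
apply: eq_bigr => i /(fock_pos (valP k)) i0.
by case: i i0 => // i _; rewrite doubleS /= -addnn -addSn natrD -natr1; field.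
Qed.

(** The amount by which psi(m) lowers the L(0)-weight. *)
Definition mwt m : R := m%:~R + 2^-1.

Lemma fock_weight_tog m k : emode m k != 0 ->
  fock_weight R (val (togI (midx m) k)) = fock_weight R (val k) - mwt m.
Proof.
rewrite /emode; case: ifP => [/eqP e _|]; last by rewrite eqxx.
rewrite /fock_weight /= (sum_tog _ (valP k)) ?ltn0Sn// -e; congr (_ + _).
rewrite /mwt; case: m {e} => i /=; first by rewrite mulrN1z -natr1 -[i%:~R]/(i%:R); field.
rewrite mulr1z NegzE rmorphN/= -[(i.+1%:Z)%:~R]/(i.+1%:R); by field.
Qed.

Lemma wt2_tog i k : ((wt2 k + (i.*2).+1 == wt2 (togI i k))%N || (i.+1 \in val k)) &&
  ((wt2 k == wt2 (togI i k) + (i.*2).+1)%N || (i.+1 \notin val k)).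
Proof.
have h := @sum_tog int (fun j => ((j.*2).-1)%:Z) i.+1 (val k) 0 (valP k) (ltn0Sn _).
have e (s : seq nat) : \sum_(j <- s) ((j.*2).-1)%:Z = (\sum_(j <- s) (j.*2).-1)%:Z.
  by elim: s => [|a s IH]; rewrite ?big_nil// !big_cons IH PoszD.
move: h; rewrite !e -/(wt2 k) -/(wt2 (togI i k)) doubleS /=.
by case: ifP => _ h; lia.
Qed.

Lemma wt2_ann (i : nat) k : emode i%:Z k != 0 -> (wt2 k = wt2 (togI i k) + (i.*2).+1)%N.
Proof.
rewrite /emode /=; case: ifP => [/eqP e _|]; last by rewrite eqxx.
by have := wt2_tog i k; rewrite -e /= orbF => /andP[_ /eqP].
Qed.

Lemma wt2_cre (i : nat) k : emode (Negz i) k != 0 -> (wt2 k + (i.*2).+1 = wt2 (togI i k))%N.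
Proof.
rewrite /emode /=; case: ifP => [/eqP e _|]; last by rewrite eqxx.
by have := wt2_tog i k; rewrite -e /= orbF => /andP[/eqP].
Qed.

(** * Parity *)

Lemma sigma_fk k : sigma V (fk k) = (-1) ^+ size (val k) *: fk k.
Proof.
have h (s : seq nat) : parity (odd (size s)) (fock psi s).
  elim: s => [|a s IH] /=; first exact: (vacuum_parity vosa).
  by rewrite -addTb; apply: (mode_parity vosa) IH; apply: (psi_odd fermion).
by have := h (val k); rewrite /parity signr_odd.
Qed.

Lemma coord_sigma v k : coord (sigma V v) k = (-1) ^+ size (val k) * coord v k.
Proof.
have sl := sigma_linear vosa.
elim/fock_ind: v k => [|c l v IH] k.
  have h := sl (-1) 0 0; rewrite scaler0 addr0 in h.
  have -> : sigma V 0 = 0 by move: h; rewrite scaleN1r addNr.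
  by rewrite coord0 mulr0.
rewrite sl sigma_fk !coordL IH coordZ coord_fk mulrDr; congr (_ + _).
by have [->|_] := eqVneq l k; rewrite ?mulr0// !mulr1 mulrC.
Qed.

Lemma parityP p v : parity p v <-> forall k, odd (size (val k)) != p -> coord v k = 0.
Proof.
split=> [pv k|h].
  have := coord_sigma v k; rewrite pv coordZ => e kp.
  apply/eqP; move/eqP: e; rewrite -subr_eq0 -mulrBl mulf_eq0 => /orP[|//].
  rewrite -(signr_odd _ (size _)); move: kp; case: p {pv} => /=; case: (odd _) => //= _.
    by rewrite expr0 expr1 -opprD oppr_eq0 (_ : 1 + 1 = 2%:R) ?pnatr_eq0.
  by rewrite expr0 expr1 opprK (_ : 1 + 1 = 2%:R) ?pnatr_eq0.
apply: coord_ext => k; rewrite coord_sigma coordZ.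
have [<-|kp] := eqVneq (odd (size (val k))) p; first by rewrite signr_odd.
by rewrite (h _ kp) !mulr0.
Qed.

Lemma parity_psi p m v : parity p v -> parity (~~ p) (psim m v).
Proof. by move=> pv; rewrite -addTb; apply: (mode_parity vosa) pv; apply: (psi_odd fermion). Qed.

Lemma parity0 p : parity p (0 : V).
Proof. by apply/parityP => k _; rewrite coord0. Qed.

Lemma parityL p a v w : parity p v -> parity p w -> parity p (a *: v + w).
Proof.
move=> /parityP pv /parityP pw; apply/parityP => k kp.
by rewrite coordL pv// pw// mulr0 addr0.
Qed.

Lemma parity_sum (I : Type) (s : seq I) p (F : I -> V) :
  (forall i, parity p (F i)) -> parity p (\sum_(i <- s) F i).
Proof.
move=> h; elim: s => [|i s IH]; first by rewrite big_nil; apply: parity0.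
by rewrite big_cons -[F i]scale1r; apply: parityL.
Qed.

Lemma parityZ p a v : parity p v -> parity p (a *: v).
Proof. by move=> pv; rewrite -[_ *: _]addr0; apply: parityL => //; apply: parity0. Qed.

(** * The operators [exp (x L(0))] and the square bracket modes *)

Lemma coord_expL0 (x : C) v k :
  coord (expL0 psi x v) k = coord v k * cexp (x * (fock_weight R (val k))%:C).
Proof.
have [s [hs _]] := coordE v.
rewrite (@coord_fset _ (fun k => coord v k * cexp (x * (fock_weight R (val k))%:C)) s)//.
  by move=> l /hs ->; rewrite mul0r.
by rewrite /expL0 (@fsbigTE _ _ _ _ s)// => l /hs ->; rewrite mul0r scale0r.
Qed.

Lemma fock1 : psim (-1) (vacuum V) = psi.
Proof. by have [] := creation vosa psi. Qed.

Definition fock_psi : fock_index := exist _ [:: 1%N] isT.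

Lemma coord_psi1 k : coord psi k = (k == fock_psi)%:R.
Proof. by rewrite eq_sym -coord_fk /= fock1. Qed.

Lemma fsum_nat (N : nat) (F : nat -> V) : (forall j, (N <= j)%N -> F j = 0) ->
  \sum_(j \in [set: nat]) F j = \sum_(j < N) F j.
Proof.
move=> h; rewrite -(big_mkord xpredT F) /index_iota subn0.
rewrite (@fsbigTE _ _ _ _ [fset j | j in iota 0 N]%fset) => [|j].
  rewrite big_imfset//=.
  apply: perm_big; apply: uniq_perm; rewrite ?iota_uniq ?enum_finmem_uniq//.
    by rewrite undup_uniq.
  by move=> j; rewrite mem_undup.
rewrite inE /= mem_iota add0n leq0n /= -leqNgt; exact: h.
Qed.

Lemma sqmode_psi n u (N : nat) : (forall j, (N <= j)%N -> psim (n + j%:Z) u = 0) ->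
  sqmode psi psi n u = \sum_(j < N) expm1_coef (2^-1) (- (n + j%:Z) - 1) j *: psim (n + j%:Z) u.
Proof.
move=> h; rewrite /sqmode (@fsbigTE _ _ _ _ [fset fock_psi]%fset) => [|k]; last first.
  by rewrite inE => /negbTE kp; rewrite coord_psi1 kp scale0r.
rewrite big_seq_fset1 coord_psi1 eqxx scale1r (@fsum_nat N) => [|j Nj]; last first.
  by rewrite /= fock1 h ?scaler0.
apply: eq_bigr => j _; rewrite /= fock1; congr (expm1_coef _ _ _ *: _).
rewrite (_ : fock_weight R [:: 1%N] = 2^-1) ?fmorphV ?rmorph_nat//.
by rewrite /fock_weight big_seq1; field.
Qed.

Lemma cexpD (x y : C) : cexp (x + y) = cexp x * cexp y.
Proof.
case: x y => [a b] [c d]; rewrite /cexp /= expRD cosD sinD rmorphM/=.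
apply/eqP; rewrite eq_complex/= !mul0r !subr0 !addr0; apply/andP; split; apply/eqP; ring.
Qed.

Lemma cexp0 : cexp (0 : C) = 1.
Proof. by rewrite /cexp /= expR0 cos0 sin0; rewrite mul1r. Qed.

Lemma expL0_psi x m v :
  expL0 psi x (psim m v) = cexp (- (x * (mwt m)%:C)) *: psim m (expL0 psi x v).
Proof.
apply: coord_ext => k; rewrite coord_expL0 coordZ !coord_psi coord_expL0.
set t := togI _ _; have [->|e0] := eqVneq (emode m t) 0; first by rewrite !mul0r mulr0.
have := fock_weight_tog e0; rewrite togIK => ->.
by rewrite rmorphB/= mulrBr addrC cexpD; ring.
Qed.

Lemma expL0L x a v w : expL0 psi x (a *: v + w) = a *: expL0 psi x v + expL0 psi x w.
Proof.
by apply: coord_ext => k; rewrite coord_expL0 !coordL !coord_expL0; ring.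
Qed.

Lemma expL0_vacuum x : expL0 psi x (vacuum V) = vacuum V.
Proof.
apply: coord_ext => k; rewrite coord_expL0.
have -> : vacuum V = fk fock0 by [].
rewrite coord_fk; have [<-|_] := eqVneq fock0 k; last by rewrite mul0r.
by rewrite /fock_weight big_nil mulr0 cexp0 mulr1.
Qed.

Lemma parity_expL0 p x v : parity p v -> parity p (expL0 psi x v).
Proof.
by move=> /parityP h; apply/parityP => k /h; rewrite coord_expL0 => ->; rewrite mul0r.
Qed.

End FockBasis.

(** * Summability of traces *)

Section NatSums.
Variable R : realType.
Local Open Scope ereal_scope.

Lemma es_nat_ub (a : nat -> \bar R) M : (forall i, 0 <= a i) ->
  (forall n, \sum_(i < n) a i <= M) -> es a <= M.
Proof.
move=> a0 h; apply: es_ub => A; pose n := (\max_(i <- A) i).+1.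
apply: le_trans (h n); rewrite -(big_mkord xpredT a).
apply: lee_sum_fset_nat => // i /= iA; rewrite ltnS.
exact: (@leq_bigmax_seq _ _ _ (fun i => i)).
Qed.

Lemma es_ratio (a : nat -> R) (q : R) (i0 : nat) : (forall i, 0 <= a i)%R ->
  (0 <= q < 1)%R -> (forall i, (i0 <= i)%N -> a i.+1 <= q * a i)%R ->
  es (fun i => (a i)%:E) < +oo.
Proof.
move=> a0 /andP[q0 q1] h.
have q1' : (0 < 1 - q)%R by rewrite subr_gt0.
pose M := (\sum_(i < i0) a i + a i0 / (1 - q))%R.
apply: (@le_lt_trans _ _ M%:E); last exact: ltry.
apply: es_nat_ub => [i|n]; first by rewrite lee_fin.
rewrite sumEFin lee_fin.
(* The remainder a(i0 + j) / (1 - q) is kept in the bound so that the induction closes by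
   telescoping. *)
have geo j : (\sum_(i < j) a (i0 + i)%N <= a i0 / (1 - q) - a (i0 + j)%N / (1 - q))%R.
  elim: j => [|j IH]; first by rewrite big_ord0 addn0 subrr.
  rewrite big_ord_recr/= (le_trans (lerD IH (lexx _)))//.
  rewrite -addrA lerD2l addnS.
  have := h (i0 + j)%N (leq_addr _ _); rewrite -!mulNr.
  set x := a (i0 + j)%N; set y := a _ => hy.
  rewrite -(ler_pM2r q1') mulrDl -!mulrA mulVf ?gt_eqF// !mulr1; lra.
have [ni|ni] := leqP n i0.
  rewrite /M -(subnKC ni) big_split_ord/= -addrA lerDl addr_ge0 ?sumr_ge0//.
  by rewrite divr_ge0// ltW.
rewrite -(subnKC (ltnW ni)) big_split_ord/= lerD2l (le_trans (geo _))//.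
by rewrite gerBl divr_ge0// ltW.
Qed.

Lemma es_binom (b : nat) (y : R) : (0 <= y < 1)%R ->
  es (fun i => ('C(b + i, i)%:R * y ^+ i)%:E) < +oo.
Proof.
move=> /andP[y0 y1]; pose q := ((1 + y) / 2)%R.
have q1 : (q < 1)%R by rewrite /q; lra.
have q0 : (0 <= q)%R by rewrite /q; lra.
(* The ratio of consecutive terms is y (b + i + 1) / (i + 1), which is at most [q] once (i + 1) (q -
   y) >= b y. *)
pose i0 := (Num.truncn (b%:R * y / (q - y))%R).+1.
have qy : (0 < q - y)%R by rewrite /q; lra.
apply: (@es_ratio _ q i0); [by move=> i; rewrite mulr_ge0// exprn_ge0|by rewrite q0|].
move=> i ii; have e : (i.+1%:R * 'C(b + i.+1, i.+1)%:R = (b + i.+1)%:R * 'C(b + i, i)%:R :> R)%R.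
  by rewrite -!natrM addnS -mul_bin_diag.
have i1 : (0 < i.+1%:R :> R)%R by rewrite ltr0n.
rewrite -(ler_pM2l i1) [leLHS]mulrA e exprS natrD.
have yi : (0 <= 'C(b + i, i)%:R * y ^+ i :> R)%R by rewrite mulr_ge0 ?exprn_ge0.
rewrite (_ : _ * _ * (y * _) = ((b%:R + i.+1%:R) * y) * ('C(b + i, i)%:R * y ^+ i))%R; last by ring.
rewrite [leRHS](_ : _ = (i.+1%:R * q) * ('C(b + i, i)%:R * y ^+ i))%R; last by ring.
rewrite ler_wpM2r// mulrDl -lerBrDr -mulrBr.
have : (b%:R * y / (q - y) <= i.+1%:R)%R.
  have /truncn_itv/andP[_ /ltW] : (0 <= b%:R * y / (q - y))%R.
    by rewrite divr_ge0 ?mulr_ge0// ltW.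
  move=> /le_trans; apply; rewrite ler_nat; exact: leq_trans ii _.
by rewrite ler_pdivrMr.
Qed.

Lemma nc_binz (n : int) (i : nat) : (nc (binz R n i) <= 'C(absz n + i, i)%:R)%R.
Proof.
elim: i => [|i IH]; first by rewrite binz0 bin0 nc1.
have i1 : (0 < i.+1%:R :> R)%R by rewrite ltr0n.
rewrite -(ler_pM2l i1).
have -> : (i.+1%:R * 'C(absz n + i.+1, i.+1)%:R = (absz n + i.+1)%:R * 'C(absz n + i, i)%:R :> R)%R.
  by rewrite -!natrM addnS -mul_bin_diag.
rewrite -nc_nat -ncM binzSr ncM ler_pM ?nc_ge0//.
rewrite (le_trans (le_ncB _ _))// nc_nat natrD lerD ?ler_nat//.
by case: n {IH} => j /=; rewrite ?NegzE ?rmorphN/= ?ncN -1?[(_%:Z)%:~R]/(_%:R) nc_nat ?ler_nat.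
Qed.

Lemma es_binz (n : int) (y : R) : (0 <= y < 1)%R ->
  es (fun i => (nc (binz R n i) * y ^+ i)%:E) < +oo.
Proof.
move=> y01; apply: le_lt_trans (es_binom (absz n) y01); apply: le_es => i.
by rewrite lee_fin ler_wpM2r ?nc_binz// exprn_ge0//; case/andP: y01.
Qed.

End NatSums.

Section Norms.
Variables (R : realType) (V : vosa_data R) (psi : V).
Hypothesis fermion : rank_one_fermion psi.
Notation C := (R[i]).
Notation psim := (mode psi).
Notation fk k := (fock psi (val k)).
Notation coord := (fock_coord psi).
Implicit Types (u v w : V) (m n l : int) (k : fock_index) (r s t : R).

Let vosa := fermion_vosa fermion.

(* Weighted l1-norms on the Fock space: the radii [r] play the role of the radii of the
   annuli in which products of vertex operators converge. *)
Definition nrm r v : \bar R := es (fun k => (nc (coord v k) * r ^+ wt2 k)%:E).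

Lemma nrm_ge0 r v : 0 <= r -> (0 <= nrm r v)%E.
Proof. by move=> r0; apply: es_ge0 => k; rewrite lee_fin mulr_ge0 ?nc_ge0 ?exprn_ge0. Qed.

Lemma nrmZ r c v : 0 <= r -> nrm r (c *: v) = ((nc c)%:E * nrm r v)%E.
Proof.
move=> r0; rewrite /nrm -es_Zl ?nc_ge0//.
  by apply: eq_es => k; rewrite (coordZ fermion) ncM -mulrA EFinM.
by move=> k; rewrite lee_fin mulr_ge0 ?nc_ge0 ?exprn_ge0.
Qed.

Lemma nrm0 r : nrm r 0 = 0%E.
Proof.
by rewrite /nrm /es esum1// => k _; rewrite (coord0 fermion) nc0 mul0r.
Qed.

Lemma nrmD r v w : 0 <= r -> (nrm r (v + w) <= nrm r v + nrm r w)%E.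
Proof.
move=> r0; rewrite /nrm -es_D; last 2 first.
- by move=> k; rewrite lee_fin mulr_ge0 ?nc_ge0 ?exprn_ge0.
- by move=> k; rewrite lee_fin mulr_ge0 ?nc_ge0 ?exprn_ge0.
apply: le_es => k; rewrite (coordD fermion) -EFinD lee_fin -mulrDl.
by rewrite ler_wpM2r ?exprn_ge0// le_ncD.
Qed.

Lemma nrm_fk r k : 0 <= r -> nrm r (fk k) = (r ^+ wt2 k)%:E.
Proof.
move=> r0; rewrite /nrm (@es_single _ _ k) => [||l lk].
- by rewrite (coord_fk fermion) eqxx nc1 mul1r.
- by rewrite lee_fin mulr_ge0 ?nc_ge0 ?exprn_ge0.
- by rewrite (coord_fk fermion) eq_sym (negbTE lk) nc0 mul0r.
Qed.

Lemma nrm_lty r v : 0 <= r -> (nrm r v < +oo)%E.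
Proof.
move=> r0; elim/(fock_ind fermion): v => [|c k v IH]; first by rewrite nrm0 ltry.
apply: le_lt_trans (nrmD _ _ r0) _; rewrite nrmZ// nrm_fk//.
by rewrite lte_add_pinfty// -EFinM ltry.
Qed.

Lemma nrm_sum (I : Type) (q : seq I) r (F : I -> V) : 0 <= r ->
  (nrm r (\sum_(i <- q) F i) <= \sum_(i <- q) nrm r (F i))%E.
Proof.
move=> r0; elim: q => [|i q IH]; first by rewrite !big_nil nrm0.
by rewrite !big_cons (le_trans (nrmD _ _ r0))// leeD2l.
Qed.

Lemma nrm_mono r t v : 0 <= r -> r <= t -> (nrm r v <= nrm t v)%E.
Proof.
move=> r0 rt; apply: le_es => k; rewrite lee_fin ler_wpM2l ?nc_ge0//.
by rewrite lerXn2r// nnegrE (le_trans r0).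
Qed.

(** Toggling permutes the basis, the coefficients are at most 1 in modulus, and where they are
    nonzero [wt2] changes by exactly -(2m + 1). *)
Lemma nrm_psi r m v : 0 < r ->
  (nrm r (psim m v) <= (r ^ (- (m * 2 + 1)))%:E * nrm r v)%E.
Proof.
move=> r0; rewrite /nrm -(es_bij _ (togI_bij (midx m))).
have r0' := ltW r0.
rewrite -es_Zl ?exprz_ge0//; last first.
  by move=> k; rewrite lee_fin mulr_ge0 ?nc_ge0 ?exprn_ge0.
apply: le_es => k; rewrite -EFinM lee_fin (coord_psi fermion) togIK ncM mulrAC.
rewrite [leRHS]mulrA [leRHS]mulrAC; apply: ler_wpM2r; first exact: nc_ge0.
have [->|e0] := eqVneq (emode R m k) 0.
  by rewrite nc0 mul0r mulr_ge0 ?exprz_ge0 ?exprn_ge0.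
apply: (@le_trans _ _ (1 * r ^+ wt2 (togI (midx m) k))).
  by rewrite ler_wpM2r ?nc_emode// exprn_ge0.
rewrite mul1r -[leRHS]/(r ^ _ * r ^ (Posz _)) -expfzDr ?gt_eqF//.
rewrite -[leLHS]/(r ^ (Posz _)) le_eqVlt; apply/orP; left; apply/eqP; congr (_ ^ _).
case: m e0 => i e0 /=; first by rewrite (wt2_ann e0); lia.
by rewrite -(wt2_cre e0); lia.
Qed.

(* A slot is the sequence of modes of one vertex operator, the power of [cexp z] included. *)
Definition slot := int -> V -> V.
Implicit Types (O X Y : slot).

(** The norms are summed over all modes of the slot: such bounds multiply when slots with matching
    radii are composed, and they are insensitive to a shift of the mode. *)
Definition bdc r t (c : R) O :=
  forall w, (es (fun l => nrm r (O l w)) <= c%:E * nrm t w)%E.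
Definition bd r t O := exists2 c, 0 <= c & bdc r t c O.

Definition sl (z : C) v : slot := fun l w => cexp z ^ (- l - 1) *: mode (expL0 psi z v) l w.
(** The square root of |e^z|, because the norms are weighted by [wt2], twice the weight. *)
Definition rho (z : C) : R := expR (complex.Re z / 2).

Lemma rho_gt0 z : 0 < rho z. Proof. exact: expR_gt0. Qed.

Lemma nc_cexp (z : C) : nc (cexp z) = expR (complex.Re z).
Proof.
rewrite /cexp ncM nc_real ger0_norm ?expR_ge0//.
by rewrite /nc normc_def/= cos2Dsin2 sqrtr1 mulr1.
Qed.

Lemma nc_cexp_mwt (z : C) m : nc (cexp (- (z * (mwt R m)%:C))) = rho z ^ (- (m * 2 + 1)).
Proof.
rewrite nc_cexp /rho; case: z => a b /=; rewrite mulr0 subr0 /mwt.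
have e (n : int) : expR (a / 2) ^ n = expR (a / 2 * n%:~R).
  case: n => n; first by rewrite -exprnP -expRM_natr.
  by rewrite NegzE -exprnN -expRM_natr -expRN rmorphN mulrN.
rewrite e; congr expR; rewrite rmorphN rmorphD rmorphM/=; by field.
Qed.

Lemma bdc_shift r t c O (f : int -> int) : bijective f -> bdc r t c O ->
  bdc r t c (fun l => O (f l)).
Proof.
move=> bf h w; rewrite (@es_bij _ _ _ f (fun l => nrm r (O l w)))//.
Qed.

Lemma addl_bij (d : int) : bijective (fun l : int => l + d).
Proof. by exists (fun l => l - d) => l; rewrite ?addrK ?subrK. Qed.

Definition compL m O : slot := fun l w => psim m (O l w).
Definition compR m O : slot := fun l w => O l (psim m w).

Lemma bdcZ r t c a O : 0 < r -> bdc r t c O -> bdc r t (nc a * c) (fun l w => a *: O l w).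
Proof.
move=> r0 h w; under eq_es do rewrite nrmZ ?ltW//.
rewrite es_Zl ?nc_ge0//; last by move=> l; rewrite nrm_ge0// ltW.
by rewrite EFinM -muleA lee_wpmul2l// lee_fin nc_ge0.
Qed.

Lemma bdc_compL r t c m O : 0 < r -> bdc r t c O ->
  bdc r t (r ^ (- (m * 2 + 1)) * c) (compL m O).
Proof.
move=> r0 h w; have p0 : 0 <= r ^ (- (m * 2 + 1)) by rewrite exprz_ge0 ?ltW.
apply: (@le_trans _ _ ((r ^ (- (m * 2 + 1)))%:E * es (fun l => nrm r (O l w)))%E).
  rewrite -es_Zl//; last by move=> l; rewrite nrm_ge0// ltW.
  by apply: le_es => l; apply: nrm_psi.
by rewrite EFinM -muleA lee_wpmul2l// lee_fin.
Qed.

Lemma bdc_compR r t c m O : 0 < t -> 0 <= c -> bdc r t c O ->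
  bdc r t (t ^ (- (m * 2 + 1)) * c) (compR m O).
Proof.
move=> t0 c0 h w; apply: le_trans (h _) _.
by rewrite mulrC EFinM -muleA lee_wpmul2l ?lee_fin// nrm_psi.
Qed.

Lemma bdcD r t c d O X : 0 < r -> bdc r t c O -> bdc r t d X -> 0 <= c -> 0 <= d ->
  bdc r t (c + d) (fun l w => O l w + X l w).
Proof.
move=> r0 hO hX c0 d0 w.
apply: (@le_trans _ _ (es (fun l => (nrm r (O l w) + nrm r (X l w))%E))).
  by apply: le_es => l; apply: nrmD; apply: ltW.
rewrite es_D; [|by move=> l; rewrite nrm_ge0// ltW..].
by rewrite EFinD ge0_muleDl ?lee_fin// leeD.
Qed.

(* A family of slots is summable with total bound [c] when the bounds of its members are. *)
Definition fbd r t (Y : nat -> slot) := exists2 c : nat -> R,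
  (forall i, 0 <= c i) /\ (es (fun i => (c i)%:E) < +oo)%E & forall i, bdc r t (c i) (Y i).

Definition fin_sum (X : slot) (Y : nat -> slot) := forall l w, exists N,
  (forall i, (N <= i)%N -> Y i l w = 0) /\ X l w = \sum_(i < N) Y i l w.

(** Tonelli exchanges the sum over the family with the sum over the modes, so the number of nonzero
    members may depend on the mode and on the vector. *)
Lemma fbd_bd r t X (Y : nat -> slot) : 0 < r -> 0 < t -> fbd r t Y -> fin_sum X Y -> bd r t X.
Proof.
move=> r0 t0 [c [c0 cs] hc] XY; have fc : es (fun i => (c i)%:E) \is a fin_num.
  by rewrite ge0_fin_numE ?es_ge0// => i; rewrite lee_fin.
exists (fine (es (fun i => (c i)%:E))); first by rewrite fine_ge0 ?es_ge0// => i; rewrite lee_fin.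
move=> w; rewrite fineK//.
have n0 i l : (0 <= nrm r (Y i l w))%E by rewrite nrm_ge0// ltW.
apply: (@le_trans _ _ (es (fun l => es (fun i => nrm r (Y i l w))))).
  apply: le_es => l; have [N [_ ->]] := XY l w; apply: le_trans (nrm_sum _ _ (ltW r0)) _.
  have -> : (\sum_(i < N) nrm r (Y i l w) = \sum_(i <- [fset i | i in iota 0 N]%fset) nrm r (Y i l w))%E.
    rewrite big_imfset//= -(big_mkord xpredT (fun i => nrm r (Y i l w))) /index_iota subn0.
    apply: perm_big; apply: uniq_perm; rewrite ?iota_uniq ?undup_uniq//.
    by move=> j; rewrite mem_undup.
  exact: es_fset.
rewrite es_exch//.
apply: (@le_trans _ _ (es (fun i => (c i)%:E * nrm t w)%E)).
  by apply: le_es => i; apply: hc.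
have tw0 := nrm_ge0 w (ltW t0).
have fw : nrm t w \is a fin_num by rewrite ge0_fin_numE// nrm_lty// ltW.
rewrite -(fineK fw) muleC -es_Zl ?fine_ge0//.
by apply: le_es => i; rewrite muleC.
Qed.

Lemma slL z a v w : sl z (a *: v + w) = fun l x => a *: sl z v l x + sl z w l x.
Proof.
apply/funext => l; apply/funext => x.
by rewrite /sl (expL0L fermion) (mode_linearl vosa) scalerDr !scalerA mulrC.
Qed.

Lemma sl_lin z v l a x y : sl z v l (a *: x + y) = a *: sl z v l x + sl z v l y.
Proof. by rewrite /sl (mode_linearr vosa) scalerDr !scalerA mulrC. Qed.

(* The two halves of the iterate formula for [psi(n) v], rescaled to the point z. *)
Definition itL z n v (i : nat) : slot := fun l w =>
  ((-1) ^+ i * binz R n i * cexp (- (z * (mwt R (n - i%:Z))%:C))) *: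
    compL (n - i%:Z) (fun l => sl z v (l + i%:Z)) l w.
Definition itR z n (p : bool) v (i : nat) : slot := fun l w =>
  (- ((-1) ^+ i * binz R n i * ((-1) ^+ p * (-1) ^ n) * cexp (- (z * (mwt R i%:Z)%:C)))) *:
    compR i%:Z (fun l => sl z v (l + (n - i%:Z))) l w.

Lemma cexp_exprz (z : C) (n : int) : cexp z ^ n = cexp (z * n%:~R).
Proof.
have nat_ (m : nat) : cexp z ^+ m = cexp (z * m%:R).
  elim: m => [|m IH]; first by rewrite expr0 mulr0 cexp0.
  by rewrite exprS IH -cexpD -natr1 mulrDr mulr1 addrC.
case: n => m; first by rewrite -exprnP nat_.
rewrite NegzE -exprnN nat_ rmorphN/= -[(m.+1%:Z)%:~R]/(m.+1%:R) mulrN.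
have e : cexp (- (z * m.+1%:R)) * cexp (z * m.+1%:R) = 1 by rewrite -cexpD addNr cexp0.
have ne : cexp (z * m.+1%:R) != 0.
  by apply/eqP => h; move: e; rewrite h mulr0 => /esym/eqP; rewrite oner_eq0.
by apply: (mulIf ne); rewrite e mulVf.
Qed.

Lemma mwtE m : (mwt R m)%:C = m%:~R + 2^-1 :> C.
Proof.
rewrite /mwt rmorphD/= fmorphV/= rmorph_nat; congr (_ + _).
by case: m => i; rewrite ?NegzE ?rmorphN/= -?[(_%:Z)%:~R]/(_%:R) rmorph_nat.
Qed.

(** Borcherds' identity with its first index 0: the left side reduces to the term j = 0, the mode of
    psi(n) b. The powers of e^z on both sides agree by the grading, as [key1] and [key2] record. *)
Lemma iter_formula z n p v : parity p v ->
  fin_sum (sl z (psim n v)) (fun i l w => itL z n v i l w + itR z n p v i l w).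
Proof.
move=> pv l w; pose b := expL0 psi z v; have pb : parity p b by apply: (parity_expL0 fermion).
have [N1 h1] := truncation vosa b w; have [N2 h2] := truncation vosa psi w.
pose F (i : nat) := ((-1) ^+ i * binz R n i) *: (psim (0 + n - i%:Z) (mode b (l + i%:Z) w)
  - ((-1) ^+ (true && p) * (-1) ^ n) *: mode b (n + l - i%:Z) (psim (0 + i%:Z) w)).
have key1 i : cexp (- (z * (mwt R (n - i%:Z))%:C)) * cexp z ^ (- (l + i%:Z) - 1) =
    cexp z ^ (- l - 1) * cexp (- (z * (mwt R n)%:C)).
  rewrite !cexp_exprz !mwtE -!cexpD; congr cexp.
  by rewrite !rmorphD !rmorphN/= rmorphD/=; ring.
have key2 i : cexp (- (z * (mwt R i%:Z)%:C)) * cexp z ^ (- (n + l - i%:Z) - 1) =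
    cexp z ^ (- l - 1) * cexp (- (z * (mwt R n)%:C)).
  rewrite !cexp_exprz !mwtE -!cexpD; congr cexp.
  by rewrite !rmorphD !rmorphN/= !rmorphD/= rmorphN/=; ring.
have FE i : itL z n v i l w + itR z n p v i l w =
    (cexp z ^ (- l - 1) * cexp (- (z * (mwt R n)%:C))) *: F i.
  rewrite /itL /itR /F /compL /compR /sl -/b andTb !add0r scalerA scalerBr !scalerA -scaleNr.
  rewrite (_ : l + (n - i%:Z) = n + l - i%:Z); last by lia.
  rewrite (modeZr fermion) scalerDr !scalerA; congr (_ *: _ + _ *: _).
    by rewrite -mulrA key1 mulrC.
  by rewrite mulNr mulrN; congr (- _); rewrite -[LHS]mulrA key2 mulrC.
pose N := (absz N1 + absz N2 + absz l)%N.
have F0 i : (N <= i)%N -> F i = 0.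
  rewrite /F /N => Ni; rewrite h1 ?h2 ?(mode0r fermion) ?scaler0 ?subr0 ?scaler0//; lia.
exists N; split => [i Ni|]; first by rewrite FE F0// scaler0.
under eq_bigr do rewrite FE.
rewrite -scaler_sumr -(fsum_nat F0) -(jacobi vosa w 0 n l (psi_odd fermion) pb).
rewrite (@fsum_nat _ _ 1%N) => [|[|j]//= _]; last first.
  by rewrite binz_nat0 scale0r.
rewrite big_ord1 binz0 scale1r /= addr0 add0r subr0 /sl (expL0_psi fermion).
by rewrite (modeZl fermion) scalerA.
Qed.

Lemma exprz_pow2 (x : R) (d : int) (i : nat) : x != 0 -> x ^ (d + (i.*2)%:Z) = x ^ d * (x ^+ 2) ^+ i.
Proof. by move=> x0; rewrite expfzDr// -exprM mul2n. Qed.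

Lemma nc_mul3 (a b c : C) : nc a = 1 -> nc (a * b * c) = nc b * nc c.
Proof. by move=> a1; rewrite !ncM a1 mul1r. Qed.

Lemma nc_signz n : nc ((-1 : C) ^ n) = 1.
Proof.
case: n => j; first by rewrite -exprnP nc_sign.
by rewrite NegzE -exprnN ncV nc_sign invr1.
Qed.

(** Up to a constant the bound of the i-th member is |binz n i| (r rho(z))^(2i), a binomial series
    inside its disc of convergence; for [itR] the inverse of t rho(z) takes the place of r
    rho(z). *)
Lemma fbd_itL r t z n v : 0 < r -> r * rho z < 1 -> bd r t (sl z v) -> fbd r t (itL z n v).
Proof.
move=> r0 rz [c c0 hc]; pose x := r * rho z.
have x0 : 0 < x by rewrite mulr_gt0 ?rho_gt0.
have r0' := ltW r0; have x0' := ltW x0.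
have xc0 : 0 <= x ^ (- (n * 2 + 1)) * c by rewrite mulr_ge0 ?exprz_ge0.
have x21 : 0 <= x ^+ 2 < 1 by rewrite exprn_ge0// expr_lt1.
have t0 i : 0 <= nc (binz R n i) * (x ^+ 2) ^+ i.
  by rewrite mulr_ge0 ?nc_ge0 ?exprn_ge0.
exists (fun i => (x ^ (- (n * 2 + 1)) * c) * (nc (binz R n i) * (x ^+ 2) ^+ i)).
  split => [i|]; first by rewrite mulr_ge0.
  under eq_es do rewrite EFinM.
  by rewrite es_Zl// lte_mul_pinfty ?lee_fin ?es_binz.
move=> i; rewrite [X in bdc _ _ X](_ : _ =
    nc ((-1) ^+ i * binz R n i * cexp (- (z * (mwt R (n - i%:Z))%:C))) *
    (r ^ (- ((n - i%:Z) * 2 + 1)) * c)).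
  by apply: bdcZ => //; apply: bdc_compL => //; apply: bdc_shift => //; apply: addl_bij.
rewrite nc_mul3 ?nc_sign// nc_cexp_mwt.
rewrite (_ : - ((n - i%:Z) * 2 + 1) = - (n * 2 + 1) + (i.*2)%:Z); last by lia.
rewrite !exprz_pow2 ?gt_eqF ?rho_gt0// /x !exprzMl ?unitfE ?gt_eqF ?rho_gt0// !exprMn; ring.
Qed.

Lemma fbd_itR r t z n p v : 0 < r -> 0 < t -> 1 < t * rho z -> bd r t (sl z v) ->
  fbd r t (itR z n p v).
Proof.
move=> r0 t0 tz [c c0 hc]; pose x := (t * rho z)^-1.
have tz0 : 0 < t * rho z by rewrite mulr_gt0 ?rho_gt0.
have x0 : 0 < x by rewrite invr_gt0.
have x1 : x < 1 by rewrite invf_lt1.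
have x0' := ltW x0; have xc0 : 0 <= x * c by rewrite mulr_ge0.
have x21 : 0 <= x ^+ 2 < 1 by rewrite exprn_ge0// expr_lt1.
have t1 i : 0 <= nc (binz R n i) * (x ^+ 2) ^+ i.
  by rewrite mulr_ge0 ?nc_ge0 ?exprn_ge0.
exists (fun i => (x * c) * (nc (binz R n i) * (x ^+ 2) ^+ i)).
  split => [i|]; first by rewrite mulr_ge0.
  under eq_es do rewrite EFinM.
  by rewrite es_Zl// lte_mul_pinfty ?lee_fin ?es_binz.
move=> i; rewrite [X in bdc _ _ X](_ : _ =
    nc (- ((-1) ^+ i * binz R n i * ((-1) ^+ p * (-1) ^ n) * cexp (- (z * (mwt R i%:Z)%:C)))) *
    (t ^ (- (i%:Z * 2 + 1)) * c)).
  by apply: bdcZ => //; apply: bdc_compR => //; apply: bdc_shift => //; apply: addl_bij.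
rewrite ncN [_ * binz R n i * _]mulrAC nc_mul3 ?nc_cexp_mwt; last first.
  by rewrite mulrA nc_mul3 ?nc_sign// nc_signz mulr1.
rewrite (_ : - (i%:Z * 2 + 1) = - (1 + (i.*2)%:Z)); last by lia.
rewrite -!invr_expz !exprz_pow2 ?gt_eqF ?rho_gt0// expr1z /x exprVn exprVn !invfM !exprMn !invfM; ring.
Qed.

(** Induction along the Fock vector by the iterate formula, whose two halves need the point strictly
    between the radii: r < 1 / rho(z) < t. The vacuum acts by its mode -1 alone, as the identity. *)
Lemma bd_sl r t z v : 0 < r -> r * rho z < 1 -> 1 < t * rho z -> bd r t (sl z v).
Proof.
move=> r0 rz tz; have t0 : 0 < t.
  by rewrite -(pmulr_lgt0 _ (rho_gt0 z)) (lt_trans _ tz).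
have rt : r <= t.
  by rewrite -(ler_pM2r (rho_gt0 z)) ltW// (lt_trans rz).
elim/(fock_ind fermion): v => [|a k v [c c0 hc]].
  exists 0 => // w; rewrite mul0e /es esum1// => l _.
  have -> : (0 : V) = -1 *: 0 + 0 by rewrite scaler0 addr0.
  by rewrite slL scaleN1r addNr nrm0.
have [d d0 hd] : bd r t (sl z (fk k)).
  elim: (val k) => [|a' s IH] /=.
    have r0' := ltW r0.
    exists 1 => // w; rewrite mul1e (@es_single _ _ (-1)) ?nrm_ge0//.
      rewrite /sl (expL0_vacuum fermion) (vacuum_mode vosa) opprK addrC subrr expr0z.
      by rewrite eqxx !scale1r nrm_mono.
    move=> l l1; rewrite /sl (expL0_vacuum fermion) (vacuum_mode vosa).
    by rewrite (negbTE l1) scale0r scaler0 nrm0.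
  have pv : parity (odd (size s)) (fock psi s).
    elim: s {IH} => [|b s IH] /=; first exact: (vacuum_parity vosa).
    exact: (parity_psi fermion).
  have [c1 [c10 c1s] h1] := fbd_itL (- a'%:Z) r0 rz IH.
  have [c2 [c20 c2s] h2] := fbd_itR (- a'%:Z) (odd (size s)) r0 t0 tz IH.
  apply: (fbd_bd r0 t0 _ (iter_formula z (- a'%:Z) pv)).
  exists (fun i => c1 i + c2 i); first split=> [i|]; first by rewrite addr_ge0.
    under eq_es do rewrite EFinD.
    by rewrite es_D ?lte_add_pinfty// => i; rewrite lee_fin.
  by move=> i; apply: bdcD.
exists (nc a * d + c); first by rewrite addr_ge0// mulr_ge0 ?nc_ge0.
by rewrite slL; apply: bdcD => //; [apply: bdcZ|rewrite mulr_ge0 ?nc_ge0].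
Qed.

End Norms.

Section FockCount.
Variable R : realType.

(** Basis vectors are finite sets of indices, so a partial sum is at most a product of factors 1 +
    f(i), hence at most the exponential of the sum of the f(i). *)
Lemma es_fock (y : R) : 0 <= y < 1 -> (es (fun k : fock_index => (y ^+ wt2 k)%:E) < +oo)%E.
Proof.
move=> y01; have /andP[y0 y1] := y01.
pose f (i : nat) := y ^+ (i.*2).-1; have f0 i : 0 <= f i by rewrite exprn_ge0.
have fs : (es (fun i => (f i)%:E) < +oo)%E.
  apply: (@es_ratio _ f y 1) => // -[|i] // _.
  rewrite /f doubleS /= -exprS !doubleS /= exprS.
  by rewrite ler_piMl ?exprn_ge0// ltW.
pose B := fine (es (fun i => (f i)%:E)).
have fB n : \sum_(i < n) f i <= B.
  have ef : (0 <= es (fun i => (f i)%:E))%E by apply: es_ge0 => i; rewrite lee_fin.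
  rewrite -lee_fin fineK ?ge0_fin_numE// -sumEFin.
  rewrite -(big_mkord xpredT (fun i => (f i)%:E)) /index_iota subn0.
  have := es_fset (fun i => (f i)%:E) [fset i | i in iota 0 n]%fset.
  rewrite big_imfset//=; congr (_ <= _)%E; apply: perm_big; apply: uniq_perm.
  - exact: undup_uniq.
  - exact: iota_uniq.
  - by move=> j; rewrite mem_undup.
apply: (@le_lt_trans _ _ (expR B)%:E); last exact: ltry.
apply: es_ub => A; rewrite sumEFin lee_fin.
pose n := (\max_(k <- A) \max_(i <- val k) i).+1.
have kn (k : fock_index) i : k \in A -> i \in val k -> (i < n)%N.
  move=> kA ik; rewrite ltnS.
  apply: leq_trans (@leq_bigmax_seq _ _ _ (fun k : fock_index => \max_(i <- val k) i)%N _ kA isT).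
  exact: (@leq_bigmax_seq _ _ _ (fun i => i)).
pose phi (k : fock_index) : {set 'I_n} := [set i : 'I_n | val i \in val k]%SET.
have uk (k : fock_index) : uniq (val k) /\ sorted ltn (val k).
  have := valP k; move=> /path_sorted sk; split=> //.
  exact: (sorted_uniq ltn_trans ltnn).
have phi_inj : {in A &, injective phi}.
  move=> k k' kA kA' e; apply: val_inj.
  apply: (irr_sorted_eq ltn_trans ltnn); [by have [] := uk k|by have [] := uk k'|].
  have h (k1 k2 : fock_index) i : k1 \in A -> phi k1 = phi k2 -> i \in val k1 -> i \in val k2.
    move=> k1A e12 ik; have /setP/(_ (Ordinal (kn _ _ k1A ik))) := e12.
    by rewrite !inE /= ik => <-.
  by move=> i; apply/idP/idP; apply: h.
have wE k : k \in A -> y ^+ wt2 k = \prod_(i in phi k) f i.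
  move=> kA; rewrite /wt2 -prodrXr.
  rewrite [RHS](_ : _ = \prod_(i < n | val i \in val k) f i); last by apply: eq_bigl => i; rewrite inE.
  rewrite -(big_mkord (fun i => i \in val k) f) -[RHS]big_filter.
  apply: perm_big; apply: uniq_perm; [by have [] := uk k|by rewrite filter_uniq// iota_uniq|].
  move=> i; rewrite mem_filter mem_index_iota /=; case ik: (i \in val k) => //=.
  by rewrite (kn k).
rewrite big_seq (eq_bigr _ (fun k kA => wE k kA)) -big_seq.
apply: (@le_trans _ _ (\sum_(J : {set 'I_n}) \prod_(i in J) f i)).
  rewrite -(big_map phi xpredT (fun J => \prod_(i in J) f (val i))) /=.
  rewrite -(undup_id (s := [seq phi k | k <- A])); last by rewrite map_inj_in_uniq.
  rewrite big_uniq ?undup_uniq//= [leRHS](bigID (mem (undup [seq phi k | k <- A])))/=.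
  by rewrite lerDl sumr_ge0// => J _; rewrite prodr_ge0.
have -> : \sum_(J : {set 'I_n}) \prod_(i in J) f i = \prod_(i < n) (f i + 1).
  rewrite bigA_distr; apply: eq_bigr => J _.
  by rewrite big_mkcond; apply: eq_bigr => i _.
apply: (@le_trans _ _ (\prod_(i < n) expR (f i))).
  apply: ler_prod => i _; rewrite addr_ge0//= addrC; exact: expR_ge1Dx.
by rewrite -expR_sum ler_expR.
Qed.

End FockCount.

(** * Absolute convergence and linearity of traces of products of slots *)

Section Traces.
Variables (R : realType) (V : vosa_data R) (psi : V).
Hypothesis fermion : rank_one_fermion psi.
Notation C := (R[i]).
Notation psim := (mode psi).
Notation fk k := (fock psi (val k)).
Notation coord := (fock_coord psi).
Notation slot := (slot V).
Notation nrm := (nrm psi).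
Notation bdc := (bdc psi).
Notation bd := (bd psi).
Notation sl := (sl psi).
Notation compL := (compL psi).
Notation compR := (compR psi).
Variables (theta tau : C).
Hypothesis theta_norm : nc theta = 1.
Hypothesis tau_gt0 : 0 < complex.Im tau.
Implicit Types (u v w : V) (m n l : int) (k : fock_index) (r s t : R) (O X : slot).
Implicit Types (P S os : seq slot) (ms : seq int).

Let vosa := fermion_vosa fermion.

(** Lists of modes of the wrong length give 0, so that traces are summed over the single type
    [seq int] whatever the number of slots. *)
Fixpoint app os ms w : V := match os, ms with
  | [::], [::] => w
  | o :: os', m :: ms' => o m (app os' ms' w)
  | _, _ => 0
  end.

(* [(- theta) ^+ size k] combines the supertrace sign with the eigenvalue of [g]. *)
Definition tr (X : V -> V) k : C :=
  (- theta) ^+ size (val k) * coord (X (fk k)) k * qpow tau (fock_weight R (val k) - 48%:R^-1).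

Definition Tt os (x : seq int * fock_index) : C := tr (app os x.1) x.2.
Definition T os : C := sum (Tt os).

Definition linO O := forall l a x y, O l (a *: x + y) = a *: O l x + O l y.
Fixpoint linl os : Prop := if os is o :: os' then linO o /\ linl os' else True.

Definition bdl r t c os :=
  forall w, (es (fun ms => nrm r (app os ms w)) <= c%:E * nrm t w)%E.

(** This is |q|^(1/2), the contraction by q^(L(0)) per unit of [wt2]. *)
Definition hq : R := expR (- pi * complex.Im tau).

Lemma hq_gt0 : 0 < hq. Proof. exact: expR_gt0. Qed.
Lemma hq_lt1 : hq < 1.
Proof. by rewrite /hq expR_lt1 mulNr oppr_lt0 mulr_gt0// pi_gt0. Qed.

Lemma nc_qpow x : nc (qpow tau x) = expR (- (2 * pi * x) * complex.Im tau).
Proof. by rewrite /qpow nc_cexp; case: tau => a b /=; rewrite mul0r sub0r mulNr. Qed.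

Definition Q0 : R := expR (2 * pi * 48%:R^-1 * complex.Im tau).

Lemma nc_qpow_wt k : nc (qpow tau (fock_weight R (val k) - 48%:R^-1)) = Q0 * hq ^+ wt2 k.
Proof.
rewrite nc_qpow fock_weightE /hq -expRM_natl /Q0 -expRD; congr expR; by field.
Qed.

Lemma nc_tr (X : V -> V) k : nc (tr X k) = nc (coord (X (fk k)) k) * (Q0 * hq ^+ wt2 k).
Proof. by rewrite /tr ncM ncM nc_qpow_wt ncX ncN theta_norm expr1n mul1r. Qed.

Definition Kc r t : \bar R := es (fun k => (Q0 * (hq * t / r) ^+ wt2 k)%:E).

Lemma Kc_lty r t : 0 < r -> 0 < t -> hq * t < r -> (Kc r t < +oo)%E.
Proof.
move=> r0 t0 h; rewrite /Kc; under eq_es do rewrite EFinM.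
have y0 : 0 <= hq * t / r by rewrite !mulr_ge0 ?invr_ge0 ?(ltW r0) ?(ltW t0) ?(ltW hq_gt0).
rewrite es_Zl ?expR_ge0//; last by move=> k; rewrite lee_fin exprn_ge0.
rewrite lte_mul_pinfty ?lee_fin ?expR_ge0// es_fock// y0/=.
by rewrite ltr_pdivrMr// mul1r.
Qed.

Lemma coord_nrm r w k : 0 < r -> ((nc (coord w k))%:E <= (r^-1 ^+ wt2 k)%:E * nrm r w)%E.
Proof.
move=> r0; have rk : 0 < r ^+ wt2 k by rewrite exprn_gt0.
apply: (@le_trans _ _ ((r^-1 ^+ wt2 k)%:E * (nc (coord w k) * r ^+ wt2 k)%:E)%E).
  by rewrite -EFinM lee_fin mulrCA exprVn mulVf ?mulr1// gt_eqF.
rewrite lee_wpmul2l ?lee_fin ?exprn_ge0 ?invr_ge0 ?(ltW r0)//.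
exact: (@es_term _ _ (fun k => (nc (coord w k) * r ^+ wt2 k)%:E)).
Qed.

(** On the diagonal entry at the basis vector k the norm of radius t contributes t^(wt2 k), reading
    off a coordinate costs r^(- wt2 k), and q^(L(0)) gives hq^(wt2 k); [Kc] adds these up and is
    finite when hq t < r. *)
Lemma trace_bound r t c os : 0 < r -> 0 < t -> 0 <= c -> bdl r t c os ->
  (asum (Tt os) <= c%:E * Kc r t)%E.
Proof.
move=> r0 t0 c0 h; rewrite asum_pair /asum /Tt /= es_exch; last first.
  by move=> ? ?; rewrite lee_fin nc_ge0.
have q0 := ltW hq_gt0; have r0' := ltW r0; have t0' := ltW t0.
have Qk0 k : 0 <= Q0 * hq ^+ wt2 k by rewrite mulr_ge0 ?expR_ge0 ?exprn_ge0.
rewrite /Kc -es_Zl//; last first.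
  by move=> k; rewrite lee_fin mulr_ge0 ?expR_ge0 ?exprn_ge0// !mulr_ge0 ?invr_ge0.
apply: le_es => k.
apply: (@le_trans _ _ ((Q0 * hq ^+ wt2 k * r^-1 ^+ wt2 k)%:E *
    es (fun ms => nrm r (app os ms (fk k))))%E).
  rewrite -es_Zl; last 2 first.
  - by rewrite mulr_ge0// exprn_ge0// invr_ge0.
  - by move=> ms; apply: nrm_ge0.
  apply: le_es => ms; rewrite nc_tr mulrC EFinM [in leRHS]EFinM -muleA lee_wpmul2l ?lee_fin//.
  exact: coord_nrm.
apply: (@le_trans _ _ ((Q0 * hq ^+ wt2 k * r^-1 ^+ wt2 k)%:E * (c%:E * nrm t (fk k)))%E).
  by rewrite lee_wpmul2l// lee_fin mulr_ge0// exprn_ge0// invr_ge0.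
rewrite (nrm_fk fermion)// -!EFinM lee_fin le_eqVlt; apply/orP; left; apply/eqP.
by rewrite !exprMn; ring.
Qed.

Lemma es_cons (f : seq int -> \bar R) : (forall ms, 0 <= f ms)%E -> f [::] = 0%E ->
  es f = es (fun ms => es (fun m => f (m :: ms))).
Proof.
move=> f0 fn; rewrite -es_pair//.
rewrite (@es_inj_eq _ _ _ (fun x : seq int * int => x.2 :: x.1) f)//.
  by move=> [a b] [c d] /= [-> ->].
by case=> [|m ms]; [right|left; exists (ms, m)].
Qed.

Lemma bdl_nil r t : 0 <= r -> r <= t -> bdl r t 1 [::].
Proof.
move=> r0 rt w; rewrite mul1e (@es_single _ _ [::])//= ?nrm_mono ?nrm_ge0//.
by case=> // m ms _; rewrite (nrm0 fermion).
Qed.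

Lemma bdl_cons r s t c d O os : 0 <= r -> 0 <= c -> 0 <= s -> bdc r s c O -> bdl s t d os ->
  bdl r t (c * d) (O :: os).
Proof.
move=> r0 c0 s0 hO hos w; rewrite es_cons; last 2 first.
- by move=> ms; apply: nrm_ge0.
- by rewrite /= (nrm0 fermion).
apply: (@le_trans _ _ (es (fun ms => c%:E * nrm s (app os ms w))%E)).
  by apply: le_es => ms; apply: hO.
rewrite es_Zl//; last by move=> ms; apply: nrm_ge0.
by rewrite EFinM -muleA lee_wpmul2l ?lee_fin.
Qed.

(** Cutting a list of modes after [size P] is injective, so the sum over lists is at most the sum
    over pairs of lists. *)
Lemma bdl_cat r s t c d P S : 0 <= r -> 0 <= c -> 0 <= s -> linl P ->
  bdl r s c P -> bdl s t d S -> bdl r t (c * d) (P ++ S).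
Proof.
move=> r0 c0 s0 lP hP hS w.
pose f (x : seq int * seq int) := nrm r (app P x.1 (app S x.2 w)).
have appPS : (es (fun ms => nrm r (app (P ++ S) ms w)) <= es f)%E.
  have split_ ms : (nrm r (app (P ++ S) ms w) <= f (take (size P) ms, drop (size P) ms))%E.
    rewrite /f /=; suff <- : app (P ++ S) ms w =
        app P (take (size P) ms) (app S (drop (size P) ms) w) by [].
    elim: P lP {hP f} ms => [|O P IH] lP ms; first by rewrite take0 drop0.
    case: ms => [|m ms] //=; by rewrite IH//; case: lP.
  apply: le_trans (le_es split_) _.
  apply: (@es_inj _ _ _ (fun ms => (take (size P) ms, drop (size P) ms))).
    by move=> x; apply: nrm_ge0.
  by move=> x y [e1 e2]; rewrite -(cat_take_drop (size P) x) e1 e2 cat_take_drop.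
apply: le_trans appPS _; rewrite /f.
rewrite (@es_pair _ _ _ (fun a b => nrm r (app P a (app S b w)))); last first.
  by move=> *; apply: nrm_ge0.
rewrite es_exch; last by move=> *; apply: nrm_ge0.
apply: (@le_trans _ _ (es (fun ms => c%:E * nrm s (app S ms w))%E)).
  by apply: le_es => ms; apply: hP.
rewrite es_Zl//; last by move=> ms; apply: nrm_ge0.
by rewrite EFinM -muleA lee_wpmul2l ?lee_fin.
Qed.

(* The slot at position [P | S] with radius [rho z] may be filled by anything bounded there. *)
Definition good P z S := linl P /\ exists s t K, [/\ 0 < s, s * rho z < 1, 1 < t * rho z, 0 <= K &
  forall O c, 0 <= c -> bdc s t c O -> (asum (Tt (P ++ O :: S)) <= (c * K)%:E)%E].

Lemma good_summ P z S v : good P z S -> summ (Tt (P ++ sl z v :: S)).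
Proof.
move=> [_ [s [t [K [s0 sz tz K0 h]]]]].
have [c c0 hc] := bd_sl fermion v s0 sz tz.
by apply: le_lt_trans (h _ _ c0 hc) _; apply: ltry.
Qed.

Lemma good_tpos s t z : 0 < s -> s * rho z < 1 -> 1 < t * rho z -> 0 < t.
Proof. by move=> s0 sz tz; rewrite -(pmulr_lgt0 _ (rho_gt0 z)) (lt_trans _ tz). Qed.

Lemma good_compL P z S v m : good P z S -> summ (Tt (P ++ compL m (sl z v) :: S)).
Proof.
move=> [_ [s [t [K [s0 sz tz K0 h]]]]].
have [c c0 hc] := bd_sl fermion v s0 sz tz.
apply: le_lt_trans (h _ _ _ (bdc_compL fermion m s0 hc)) (ltry _).
by rewrite mulr_ge0 ?exprz_ge0// ltW.
Qed.

Lemma good_compR P z S v m : good P z S -> summ (Tt (P ++ compR m (sl z v) :: S)).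
Proof.
move=> [_ [s [t [K [s0 sz tz K0 h]]]]].
have [c c0 hc] := bd_sl fermion v s0 sz tz; have t0 := good_tpos s0 sz tz.
apply: le_lt_trans (h _ _ _ (bdc_compR fermion m t0 c0 hc)) (ltry _).
by rewrite mulr_ge0 ?exprz_ge0// ltW.
Qed.

Lemma app_lin P S X O O' a : linl P -> (forall l w, X l w = a *: O l w + O' l w) ->
  forall ms w, app (P ++ X :: S) ms w = a *: app (P ++ O :: S) ms w + app (P ++ O' :: S) ms w.
Proof.
move=> + h; elim: P => [|Q P IH] /= lP [|m ms] w; rewrite ?scaler0 ?addr0 ?h//.
by rewrite IH; case: lP.
Qed.

Lemma trL (X Y Z : V -> V) a k : X (fk k) = a *: Y (fk k) + Z (fk k) ->
  tr X k = a * tr Y k + tr Z k.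
Proof. by move=> e; rewrite /tr e (coordL fermion); ring. Qed.

Lemma T_lin P S X O O' a : linl P -> (forall l w, X l w = a *: O l w + O' l w) ->
  summ (Tt (P ++ O :: S)) -> summ (Tt (P ++ O' :: S)) ->
  T (P ++ X :: S) = a * T (P ++ O :: S) + T (P ++ O' :: S).
Proof.
move=> lP h s1 s2; rewrite /T -sumZ// -sumD//; last exact: summZ.
by apply: eq_sum => x; apply: trL; apply: app_lin.
Qed.

Lemma summ_lin P S X O O' a : linl P -> (forall l w, X l w = a *: O l w + O' l w) ->
  summ (Tt (P ++ O :: S)) -> summ (Tt (P ++ O' :: S)) -> summ (Tt (P ++ X :: S)).
Proof.
move=> lP h s1 s2; apply: summ_eq (summD (summZ a s1) s2) => x.
by apply: trL; apply: app_lin.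
Qed.

Lemma T_zero P S X : linl P -> (forall l w, X l w = 0) -> forall x, Tt (P ++ X :: S) x = 0.
Proof.
move=> lP h x; rewrite /Tt /tr.
have hX l w : X l w = -1 *: X l w + X l w by rewrite !h scaler0 addr0.
by rewrite (@app_lin P S X X X (-1) lP hX) scaleN1r addNr (coord0 fermion) mulr0 mul0r.
Qed.

Lemma T_sum (I : Type) (q : seq I) P S X (Y : I -> slot) (a : I -> C) : linl P ->
  (forall l w, X l w = \sum_(i <- q) a i *: Y i l w) ->
  (forall i, summ (Tt (P ++ Y i :: S))) ->
  summ (Tt (P ++ X :: S)) /\ T (P ++ X :: S) = \sum_(i <- q) a i * T (P ++ Y i :: S).
Proof.
move=> lP + hs; elim: q X => [|i q IH] X h.
  have z := T_zero (X := X) S lP; have {}z x := z (fun l w => etrans (h l w) (big_nil _ _ _ _)) x.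
  by split; [apply: (@summ_eq _ _ _ (fun=> 0)) => //; exact: summ0|rewrite big_nil /T sum0].
have [s2 e2] := IH (fun l w => \sum_(i <- q) a i *: Y i l w) (fun _ _ => erefl).
have hX l w : X l w = a i *: Y i l w + \sum_(i <- q) a i *: Y i l w by rewrite h big_cons.
split; first exact: (summ_lin lP hX).
by rewrite (T_lin lP hX)// big_cons e2.
Qed.

Fixpoint shf (p : nat) (d : int) ms : seq int := match p, ms with
  | _, [::] => [::]
  | 0%N, m :: ms' => (m + d) :: ms'
  | p'.+1, m :: ms' => m :: shf p' d ms'
  end.

Lemma shfK p d : cancel (shf p d) (shf p (- d)).
Proof.
elim: p => [|p IH] [|m ms] //=; first by rewrite addrK.
by rewrite IH.
Qed.

Lemma app_shift P S O d ms w :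
  app (P ++ (fun l => O (l + d)) :: S) ms w = app (P ++ O :: S) (shf (size P) d ms) w.
Proof. by elim: P ms => [|Q P IH] [|m ms] //=; rewrite IH. Qed.

Definition shf2 (p : nat) d (x : seq int * fock_index) := (shf p d x.1, x.2).
Lemma shf2_bij p d : bijective (shf2 p d).
Proof.
exists (shf2 p (- d)) => -[a b]; rewrite /shf2 /= ?shfK//.
by have := @shfK p (- d); rewrite opprK => ->.
Qed.

Lemma summ_shift P S O d : summ (Tt (P ++ O :: S)) ->
  summ (Tt (P ++ (fun l => O (l + d)) :: S)).
Proof.
move=> h; apply: summ_eq (summ_inj (bij_inj (shf2_bij (size P) d)) h) => x.
by rewrite /Tt /tr app_shift.
Qed.

Lemma T_shift P S O d : summ (Tt (P ++ O :: S)) ->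
  T (P ++ (fun l => O (l + d)) :: S) = T (P ++ O :: S).
Proof.
move=> h; rewrite /T -(sum_bij (shf2_bij (size P) d) h); apply: eq_sum => x.
by rewrite /Tt /tr app_shift.
Qed.

Lemma app_fam P S X (Y : nat -> slot) ms w : linl P -> fin_sum X Y ->
  exists N, (forall i, (N <= i)%N -> app (P ++ Y i :: S) ms w = 0) /\
    app (P ++ X :: S) ms w = \sum_(i < N) app (P ++ Y i :: S) ms w.
Proof.
move=> + h; elim: P ms => [|Q P IH] [|m ms] lP /=; try by exists 0%N; rewrite big_ord0.
  exact: h.
case: lP => lQ lP; have [N [h0 ->]] := IH ms lP; exists N.
have Q0 : Q m 0 = 0 by have := lQ m (-1) 0 0; rewrite scaler0 addr0 scaleN1r addNr.
split=> [i /h0 ->//|]; have Qs (q : seq 'I_N) (F : 'I_N -> V) :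
    Q m (\sum_(i <- q) F i) = \sum_(i <- q) Q m (F i).
  elim: q => [|i q IHq]; first by rewrite !big_nil.
  by rewrite !big_cons -IHq -[F i]scale1r lQ !scale1r.
exact: Qs.
Qed.

Lemma T_fam_summ P z S (Y : nat -> slot) : good P z S ->
  (forall s t, 0 < s -> s * rho z < 1 -> 1 < t * rho z -> fbd psi s t Y) ->
  summ (fun x : nat * (seq int * fock_index) => Tt (P ++ Y x.1 :: S) x.2).
Proof.
move=> [lP [s [t [K [s0 sz tz K0 h]]]]] hY.
have [c [c0 cs] hc] := hY s t s0 sz tz.
have hi i : (asum (Tt (P ++ Y i :: S)) <= (c i * K)%:E)%E by apply: h.
rewrite /summ asum_pair /=.
apply: (@le_lt_trans _ _ (es (fun i => K%:E * (c i)%:E)%E)).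
  by apply: le_es => i; rewrite -EFinM mulrC; apply: hi.
by rewrite es_Zl ?lte_mul_pinfty// => i; rewrite lee_fin.
Qed.

(** For fixed modes and basis vector the family is a finite sum, but of varying length; the exchange
    with the trace rests on the summable bounds of the members, which [good] turns into bounds of
    traces. *)
Lemma T_fam P z S X (Y : nat -> slot) : good P z S -> fin_sum X Y ->
  (forall s t, 0 < s -> s * rho z < 1 -> 1 < t * rho z -> fbd psi s t Y) ->
  T (P ++ X :: S) = sum (fun i => T (P ++ Y i :: S)).
Proof.
move=> g XY hY; have lP := g.1; have su := T_fam_summ g hY.
rewrite /T (sum_exch (u := fun i x => Tt (P ++ Y i :: S) x))//.
apply: eq_sum => x; have [N [h0 e]] := @app_fam P S X Y x.1 (fk x.2) lP XY.
have tr0 i : (N <= i)%N -> Tt (P ++ Y i :: S) x = 0.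
  by move=> /h0 e0; rewrite /Tt /tr e0 (coord0 fermion) mulr0 mul0r.
have -> : Tt (P ++ X :: S) x = \sum_(i <- [fset i | i in iota 0 N]%fset) Tt (P ++ Y i :: S) x.
  rewrite big_imfset//= (perm_big (iota 0 N)) /=; last first.
    by apply: uniq_perm; rewrite ?undup_uniq ?iota_uniq// => j; rewrite mem_undup.
  have -> : iota 0 N = index_iota 0 N by rewrite /index_iota subn0.
  rewrite big_mkord /Tt /tr e (coord_sum fermion) mulr_sumr mulr_suml.
  by apply: eq_bigr.
apply/esym/hs_sum/hs_finsupp => i; rewrite inE /= mem_iota leq0n add0n /= -leqNgt.
exact: tr0.
Qed.

End Traces.

(** * Commuting a fermion mode through a trace *)

Definition del (A : Type) (j : nat) (s : seq A) := take j s ++ drop j.+1 s.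

Lemma del0 (A : Type) (x : A) s : del 0 (x :: s) = s.
Proof. by rewrite /del /= drop0. Qed.

Lemma size_del (A : Type) j (s : seq A) : (j < size s)%N -> size (del j s) = (size s).-1.
Proof. by move=> js; rewrite size_cat size_take size_drop js; lia. Qed.

(** * Action of the modes of psi on square bracket Fock vectors *)

Section SquareFock.
Variables (R : realType) (V : vosa_data R) (psi : V).
Hypothesis fermion : rank_one_fermion psi.
Notation C := (R[i]).
Notation psim := (mode psi).
Implicit Types (u v w : V) (m n l : int).

Let vosa := fermion_vosa fermion.
Let h : C := 2^-1.

Lemma psi_trunc v : exists N : nat, forall n : int, N%:Z <= n -> psim n v = 0.
Proof.
have [N hN] := truncation vosa psi v; exists (absz N) => n Nn; apply: hN; lia.
Qed.

Lemma sqmode_psiE k v (N : nat) : (forall n : int, N%:Z <= n -> psim n v = 0) ->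
  forall M, (N + k <= M)%N -> sqmode psi psi (- k%:Z) v =
    \sum_(j < M) expm1_coef h (- (- k%:Z + j%:Z) - 1) j *: psim (- k%:Z + j%:Z) v.
Proof. by move=> hN M hM; apply: (sqmode_psi fermion) => j Mj; apply: hN; lia. Qed.

Lemma sqmodeL k a v w :
  sqmode psi psi (- k%:Z) (a *: v + w) =
  a *: sqmode psi psi (- k%:Z) v + sqmode psi psi (- k%:Z) w.
Proof.
have [N1 h1] := psi_trunc v; have [N2 h2] := psi_trunc w.
pose N := (N1 + N2)%N.
have h1' n : N%:Z <= n -> psim n v = 0 by move=> ?; apply: h1; lia.
have h2' n : N%:Z <= n -> psim n w = 0 by move=> ?; apply: h2; lia.
have h3' n : N%:Z <= n -> psim n (a *: v + w) = 0.
  by move=> ?; rewrite (mode_linearr vosa) h1' ?h2'// scaler0 addr0.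
rewrite (sqmode_psiE h1' (leqnn _)) (sqmode_psiE h2' (leqnn _)) (sqmode_psiE h3' (leqnn _)).
rewrite scaler_sumr -big_split; apply: eq_bigr => j _ /=.
by rewrite (mode_linearr vosa) scalerDr !scalerA mulrC.
Qed.

Lemma sqmode0 k : sqmode psi psi (- k%:Z) 0 = 0.
Proof. by have := sqmodeL k (-1) 0 0; rewrite scaler0 addr0 scaleN1r addNr. Qed.

Lemma sqmode_sum (q : seq nat) (a : nat -> C) (F : nat -> V) k :
  sqmode psi psi (- k%:Z) (\sum_(i <- q) a i *: F i) =
  \sum_(i <- q) a i *: sqmode psi psi (- k%:Z) (F i).
Proof.
elim: q => [|i q IH]; first by rewrite !big_nil sqmode0.
by rewrite !big_cons sqmodeL IH.
Qed.

Lemma parity_sqfock ks : parity (odd (size ks)) (sqfock psi ks).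
Proof.
elim: ks => [|k ks IH] /=; first exact: (vacuum_parity vosa).
have [N hN] := psi_trunc (sqfock psi ks).
rewrite (sqmode_psiE hN (leqnn _)); apply: (parity_sum fermion) => j.
by apply: (parityZ fermion); apply: (parity_psi fermion).
Qed.

(* [ann_coef p l] is the anticommutator of [psi(p)] and [psi[-l]]. *)
Definition ann_coef (p l : nat) : C :=
  if (p < l)%N then expm1_coef h p%:Z (l - p).-1 else 0.

Lemma psi_sqmode (p l : nat) v : psim p%:Z (sqmode psi psi (- l%:Z) v) =
  ann_coef p l *: v - sqmode psi psi (- l%:Z) (psim p%:Z v).
Proof.
have [N hN] := psi_trunc v.
have hN' n : N%:Z <= n -> psim n (psim p%:Z v) = 0.
  move=> Nn; rewrite (psi_swap fermion) hN// (mode0r fermion) subr0.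
  by rewrite (_ : _ == 0 = false) ?scale0r//; lia.
rewrite (sqmode_psiE hN (leqnn _)) (sqmode_psiE hN' (leqnn _)) (mode_sumr fermion).
under eq_bigr => j _ do rewrite (modeZr fermion) (psi_swap fermion) scalerBr scalerA.
rewrite sumrB; congr (_ - _); rewrite -scaler_suml; congr (_ *: _).
rewrite /ann_coef; case: ltnP => pl; last first.
  by rewrite big1// => j _; rewrite (_ : _ == 0 = false) ?mulr0//; lia.
(* psi(p) has a nonzero anticommutator with psi(-p-1) only, which is the term j = l - p - 1 of
   psi[-l]. *)
have jN : ((l - p).-1 < N + l)%N by lia.
rewrite (bigD1 (Ordinal jN))//= big1 ?addr0 => [|j /eqP hj].
  rewrite (_ : _ == 0 = true) ?mulr1; last by lia.
  by congr (expm1_coef _ _ _); lia.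
rewrite (_ : _ == 0 = false) ?mulr0//; apply/negbTE/eqP => e; apply: hj.
by apply: val_inj => /=; lia.
Qed.

Lemma psi_sqfock (p : nat) ks : psim p%:Z (sqfock psi ks) =
  \sum_(j < size ks) ((-1) ^+ j * ann_coef p (nth 0%N ks j)) *: sqfock psi (del j ks).
Proof.
elim: ks => [|l ks IH] /=; first by rewrite big_ord0 (psi_vacuum fermion).
rewrite psi_sqmode IH big_ord_recl expr0 mul1r del0; congr (_ + _).
rewrite -(big_mkord xpredT (fun j => ((-1) ^+ j * ann_coef p (nth 0%N ks j)) *:
  sqfock psi (del j ks))) sqmode_sum big_mkord -sumrN.
by apply: eq_bigr => j _; rewrite lift0 exprS mulN1r mulNr scaleNr.
Qed.

(* [psi(m)] commutes with [Y(v, x)] up to [\sum_j binz m j * x ^ (m - j) * Y(psi(j) v, x)]; for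
   square bracket Fock vectors [Ann m] acts as an odd derivation that removes one fermion. *)
Definition Ann m v : V := \sum_(j \in [set: nat]) binz R m j *: psim j%:Z v.

Lemma AnnE m v (N : nat) : (forall j : nat, (N <= j)%N -> psim j%:Z v = 0) ->
  Ann m v = \sum_(j < N) binz R m j *: psim j%:Z v.
Proof. by move=> hN; apply: fsum_nat => j /hN ->; rewrite scaler0. Qed.

(** A fermion psi[-l] contributes the sum over p of [binz m p] times the coefficient of x^(l-1) in
    e^(x/2) (e^x - 1)^p; by [expm1_sum_binz] this is the coefficient in e^((m + 1/2) x). *)
Lemma Ann_sqfock m ks : all (fun l : nat => (0 < l)%N) ks -> Ann m (sqfock psi ks) =
  \sum_(j < size ks) ((-1) ^+ j * ((mwt R m)%:C ^+ (nth 0%N ks j).-1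
    / ((nth 0%N ks j).-1)`!%:R)) *: sqfock psi (del j ks).
Proof.
move=> ks0; have [N0 hN] := psi_trunc (sqfock psi ks).
(* Adding the entries makes [N] at least each of them, so that the sum over j < N contains all
   nonzero anticommutators. *)
pose N := (N0 + \sum_(l <- ks) l)%N.
have hN' (j : nat) : (N <= j)%N -> psim j%:Z (sqfock psi ks) = 0.
  by move=> Nj; apply: hN; lia.
rewrite (AnnE m hN'); under eq_bigr do rewrite psi_sqfock scaler_sumr.
rewrite exchange_big /=; apply: eq_bigr => j _; under eq_bigr do rewrite scalerA.
rewrite -scaler_suml; congr (_ *: _); set l := nth _ _ _.
have l0 : (0 < l)%N by rewrite (all_nthP 0%N ks0).
have lN : (l <= N)%N.
  by rewrite /N (big_rem l (mem_nth 0%N (ltn_ord j)))/=; lia.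
under eq_bigr do rewrite mulrCA; rewrite -mulr_sumr; congr (_ * _).
have := expm1_sum_binz h m l.-1; rewrite prednK// mwtE addrC => <-.
rewrite (big_ord_widen N (fun p => binz R m p * expm1_coef h p%:Z (l.-1 - p)%N) lN).
rewrite [RHS]big_mkcond; apply: eq_bigr => i _; rewrite /ann_coef.
case: ifP => il; rewrite ?mulr0//; congr (_ * expm1_coef _ _ _); lia.
Qed.

End SquareFock.

Section Commutation.
Variables (R : realType) (V : vosa_data R) (psi : V).
Hypothesis fermion : rank_one_fermion psi.
Notation C := (R[i]).
Notation psim := (mode psi).
Notation fk k := (fock psi (val k)).
Notation coord := (fock_coord psi).
Notation slot := (slot V).
Notation sl := (sl psi).
Notation compL := (compL psi).
Notation compR := (compR psi).
Variables (theta tau : C).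
Hypothesis theta_sq : theta ^+ 2 = 1.
Hypothesis tau_gt0 : 0 < complex.Im tau.
Notation Tt := (Tt psi theta tau).
Notation T := (T psi theta tau).
Notation tr := (tr psi theta tau).
Notation good := (good psi theta tau).
Implicit Types (u v w : V) (m n l : int) (k : fock_index) (r s t : R) (O X : slot).
Implicit Types (P S os : seq slot) (ms : seq int).

Let vosa := fermion_vosa fermion.

Lemma theta_norm : nc theta = 1.
Proof.
have : nc theta ^+ 2 = 1 by rewrite -ncX theta_sq nc1.
by move=> /eqP; rewrite -[1](expr1n _ 2%N) eqrXn2 ?nc_ge0// => /eqP ->; rewrite expr1n.
Qed.

Lemma sl0 z l w : sl z 0 l w = 0.
Proof.
have := congr1 (fun f => f l w) (slL fermion z (-1) 0 0).
by rewrite scaler0 addr0 scaleN1r addNr.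
Qed.

Lemma sl_sum z (N : nat) (a : 'I_N -> C) (F : 'I_N -> V) l w :
  sl z (\sum_(i < N) a i *: F i) l w = \sum_(i < N) a i *: sl z (F i) l w.
Proof.
elim: (index_enum _) => [|i q IH]; first by rewrite !big_nil sl0.
by rewrite !big_cons (slL fermion) IH.
Qed.

(** The commutator formula: Borcherds' identity with its middle index 0, whose right side has only
    the term j = 0. *)
Lemma psi_sl z m p v (N : nat) l w : parity p v ->
  (forall j : nat, (N <= j)%N -> psim j%:Z v = 0) ->
  psim m (sl z v l w) = (-1) ^+ p *: sl z v l (psim m w) +
    \sum_(j < N) (cexp (z * (mwt R m)%:C) * binz R m j) *: sl z (psim j%:Z v) (l + (m - j%:Z)) w.
Proof.
move=> pv hN; set b := expL0 psi z v; have pb : parity p b by apply: (parity_expL0 fermion).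
have eb j : psim j b = cexp (z * (mwt R j)%:C) *: expL0 psi z (psim j v).
  by rewrite (expL0_psi fermion) scalerA -cexpD subrr cexp0 scale1r.
have := jacobi vosa w m 0 l (psi_odd fermion) pb.
rewrite (@fsum_nat _ _ N) => [|j /hN vj]; last first.
  rewrite add0r eb vj; have -> : expL0 psi z 0 = 0.
    have := expL0L fermion z (-1) 0 0; by rewrite scaler0 addr0 scaleN1r addNr.
  by rewrite scaler0 (mode0l fermion) scaler0.
rewrite (@fsum_nat _ _ 1%N) => [|[|j]//= _]; last first.
  by rewrite binz_nat0 mulr0 scale0r.
rewrite big_ord1 binz0 expr0 mulr1 scale1r andTb expr0z mulr1 => e.
have {}e : \sum_(j < N) binz R m j *: mode (psim (0 + j%:Z) b) (m + l - j%:Z) w =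
    psim m (mode b l w) - (-1) ^+ p *: mode b l (psim m w).
  by rewrite e; congr (psim _ (mode _ _ _) - _ *: mode _ _ (psim _ _)); rewrite /=; lia.
move/eqP: e; rewrite eq_sym subr_eq => /eqP e.
rewrite /sl -/b (modeZr fermion) e scalerDr addrC !scalerA [_ * (-1) ^+ p]mulrC; congr (_ + _).
rewrite scaler_sumr; apply: eq_bigr => j _.
rewrite add0r eb (modeZl fermion) !scalerA addrA [l + m]addrC; congr (_ *: _).
rewrite mulrC mulrA [RHS]mulrAC; congr (_ * _).
rewrite !cexp_exprz !mwtE -!cexpD; congr cexp.
by rewrite !rmorphD !rmorphN/= !rmorphD/=; ring.
Qed.

(** Inside the trace the shifts of the mode by m - j disappear, since all modes are summed; the
    binomial sum that remains is [Ann]. *)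
Lemma T_comm P z S v p m : good P z S -> parity p v ->
  T (P ++ compL m (sl z v) :: S) = (-1) ^+ p * T (P ++ compR m (sl z v) :: S) +
    cexp (z * (mwt R m)%:C) * T (P ++ sl z (Ann psi m v) :: S).
Proof.
move=> g pv; have lP := g.1; have [N hN] := psi_trunc fermion v.
have hN' (j : nat) : (N <= j)%N -> psim j%:Z v = 0 by move=> ?; apply: hN; lia.
pose Y (j : 'I_N) : slot := fun l => sl z (psim j%:Z v) (l + (m - j%:Z)).
pose W : slot := fun l w => \sum_(j < N) (cexp (z * (mwt R m)%:C) * binz R m j) *: Y j l w.
have sY j : summ (Tt (P ++ Y j :: S)).
  by apply: summ_shift; apply: (good_summ fermion _ g).
have [sW eW] := T_sum fermion lP (fun _ _ => erefl : W _ _ = _) sY.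
rewrite (T_lin fermion lP (fun l w => psi_sl z m l w pv hN') _ sW); last first.
  exact: (good_compR fermion v m g).
congr (_ + _); rewrite eW.
have sZ (j : 'I_N) : summ (Tt (P ++ sl z (psim j%:Z v) :: S)).
  exact: (good_summ fermion _ g).
have hA l w : sl z (Ann psi m v) l w = \sum_(j < N) binz R m j *: sl z (psim j%:Z v) l w.
  by rewrite (AnnE m hN') sl_sum.
have [_ ->] := T_sum fermion lP hA sZ.
rewrite mulr_sumr; apply: eq_bigr => j _; rewrite mulrA; congr (_ * _).
exact: T_shift (sZ j).
Qed.

Lemma app_linr os ms a w : linl os -> app os ms (a *: w) = a *: app os ms w.
Proof.
elim: os ms => [|o os IH] [|m ms] //= lo; rewrite ?scaler0//.
case: lo => lo /IH ->; rewrite -[a *: app _ _ _]addr0 lo.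
by have := lo m (-1) 0 0; rewrite scaler0 addr0 scaleN1r addNr => ->; rewrite addr0.
Qed.

Definition tL m os := sum (fun x : seq int * fock_index => tr (fun w => psim m (app os x.1 w)) x.2).
Definition tR m os := sum (fun x : seq int * fock_index => tr (fun w => app os x.1 (psim m w)) x.2).

Lemma qpowD (x y : R) : qpow tau (x + y) = qpow tau x * qpow tau y.
Proof.
rewrite /qpow -cexpD; congr cexp; rewrite -mulrDl; congr (_ * _).
by apply/eqP; rewrite eq_complex/= addr0 eqxx/= mulrDr.
Qed.

Lemma thetaN_odd (n : nat) : (- theta) ^+ n = (- theta) ^+ odd n.
Proof.
rewrite -{1}(odd_double_half n) exprD -mul2n exprM sqrrN theta_sq expr1n mulr1//.
Qed.

(** Cyclicity is the reindexing of the basis by [togI]: the same coefficient of psi(m) occurs on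
    both sides, while the weight changes by [mwt m] and the parity flips. The first costs q^(-(m +
    1/2)), the second, as theta^2 = 1, the factor -theta. *)
Lemma trace_cyclic m os : linl os ->
  summ (fun x : seq int * fock_index => tr (fun w => psim m (app os x.1 w)) x.2) ->
  tL m os = - theta * qpow tau (- mwt R m) * tR m os /\
  summ (fun x : seq int * fock_index => tr (fun w => app os x.1 (psim m w)) x.2).
Proof.
move=> lo sL; pose c := - theta * qpow tau (- mwt R m).
pose g (x : seq int * fock_index) := (x.1, togI (midx m) x.2).
have bg : bijective g.
  by exists g => -[a b]; rewrite /g /= togIK.
have e x : tr (fun w => psim m (app os x.1 w)) (g x).2 = c * tr (fun w => app os x.1 (psim m w)) x.2.
  rewrite /tr -[(g x).2]/(togI (midx m) x.2) (coord_psi fermion) togIK (psi_fock fermion) app_linr// (coordZ fermion).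
  have [->|e0] := eqVneq (emode R m x.2) 0; first by rewrite !mul0r !mulr0 !mul0r mulr0.
  rewrite (fock_weight_tog e0) thetaN_odd size_tog [in RHS]thetaN_odd.
  rewrite addrAC [qpow tau (_ - mwt _ _)]qpowD /c.
  have -> : (- theta) ^+ (~~ odd (size (val x.2))) = - theta * (- theta) ^+ odd (size (val x.2)).
    by case: odd => /=; rewrite ?expr0 ?expr1 ?mulr1// mulrNN -expr2 theta_sq.
  ring.
have c0 : c != 0.
  rewrite -nc_gt0 /c ncM ncN theta_norm mul1r /qpow nc_cexp expR_gt0//.
have sc : summ (fun x => c * tr (fun w => app os x.1 (psim m w)) x.2).
  apply: summ_eq (summ_inj (bij_inj bg) sL) => x; by rewrite -e.
have sR : summ (fun x : seq int * fock_index => tr (fun w => app os x.1 (psim m w)) x.2).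
  by apply: summ_eq (summZ c^-1 sc) => x; rewrite mulKf.
split=> //; rewrite /tL /tR -/c -sumZ// -(sum_bij bg sL); apply: eq_sum => x; exact: e.
Qed.

Lemma app_compL m O S ms w : app (compL m O :: S) ms w = psim m (app (O :: S) ms w).
Proof. by case: ms => [|l ms] //=; rewrite (mode0r fermion). Qed.

Lemma app_compR P O m ms w :
  app (P ++ [:: compR m O]) ms w = app (P ++ [:: O]) ms (psim m w).
Proof. by elim: P ms => [|Q P IH] [|l ms] //=; rewrite ?IH//; case: ms => //= *; rewrite /compR (mode0r fermion). Qed.

Lemma app_compRL P O O' S m ms w :
  app (P ++ compR m O :: O' :: S) ms w = app (P ++ O :: compL m O' :: S) ms w.
Proof.
elim: P ms => [|Q P IH] [|l ms] //=; rewrite ?IH//; case: ms => [|l' ms]//=.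
by rewrite /compR (mode0r fermion).
Qed.

Lemma eq_T os os' : (forall ms w, app os ms w = app os' ms w) -> T os = T os'.
Proof. by move=> e; apply: eq_sum => x; rewrite /Tt /tr e. Qed.

Definition blk (b : C * seq nat) : slot := sl b.1 (sqfock psi b.2).
Implicit Types (b : C * seq nat) (L : seq (C * seq nat)).

Definition goodL P L := forall L1 b L2, L = L1 ++ b :: L2 ->
  good (P ++ map blk L1) b.1 (map blk L2).

Lemma goodL_rcons P b L : goodL P (b :: L) -> goodL (rcons P (blk b)) L.
Proof.
move=> h L1 b' L2 e; have := h (b :: L1) b' L2; rewrite e => /(_ erefl).
by rewrite /= cat_rcons.
Qed.

Lemma goodL_head P b L : goodL P (b :: L) -> good P b.1 (map blk L).
Proof. by move=> h; have := h [::] b L erefl; rewrite cats0. Qed.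

Definition nl L : nat := \sum_(b <- L) size b.2.

Lemma nl_cons b L : nl (b :: L) = (size b.2 + nl L)%N.
Proof. by rewrite /nl big_cons. Qed.

(* The terms created when [psi(m)] moves to the right through the blocks [L], [P] being those
   already to its left. *)
Fixpoint cm m P L : C := match L with
  | [::] => 0
  | b :: L' => cexp (b.1 * (mwt R m)%:C) * T (P ++ sl b.1 (Ann psi m (sqfock psi b.2)) :: map blk L')
      + (-1) ^+ size b.2 * cm m (rcons P (blk b)) L'
  end.

Lemma T_comm_all m P b L : goodL P (b :: L) ->
  T (P ++ compL m (blk b) :: map blk L) =
  (-1) ^+ nl (b :: L) * tR m (P ++ map blk (b :: L)) + cm m P (b :: L).
Proof.
elim: L P b => [|b' L IH] P b g.
  rewrite (T_comm m (goodL_head g) (parity_sqfock fermion b.2)) signr_odd.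
  rewrite /nl big_seq1 /= mulr0 addr0; congr (_ * _ + _).
  by apply: eq_sum => x; rewrite /Tt /tr app_compR.
rewrite (T_comm m (goodL_head g) (parity_sqfock fermion b.2)) signr_odd.
rewrite (eq_T (app_compRL _ _ _ _ _)) -cat_rcons IH; last exact: goodL_rcons.
rewrite mulrDr mulrA -exprD -nl_cons -addrA cat_rcons; congr (_ + _).
exact: addrC.
Qed.

(** Radii interleaved with the points, r < 1 / rho(z_1) < s < 1 / rho(z_2) < ..., ending at t, so
    that the bounds of consecutive slots compose. *)
Fixpoint domr r (zs : seq C) t : Prop := match zs with
  | [::] => r <= t
  | z :: zs' => exists s, [/\ r * rho z < 1, 1 < s * rho z & domr s zs' t]
  end.

Lemma domr_lt r z zs t : domr r (z :: zs) t -> exists2 s, r < s & domr s zs t.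
Proof.
move=> [s [h1 h2 h3]]; exists s => //.
by rewrite -(ltr_pM2r (rho_gt0 z)) (lt_trans h1).
Qed.

Lemma domr_le r zs t : domr r zs t -> r <= t.
Proof.
elim: zs r => [|z zs IH] r // /domr_lt[s rs /IH]; apply: le_trans; exact: ltW.
Qed.

Lemma domr_cat r zs1 z zs2 t : domr r (zs1 ++ z :: zs2) t -> exists (s u : R),
  [/\ domr r zs1 s, s * rho z < 1, 1 < u * rho z & domr u zs2 t].
Proof.
elim: zs1 r => [|z1 zs1 IH] r /=; first by move=> [s [h1 h2 h3]]; exists r, s.
move=> [s [h1 h2 /IH[s' [u [h3 h4 h5 h6]]]]]; exists s', u; split=> //.
by exists s.
Qed.

Lemma domr_bdl r zs (os : seq (C * V)) t : 0 < r -> map fst os = zs -> domr r zs t ->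
  exists2 c, 0 <= c & bdl psi r t c [seq sl x.1 x.2 | x <- os].
Proof.
elim: os r zs => [|[z v] os IH] r zs r0 <- /= h.
  by exists 1 => //; apply: bdl_nil => //; apply: ltW.
have [s [h1 h2 h3]] := h; have s0 := good_tpos r0 h1 h2.
have [c c0 hc] := IH _ _ s0 erefl h3.
have [d d0 hd] := bd_sl fermion v r0 h1 h2.
exists (d * c); first by rewrite mulr_ge0.
by apply: (bdl_cons fermion _ d0 _ hd hc) => //; apply: ltW.
Qed.

(** The condition [hq tau * t < r] says that q^(L(0)) closes the chain of radii around the trace. *)
Definition dom (zs : seq C) := exists r t, [/\ 0 < r, hq tau * t < r & domr r zs t].

Lemma linl_sl (os : seq (C * V)) : linl [seq sl x.1 x.2 | x <- os].
Proof.
by elim: os => [|x os IH]//=; split=> // l a y w; apply: (sl_lin fermion).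
Qed.

Lemma good_dom (os1 os2 : seq (C * V)) z : dom (map fst os1 ++ z :: map fst os2) ->
  good [seq sl x.1 x.2 | x <- os1] z [seq sl x.1 x.2 | x <- os2].
Proof.
move=> [r [t [r0 hrt /domr_cat[s [u [h1 h2 h3 h4]]]]]]; split; first exact: linl_sl.
have s0 : 0 < s by apply: lt_le_trans r0 (domr_le h1).
have u0 := good_tpos s0 h2 h3; have t0 : 0 < t by apply: lt_le_trans u0 (domr_le h4).
have [c c0 hc] := domr_bdl r0 erefl h1; have [d d0 hd] := domr_bdl u0 erefl h4.
have kf : (Kc tau r t < +oo)%E by apply: Kc_lty.
have k0 : (0 <= Kc tau r t)%E.
  apply: es_ge0 => k; rewrite lee_fin mulr_ge0 ?expR_ge0// exprn_ge0//.
  by rewrite !mulr_ge0 ?invr_ge0 ?(ltW r0) ?(ltW t0)// ltW ?hq_gt0.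
exists s, u, (c * d * fine (Kc tau r t)); split=> //.
  by rewrite !mulr_ge0 ?fine_ge0.
move=> O e e0 he.
have r0' := ltW r0; have s0' := ltW s0; have u0' := ltW u0.
have hOS := bdl_cons fermion s0' e0 u0' he hd.
have hall := bdl_cat r0' c0 s0' (linl_sl _) hc hOS.
have ced0 : 0 <= c * (e * d) by rewrite !mulr_ge0.
have h5 := trace_bound fermion tau theta_norm r0 t0 ced0 hall.
apply: (le_trans h5).
rewrite -[X in (_ * X <= _)%E](@fineK _ (Kc _ _ _)) ?ge0_fin_numE//.
by rewrite -EFinM lee_fin le_eqVlt; apply/orP; left; apply/eqP; ring.
Qed.

Lemma map_blk L : map blk L = [seq sl x.1 x.2 | x <- [seq (b.1, sqfock psi b.2) | b <- L]].
Proof. by rewrite -map_comp. Qed.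

Lemma goodL_dom L0 L : dom (map fst (L0 ++ L)) -> goodL (map blk L0) L.
Proof.
move=> h L1 b L2 e; rewrite -map_cat !map_blk; apply: good_dom.
by rewrite -!map_comp; move: h; rewrite e !map_cat -!catA.
Qed.

Lemma dom_tail z zs : dom (z :: zs) -> dom zs.
Proof.
move=> [r [t [r0 hrt /domr_lt[s rs h]]]]; exists s, t; split=> //.
  exact: lt_trans rs.
exact: lt_trans rs.
Qed.

End Commutation.

(** * The recursion for traces *)

Section Lambert.
Variables (R : realType) (theta tau : R[i]).
Notation C := (R[i]).
Hypothesis theta_sq : theta ^+ 2 = 1.
Hypothesis tau_gt0 : 0 < complex.Im tau.
Implicit Types (m r : nat) (w : C).

Definition uu r : R := r%:R + 2^-1.
(** [lam] and [lamB] come from solving the cyclicity equation for psi(-r-1), up to sign, and for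
    psi(r); [sA] and [sB] are the corresponding terms of Lambert series with negative and positive
    exponents. *)
Definition lam r : C := theta * qpow tau (uu r) / (1 - theta * qpow tau (uu r)).
Definition lamB r : C := 1 / (1 - theta * qpow tau (uu r)).
Definition sA m w r : C := (uu r)%:C ^+ m * cexp (- (w * (uu r)%:C)) * lam r.
Definition sB m w r : C := (uu r)%:C ^+ m * cexp (w * (uu r)%:C) * lamB r.

Lemma uu_gt0 r : 0 < uu r. Proof. by rewrite /uu ltr_wpDl ?invr_gt0. Qed.

Lemma nc_qpow_uu r : nc (qpow tau (uu r)) <= hq tau.
Proof.
rewrite nc_qpow /hq ler_expR !mulNr lerN2 ler_pM2r// mulrAC ler_peMl ?pi_ge0//.
by rewrite /uu; have := ler0n R r; lra.
Qed.

Lemma nc_den r : 1 - hq tau <= nc (1 - theta * qpow tau (uu r)).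
Proof.
rewrite lerBlDr; apply: le_trans (_ : nc (1 - theta * qpow tau (uu r)) + nc (theta * qpow tau (uu r)) <= _).
  by rewrite -[X in X <= _](nc1 R) -{1}[1](subrK (theta * qpow tau (uu r))) le_ncD.
by rewrite lerD2l ncM (theta_norm theta_sq) mul1r nc_qpow_uu.
Qed.

Lemma den_neq0 r : 1 - theta * qpow tau (uu r) != 0.
Proof. by rewrite -nc_gt0 (lt_le_trans _ (nc_den r))// subr_gt0 hq_lt1. Qed.

Lemma lamBE r : lamB r = lam r + 1.
Proof.
have := den_neq0 r; rewrite /lamB /lam; set x := theta * _ => x1.
by field; rewrite x1.
Qed.

(** The m-th power of r + 1 is at most m! times a binomial coefficient, so [es_binom] applies. *)
Lemma summ_poly_geo (f : nat -> C) (K y : R) m : 0 <= K -> 0 <= y < 1 ->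
  (forall r, nc (f r) <= K * (r.+1%:R ^+ m * y ^+ r)) -> summ f.
Proof.
move=> K0 /[dup] y01 /andP[y0 y1] h.
have pc r : (r.+1 ^ m <= m`! * 'C(m + r, r))%N.
  elim: m {h} => [|m IH]; first by rewrite expn0 fact0 add0n binn.
  rewrite expnS factS -mulnA mulnCA.
  have e : (m.+1 * 'C(m.+1 + r, r) = (m.+1 + r) * 'C(m + r, r))%N.
    have := mul_bin_diag (m + r).+1 m; rewrite /= => e0.
    rewrite -(bin_sub (leq_addl _ _)) addnK addSn -e0 -[in RHS](bin_sub (leq_addl _ _)) addnK.
    by [].
  rewrite e mulnCA; apply: leq_mul => //.
  by rewrite addSn ltnS leq_addl.
apply: (@le_lt_trans _ _ (es (fun r => (K * m`!%:R)%:E * ('C(m + r, r)%:R * y ^+ r)%:E))%E).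
  apply: le_es => r; rewrite -EFinM lee_fin (le_trans (h r))// -mulrA ler_wpM2l//.
  by rewrite mulrA -natrM ler_wpM2r ?exprn_ge0// -natrX ler_nat.
rewrite es_Zl ?mulr_ge0// => [|r]; last by rewrite lee_fin mulr_ge0 ?exprn_ge0.
by rewrite lte_mul_pinfty ?lee_fin ?mulr_ge0// es_binom.
Qed.

Lemma uu_pow m r : nc ((uu r)%:C ^+ m) <= r.+1%:R ^+ m.
Proof.
have u0 := ltW (uu_gt0 r).
rewrite ncX nc_real ger0_norm// lerXn2r// ?nnegrE//.
by rewrite /uu -[r.+1%:R]natr1 lerD2l; lra.
Qed.

Lemma expR_uu (c : R) r : expR (c * uu r) = expR (c / 2) * expR c ^+ r.
Proof. by rewrite -expRM_natl -expRD; congr expR; rewrite /uu; ring. Qed.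

Lemma ncV_den r : nc (1 - theta * qpow tau (uu r))^-1 <= (1 - hq tau)^-1.
Proof.
have q1 : 0 < 1 - hq tau by rewrite subr_gt0 hq_lt1.
by rewrite ncV lef_pV2 ?posrE ?nc_den// nc_gt0 den_neq0.
Qed.

Lemma summ_sA m w : - (2 * pi * complex.Im tau) < complex.Re w -> summ (sA m w).
Proof.
(* exp(c) is |q e^(-w)|, the ratio of the majorising geometric series. *)
move=> hw; pose c := - complex.Re w - 2 * pi * complex.Im tau.
have q1 : 0 < 1 - hq tau by rewrite subr_gt0 hq_lt1.
apply: (@summ_poly_geo _ (expR (c / 2) / (1 - hq tau)) (expR c) m).
- by rewrite divr_ge0 ?expR_ge0// ltW.
- by rewrite expR_ge0 expR_lt1 /c; lra.
move=> r; rewrite /sA /lam; set E := cexp _; set D := (1 - _)^-1; set q := qpow _ _.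
have e : nc E * nc q = expR (c / 2) * expR c ^+ r.
  rewrite -expR_uu /E nc_cexp nc_qpow -expRD; congr expR.
  by case: w {hw E} @c => a b /=; rewrite mulr0 subr0; ring.
rewrite (ncM (_ * E)) (ncM _ E) (ncM _ D) (ncM theta) (theta_norm theta_sq) mul1r.
rewrite (_ : _ * _ = (nc E * nc q) * (nc ((uu r)%:C ^+ m) * nc D)); last by ring.
rewrite e (_ : expR (c / 2) / _ * _ = expR (c / 2) * expR c ^+ r * (r.+1%:R ^+ m * (1 - hq tau)^-1)); last by ring.
rewrite ler_wpM2l ?mulr_ge0 ?exprn_ge0 ?expR_ge0//.
by rewrite ler_pM ?nc_ge0 ?uu_pow ?ncV_den.
Qed.

Lemma summ_sB m w : complex.Re w < 0 -> summ (sB m w).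
Proof.
move=> hw; pose c := complex.Re w.
have q1 : 0 < 1 - hq tau by rewrite subr_gt0 hq_lt1.
apply: (@summ_poly_geo _ (expR (c / 2) / (1 - hq tau)) (expR c) m).
- by rewrite divr_ge0 ?expR_ge0// ltW.
- by rewrite expR_ge0 expR_lt1.
move=> r; rewrite /sB /lamB mul1r; set E := cexp _; set D := (1 - _)^-1.
have e : nc E = expR (c / 2) * expR c ^+ r.
  rewrite -expR_uu /E nc_cexp; congr expR.
  by case: w {hw E} @c => a b /=; rewrite mulr0 subr0.
rewrite ncM ncM e mulrAC mulrC (_ : expR (c / 2) / _ * _ = expR (c / 2) * expR c ^+ r * (r.+1%:R ^+ m * (1 - hq tau)^-1)); last by ring.
rewrite ler_wpM2l ?mulr_ge0 ?exprn_ge0 ?expR_ge0//.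
by rewrite ler_pM ?nc_ge0 ?uu_pow ?ncV_den.
Qed.

(** The matrix entries in the form in which the recursion produces them. In [entC] both Lambert sums
    are of type [sA], and [expm1_pair] comes from the annihilating modes in psi[-k], which reach
    only fermions of the same vector. *)
Definition entC (k l : nat) : C :=
  ((-1) ^+ l * sum (sA (k.-1 + l.-1) 0) + (-1) ^+ k.-1 * sum (sA (k.-1 + l.-1) 0))
    / ((k.-1)`! * (l.-1)`!)%:R + expm1_pair R k l.-1.
Definition entD (k l : nat) w : C :=
  ((-1) ^+ l * sum (sA (k.-1 + l.-1) w) + (-1) ^+ k.-1 * sum (sB (k.-1 + l.-1) w))
    / ((k.-1)`! * (l.-1)`!)%:R.

End Lambert.

Section Zhu.
Variables (R : realType) (V : vosa_data R) (psi : V).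
Hypothesis fermion : rank_one_fermion psi.
Notation C := (R[i]).
Notation psim := (mode psi).
Notation slot := (slot V).
Notation sl := (sl psi).
Notation compL := (compL psi).
Notation compR := (compR psi).
Variables (theta tau : C).
Hypothesis theta_sq : theta ^+ 2 = 1.
Hypothesis tau_gt0 : 0 < complex.Im tau.
Notation Tt := (Tt psi theta tau).
Notation T := (T psi theta tau).
Notation good := (good psi theta tau).
Notation blk := (blk psi).
Notation goodL := (goodL psi theta tau).
Notation cm := (cm psi theta tau).
Notation uu := (uu R).
Notation lam := (lam theta tau).
Notation lamB := (lamB theta tau).
Notation sA := (sA theta tau).
Notation sB := (sB theta tau).
Implicit Types (u v w : V) (O X : slot).
Implicit Types (P S os : seq slot) (ms : seq int).
Implicit Types (b : C * seq nat) (L : seq (C * seq nat)).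

Let h : C := 2^-1.

Lemma T_scale P S X O a : linl P -> (forall l w, X l w = a *: O l w) ->
  summ (Tt (P ++ O :: S)) -> T (P ++ X :: S) = a * T (P ++ O :: S).
Proof.
move=> lP hX sO.
have hX' l w : X l w = \sum_(i <- [:: tt]) (fun=> a) i *: (fun=> O) i l w by rewrite big_seq1.
by have [_ ->] := T_sum fermion lP hX' (fun=> sO); rewrite big_seq1.
Qed.

Lemma T_slsum P z S (N : nat) (a : 'I_N -> C) (F : 'I_N -> V) : good P z S ->
  T (P ++ sl z (\sum_(i < N) a i *: F i) :: S) = \sum_(i < N) a i * T (P ++ sl z (F i) :: S).
Proof.
move=> g; have hX l w := sl_sum fermion z a F l w.
have sF i : summ (Tt (P ++ sl z (F i) :: S)) by apply: (good_summ fermion).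
by have [_ ->] := T_sum fermion g.1 hX sF.
Qed.

Lemma binz_neg (i j : nat) : (-1) ^+ j * binz R (Negz i) j = 'C(i + j, i)%:R :> C.
Proof.
elim: j => [|j IH]; first by rewrite binz0 addn0 binn expr0 mul1r.
have j0 : j.+1%:R != 0 :> C by rewrite pnatr_eq0.
apply: (mulfI j0); rewrite mulrCA binzSr NegzE rmorphN/= -[(i.+1%:Z)%:~R]/(i.+1%:R).
have e : j.+1%:R * 'C(i + j.+1, i)%:R = (i.+1%:R + j%:R) * 'C(i + j, i)%:R :> C.
  rewrite -natrD -!natrM; congr (_%:R).
  rewrite -(bin_sub (leq_addr j.+1 i)) -(bin_sub (leq_addr j i)) !addKn addnS -mul_bin_diag.
  by rewrite addSn.
by rewrite e -IH exprS NegzE; ring.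
Qed.

Lemma mwt_Negz (r : nat) : mwt R (Negz r) = - uu r.
Proof.
by rewrite /mwt /uu NegzE rmorphN/= -[(r.+1%:Z)%:~R]/(r.+1%:R) -natr1; field.
Qed.

Lemma subNegz (i j : nat) : Negz i - j%:Z = Negz (i + j).
Proof. by rewrite !NegzE; lia. Qed.

Lemma sum_rev (N : nat) (F : nat -> C) : \sum_(i < N) F i = \sum_(i < N) F (N - i.+1)%N.
Proof. by rewrite (reindex_inj rev_ord_inj). Qed.

Section HeadSlot.
Variables (z : C) (v : V) (S : seq slot) (p : bool).
Hypothesis g : good [::] z S.
Hypothesis pv : parity p v.
Let t (m : int) := T (compL m (sl z v) :: S).
Let t' (m : int) := T (compR m (sl z v) :: S).

Let a_ (i j : nat) := 'C(i + j, i)%:R * (cexp (z * (uu (i + j))%:C) * t (Negz (i + j))).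
Let b_ (i j : nat) := (-1) ^+ i * 'C(i + j, i)%:R * ((-1) ^+ p * cexp (- (z * (uu j)%:C)) * t' j%:Z).

Lemma T_itL (i j : nat) : T (itL psi z (Negz i) v j :: S) = a_ i j.
Proof.
have gs := good_compL fermion v (Negz (i + j)) g.
have gsh := @summ_shift _ _ _ theta tau [::] S (compL (Negz (i + j)) (sl z v)) j%:Z gs.
rewrite (@T_scale [::] S _ (fun l => compL (Negz (i + j)) (sl z v) (l + j%:Z))
  ((-1) ^+ j * binz R (Negz i) j * cexp (- (z * (mwt R (Negz i - j%:Z))%:C))))//; last first.
  by move=> l w; rewrite /itL subNegz.
rewrite (@T_shift _ _ _ theta tau [::] S (compL (Negz (i + j)) (sl z v)) j%:Z gs).
by rewrite subNegz mwt_Negz binz_neg rmorphN/= mulrN opprK -mulrA.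
Qed.

Lemma T_itR (i j : nat) : T (itR psi z (Negz i) p v j :: S) = b_ i j.
Proof.
have gs := good_compR fermion v j%:Z g.
pose d := Negz i - j%:Z.
have gsh := @summ_shift _ _ _ theta tau [::] S (compR j%:Z (sl z v)) d gs.
rewrite (@T_scale [::] S _ (fun l => compR j%:Z (sl z v) (l + d))
  (- ((-1) ^+ j * binz R (Negz i) j * ((-1) ^+ p * (-1) ^ (Negz i)) * cexp (- (z * (mwt R j%:Z)%:C)))))//.
rewrite (@T_shift _ _ _ theta tau [::] S (compR j%:Z (sl z v)) d gs) binz_neg /b_.
have -> : (-1) ^ (Negz i) = - (-1) ^+ i :> C.
  by rewrite NegzE -exprnN exprS mulN1r invrN invr_sign.
by rewrite /t' -[mwt R j%:Z]/(uu j); ring.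
Qed.

Lemma summ_a i : summ (a_ i).
Proof.
apply: summ_eq (summ_fubini (@T_fam_summ _ _ _ theta tau [::] z S (itL psi z (Negz i) v) g _)).
  by move=> j; rewrite -T_itL.
move=> r s r0 h1 h2; exact: fbd_itL (bd_sl fermion v r0 h1 h2).
Qed.

Lemma summ_b i : summ (b_ i).
Proof.
apply: summ_eq (summ_fubini (@T_fam_summ _ _ _ theta tau [::] z S (itR psi z (Negz i) p v) g _)).
  by move=> j; rewrite -T_itR.
move=> r s r0 h1 h2; apply: fbd_itR (bd_sl fermion v r0 h1 h2) => //; exact: good_tpos h1 h2.
Qed.

Lemma T_create (i : nat) : T (sl z (psim (Negz i) v) :: S) = sum (a_ i) + sum (b_ i).
Proof.
rewrite (@T_fam _ _ _ fermion theta tau [::] z S _ _ g (iter_formula fermion z (Negz i) pv)); last first.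
  move=> r s r0 h1 h2; have s0 := good_tpos r0 h1 h2.
  have [c1 [c10 c1s] hc1] := fbd_itL fermion (Negz i) r0 h1 (bd_sl fermion v r0 h1 h2).
  have [c2 [c20 c2s] hc2] := fbd_itR fermion (Negz i) p r0 s0 h2 (bd_sl fermion v r0 h1 h2).
  exists (fun j => c1 j + c2 j); first split=> [j|]; first by rewrite addr_ge0.
    under eq_es do rewrite EFinD.
    by rewrite es_D ?lte_add_pinfty// => j; rewrite lee_fin.
  by move=> j; apply: (bdcD fermion r0 (hc1 j) (hc2 j)).
rewrite -sumD; [|exact: summ_a|exact: summ_b].
apply: eq_sum => j; rewrite -T_itL -T_itR.
have s1 : summ (Tt ([::] ++ itL psi z (Negz i) v j :: S)).
  apply: (@summ_row _ _ _ (fun x => Tt ([::] ++ itL psi z (Negz i) v x.1 :: S) x.2) j).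
  apply: (T_fam_summ g) => r s r0 h1 h2; exact: fbd_itL (bd_sl fermion v r0 h1 h2).
have s2 : summ (Tt ([::] ++ itR psi z (Negz i) p v j :: S)).
  apply: (@summ_row _ _ _ (fun x => Tt ([::] ++ itR psi z (Negz i) p v x.1 :: S) x.2) j).
  apply: (T_fam_summ g) => r s r0 h1 h2.
  apply: fbd_itR (bd_sl fermion v r0 h1 h2) => //; exact: good_tpos h1 h2.
rewrite /= -[X in _ = X + _]mul1r.
by apply: (@T_lin _ _ _ fermion theta tau [::]) => // l w; rewrite scale1r.
Qed.

(** In the first half of the iterate formula the mode is fixed by r = i + j, in the second by r = j;
    in both, the sum over i at fixed r is evaluated by [expm1_sum_binz], with m = r and m = -r-1
    respectively. *)
Lemma sum_create (k : nat) :
  \sum_(i < k.+1) expm1_coef h i%:Z (k - i)%N * T (sl z (psim (Negz i) v) :: S) =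
  sum (fun r => (uu r)%:C ^+ k / k`!%:R * (cexp (z * (uu r)%:C) * t (Negz r))) +
  sum (fun r => (- (uu r)%:C) ^+ k / k`!%:R * ((-1) ^+ p * cexp (- (z * (uu r)%:C)) * t' r%:Z)).
Proof.
have uE r : (uu r)%:C = h + r%:R.
  by rewrite /uu rmorphD/= fmorphV/= !rmorph_nat addrC.
under eq_bigr do rewrite T_create mulrDr.
rewrite big_split/=; congr (_ + _).
  pose F (i r : nat) := 'C(r, i)%:R * (cexp (z * (uu r)%:C) * t (Negz r)).
  have Fi i : injective (fun j => (i + j)%N) by move=> x y /addnI.
  have F0 i j : (exists j', (i + j')%N = j) \/ F i j = 0.
    have [ij|ij] := leqP i j; first by left; exists (j - i)%N; rewrite subnKC.
    by right; rewrite /F bin_small ?mul0r.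
  have sF i : summ (F i) by apply: (summ_injV (Fi i) (F0 i)); apply: summ_a.
  have -> : \sum_(i < k.+1) expm1_coef h i%:Z (k - i)%N * sum (a_ i) =
      \sum_(i < k.+1) sum (fun r => expm1_coef h i%:Z (k - i)%N * F i r).
    by apply: eq_bigr => i _; rewrite (sumZ _ (sF i)) -(sum_inj (Fi i) (F0 i) (sF i)).
  rewrite -sum_sumr; last by move=> i; exact: summZ (sF i).
  apply: eq_sum => r; rewrite /F; under eq_bigr do rewrite mulrA.
  rewrite -mulr_suml uE -[r%:R]/((r%:Z)%:~R) -expm1_sum_binz; congr (_ * _).
  by apply: eq_bigr => i _; rewrite binz_nat mulrC.
have -> : \sum_(i < k.+1) expm1_coef h i%:Z (k - i)%N * sum (b_ i) =
    \sum_(i < k.+1) sum (fun r => expm1_coef h i%:Z (k - i)%N * b_ i r).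
  by apply: eq_bigr => i _; rewrite (sumZ _ (summ_b i)).
rewrite -sum_sumr; last by move=> i; exact: summZ (summ_b i).
apply: eq_sum => r; set E := _ * t' _.
transitivity (\sum_(i < k.+1) (expm1_coef h i%:Z (k - i)%N * ((-1) ^+ i * 'C(i + r, i)%:R)) * E).
  by apply: eq_bigr => i _; rewrite /b_ -/E mulrA.
rewrite -mulr_suml; congr (_ * _).
have -> : - (uu r)%:C = h + (Negz r)%:~R.
  have := mwtE R (Negz r); rewrite mwt_Negz rmorphN/= => ->; exact: addrC.
rewrite -expm1_sum_binz; apply: eq_bigr => i _.
rewrite -(bin_sub (leq_addr r i)) addKn addnC -binz_neg.
by rewrite [(-1) ^+ i * (_ * _)]mulrA -expr2 sqrr_sign mul1r mulrC.
Qed.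

End HeadSlot.

Section Recursion.
Variables (z : C) (ks : seq nat) (L : seq (C * seq nat)).
Let b := (z, ks).
Let v := sqfock psi ks.
Let S := map blk L.
Let p := odd (size ks).
Hypothesis gL : goodL [::] (b :: L).
Hypothesis odd_n : odd (nl (b :: L)).
Hypothesis ks_pos : all (fun l : nat => (0 < l)%N) ks.
Let t (m : int) := T (compL m (sl z v) :: S).
Let t' (m : int) := T (compR m (sl z v) :: S).

(** As the number of fermions in the blocks is odd, commuting psi(m) through all of them gives t =
    -tR + cm, and cyclicity gives t as a multiple of tR; eliminating tR leaves the equation. *)
Lemma cyc_eq (m : int) : t m * (1 - theta * qpow tau (- mwt R m)) =
  - theta * qpow tau (- mwt R m) * cm m [::] (b :: L).
Proof.
have lo : linl (map blk (b :: L)) by rewrite map_blk; apply: (linl_sl fermion).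
have e (x : seq int * fock_index) : Tt (compL m (sl z v) :: S) x =
    tr psi theta tau (fun w => psim m (app (map blk (b :: L)) x.1 w)) x.2.
  by rewrite /Tt /tr (app_compL fermion).
have sL : summ (fun x : seq int * fock_index =>
    tr psi theta tau (fun w => psim m (app (map blk (b :: L)) x.1 w)) x.2).
  apply: (summ_eq (fun x => esym (e x))).
  exact: (good_compL fermion v m (goodL_head gL)).
have tLE : t m = tL psi theta tau m (map blk (b :: L)) by apply: eq_sum => x; exact: e.
have [eR _] := trace_cyclic fermion theta_sq lo sL.
have := T_comm_all fermion tau_gt0 m gL; rewrite cat0s -signr_odd odd_n expr1 mulN1r => eC.
have tE : t m = - tR psi theta tau m (map blk (b :: L)) + cm m [::] (b :: L) by exact: eC.
have hR : tR psi theta tau m (map blk (b :: L)) = cm m [::] (b :: L) - t m by rewrite tE; ring.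
have : t m = - theta * qpow tau (- mwt R m) * (cm m [::] (b :: L) - t m) by rewrite -hR tLE.
by rewrite mulrBr => e2; rewrite mulrBr mulr1 {1}e2; ring.
Qed.

Lemma t_Negz (r : nat) : t (Negz r) = - lam r * cm (Negz r) [::] (b :: L).
Proof.
have := cyc_eq (Negz r); rewrite mwt_Negz opprK /lam => e.
apply: (mulIf (den_neq0 theta_sq tau_gt0 r)); rewrite e.
by field; rewrite (den_neq0 theta_sq tau_gt0 r).
Qed.

Lemma t_Posz (r : nat) : t r%:Z = lamB r * cm r%:Z [::] (b :: L).
Proof.
have := cyc_eq r%:Z; rewrite -[mwt R r%:Z]/(uu r) /lamB => e.
have qq : qpow tau (uu r) * qpow tau (- uu r) = 1.
  by rewrite -qpowD subrr /qpow mulr0 (_ : 0 +i* 0 = 0)// mul0r cexp0.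
have e2 : t r%:Z * (1 - theta * qpow tau (uu r)) = cm r%:Z [::] (b :: L).
  transitivity ((- theta * qpow tau (uu r)) * (t r%:Z * (1 - theta * qpow tau (- uu r)))).
    rewrite (_ : _ * (t _ * _) = t r%:Z * (theta ^+ 2 * (qpow tau (uu r) * qpow tau (- uu r)) - theta * qpow tau (uu r))); last by ring.
    by rewrite qq theta_sq mulr1.
  rewrite e (_ : _ * (_ * _) = theta ^+ 2 * (qpow tau (uu r) * qpow tau (- uu r)) * cm r%:Z [::] (b :: L)); last by ring.
  by rewrite qq theta_sq !mul1r.
by rewrite -e2; field; rewrite (den_neq0 theta_sq tau_gt0 r).
Qed.

Lemma t'_Posz (r : nat) : (-1) ^+ p * t' r%:Z = t r%:Z -
  cexp (z * (uu r)%:C) * T (sl z (Ann psi r%:Z v) :: S).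
Proof.
have := T_comm fermion tau_gt0 r%:Z (goodL_head gL) (parity_sqfock fermion ks).
by rewrite !cat0s -[mwt R r%:Z]/(uu r) => e; rewrite /t e addrK.
Qed.

Variables (n : nat) (lb : nat -> C * nat) (G : nat -> C).
Hypothesis size_n : (size ks <= n)%N.
Hypothesis lb_ks : forall j, (j < size ks)%N -> lb j = (z, nth 0%N ks j).
Hypothesis lb_pos : forall j, (j < n)%N -> (0 < (lb j).2)%N.
Hypothesis lb_dom : forall j, (size ks <= j < n)%N ->
  - (2 * pi * complex.Im tau) < complex.Re ((lb j).1 - z) < 0.
Hypothesis cmE : forall m, cm m [::] (b :: L) = \sum_(j < n) (-1) ^+ j *
  (cexp ((lb j).1 * (mwt R m)%:C) * (mwt R m)%:C ^+ (lb j).2.-1 / ((lb j).2.-1)`!%:R) * G j.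
Hypothesis TE : forall (j : nat), (j < size ks)%N -> T (sl z (sqfock psi (del j ks)) :: S) = G j.

Lemma T_annih (c : nat -> C) : T (sl z (\sum_(j < size ks) c j *: sqfock psi (del j ks)) :: S) =
  \sum_(j < n) if (j < size ks)%N then c j * G j else 0.
Proof.
rewrite -big_mkcond /= -(big_ord_widen n (fun j => c j * G j) size_n).
rewrite -[sl _ _ :: S]cat0s (T_slsum _ _ (goodL_head gL)).
by apply: eq_bigr => j _; rewrite TE.
Qed.

Let alg1 (U1 U2 e1 e2 la s g q f1 f2 : C) : f1 != 0 -> f2 != 0 ->
  U1 / f1 * (e1 * (- la * (s * (e2 * (q * U2) / f2) * g))) =
  s * g / (f1 * f2) * (-1 * q) * (U1 * U2 * (e1 * e2) * la).
Proof. by move=> h1 h2; field; rewrite h1 h2. Qed.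

Let alg2 (U1 U2 e1 e2 la s g q f1 f2 : C) : f1 != 0 -> f2 != 0 -> e1 * e2 = 1 ->
  q * U1 / f1 * (e1 * ((la + 1) * (s * (e2 * U2 / f2) * g) - e2 * (s * (U2 / f2) * g))) =
  s * g / (f1 * f2) * q * (U1 * U2 * la).
Proof.
move=> h1 h2 h12; transitivity ((e1 * e2) * (s * g / (f1 * f2) * q * (U1 * U2 * la))).
  by field; rewrite h1 h2.
by rewrite h12 mul1r.
Qed.

Let alg3 (U1 U2 e1 e2 la s g q f1 f2 : C) : f1 != 0 -> f2 != 0 ->
  q * U1 / f1 * (e1 * (la * (s * (e2 * U2 / f2) * g))) =
  s * g / (f1 * f2) * q * (U1 * U2 * (e1 * e2) * la).
Proof. by move=> h1 h2; field; rewrite h1 h2. Qed.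

(** [lb] lists the point and index of every remaining fermion, the first [size ks] being those of
    the leading vector, and [G j] is the trace with the j-th of them removed. All terms carry the
    same sign and the same [G j], so only coefficients have to be compared. *)
Lemma zhu (k : nat) : (0 < k)%N -> T (blk (z, k :: ks) :: S) =
  \sum_(j < n) (-1) ^+ j * (if (j < size ks)%N then entC theta tau k (lb j).2
    else entD theta tau k (lb j).2 ((lb j).1 - z)) * G j.
Proof.
move=> k0; have [N0 hN0] := psi_trunc fermion v.
pose N := (N0 + \sum_(l <- ks) l)%N.
have hN m : N%:Z <= m -> psim m v = 0 by move=> ?; apply: hN0; lia.
rewrite /blk /= (sqmode_psiE fermion hN (leqnn _)) -[sl _ _ :: S]cat0s.
rewrite (T_slsum _ _ (goodL_head gL)) addnC big_split_ord /=.
(* The terms of psi[-k] before the k-th are creating modes psi(-i-1), listed here in reverse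
   order. *)
have part1 : \sum_(i < k) expm1_coef h (- (- k%:Z + i%:Z) - 1) i * T (sl z (psim (- k%:Z + i%:Z) v) :: S) =
    \sum_(j < n) (-1) ^+ j * (if (j < size ks)%N then
      ((-1) ^+ (lb j).2 * sum (sA (k.-1 + (lb j).2.-1) 0) + (-1) ^+ k.-1 * sum (sA (k.-1 + (lb j).2.-1) 0))
        / ((k.-1)`! * ((lb j).2.-1)`!)%:R
    else entD theta tau k (lb j).2 ((lb j).1 - z)) * G j.
  have -> : \sum_(i < k) expm1_coef h (- (- k%:Z + i%:Z) - 1) i * T (sl z (psim (- k%:Z + i%:Z) v) :: S) =
      \sum_(i < k.-1.+1) expm1_coef h i%:Z (k.-1 - i)%N * T (sl z (psim (Negz i) v) :: S).
    rewrite (sum_rev k (fun i => expm1_coef h (- (- k%:Z + i%:Z) - 1) i * T (sl z (psim (- k%:Z + i%:Z) v) :: S))).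
    rewrite (prednK k0); apply: eq_bigr => i _.
    congr (expm1_coef h _ _ * T (sl z (psim _ v) :: S)); rewrite ?NegzE; have := ltn_ord i; lia.
  rewrite (@sum_create z v S p (goodL_head gL) (parity_sqfock fermion ks)) -/t -/t'.
  pose al j : C := (-1) ^+ j * G j / ((k.-1)`! * ((lb j).2.-1)`!)%:R.
  pose w j := (lb j).1 - z.
  have be j : (j < size ks)%N -> w j = 0 by move=> /lb_ks; rewrite /w => ->; rewrite subrr.
  have f1 : ((k.-1)`!)%:R != 0 :> C by rewrite pnatr_eq0 -lt0n fact_gt0.
  have f2 j : ((lb j).2.-1)`!%:R != 0 :> C by rewrite pnatr_eq0 -lt0n fact_gt0.
  have e1 r : (uu r)%:C ^+ k.-1 / (k.-1)`!%:R * (cexp (z * (uu r)%:C) * t (Negz r)) =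
      \sum_(j < n) al j * (-1) ^+ (lb j).2 * sA (k.-1 + (lb j).2.-1) (w j) r.
    rewrite t_Negz cmE !mulr_sumr; apply: eq_bigr => j _; rewrite mwt_Negz /sA /w.
    have -> : cexp (- (((lb j).1 - z) * (uu r)%:C)) =
        cexp (z * (uu r)%:C) * cexp ((lb j).1 * (- uu r)%:C).
      by rewrite -cexpD; congr cexp; rewrite rmorphN/=; ring.
    rewrite rmorphN/= [(- (uu r)%:C) ^+ _]exprNn.
    rewrite -[in (-1) ^+ (lb j).2](prednK (lb_pos (ltn_ord j))) exprS exprD /al natrM.
    exact: alg1 f1 (f2 j).
  (* For a fermion of the leading vector the [Ann] term of [t'_Posz] subtracts exactly 1 from
     [lamB], which leaves [lam]; for the others [lamB] stays. *)
  have e2 r : (- (uu r)%:C) ^+ k.-1 / (k.-1)`!%:R * ((-1) ^+ p * cexp (- (z * (uu r)%:C)) * t' r%:Z) =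
      \sum_(j < n) al j * (-1) ^+ k.-1 * (if (j < size ks)%N then sA (k.-1 + (lb j).2.-1) 0 r
        else sB (k.-1 + (lb j).2.-1) (w j) r).
    rewrite [(-1) ^+ p * _]mulrC -[_ * _ * t' _]mulrA t'_Posz t_Posz cmE.
    rewrite (Ann_sqfock fermion _ ks_pos).
    rewrite (T_annih (fun j => (-1) ^+ j * ((mwt R r%:Z)%:C ^+ (nth 0%N ks j).-1 / ((nth 0%N ks j).-1)`!%:R))).
    rewrite mulr_sumr mulr_sumr -sumrB !mulr_sumr; apply: eq_bigr => j _.
    rewrite -[mwt R r%:Z]/(uu r) [(- (uu r)%:C) ^+ _]exprNn.
    have ee : cexp (- (z * (uu r)%:C)) * cexp (z * (uu r)%:C) = 1 by rewrite -cexpD addNr cexp0.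
    case: ifP => jk.
      have -> : nth 0%N ks j = (lb j).2 by rewrite lb_ks.
      have -> : (lb j).1 = z by rewrite lb_ks.
      rewrite lamBE// /sA mul0r oppr0 cexp0 mulr1 exprD /al natrM.
      exact: alg2 f1 (f2 j) ee.
    rewrite mulr0 subr0 /sB /w exprD /al natrM.
    have -> : cexp (((lb j).1 - z) * (uu r)%:C) = cexp (- (z * (uu r)%:C)) * cexp ((lb j).1 * (uu r)%:C).
      by rewrite -cexpD; congr cexp; ring.
    exact: alg3 f1 (f2 j).
  have sA0 m : summ (sA m 0).
    by apply: summ_sA => //=; rewrite oppr_lt0 !mulr_gt0// ?pi_gt0.
  have sAw (j : 'I_n) : summ (sA (k.-1 + (lb j).2.-1) (w j)).
    have [jk|jk] := ltnP j (size ks); first by rewrite be.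
    have /lb_dom/andP[h1 h2] : (size ks <= j < n)%N by rewrite jk ltn_ord.
    exact: summ_sA.
  have sAB (j : 'I_n) : summ (fun r => if (j < size ks)%N then sA (k.-1 + (lb j).2.-1) 0 r
        else sB (k.-1 + (lb j).2.-1) (w j) r).
    case: ltnP => jk; first exact: sA0.
    have /lb_dom/andP[h1 h2] : (size ks <= j < n)%N by rewrite jk ltn_ord.
    exact: summ_sB.
  rewrite (eq_sum e1) (eq_sum e2) !sum_sumr; last 2 first.
  - by move=> j; apply: summZ.
  - by move=> j; apply: summZ.
  rewrite -big_split /=; apply: eq_bigr => j _; rewrite !sumZ// /entD -/(w j).
  case: ifP => jk; first by rewrite be// /al; ring.
  by rewrite /al; ring.
(* The later terms of psi[-k] are psi(i) with i >= 0: they remove fermions of the leading vector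
   only, with coefficients that add up to [expm1_pair]. *)
have part2 : \sum_(i < N) expm1_coef h (- (- k%:Z + (k + i)%N%:Z) - 1) (k + i)%N *
      T (sl z (psim (- k%:Z + (k + i)%N%:Z) v) :: S) =
    \sum_(j < n) (-1) ^+ j * (if (j < size ks)%N then expm1_pair R k (lb j).2.-1 else 0) * G j.
  transitivity (\sum_(i < N) \sum_(j < n) expm1_coef h (- (i.+1%:Z)) (i + k)%N *
      (if (j < size ks)%N then (-1) ^+ j * ann_coef R i (lb j).2 * G j else 0)).
    apply: eq_bigr => i _; rewrite -mulr_sumr; congr (expm1_coef _ _ _ * _); [lia|lia|].
    rewrite (_ : - k%:Z + (k + i)%N%:Z = i%:Z); last by lia.
    rewrite (psi_sqfock fermion) (T_annih (fun j => (-1) ^+ j * ann_coef R i (nth 0%N ks j))).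
    by apply: eq_bigr => j _; case: ifP => // jk; rewrite lb_ks.
  rewrite exchange_big /=; apply: eq_bigr => j _; case: ifP => jk; last first.
    by rewrite big1 => [|i _]; rewrite mulr0// mul0r.
  rewrite mulrAC mulrC /expm1_pair; set l := (lb j).2.
  have l0 : (0 < l)%N by apply: lb_pos; apply: leq_trans jk size_n.
  have lN : (l.-1.+1 <= N)%N.
    rewrite prednK// /l lb_ks//= /N (big_rem _ (mem_nth 0%N jk))/=; lia.
  rewrite (big_ord_widen N (fun q => expm1_coef (2^-1) (- (q.+1%:Z)) (q + k)%N * expm1_coef (2^-1) q%:Z (l.-1 - q)%N) lN).
  rewrite [in RHS]big_mkcond mulr_suml; apply: eq_bigr => i _; rewrite (prednK l0) /ann_coef.
  case: ifP => il; last by rewrite mulr0 mul0r mulr0 mul0r.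
  have -> : (l - i).-1 = (l.-1 - i)%N by lia.
  by rewrite /h; ring.
rewrite part1 part2 -big_split /=; apply: eq_bigr => j _.
rewrite /entC; case: ifP => _; last by rewrite mulr0 mul0r addr0.
by rewrite -mulrDl -mulrDr.
Qed.

End Recursion.
End Zhu.

(** * Pfaffians of lists *)

Section ListPfaffian.
Variables (K : comPzRingType) (A : Type) (e : A -> A -> K).

(** Expansion along the first row, with [n] as fuel because [del j s'] is not a structural
    subterm. *)
Fixpoint pfn (n : nat) (s : seq A) : K := match n, s with
  | _, [::] => 1
  | n'.+1, x :: s' => \sum_(j < size s') (-1) ^+ j * e x (nth x s' j) * pfn n' (del j s')
  | 0%N, _ => 0
  end.

Definition pf s := pfn (size s) s.

Lemma pfn_fuel n m s : (size s <= n)%N -> (size s <= m)%N -> pfn n s = pfn m s.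
Proof.
elim: n m s => [|n IH] [|m] [|x s] //= sn sm.
apply: eq_bigr => j _; congr (_ * _); apply: IH; rewrite size_del//; lia.
Qed.

Lemma pf_nil : pf [::] = 1. Proof. by []. Qed.

Lemma pf_cons x s : pf (x :: s) =
  \sum_(j < size s) (-1) ^+ j * e x (nth x s j) * pf (del j s).
Proof.
rewrite /pf /=; apply: eq_bigr => j _; congr (_ * _).
apply: pfn_fuel => //; rewrite size_del//; lia.
Qed.

End ListPfaffian.

Lemma del_cat (A : Type) j (s1 s2 : seq A) : del j (s1 ++ s2) =
  if (j < size s1)%N then del j s1 ++ s2 else s1 ++ del (j - size s1) s2.
Proof.
rewrite /del take_cat drop_cat; case: ltnP => js.
  case: ltnP => js'; first by rewrite catA.
  have -> : j.+1 = size s1 by lia.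
  by rewrite subnn drop0 drop_size cats0.
by rewrite ltnNge leqW//= subSn// catA.
Qed.

Section Blocks.
Variable C : eqType.
Implicit Types (b : C * seq nat) (L : seq (C * seq nat)).

Definition lab L : seq (C * nat) := flatten [seq [seq (b.1, k) | k <- b.2] | b <- L].

Fixpoint delb L (j : nat) := match L with
  | [::] => [::]
  | b :: L' => if (j < size b.2)%N then (b.1, del j b.2) :: L' else b :: delb L' (j - size b.2)
  end.

Lemma lab_cons b L : lab (b :: L) = [seq (b.1, k) | k <- b.2] ++ lab L.
Proof. by []. Qed.

Lemma lab_delb L j : lab (delb L j) = del j (lab L).
Proof.
elim: L j => [|b L IH] j //=; rewrite lab_cons del_cat size_map.
case: ltnP => jb; last by rewrite lab_cons IH.
by rewrite lab_cons /= /del map_cat map_take map_drop.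
Qed.

Lemma fst_delb L j : map fst (delb L j) = map fst L.
Proof. by elim: L j => [|b L IH] j //=; case: ifP => //= _; rewrite IH. Qed.

Lemma size_delb L j : size (delb L j) = size L.
Proof. by rewrite -(size_map fst) fst_delb size_map. Qed.

End Blocks.

Section TracePfaffian.
Variables (R : realType) (V : vosa_data R) (psi : V).
Hypothesis fermion : rank_one_fermion psi.
Notation C := (R[i]).
Variables (theta tau : C).
Hypothesis theta_sq : theta ^+ 2 = 1.
Hypothesis tau_gt0 : 0 < complex.Im tau.
Notation T := (T psi theta tau).
Notation goodL := (goodL psi theta tau).
Notation blk := (blk psi).
Notation cm := (cm psi theta tau).
Implicit Types (b : C * seq nat) (L P : seq (C * seq nat)).

Let d0 : C * nat := (0, 0%N).
Lemma size_lab L : size (lab L) = nl L.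
Proof.
elim: L => [|b L IH]; first by rewrite /nl big_nil.
by rewrite lab_cons size_cat size_map IH /nl big_cons.
Qed.

Definition pos_blocks L := all (fun b => all (fun l : nat => (0 < l)%N) b.2) L.

(** Passing a block costs the sign of its size, so the signs of the blocks passed and of the place
    inside a block combine to that of the position in the flattened list. *)
Lemma cm_lab m P L : goodL (map blk P) L -> pos_blocks L ->
  cm m (map blk P) L = \sum_(j < size (lab L)) (-1) ^+ j *
    (cexp ((nth d0 (lab L) j).1 * (mwt R m)%:C) * (mwt R m)%:C ^+ (nth d0 (lab L) j).2.-1
      / ((nth d0 (lab L) j).2.-1)`!%:R) * T (map blk (P ++ delb L j)).
Proof.
elim: L P => [|b L IH] P g pos; first by rewrite /lab /= big_ord0.
have /andP[posb posL] := pos.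
rewrite lab_cons size_cat size_map big_split_ord /=; congr (_ + _).
  rewrite (Ann_sqfock fermion _ posb) (T_slsum fermion _ _ (goodL_head g)) mulr_sumr.
  apply: eq_bigr => j _; rewrite nth_cat size_map ltn_ord (nth_map 0%N)//=.
  by rewrite map_cat /=; ring.
have -> : rcons (map blk P) (blk b) = map blk (rcons P b) by rewrite map_rcons.
rewrite IH//; last by rewrite map_rcons; apply: goodL_rcons.
rewrite mulr_sumr; apply: eq_bigr => j _.
rewrite nth_cat size_map ltnNge leq_addr/= addKn cat_rcons exprD.
by ring.
Qed.

(** Equality of points decides whether two fermions belong to the same vector, since [sep] makes the
    points of different vectors distinct. *)
Definition ent (x y : C * nat) : C :=
  if y.1 == x.1 then entC theta tau x.2 y.2 else entD theta tau x.2 y.2 (y.1 - x.1).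

Definition sep (z z' : C) : bool :=
  - (2 * pi * complex.Im tau) < complex.Re (z' - z) < 0.

Lemma T_vacuum z L : dom tau (map fst ((z, [::]) :: L)) ->
  T (map blk ((z, [::]) :: L)) = T (map blk L).
Proof.
move=> hd; have g := @goodL_dom _ _ _ fermion theta tau theta_sq [::] ((z, [::]) :: L) hd.
have s := good_summ fermion (sqfock psi [::]) (goodL_head g).
rewrite /T /=; apply/esym.
have blkE l w : blk (z, [::]) l w = (l == -1)%:R *: w.
  rewrite /blk /sl /= (expL0_vacuum fermion) (vacuum_mode (fermion_vosa fermion)).
  have [->|_] := eqVneq l (-1); last by rewrite !scale0r scaler0.
  by rewrite opprK addrC subrr expr0z scale1r.
pose f (x : seq int * fock_index) := (-1 :: x.1, x.2).
rewrite -(@sum_inj _ _ _ f (Tt psi theta tau (blk (z, [::]) :: map blk L)))//.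
- by apply: eq_sum => x; rewrite /Tt /tr /= blkE eqxx scale1r.
- by move=> [a b] [c d] [-> ->].
move=> [[|l ms] k]; first by right; rewrite /Tt /tr /= (coord0 fermion) mulr0 mul0r.
have [->|l1] := eqVneq l (-1); first by left; exists (ms, k).
by right; rewrite /Tt /tr /= blkE (negbTE l1) scale0r (coord0 fermion) mulr0 mul0r.
Qed.

(** The induction measure also counts the blocks: an exhausted block is a vacuum vector, which is
    dropped without removing a fermion. *)
Lemma T_pf n L : (size (lab L) + size L <= n)%N -> ~~ odd (size (lab L)) -> pos_blocks L ->
  dom tau (map fst L) -> pairwise sep (map fst L) ->
  T (map blk L) = pf ent (lab L) * T [::].
Proof.
elim: n L => [|n IH] [|[z [|k ks]] L] //=; rewrite ?pf_nil ?mul1r//.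
- by rewrite addnS.
- move=> sn on pos hd /andP[_ pw]; rewrite (T_vacuum hd) IH//; last exact: dom_tail hd.
  by move: sn; rewrite lab_cons /=; lia.
rewrite lab_cons /= => sn on /andP[/= /andP[k0 ksp] posL] hd /andP[sz pw].
pose L0 := (z, ks) :: L.
have labL0 : lab L0 = [seq (z, k) | k <- ks] ++ lab L by [].
have sL0 : size (lab L0) = nl L0 by apply: size_lab.
have g := @goodL_dom _ _ _ fermion theta tau theta_sq [::] L0 hd.
have pos0 : pos_blocks L0 by rewrite /pos_blocks /= ksp.
have onl : odd (nl L0) by move: on; rewrite -labL0 -sL0 negbK.
pose G j := T (map blk (delb L0 j)).
have lbz j : (j < size ks)%N -> nth d0 (lab L0) j = (z, nth 0%N ks j).
  by move=> jk; rewrite labL0 nth_cat size_map jk (nth_map 0%N).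
have lbpos (j : nat) : (j < size (lab L0))%N -> (0 < (nth d0 (lab L0) j).2)%N.
  move=> jl; have : all (fun x : C * nat => (0 < x.2)%N) (lab L0).
    elim: (L0) pos0 => [|b L1 IH1] //= /andP[pb /IH1 h1]; rewrite lab_cons all_cat h1 andbT.
    by rewrite all_map.
  by move=> /(all_nthP d0); apply.
have lbdom j : (size ks <= j < size (lab L0))%N ->
    sep z (nth d0 (lab L0) j).1.
  rewrite labL0 size_cat size_map nth_cat size_map => /andP[h1 h2].
  rewrite ltnNge h1 /=; have jL : (j - size ks < size (lab L))%N by lia.
  have : all (fun x : C * nat => sep z x.1) (lab L).
    elim: (L) sz => [|b L1 IH1] //= /andP[pb /IH1 h3]; rewrite lab_cons all_cat h3 andbT.
    by rewrite all_map; apply/allP => q _.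
  by move=> /(all_nthP d0); apply.
rewrite -[blk _]/(blk (z, k :: ks)).
rewrite (@zhu _ _ _ fermion theta tau theta_sq tau_gt0 z ks L g onl ksp (size (lab L0)) (fun j => nth d0 (lab L0) j) G)//.
- rewrite pf_cons mulr_suml -labL0; apply: eq_bigr => j _.
  have -> : G j = pf ent (del j (lab L0)) * T [::].
    rewrite /G IH ?lab_delb//.
    + by rewrite size_del// size_delb; move: sn; rewrite -labL0 /=; lia.
    + rewrite size_del//; have : (0 < size (lab L0))%N by apply: leq_ltn_trans (ltn_ord j).
      by move: on; rewrite -labL0; move: (size (lab L0)) => [|q] //=; rewrite negbK.
    + move: (j : nat) => j'; elim: (L0) j' pos0 => [|b L1 IH1] j' //= /andP[pb pL1].
      case: ifP => _ /=; rewrite ?pb ?IH1 ?pL1 ?andbT//=.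
      apply/allP => q; rewrite /del mem_cat => /orP[/mem_take|/mem_drop]; exact: (allP pb).
    + by rewrite fst_delb.
    + by rewrite fst_delb /= sz.
  rewrite mulrA; congr (_ * _ * _ * _).
  rewrite /ent (set_nth_default d0)//.
  case: ltnP => jk; first by rewrite lbz //= eqxx.
  have /lbdom : (size ks <= j < size (lab L0))%N by rewrite jk ltn_ord.
  rewrite /sep /=; have [->|//] := eqVneq (nth d0 (lab L0) j).1 z.
  by rewrite subrr /= ltxx andbF.
- by rewrite labL0 size_cat size_map leq_addr.
- by move=> m; rewrite -[[::]]/(map blk [::]) cm_lab.
- by move=> j jk; rewrite /G /= jk.
Qed.

End TracePfaffian.

(** * The n-point function as a trace *)

Section NPoint.
Variables (R : realType) (V : vosa_data R) (psi : V).
Hypothesis fermion : rank_one_fermion psi.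
Notation C := (R[i]).
Variables (theta tau : C).
Hypothesis theta_sq : theta ^+ 2 = 1.
Hypothesis tau_gt0 : 0 < complex.Im tau.
Notation T := (T psi theta tau).
Notation Tt := (Tt psi theta tau).
Notation sl := (sl psi).
Notation blk := (blk psi).
Notation fk k := (fock psi (val k)).
Notation coord := (fock_coord psi).
Implicit Types (L : seq (C * seq nat)).

Lemma dom_summ (os : seq (C * V)) : dom tau (map fst os) -> summ (Tt [seq sl x.1 x.2 | x <- os]).
Proof.
move=> [r [t [r0 hrt h]]]; have [c c0 hc] := domr_bdl fermion r0 erefl h.
have t0 : 0 < t by apply: lt_le_trans r0 (domr_le h).
apply: le_lt_trans (trace_bound fermion tau (theta_norm theta_sq) r0 t0 c0 hc) _.
by rewrite lte_mul_pinfty// Kc_lty.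
Qed.

Lemma parity_app L ms w p : parity p w -> parity (p (+) odd (nl L)) (app (map blk L) ms w).
Proof.
elim: L ms => [|b L IH] [|m ms] pw; try exact: (parity0 fermion).
  by rewrite /nl big_nil addbF.
rewrite nl_cons oddD addbCA /blk /sl; apply: (parityZ fermion).
apply: (mode_parity (fermion_vosa fermion)); last exact: IH.
exact/(parity_expL0 fermion)/parity_sqfock.
Qed.

(** The product reverses parity, so its diagonal entries in the basis of parity eigenvectors
    vanish. *)
Lemma T_odd L : odd (nl L) -> T (map blk L) = 0.
Proof.
move=> on; apply: sum0 => -[ms k]; rewrite /Tt /tr /=.
have pk : parity (odd (size (val k))) (fk k).
  by have := sigma_fk fermion k; rewrite /parity signr_odd.
have /(parityP fermion) -> := parity_app L ms pk; first by rewrite mulr0 mul0r.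
by rewrite on addbT; case: odd.
Qed.

Lemma pairwise_sep_rho (z : C) zs : all (sep tau z) zs -> all (fun z' => rho z' < rho z) zs.
Proof.
apply: sub_all => z' /andP[_]; rewrite raddfB /= subr_lt0 /rho ltr_expR => h; lra.
Qed.

Lemma domr_ex r z zs t : 0 < r -> pairwise (sep tau) (z :: zs) ->
  r * rho z < 1 -> 1 < t * rho (last z zs) -> domr r (z :: zs) t.
Proof.
elim: zs r z => [|z' zs IH] r z r0 /=; first by move=> _ h1 h2; exists t.
move=> /andP[/andP[sz szs] /andP[s1 s2]] h1 h2.
have rz : rho z' < rho z by have /= := @pairwise_sep_rho z [:: z']; rewrite sz => /(_ isT)/andP[].
have p1 := rho_gt0 z; have p2 := rho_gt0 z'.
(* The midpoint of the two consecutive values of 1 / rho between which the radius must lie. *)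
pose s := ((rho z)^-1 + (rho z')^-1) / 2.
have i12 : (rho z)^-1 < (rho z')^-1 by rewrite ltf_pV2.
have i1 : 0 < (rho z)^-1 by rewrite invr_gt0.
have s0 : 0 < s by rewrite /s; lra.
have sz1 : 1 < s * rho z by rewrite -ltr_pdivrMr// div1r /s; lra.
have sz2 : s * rho z' < 1 by rewrite -ltr_pdivlMr// div1r /s; lra.
exists s; split=> //.
by apply: IH => //=; rewrite s1.
Qed.

Lemma dom_sep zs : pairwise (sep tau) zs -> dom tau zs.
Proof.
case: zs => [|z zs] pw; first by exists 1, 1; split=> //=; rewrite mulr1 hq_lt1.
have p1 := rho_gt0 z; have p2 := rho_gt0 (last z zs); have h0 := hq_gt0 tau.
have hlt : hq tau * rho z < rho (last z zs).
  case: zs pw {p2} => [_|z' zs]; first by rewrite gtr_pMl ?hq_lt1.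
  move=> /andP[/allP h _]; have /h/andP[+ _] := mem_last z' zs; rewrite [last _ _]/=.
  rewrite raddfB /= /hq /rho -expRD ltr_expR => h1; lra.
(* [A < B] is the inequality |q| < |e^(z' - z)| for the first point z and the last point z'. [r] is
   put between [A] and [B], and [t] between 1 / rho(z') and [r / hq tau]. *)
pose A := hq tau / rho (last z zs); pose B := (rho z)^-1.
have AB : A < B by rewrite /A /B ltr_pdivrMr// mulrC ltr_pdivlMr.
have A0 : 0 < A by rewrite divr_gt0.
pose r := (A + B) / 2; pose t := ((rho (last z zs))^-1 + r / hq tau) / 2.
have e1 : hq tau * (rho (last z zs))^-1 = A by [].
have e2 : hq tau * (r / hq tau) = r by rewrite mulrCA divff ?mulr1// gt_eqF.
have r0 : 0 < r by rewrite /r; lra.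
exists r, t; split=> //.
  rewrite /t mulrA mulrDr e1 e2 /r; lra.
apply: domr_ex => //.
  rewrite -ltr_pdivlMr// div1r -/B /r; lra.
rewrite -ltr_pdivrMr// div1r /t.
suff : (rho (last z zs))^-1 < r / hq tau by lra.
by rewrite ltr_pdivlMr// mulrC e1 /r; lra.
Qed.

Lemma normc_lt (x y : C) : (`|x| < `|y|) = (nc x < nc y).
Proof. by rewrite !ncE ltcR. Qed.

Lemma domain_sep n (z : 'rV[C]_n) : npoint_domain z tau ->
  pairwise (sep tau) [seq z 0 a | a <- enum 'I_n].
Proof.
move=> [_ h]; rewrite pairwise_map.
have : pairwise (fun i j : 'I_n => (i < j)%N) (enum 'I_n).
  rewrite -(pairwise_map val ltn) val_enum_ord.
  by rewrite -sorted_pairwise ?iota_ltn_sorted//; apply: ltn_trans.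
apply: sub_pairwise => i j /h; rewrite !normc_lt => /andP[h1].
rewrite ncE -[1]/(1%:C) ltcR.
move: h1; rewrite nc_qpow nc_cexp => h1 h2.
apply/andP; split; first by move: h1; rewrite ltr_expR mulr1 mulNr.
by move: h2; rewrite expR_lt1.
Qed.

Variables (g : V -> V) (n : nat) (k : 'I_n -> seq nat).
Hypothesis g_theta : g = idfun /\ theta = 1 \/ g = sigma V /\ theta = -1.

Lemma str_termE X l : str_term psi (fun u => g (X u)) tau l = tr psi theta tau X l.
Proof.
rewrite /str_term /tr; case: g_theta => -[-> ->] //.
by rewrite (coord_sigma fermion) mulrA -expr2 sqrr_sign opprK expr1n.
Qed.

Definition slots_of (v : 'I_n -> V) (z : 'rV[C]_n) := [seq sl (z 0 a) (v a) | a <- enum 'I_n].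
Definition idx_of (x : {ffun 'I_n -> int} * fock_index) : seq int * fock_index :=
  ([seq x.1 a | a <- enum 'I_n], x.2).

Lemma idx_of_inj : injective idx_of.
Proof.
move=> [f1 k1] [f2 k2] [/eq_in_map e ->]; congr (_, _); apply/ffunP => a.
by apply: e; rewrite mem_enum.
Qed.

Lemma npoint_termE v z x : npoint_term psi g v z tau x = Tt (slots_of v z) (idx_of x).
Proof.
case: x => f l; rewrite /npoint_term str_termE /Tt /tr /=.
set X := foldr _ _ _.
suff -> : app (slots_of v z) [seq f a | a <- enum 'I_n] (fk l) =
    (\prod_(a < n) cexp (z 0 a) ^ (- f a - 1)) *: X.
  rewrite (coordZ fermion); move: (\prod_(a < n) _) (coord X l) (qpow _ _) (_ ^+ _) => P c Q A.
  by ring.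
rewrite -big_enum /slots_of /X; elim: (enum 'I_n) => [|a s IH] /=.
  by rewrite big_nil scale1r.
by rewrite big_cons IH /sl (modeZr fermion) scalerA.
Qed.

Lemma idx_of_surj v z y : (exists x, idx_of x = y) \/ Tt (slots_of v z) y = 0.
Proof.
case: y => ms l; have [sm|sm] := eqVneq (size ms) n.
  left; exists ([ffun a : 'I_n => nth 0 ms a], l); congr (_, _).
  apply: (@eq_from_nth _ 0) => [|i]; first by rewrite size_map size_enum_ord sm.
  rewrite size_map size_enum_ord => ilt.
  by rewrite (nth_map (Ordinal ilt)) ?size_enum_ord// ffunE nth_enum_ord.
right; rewrite /Tt /tr /=; suff -> : app (slots_of v z) ms (fk l) = 0.
  by rewrite (coord0 fermion) mulr0 mul0r.
have : size ms != size (slots_of v z) by rewrite size_map size_enum_ord.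
rewrite /slots_of; elim: (enum 'I_n) ms {sm} => [|a s IH] [|m ms] //=.
by rewrite eqSS => /IH ->; rewrite /sl (mode0r fermion) scaler0.
Qed.

Lemma npoint_T v z : npoint_domain z tau -> npoint psi g v z tau = T (slots_of v z).
Proof.
move=> hd; have hs : summ (Tt (slots_of v z)).
  have -> : slots_of v z = [seq sl x.1 x.2 | x <- [seq (z 0 a, v a) | a <- enum 'I_n]].
    by rewrite -map_comp.
  by apply: dom_summ; rewrite -map_comp; apply/dom_sep/domain_sep.
rewrite /npoint (eq_sum (npoint_termE v z)) /T.
exact: (sum_inj idx_of_inj (idx_of_surj v z) hs).
Qed.

Lemma Zfun_T : Zfun psi g tau = T [::].
Proof.
have hs : summ (Tt [::]) by apply: (@dom_summ [::]); apply: dom_sep.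
have fi : injective (fun l : fock_index => ([::] : seq int, l)) by move=> x y [].
rewrite /Zfun /T -(sum_inj fi _ hs) => [|[[|m ms] l]].
- by apply: eq_sum => l; rewrite (str_termE (fun u => u)).
- by left; exists l.
- by right; rewrite /Tt /tr /= (coord0 fermion) mulr0 mul0r.
Qed.

Lemma npoint_pf z : (forall a, path ltn 0%N (k a)) -> npoint_domain z tau ->
  npoint psi g (fun a => sqfock psi (k a)) z tau =
  if odd (\sum_(a < n) size (k a)) then 0
  else pf (ent theta tau) (lab [seq (z 0 a, k a) | a <- enum 'I_n]) * Zfun psi g tau.
Proof.
move=> k_incr hd; rewrite npoint_T//; set L := [seq (z 0 a, k a) | a <- enum 'I_n].
have -> : slots_of (fun a => sqfock psi (k a)) z = map blk L by rewrite -map_comp.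
have nE : nl L = \sum_(a < n) size (k a) by rewrite /nl big_map big_enum.
rewrite -nE; case: ifP => on; first exact: T_odd.
have e1 : map fst L = [seq z 0 a | a <- enum 'I_n] by rewrite -map_comp.
have pw : pairwise (sep tau) (map fst L) by rewrite e1; apply: domain_sep.
rewrite Zfun_T (T_pf fermion theta_sq tau_gt0 (leqnn _))//.
- by rewrite size_lab on.
- rewrite /pos_blocks /L all_map; apply/allP => a _ /=; apply/allP => i.
  exact: fock_pos.
- exact: dom_sep.
Qed.

End NPoint.

(** * The Pfaffian of a matrix *)

Lemma pfn_map (K : comPzRingType) (A B : Type) (f : A -> B) (e : B -> B -> K) n s :
  pfn e n (map f s) = pfn (fun x y => e (f x) (f y)) n s.
Proof.
elim: n s => [|n IH] [|x s] //=; rewrite size_map; apply: eq_bigr => j _.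
rewrite (nth_map x)//; congr (_ * _).
by rewrite -IH /del map_cat map_take map_drop.
Qed.

Lemma pf_map (K : comPzRingType) (A B : Type) (f : A -> B) (e : B -> B -> K) s :
  pf e (map f s) = pf (fun x y => e (f x) (f y)) s.
Proof. by rewrite /pf pfn_map size_map. Qed.

Lemma del_enum n (j : 'I_n.+1) : del j (enum 'I_n.+1) = map (lift j) (enum 'I_n).
Proof.
apply: (inj_map val_inj); rewrite /del map_cat map_take map_drop val_enum_ord.
rewrite -map_comp (map_comp (bump j) val) val_enum_ord.
rewrite take_iota drop_iota add0n (minn_idPl (ltnW (ltn_ord j))).
have : (j <= n)%N by rewrite -ltnS.
move: (nat_of_ord j) => m mn; rewrite subSS succnK -{2}(subnKC mn) iotaD map_cat; congr (_ ++ _).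
  rewrite -[LHS]map_id; apply/eq_in_map => i; rewrite mem_iota /bump => /andP[_ h].
  by rewrite leqNgt h.
rewrite add0n -[m.+1]addn1 addnC iotaDl; apply/eq_in_map => i.
by rewrite mem_iota /bump => /andP[-> _].
Qed.

Definition pf_perm N (s : 'S_N) := [forall i : 'I_N, forall j : 'I_N,
  ~~ odd i && ((j == i.+1 :> nat) || (j == i.+2 :> nat)) ==> (s i < s j)%N].

(* The condition [pf_perm s] forces [s 0 = 0], so [s] is determined by [s 1] and by the
   relative order of the other values, which is again a permutation satisfying it. *)
Definition pf_lift n (x : 'I_n.+1 * 'S_n) : 'S_n.+2 :=
  lift_perm ord0 ord0 (lift_perm ord0 x.1 x.2).

Lemma lift_perm_surj n (s : 'S_n.+1) : exists s', s = lift_perm ord0 (s ord0) s'.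
Proof.
pose f (k : 'I_n) := odflt k (unlift (s ord0) (s (lift ord0 k))).
have fE k : lift (s ord0) (f k) = s (lift ord0 k).
  rewrite /f; case: unliftP => [j ->//|/perm_inj/eqP].
  by rewrite eq_sym (negbTE (neq_lift _ _)).
have fi : injective f.
  by move=> x y /(congr1 (lift (s ord0))); rewrite !fE => /perm_inj/lift_inj.
exists (perm fi); apply/permP => i; case: (unliftP ord0 i) => [k|] ->.
  by rewrite lift_perm_lift permE fE.
by rewrite lift_perm_id.
Qed.

Lemma pf_lift0 n x : @pf_lift n x ord0 = ord0.
Proof. by rewrite /pf_lift lift_perm_id. Qed.

Lemma pf_lift1 n x : @pf_lift n x (lift ord0 ord0) = lift ord0 x.1.
Proof. by rewrite /pf_lift lift_perm_lift lift_perm_id. Qed.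

Lemma pf_liftS n x i : @pf_lift n x (lift ord0 (lift ord0 i)) = lift ord0 (lift x.1 (x.2 i)).
Proof. by rewrite /pf_lift !lift_perm_lift. Qed.

Lemma pf_lift_inj n : injective (@pf_lift n).
Proof.
move=> [j s] [j' s'] e; have e1 : j = j'.
  by apply: (@lift_inj _ ord0); have := congr1 (fun s : 'S__ => s (lift ord0 ord0)) e; rewrite !pf_lift1.
subst j'; congr (_, _); apply/permP => i; apply: (@lift_inj _ j); apply: (@lift_inj _ ord0).
by have := congr1 (fun s : 'S__ => s (lift ord0 (lift ord0 i))) e; rewrite !pf_liftS.
Qed.

Lemma ltn_lift n (h : 'I_n.+1) (i j : 'I_n) : (lift h i < lift h j)%N = (i < j)%N.
Proof. by rewrite /= /bump; case: leqP; case: leqP; lia. Qed.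

Lemma pf_lift_perm n x : pf_perm (@pf_lift n x) = pf_perm x.2.
Proof.
apply/forallP/forallP => h i; apply/forallP => j; apply/implyP => /andP[oi ij].
  have /forallP/(_ (lift ord0 (lift ord0 j)))/implyP := h (lift ord0 (lift ord0 i)).
  rewrite !pf_liftS !ltn_lift; apply.
  by rewrite !lift0 /= negbK oi !eqSS.
case: (unliftP ord0 i) oi ij => [i' ->|->] oi ij.
  case: (unliftP ord0 i') oi ij => [k ->|->] oi ij; last by rewrite lift0 in oi.
  case: (unliftP ord0 j) ij => [j' ->|-> /orP[]//] ij.
  case: (unliftP ord0 j') ij => [l ->|-> /orP[]//] ij.
  rewrite !pf_liftS !ltn_lift.
  have /forallP/(_ l)/implyP := h k; apply.
  by move: oi ij; rewrite !lift0 /= negbK !eqSS => -> ->.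
rewrite pf_lift0; case: (unliftP ord0 (pf_lift x j)) => [l ->|]//.
rewrite -(pf_lift0 x) => /perm_inj ej; move: ij; rewrite ej.
by case/orP.
Qed.

(** Every position i > 0 has a value above that of position 0: an odd position exceeds its partner i
    - 1, and an even one exceeds the start i - 2 of the previous pair. Hence the value 0 can only
    sit at position 0. *)
Lemma pf_perm0 n (s : 'S_n.+2) : pf_perm s -> s ord0 = ord0.
Proof.
move=> /forallP h; set i0 := (s^-1)%g ord0.
have s0 : s i0 = ord0 by rewrite permKV.
have hlt (i : 'I_n.+2) : (0 < i)%N -> (s ord0 < s i)%N.
  elim/ltn_ind: {i}(val i) {-2}i (erefl (val i)) => m IH i im i0'.
  have [|m1|m2] := ltngtP (val i) 1%N.
  - by rewrite ltnS leqn0 => /eqP e; rewrite e in i0'.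
  - rewrite im in m1; have [p [pm op mp]] : exists p, [/\ (0 < p < m)%N || (p == 0%N), ~~ odd p &
        (m == p.+1) || (m == p.+2)].
      case: m m1 {IH im} => [|[|m]]// _; have [om|om] := boolP (odd m).
        by exists m.+1; rewrite /= om eqxx ltnSn.
      by exists m; rewrite om eqxx orbT; split=> //; lia.
    have pn : (p < n.+2)%N by have := ltn_ord i; rewrite im; case/orP: mp => /eqP ->; lia.
    have h2 : (s (inord p) < s i)%N.
      by have /forallP/(_ i)/implyP := h (inord p); apply; rewrite !inordK// im op.
    case/orP: pm => [/andP[p0 pm]|/eqP e].
      by apply: ltn_trans h2; apply: (IH p); rewrite /= ?inordK.
    by move: h2; rewrite e; have -> : inord 0 = ord0 :> 'I_n.+2 by apply: val_inj; rewrite /= inordK.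
  - have /forallP/(_ i)/implyP := h ord0; apply; by rewrite m2.
have [e|] := eqVneq i0 ord0; first by rewrite -[RHS]s0 e.
by rewrite -val_eqE -lt0n => /hlt; rewrite s0.
Qed.

Lemma pf_lift_surj n (s : 'S_n.+2) : pf_perm s -> exists x, s = pf_lift x.
Proof.
move=> /pf_perm0 s0; have [s1 e] := lift_perm_surj s; rewrite s0 in e.
have [s2 e2] := lift_perm_surj s1.
by exists (s1 ord0, s2); rewrite /pf_lift -e2.
Qed.

(** Reindexing by [pf_lift]: a term consists of the partner j of the first index and a term of the
    smaller Pfaffian, and lifting the permutation multiplies its sign by (-1)^j. *)
Lemma PfaffianSS (K : comPzRingType) n (e : 'I_n.+2 -> 'I_n.+2 -> K) :
  Pfaffian (\matrix_(i, j) e i j) = \sum_(j < n.+1) (-1) ^+ j * e ord0 (lift ord0 j) *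
    Pfaffian (\matrix_(a, b) e (lift ord0 (lift j a)) (lift ord0 (lift j b))).
Proof.
rewrite /Pfaffian; under [RHS]eq_bigr do rewrite big_distrr.
rewrite pair_big_dep /= -/(pf_perm _).
transitivity (\sum_(s in [set pf_lift x | x in [set x : 'I_n.+1 * 'S_n | pf_perm x.2]]%SET)
   (-1) ^+ s * \prod_(i < n.+2) \prod_(j < n.+2 | ~~ odd i && (j == i.+1 :> nat))
      (\matrix_(i, j) e i j) (s i) (s j)).
  apply: eq_bigl => s; rewrite -/(pf_perm s); apply/idP/imsetP => [h|[x]].
    by have [x e0] := pf_lift_surj h; exists x => //; rewrite inE -pf_lift_perm -e0.
  by rewrite inE => h ->; rewrite pf_lift_perm.
rewrite big_imset /=; last by move=> x y _ _; apply: pf_lift_inj.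
under eq_bigl do rewrite inE.
apply: eq_bigr => -[j s] _ /=; rewrite /pf_lift !odd_lift_perm /= -/(pf_lift (j, s)).
rewrite signr_addb signr_odd -!mulrA; congr (_ * _); rewrite mulrCA; congr (_ * _).
rewrite big_ord_recl (big_pred1 (lift ord0 ord0)) => [|i]; last by [].
rewrite mxE pf_lift0 pf_lift1; congr (_ * _).
rewrite big_ord_recl [X in X * _]big_pred0 ?mul1r//.
apply: eq_bigr => a _; rewrite [LHS]big_mkcond [RHS]big_mkcond !big_ord_recl.
rewrite !ifF ?andbF// !Monoid.mul1m; apply: eq_bigr => b _.
by rewrite !mxE !pf_liftS /= negbK !eqSS.
Qed.

Lemma pf_Pfaffian (K : comPzRingType) n (e : 'I_n -> 'I_n -> K) :
  ~~ odd n -> Pfaffian (\matrix_(i, j) e i j) = pf e (enum 'I_n).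
Proof.
elim/ltn_ind: n e => -[|[|n]] IH e // on.
  rewrite (_ : enum 'I_0 = [::]) ?pf_nil; last by apply/nilP; rewrite /nilp size_enum_ord.
  rewrite /Pfaffian (big_pred1 1%g) => [|s]; first by rewrite odd_perm1 mul1r big_ord0.
  rewrite (_ : s = 1%g) ?eqxx; last by apply/permP => -[].
  by rewrite /= eqxx; apply/forallP => -[].
rewrite PfaffianSS enum_ordSl pf_cons size_map size_enum_ord; apply: eq_bigr => j _.
rewrite (nth_map ord0) ?size_enum_ord// nth_ord_enum; congr (_ * _).
have -> : del j [seq lift ord0 i | i <- enum 'I_n.+1] = map (lift ord0) (del j (enum 'I_n.+1)).
  by rewrite /del map_cat map_take map_drop.
rewrite del_enum -map_comp pf_map -IH//; first by rewrite /= negbK in on.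
Qed.

Lemma flatten_iota (p : nat -> nat) n :
  flatten [seq iota (\sum_(i < m) p i)%N (p m) | m <- iota 0 n] = iota 0 (\sum_(i < n) p i)%N.
Proof.
elim: n => [|n IH]; first by rewrite big_ord0.
by rewrite -addn1 iotaD map_cat flatten_cat IH /= cats0 add0n addn1 big_ord_recr iotaD.
Qed.

(** The rank of an index is the size of the preceding blocks plus its place in its own block, and
    such intervals tile the range by [flatten_iota]. *)
Lemma enum_rank_tag n (p : 'I_n -> nat) :
  enum 'I_(\sum_(a < n) p a) =
  flatten [seq [seq @tagnat.Rank n p a i | i <- enum 'I_(p a)] | a <- enum 'I_n].
Proof.
apply: (inj_map val_inj); rewrite val_enum_ord map_flatten -map_comp.
(* [flatten_iota] sums a function on all naturals; [P] extends [p] by 0. *)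
pose P m := if insub m is Some a then p a else 0%N.
have PE (a : 'I_n) : P a = p a by rewrite /P valK.
transitivity (iota 0 (\sum_(a < n) P a)%N); first by congr iota; apply: eq_bigr => a _.
rewrite -flatten_iota -val_enum_ord -map_comp.
congr flatten; apply: eq_map => a /=.
rewrite -map_comp (eq_map (g := addn (\sum_(i < a) P i) \o val)); last first.
  move=> i; apply: etrans (tagnat.RankEsum i) _; congr (_ + _)%N.
  rewrite (big_ord_widen n P (ltnW (ltn_ord a))).
  by apply: eq_bigr => b _; rewrite PE.
by rewrite map_comp val_enum_ord -iotaDl addn0 PE.
Qed.

Lemma enum_labels (A : Type) n (p : 'I_n -> nat) (f : forall a, 'I_(p a) -> A) :
  [seq f (tagnat.sig1 s) (tagnat.sig2 s) | s <- enum 'I_(\sum_(a < n) p a)] =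
  flatten [seq [seq f a i | i <- enum 'I_(p a)] | a <- enum 'I_n].
Proof.
rewrite enum_rank_tag map_flatten -map_comp; congr flatten; apply: eq_map => a /=.
rewrite -map_comp; apply: eq_map => i /=.
pose g (x : {a & 'I_(p a)}) := f (tag x) (tagged x).
by rewrite -[LHS]/(g (tagnat.sig _)) tagnat.rankK.
Qed.

Lemma Pfaffian_labels (K : comPzRingType) (A : eqType) n (k : 'I_n -> seq nat) (z : 'I_n -> A)
    (M : 'M[K]_(\sum_(a < n) size (k a))) (e : A * nat -> A * nat -> K) :
  (forall s t, M s t = e (z (tagnat.sig1 s), nth 0%N (k (tagnat.sig1 s)) (tagnat.sig2 s))
                         (z (tagnat.sig1 t), nth 0%N (k (tagnat.sig1 t)) (tagnat.sig2 t))) ->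
  ~~ odd (\sum_(a < n) size (k a)) ->
  Pfaffian M = pf e (lab [seq (z a, k a) | a <- enum 'I_n]).
Proof.
move=> ME oN; pose f a (i : 'I_(size (k a))) := (z a, nth 0%N (k a) i).
have -> : lab [seq (z a, k a) | a <- enum 'I_n] =
    flatten [seq [seq f a i | i <- enum 'I_(size (k a))] | a <- enum 'I_n].
  rewrite /lab -map_comp; congr flatten; apply: eq_map => a /=.
  rewrite -{1}[k a](mkseq_nth 0%N) /mkseq -val_enum_ord -!map_comp.
  exact: eq_map.
rewrite -enum_labels pf_map -pf_Pfaffian//; congr Pfaffian.
by apply/matrixP => s t; rewrite mxE ME.
Qed.

(** * Power series in one variable *)

Section NatSeries.
Variable R : realType.
Notation C := (R[i]).
Implicit Types (u v : C^nat).

Lemma sum_fset_iota u n : \sum_(i <- [fset j | j in iota 0 n]%fset) u i = \sum_(k < n) u k.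
Proof.
rewrite -(big_mkord xpredT u) /index_iota subn0 big_imfset//=.
apply: perm_big; apply: uniq_perm; rewrite ?iota_uniq ?enum_finmem_uniq ?undup_uniq//.
by move=> j; rewrite mem_undup.
Qed.

Lemma hs_seq u s : hs u s -> forall e : R, 0 < e ->
  exists N, forall n, (N <= n)%N -> nc (\sum_(k < n) u k - s) <= e.
Proof.
move=> hu e /hu[A hA]; exists (\max_(i <- A) i).+1 => n Nn.
rewrite -sum_fset_iota; apply: hA; apply/fsubsetP => i iA.
rewrite inE /= mem_iota add0n; apply: leq_trans Nn; rewrite ltnS.
exact: (@leq_bigmax_seq _ _ _ (fun i => i)).
Qed.

Lemma cvg_hs u s : hs u s -> series u @ \oo --> s.
Proof.
move=> hu; apply/cvgrPdist_le => e e0.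
have e0' : 0 < complex.Re e by move: e0; rewrite ltcE => /andP[].
have [N hN] := hs_seq hu e0'; exists N => // n /= /hN h.
rewrite distrC ncE /series /= big_mkord lecE/= (ger0_Im (ltW e0)) eqxx/=; exact: h.
Qed.

Lemma limn_sum u : summ u -> limn (series u) = sum u.
Proof. by move=> hu; apply/cvg_lim/cvg_hs/summ_sumP => //; apply: norm_hausdorff. Qed.

Lemma cvg_sum u l : summ u -> series u @ \oo --> l -> l = sum u.
Proof.
by move=> hu hl; rewrite -(limn_sum hu); symmetry; apply/cvg_lim => //; apply: norm_hausdorff.
Qed.

Lemma sum_recl u : summ u -> sum u = u 0%N + sum (fun k => u k.+1).
Proof.
move=> hu; pose d k := (k == 0%N)%:R * u k; pose v k := (k != 0%N)%:R * u k.
have hd : summ d by apply: summ_le hu => -[|k]; rewrite /d ?mul1r// mul0r nc0 nc_ge0.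
have hv : summ v by apply: summ_le hu => -[|k]; rewrite /v ?mul1r// mul0r nc0 nc_ge0.
rewrite (eq_sum (v := fun k => d k + v k)) => [|[|k]]; last 2 first.
- by rewrite /d /v mul1r mul0r addr0.
- by rewrite /d /v mul1r mul0r add0r.
rewrite sumD// (sum_single (i0 := 0%N)) => [|[|k]//]; last by rewrite /d mul0r.
rewrite {1}/d mul1r; congr (_ + _); rewrite -(@sum_inj _ _ _ S)//.
- by apply: eq_sum => k; rewrite /v mul1r.
- by move=> ? ? [].
- by case=> [|k]; [right; rewrite /v mul0r|left; exists k].
Qed.

(** The map (i, j) to (i + j, i) turns the double sum into a sum over antidiagonals. *)
Lemma cauchy u v : summ u -> summ v -> sum (fps_mul u v) = sum u * sum v.
Proof.
move=> hu hv; have h := summ_prod hu hv.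
pose f (x : nat * nat) := ((x.1 + x.2)%N, x.1).
pose w (y : nat * nat) := if (y.2 <= y.1)%N then u y.2 * v (y.1 - y.2)%N else 0.
have fi : injective f by move=> [a b] [c d] [+ ac]; rewrite ac => /addnI ->.
have fw x : w (f x) = u x.1 * v x.2 by rewrite /w /f /= leq_addr addKn.
have fs y : (exists x, f x = y) \/ w y = 0.
  case: y => k i; rewrite /w /=; case: leqP => ik; [left|by right].
  by exists (i, k - i)%N; rewrite /f /= subnKC.
have hw : summ w by apply: summ_injV fi fs _; apply: summ_eq h.
rewrite -sum_prod// -(eq_sum fw) (sum_inj fi fs hw) (sum_fubini hw).
apply: eq_sum => k; rewrite (hs_sum (@hs_finsupp _ _ (fun j => w (k, j)) [fset j | j in iota 0 k.+1]%fset _)).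
  rewrite sum_fset_iota; apply: eq_bigr => i _; rewrite /w /= ifT// -ltnS; exact: ltn_ord.
move=> j; rewrite /w /=; case: leqP => // jk; rewrite !inE /=.
by case: j jk => [|j] jk; rewrite ?mem_iota ?add1n ?ltnS ?jk.
Qed.

Lemma es_expR (x : R) : 0 <= x -> (es (fun k => (x ^+ k / k`!%:R)%:E) <= (expR x)%:E)%E.
Proof.
move=> x0; apply: es_nat_ub => [k|n]; first by rewrite lee_fin divr_ge0 ?exprn_ge0.
rewrite sumEFin lee_fin.
have := @nondecreasing_cvgn_le _ (series (exp_coeff x)) _ (is_cvg_series_exp_coeff x) n.
rewrite /series /= big_mkord; apply; apply/nondecreasing_seqP => k /=.
by rewrite !big_mkord big_ord_recr /= lerDl exp_coeff_ge0.
Qed.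

Lemma summ_exp (w : C) : summ (fun k => w ^+ k / k`!%:R).
Proof.
apply: (@le_lt_trans _ _ (expR (nc w))%:E); last exact: ltry.
apply: le_trans (es_expR (nc_ge0 w)); apply: le_es => k.
by rewrite ncM ncV ncX nc_nat.
Qed.

(** [cexp] is built from real functions: the series at real and at imaginary arguments come from
    those of [expR], [cos] and [sin], and the Cauchy product joins them. *)
Lemma sum_cexp (w : C) : sum (fun k => w ^+ k / k`!%:R) = cexp w.
Proof.
have hR (x : R) : sum (fun k => x%:C ^+ k / k`!%:R) = (expR x)%:C.
  symmetry; apply: cvg_sum; first exact: summ_exp.
  have h : series (exp_coeff x) @ \oo --> expR x by exact: is_cvg_series_exp_coeff.
  apply/cvgrPdist_le => e e0.
  have e0' : 0 < complex.Re e by move: e0; rewrite ltcE => /andP[].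
  move/cvgrPdist_le: h => /(_ _ e0')[N _ hN]; exists N => // n /= /hN.
  rewrite (_ : series _ n = (series (exp_coeff x) n)%:C) => [h|].
    rewrite -rmorphB ncE nc_real lecE/= (ger0_Im (ltW e0)) eqxx/=; exact: h.
  rewrite /series /= rmorph_sum; apply: eq_bigr => k _.
  by rewrite /exp_coeff fmorph_div rmorphXn rmorph_nat.
have hI (y : R) : sum (fun k => (0 +i* y) ^+ k / k`!%:R) = cos y +i* sin y.
  set s := sum _; have hs := summ_sumP (summ_exp (0 +i* y)); rewrite -/s in hs.
  have term k : (0 +i* y) ^+ k / k`!%:R = cos_coeff y k +i* sin_coeff y k.
    have -> : 0 +i* y = (0 +i* 1) * y%:C.
      by apply/eqP; rewrite eq_complex /=; apply/andP; split; apply/eqP; ring.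
    rewrite exprMn -{1}(odd_double_half k) exprD -mul2n exprM.
    have -> : (0 +i* 1) ^+ 2 = -1 :> C.
      by apply/eqP; rewrite eq_complex /=; apply/andP; split; apply/eqP; ring.
    rewrite /cos_coeff /sin_coeff.
    have -> : (k`!%:R : C) = (k`!%:R)%:C by rewrite rmorph_nat.
    have -> : (-1 : C) = (-1)%:C by rewrite rmorphN1.
    rewrite -!rmorphXn -fmorphV.
    rewrite /=; have [ok|/negbTE ok] := boolP (odd k); rewrite ?ok /=; apply/eqP; rewrite eq_complex /=;
      rewrite -!(exprnP, mulrA); apply/andP; split; apply/eqP; try ring.
    have -> : k.-1./2 = k./2 by rewrite -{1}(odd_double_half k) ok add1n /= doubleK.
    by ring.
  have hre : series (cos_coeff y) @ \oo --> complex.Re s.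
    apply/cvgrPdist_le => e e0; have [N hN] := hs_seq hs e0; exists N => // n /= /hN h.
    apply: le_trans h; rewrite distrC; apply: le_trans (nc_Re_le _).
    rewrite raddfB raddf_sum /series /= big_mkord.
    by under [X in _ <= `|X - _|]eq_bigr do rewrite term /=.
  have him : series (sin_coeff y) @ \oo --> complex.Im s.
    apply/cvgrPdist_le => e e0; have [N hN] := hs_seq hs e0; exists N => // n /= /hN h.
    apply: le_trans h; rewrite distrC; apply: le_trans (nc_Im_le _).
    rewrite raddfB raddf_sum /series /= big_mkord.
    by under [X in _ <= `|X - _|]eq_bigr do rewrite term /=.
  have ec : cos y = complex.Re s by rewrite unlock; apply/cvg_lim.
  have es : sin y = complex.Im s by rewrite unlock; apply/cvg_lim.
  by rewrite ec es; case: (s).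
case: w => x y; have e : x +i* y = x%:C + (0 +i* y).
  by apply/eqP; rewrite eq_complex /= addr0 add0r !eqxx.
rewrite e /cexp raddfD raddfD /= addr0 add0r -hR -hI.
rewrite -cauchy; [|exact: summ_exp..].
by apply: eq_sum => k; rewrite -[LHS]/(expE _ k) -expE_mul.
Qed.

End NatSeries.

(** * Analytic germs *)

Section Germs.
Variable R : realType.
Notation C := (R[i]).
Implicit Types (a b : C^nat) (f g : C -> C) (z w : C).

(** Positive radius of convergence in the form of a geometric bound on the coefficients, which
    passes directly to products and inverses. *)
Definition pcv a := exists K A : R, [/\ 0 < K, 0 < A & forall k, nc (a k) <= K * A ^+ k].
Definition pser a w : C := sum (fun k => a k * w ^+ k).

Definition nearC z (P : C -> Prop) := exists2 r : R, 0 < r & forall w, nc (w - z) < r -> P w.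

Lemma nearC_and z P Q : nearC z P -> nearC z Q -> nearC z (fun w => P w /\ Q w).
Proof.
move=> [r r0 hr] [s s0 hs]; exists (Num.min r s); first by rewrite lt_min r0.
by move=> w; rewrite lt_min => /andP[/hr ? /hs].
Qed.

Lemma nearC_imp z (P Q : C -> Prop) : (forall w, P w -> Q w) -> nearC z P -> nearC z Q.
Proof. by move=> h [r r0 hr]; exists r => // w /hr/h. Qed.

Lemma nearC2 z (P Q S : C -> Prop) : (forall w, P w -> Q w -> S w) -> nearC z P -> nearC z Q -> nearC z S.
Proof. by move=> h hp hq; apply: nearC_imp (nearC_and hp hq) => w []; apply: h. Qed.

Lemma nbhs_nearC z (P : C -> Prop) : (\forall w \near z, P w) <-> nearC z P.
Proof.
split=> [/nbhs_ballP[e /= e0 he]|[r r0 hr]].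
  exists (complex.Re e); first by move: e0; rewrite ltcE => /andP[].
  move=> w hw; apply: he; rewrite -ball_normE /= distrC ncE.
  by rewrite ltcE /= (ger0_Im (ltW e0)) eqxx.
apply/nbhs_ballP; exists r%:C; first by rewrite /= ltcR.
by move=> w; rewrite -ball_normE /= distrC ncE ltcR => /hr.
Qed.

Lemma nearC_shift z w (P : C -> Prop) : nearC (z + w) P -> nearC z (fun x => P (x + w)).
Proof. by move=> [r r0 h]; exists r => // x hx; apply: h; rewrite opprD addrACA subrr addr0. Qed.

Lemma es_geo (K q : R) : 0 <= K -> 0 <= q < 1 -> (es (fun k => (K * q ^+ k)%:E) < +oo)%E.
Proof.
move=> K0 q01; have /andP[q0 _] := q01; apply: (@es_ratio _ _ q 0%N) => // [i|i _].
  by rewrite mulr_ge0 ?exprn_ge0.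
by rewrite exprS mulrCA.
Qed.

Lemma pcv_near a : pcv a -> nearC 0 (fun w => summ (fun k => a k * w ^+ k)).
Proof.
move=> [K [A [K0 A0 h]]]; exists A^-1; first by rewrite invr_gt0.
move=> w; rewrite subr0 => hw.
have Aw : 0 <= A * nc w < 1.
  by rewrite mulr_ge0 ?(ltW A0) ?nc_ge0//= mulrC -ltr_pdivlMr// div1r.
apply: le_lt_trans (es_geo (ltW K0) Aw); apply: le_es => k.
by rewrite lee_fin ncM ncX exprMn mulrA ler_wpM2r ?exprn_ge0 ?nc_ge0.
Qed.

Lemma pcv_max a b : pcv a -> pcv b -> exists K A : R, [/\ 0 < K, 0 < A,
  forall k, nc (a k) <= K * A ^+ k & forall k, nc (b k) <= K * A ^+ k].
Proof.
move=> [K [A [K0 A0 h]]] [K' [A' [K0' A0' h']]]; exists (K + K'), (A + A').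
split; rewrite ?addr_gt0// => k.
- apply: le_trans (h k) _; rewrite ler_pM ?exprn_ge0 ?(ltW K0) ?(ltW A0)//; first by rewrite lerDl ltW.
  by rewrite lerXn2r ?nnegrE ?addr_ge0 ?(ltW A0) ?(ltW A0')// lerDl ltW.
- apply: le_trans (h' k) _; rewrite ler_pM ?exprn_ge0 ?(ltW K0') ?(ltW A0')//; first by rewrite lerDr ltW.
  by rewrite lerXn2r ?nnegrE ?addr_ge0 ?(ltW A0) ?(ltW A0')// lerDr ltW.
Qed.

Lemma pcvD a b : pcv a -> pcv b -> pcv (fun k => a k + b k).
Proof.
move=> ha hb; have [K [A [K0 A0 h h']]] := pcv_max ha hb.
exists (K + K), A; split; rewrite ?addr_gt0// => k.
by rewrite mulrDl (le_trans (le_ncD _ _))// lerD.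
Qed.

Lemma pcvM a b : pcv a -> pcv b -> pcv (fps_mul a b).
Proof.
move=> ha hb; have [K [A [K0 A0 h h']]] := pcv_max ha hb.
exists (K * K), (2 * A); split; rewrite ?mulr_gt0// => k.
rewrite /fps_mul; apply: le_trans (le_nc_sum _ _) _.
apply: (@le_trans _ _ (\sum_(i < k.+1) K * K * A ^+ k)).
  apply: ler_sum => i _; rewrite ncM.
  have -> : K * K * A ^+ k = (K * A ^+ i) * (K * A ^+ (k - i)).
    by rewrite mulrACA -exprD subnKC// -ltnS.
  by rewrite ler_pM ?nc_ge0.
rewrite sumr_const card_ord -[leLHS]mulr_natr exprMn -!mulrA !ler_wpM2l ?(ltW K0)//.
rewrite mulrC ler_wpM2r ?exprn_ge0 ?(ltW A0)// -natrX ler_nat.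
exact: ltn_expl.
Qed.

Lemma pcv_drop a N : pcv a -> pcv (fun k => a (k + N)%N).
Proof.
move=> [K [A [K0 A0 h]]]; exists (K * A ^+ N), A; split; rewrite ?mulr_gt0 ?exprn_gt0// => k.
by apply: le_trans (h _) _; rewrite exprD mulrAC mulrA.
Qed.

Definition monic_at N (c : C) : C^nat := fun k => (k == N)%:R * c.

Lemma pcv_monic N c : pcv (monic_at N c).
Proof.
exists (nc c + 1), 1; split; rewrite ?ltr_wpDl ?nc_ge0// => k.
rewrite expr1n mulr1 /monic_at ncM; have := nc_ge0 c.
by case: eqP => _; rewrite ?nc0 ?nc1; lra.
Qed.

Lemma pser_monic N c w : pser (monic_at N c) w = c * w ^+ N.
Proof.
rewrite /pser (sum_single (i0 := N)) => [|k /negbTE kN]; last by rewrite /monic_at kN !mul0r.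
by rewrite /monic_at eqxx mul1r.
Qed.

Lemma pserM a b w : summ (fun k => a k * w ^+ k) -> summ (fun k => b k * w ^+ k) ->
  pser (fps_mul a b) w = pser a w * pser b w.
Proof.
move=> ha hb; rewrite /pser -cauchy//; apply: eq_sum => k.
rewrite /fps_mul big_distrl; apply: eq_bigr => i _ /=.
by rewrite mulrACA -exprD subnKC// -ltnS.
Qed.

Lemma pserD a b w : summ (fun k => a k * w ^+ k) -> summ (fun k => b k * w ^+ k) ->
  pser (fun k => a k + b k) w = pser a w + pser b w.
Proof. by move=> ha hb; rewrite /pser -sumD//; apply: eq_sum => k; rewrite mulrDl. Qed.

Lemma pser0 a : pser a 0 = a 0%N.
Proof.
rewrite /pser (sum_single (i0 := 0%N)) ?mulr1// => k k0.
by rewrite expr0n (negbTE k0) mulr0.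
Qed.

Lemma pser_recl a w : summ (fun k => a k * w ^+ k) -> summ (fun k => a (k + 1)%N * w ^+ k) ->
  pser a w = a 0%N + w * pser (fun k => a (k + 1)%N) w.
Proof.
move=> h h'; rewrite /pser sum_recl// mulr1 -sumZ//; congr (_ + _).
by apply: eq_sum => k; rewrite exprS addn1 mulrCA.
Qed.

Lemma pser_bound a : pcv a -> exists2 K : R, 0 < K & nearC 0 (fun w => nc (pser a w) <= K).
Proof.
move=> [K [A [K0 A0 h]]]; pose r := (2 * A)^-1.
have r0 : 0 < r by rewrite invr_gt0 mulr_gt0.
have h1 : (es (fun k => (K * 2^-1 ^+ k)%:E) < +oo)%E by apply: es_geo; [exact: ltW|lra].
have h0 : (0 <= es (fun k => (K * 2^-1 ^+ k)%:E))%E.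
  by apply: es_ge0 => k; rewrite lee_fin mulr_ge0 ?exprn_ge0 ?(ltW K0).
exists (fine (es (fun k => (K * 2^-1 ^+ k)%:E)) + 1); first by rewrite ltr_wpDl ?fine_ge0.
exists r => // w; rewrite subr0 => wr.
have le k : nc (a k * w ^+ k) <= K * 2^-1 ^+ k.
  have -> : K * 2^-1 ^+ k = (K * A ^+ k) * r ^+ k.
    by rewrite -mulrA -exprMn /r invfM mulrCA divff ?mulr1// gt_eqF.
  by rewrite ncM ncX ler_pM ?exprn_ge0 ?nc_ge0// lerXn2r ?nnegrE ?nc_ge0 ?(ltW r0) ?(ltW wr).
have sm : summ (fun k => a k * w ^+ k).
  by apply: le_lt_trans h1; apply: le_es => k; rewrite lee_fin.
apply: ler_wpDr => //; rewrite -lee_fin fineK; last by rewrite ge0_fin_numE.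
by apply: le_trans (sum_norm sm) _; apply: le_es => k; rewrite lee_fin.
Qed.

Lemma pser_cont a : pcv a -> forall e : R, 0 < e -> nearC 0 (fun w => nc (pser a w - a 0%N) <= e).
Proof.
move=> ha e e0; have hd := pcv_drop 1 ha; have [K K0 hK] := pser_bound hd.
have hw : nearC 0 (fun w => nc w <= e / K).
  by exists (e / K); rewrite ?divr_gt0// => w; rewrite subr0 => /ltW.
apply: nearC2 (nearC_and hK hw) (nearC_and (pcv_near ha) (pcv_near hd)) => w [bK we] [h1 h2].
rewrite pser_recl// addrC addKr ncM; apply: le_trans (_ : e / K * K <= _).
  by rewrite ler_pM ?nc_ge0.
by rewrite divfK ?gt_eqF.
Qed.

Lemma pser_head0 a : pcv a ->
  (forall r : R, 0 < r -> exists w, [/\ w != 0, nc w < r & pser a w = 0]) -> a 0%N = 0.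
Proof.
move=> ha h; apply/eqP; rewrite -nc_eq0 eq_le nc_ge0 andbT; apply/ler_addgt0Pr => e e0.
have [r r0 hr] := pser_cont ha e0; have [w [_ wr w0]] := h r r0.
by have := hr w; rewrite subr0 w0 sub0r ncN add0r; apply.
Qed.

(** Zeros accumulating at 0 make the constant term vanish by continuity; after division by w the
    same zeros serve for the next coefficient. *)
Lemma pser_zero a : pcv a ->
  (forall r : R, 0 < r -> exists w, [/\ w != 0, nc w < r & pser a w = 0]) -> forall k, a k = 0.
Proof.
move=> + + k; elim: k a => [|k IH] a ha h; first exact: pser_head0.
have a0 := pser_head0 ha h; have hd := pcv_drop 1 ha.
rewrite -addn1; apply: (IH (fun k => a (k + 1)%N)) => // r r0.
have [s s0 hs] := nearC_and (pcv_near ha) (pcv_near hd).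
have [w [w0 wr pw]] := h (Num.min r s) (ltac:(by rewrite lt_min r0)).
move: wr; rewrite lt_min => /andP[wr ws]; exists w; split=> //.
have := hs w; rewrite subr0 => /(_ ws)[h1 h2].
by move: pw; rewrite pser_recl// a0 add0r => /eqP; rewrite mulf_eq0 (negbTE w0) => /eqP.
Qed.

(* The coefficients of the inverse series, last one first. *)
Fixpoint invs a n : seq C := match n with
  | 0%N => [:: (a 0%N)^-1]
  | n'.+1 => - (a 0%N)^-1 * (\sum_(i < n'.+1) a i.+1 * nth 0 (invs a n') i) :: invs a n'
  end.
Definition pinv a : C^nat := fun n => head 0 (invs a n).

Lemma nth_invs a n i : (i <= n)%N -> nth 0 (invs a n) i = pinv a (n - i)%N.
Proof.
elim: n i => [|n IH] [|i] //=; rewrite ltnS => h; by rewrite IH// subSS.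
Qed.

Lemma pinvS a n : pinv a n.+1 = - (a 0%N)^-1 * \sum_(i < n.+1) a i.+1 * pinv a (n - i)%N.
Proof.
rewrite {1}/pinv /=; congr (_ * _); apply: eq_bigr => i _; rewrite nth_invs// -ltnS; exact: ltn_ord.
Qed.

Lemma fps_pinv a : a 0%N != 0 -> fps_mul a (pinv a) =1 fps1 R.
Proof.
move=> a0 [|k]; rewrite /fps_mul /fps1.
  by rewrite big_ord1 subn0 /pinv /= divff.
rewrite big_ord_recl subn0 pinvS /= mulNr mulrN mulrA divff// mul1r addrC.
by apply/eqP; rewrite subr_eq0; apply/eqP/eq_bigr => i _; rewrite /= /bump /= add1n subSS.
Qed.

Lemma pcv_pinv a : a 0%N != 0 -> pcv a -> pcv (pinv a).
Proof.
move=> a0 [K [A [K0 A0 h]]].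
have n0 : 0 < nc (a 0%N) by rewrite nc_gt0.
(* [D] majorises the convolution in the recursion for the inverse series b and satisfies D(k+1) = A
   |b_(k+1)| + A D(k) <= B D(k), which dictates [B]. *)
pose B := A * (K / nc (a 0%N) + 1).
pose D k := \sum_(i < k.+1) A ^+ i.+1 * nc (pinv a (k - i)%N).
have D0 k : 0 <= D k by apply: sumr_ge0 => i _; rewrite mulr_ge0 ?exprn_ge0 ?nc_ge0 ?(ltW A0).
have pD k : nc (pinv a k.+1) <= K / nc (a 0%N) * D k.
  rewrite pinvS ncM ncN ncV [leRHS](_ : _ = (nc (a 0%N))^-1 * (K * D k)); last by ring.
  rewrite ler_wpM2l ?invr_ge0 ?nc_ge0//.
  apply: le_trans (le_nc_sum _ _) _; rewrite mulr_sumr; apply: ler_sum => i _.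
  by rewrite ncM mulrA ler_wpM2r ?nc_ge0.
have DS k : D k.+1 = A * nc (pinv a k.+1) + A * D k.
  rewrite {1}/D big_ord_recl subn0 expr1; congr (_ + _); rewrite mulr_sumr.
  by apply: eq_bigr => i _; rewrite /= /bump /= add1n subSS exprS mulrA.
have DB k : D k <= D 0%N * B ^+ k.
  elim: k => [|k IH]; first by rewrite mulr1.
  rewrite DS exprSr mulrA; apply: le_trans (_ : D k * B <= _); last first.
    by rewrite ler_wpM2r// /B mulr_ge0 ?addr_ge0 ?divr_ge0 ?nc_ge0 ?(ltW A0) ?(ltW K0).
  rewrite /B mulrCA -mulrDr ler_wpM2l ?(ltW A0)// mulrDr mulr1 lerD2r mulrC; exact: pD.
exists (D 0%N / A + 1), B; split.
- by rewrite ltr_wpDl// divr_ge0 ?(ltW A0).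
- by rewrite /B mulr_gt0// ltr_wpDl// divr_ge0 ?nc_ge0 ?(ltW K0).
move=> k; have B0 : 0 <= B ^+ k.
  by rewrite exprn_ge0// /B mulr_ge0 ?addr_ge0 ?divr_ge0 ?nc_ge0 ?(ltW A0) ?(ltW K0).
rewrite mulrDl mul1r ler_wpDr// mulrAC ler_pdivlMr//.
apply: le_trans (DB k); rewrite /D big_ord_recl expr1 subn0 mulrC lerDl.
by apply: sumr_ge0 => i _; rewrite mulr_ge0 ?exprn_ge0 ?nc_ge0 ?(ltW A0).
Qed.

Definition ana f z a := pcv a /\ nearC z (fun w => f w = pser a (w - z)).

Lemma near_pcv z a : pcv a -> nearC z (fun w => summ (fun k => a k * (w - z) ^+ k)).
Proof.
by move=> /pcv_near[r r0 h]; exists r => // w hw; apply: h; rewrite subr0.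
Qed.

Lemma ana_val f z a : ana f z a -> f z = a 0%N.
Proof. by move=> [_ [r r0 h]]; rewrite h subrr ?nc0// pser0. Qed.

Lemma anaD f g z a b : ana f z a -> ana g z b -> ana (fun w => f w + g w) z (fun k => a k + b k).
Proof.
move=> [ha hf] [hb hg]; split; first exact: pcvD.
apply: nearC2 (nearC_and hf hg) (nearC_and (near_pcv z ha) (near_pcv z hb)) => w [-> ->] [h1 h2].
by rewrite pserD.
Qed.

Lemma anaM f g z a b : ana f z a -> ana g z b -> ana (fun w => f w * g w) z (fps_mul a b).
Proof.
move=> [ha hf] [hb hg]; split; first exact: pcvM.
apply: nearC2 (nearC_and hf hg) (nearC_and (near_pcv z ha) (near_pcv z hb)) => w [-> ->] [h1 h2].
by rewrite pserM.
Qed.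

Lemma ana_monic z N c : ana (fun w => c * (w - z) ^+ N) z (monic_at N c).
Proof. by split; [exact: pcv_monic|exists 1 => // w _; rewrite pser_monic]. Qed.

Lemma ana_cst z c : ana (fun=> c) z (monic_at 0 c).
Proof. by split; [exact: pcv_monic|exists 1 => // w _; rewrite pser_monic mulr1]. Qed.

Lemma anaV f z a : ana f z a -> f z != 0 -> ana (fun w => (f w)^-1) z (pinv a).
Proof.
move=> hf; rewrite (ana_val hf) => a0; case: hf => ha hf; have hp := pcv_pinv a0 ha.
split=> //; apply: nearC2 hf (nearC_and (near_pcv z ha) (near_pcv z hp)) => w -> [h1 h2].
have e : pser a (w - z) * pser (pinv a) (w - z) = 1.
  rewrite -pserM// /pser (eq_sum (v := fun k => fps1 R k * (w - z) ^+ k)) => [|k]; last by rewrite fps_pinv.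
  rewrite (sum_single (i0 := 0%N)) => [|k /negbTE k0]; last by rewrite /fps1 k0 mul0r.
  by rewrite /fps1 mul1r.
by rewrite -[RHS]mul1r -[in RHS](mulVf (x := pser a (w - z))) -?mulrA ?e ?mulr1//;
  apply: contra_eq_neq e => ->; rewrite mul0r eq_sym oner_neq0.
Qed.

Lemma ana_eq f g z a : nearC z (fun w => f w = g w) -> ana f z a -> ana g z a.
Proof. by move=> h [ha hf]; split=> //; apply: nearC2 h hf => w ->. Qed.

(** Each exponential is expanded at z and the two sums are exchanged; the factor exp(d |s|) in the
    hypothesis is the absolute sum of the expansions at distance d. *)
Lemma ana_sum (I : choiceType) (c : I -> C) (s : I -> R) z (d : R) : 0 < d ->
  summ (fun i => c i * cexp ((s i)%:C * z) * (expR (d * `|s i|))%:C) ->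
  ana (fun w => sum (fun i => c i * cexp ((s i)%:C * w))) z
      (fun k => sum (fun i => c i * cexp ((s i)%:C * z) * ((s i)%:C ^+ k / k`!%:R))).
Proof.
move=> d0; have [c' c'E] : exists c', c' = fun i => c i * cexp ((s i)%:C * z) by eexists.
move=> h0; have hc : summ (fun i => c' i * (expR (d * `|s i|))%:C) by rewrite c'E.
suff : ana (fun w => sum (fun i => c i * cexp ((s i)%:C * w))) z
    (fun k => sum (fun i => c' i * ((s i)%:C ^+ k / k`!%:R))) by rewrite c'E.
have c0 : summ c'.
  apply: summ_le hc => i; rewrite ncM nc_real ger0_norm ?expR_ge0// ler_peMr ?nc_ge0//.
  by rewrite -expR0 ler_expR mulr_ge0 ?(ltW d0).
pose P := fine (asum (fun i => c' i * (expR (d * `|s i|))%:C)).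
have P0 : 0 <= P by rewrite fine_ge0 ?asum_ge0.
have term (k : nat) (x : R) : 0 <= x -> x ^+ k / k`!%:R <= expR x.
  move=> x0; rewrite -lee_fin; apply: le_trans (es_expR x0).
  exact: (es_term (fun k => (x ^+ k / k`!%:R)%:E)).
have le k i : nc (c' i * ((s i)%:C ^+ k / k`!%:R)) <= nc ((d^-1 ^+ k)%:C * (c' i * (expR (d * `|s i|))%:C)).
    rewrite !ncM !nc_real ncV ncX nc_real nc_nat (ger0_norm (expR_ge0 _)).
    rewrite (ger0_norm (_ : 0 <= d^-1 ^+ k)) ?exprn_ge0 ?invr_ge0 ?(ltW d0)// [leRHS]mulrCA ler_wpM2l ?nc_ge0//.
    have := term k (d * `|s i|); rewrite mulr_ge0 ?(ltW d0)// => /(_ isT).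
    move=> /(ler_wpM2l (_ : 0 <= d^-1 ^+ k)); rewrite exprn_ge0 ?invr_ge0 ?(ltW d0)// => /(_ isT).
    by apply: le_trans; rewrite mulrA -exprMn mulrA mulVf ?mul1r// gt_eqF.
have hk k : summ (fun i => c' i * ((s i)%:C ^+ k / k`!%:R)).
    by apply: summ_le (summZ (d^-1 ^+ k)%:C hc) => i; apply: le.
split.
  exists (P + 1), d^-1; split; rewrite ?ltr_wpDl ?invr_gt0// => k.
  rewrite mulrDl mul1r ler_wpDr ?exprn_ge0 ?invr_ge0 ?(ltW d0)// -lee_fin.
  apply: le_trans (sum_norm (hk k)) _; rewrite mulrC EFinM fineK ?summ_fin//.
  have -> : d^-1 ^+ k = nc (d^-1 ^+ k)%:C :> R.
    by rewrite nc_real ger0_norm// exprn_ge0 ?invr_ge0 ?(ltW d0).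
  by rewrite -asumZ; apply: le_es => i; rewrite lee_fin.
exists d => // w wd.
have h : summ (fun x : I * nat => c' x.1 * ((s x.1)%:C ^+ x.2 / x.2`!%:R) * (w - z) ^+ x.2).
  rewrite /summ asum_pair; apply: le_lt_trans hc; apply: le_es => i.
  rewrite (_ : asum _ = (nc (c' i))%:E * asum (fun k => (((s i)%:C * (w - z)) ^+ k / k`!%:R)%R))%E; last first.
    by rewrite -asumZ; apply: eq_es => k; rewrite /= exprMn; congr (nc _)%:E; rewrite -mulrA mulrAC.
  rewrite ncM EFinM lee_wpmul2l ?lee_fin ?nc_ge0//.
  rewrite nc_real ger0_norm ?expR_ge0//.
  apply: le_trans (_ : (expR (`|s i| * nc (w - z)))%:E <= _)%E.
    apply: le_trans (es_expR _); last by rewrite mulr_ge0 ?nc_ge0.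
    by apply: le_es => k; rewrite lee_fin ncM ncV ncX ncM nc_real nc_nat.
  by rewrite lee_fin ler_expR mulrC ler_wpM2r// ltW.
rewrite /pser [RHS](eq_sum (v := fun k => sum (fun i => c' i * ((s i)%:C ^+ k / k`!%:R) * (w - z) ^+ k))) => [|k].
  rewrite -(sum_exch h); apply: eq_sum => i.
  have -> : c i * cexp ((s i)%:C * w) = c' i * cexp ((s i)%:C * (w - z)).
    by rewrite c'E -mulrA -cexpD -mulrDr [z + _]addrC subrK.
  rewrite -sum_cexp -sumZ; last exact: summ_exp.
  by apply: eq_sum => k; rewrite exprMn -!mulrA; congr (_ * (_ * _)); rewrite mulrC.
rewrite mulrC -sumZ; first by apply: eq_sum => i; rewrite mulrC.
exact: hk.
Qed.

End Germs.

(** * Meromorphic functions *)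

Section Meromorphic.
Variable R : realType.
Notation C := (R[i]).
Implicit Types (a b : C^nat) (f g : C -> C) (z w : C).

(** [meromorphic_at] with the limits of series replaced by absolutely convergent sums and explicit
    discs; the two are equivalent by [mform_mero] and [mero_mform]. *)
Definition mform f z := exists N a, [/\ pcv a, if N == 0%N then f z = a 0%N else a 0%N != 0 &
  nearC z (fun w => w != z -> pser a (w - z) = (w - z) ^+ N * f w)].

Lemma mform_mero f z : mform f z -> meromorphic_at f z.
Proof.
move=> [N [a [ha h0 h]]]; exists N, a; split=> //.
apply/(nbhs_nearC z (fun w => w != z -> series (fun k => a k * (w - z) ^+ k) @ \oo --> (w - z) ^+ N * f w)).
by apply: nearC2 h (near_pcv z ha) => w e s wz; rewrite -e//; apply/cvg_hs/summ_sumP.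
Qed.

(** Abel's argument: the terms of a series convergent at one nonzero point tend to 0, hence are
    bounded there, here by [M]. *)
Lemma cvg_pcv a w : w != 0 -> cvgn (series (fun k => a k * w ^+ k)) -> pcv a.
Proof.
move=> w0 /cvg_series_cvg_0/cvgrPdist_le/(_ _ ltr01)[N _ hN].
pose M := 1 + \sum_(k < N) nc (a k * w ^+ k).
have S0 : 0 <= \sum_(k < N) nc (a k * w ^+ k) by apply: sumr_ge0 => k _; apply: nc_ge0.
have wgt : 0 < nc w by rewrite nc_gt0.
exists M, (nc w)^-1; split; rewrite ?invr_gt0//; first by rewrite /M ltr_wpDr.
move=> k; rewrite exprVn ler_pdivlMr ?exprn_gt0// -ncX -ncM /M.
have [kN|Nk] := ltnP k N.
  rewrite (bigD1 (Ordinal kN))//= addrCA lerDl addr_ge0//.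
  by apply: sumr_ge0 => i _; apply: nc_ge0.
have := hN k Nk; rewrite /= sub0r normrN ncE -[1]/(1%:C) lecR => /le_trans; apply.
by rewrite lerDl.
Qed.

Lemma mero_mform f z : meromorphic_at f z -> mform f z.
Proof.
move=> [N [a [h0 h]]]; exists N, a.
have [r r0 hr] : nearC z (fun w => w != z ->
    series (fun k => a k * (w - z) ^+ k) @ \oo --> (w - z) ^+ N * f w).
  exact/nbhs_nearC.
have ha : pcv a.
  pose w := z + (r / 2)%:C; have wz : w - z = (r / 2)%:C by rewrite /w addrC addKr.
  have r2 : 0 < r / 2 by rewrite divr_gt0.
  have w0 : w - z != 0 by rewrite wz -nc_gt0 nc_real gtr0_norm.
  apply: (@cvg_pcv _ (w - z)) => //; apply/cvg_ex; exists ((w - z) ^+ N * f w).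
  by apply: hr; [rewrite wz nc_real gtr0_norm//; lra|rewrite -subr_eq0].
split=> //; have hr' : nearC z (fun w => w != z ->
    series (fun k => a k * (w - z) ^+ k) @ \oo --> (w - z) ^+ N * f w) by exists r.
by apply: nearC2 hr' (near_pcv z ha) => w c s wz; rewrite (cvg_sum s (c wz)).
Qed.

Lemma ana_mform f z a : ana f z a -> mform f z.
Proof.
move=> ha; exists 0%N, a; split; [by case: ha|exact: ana_val|].
by case: ha => _; apply: nearC_imp => w -> _; rewrite mul1r.
Qed.

Definition eqC f g z := nearC z (fun w => w != z -> f w = g w).

Lemma ana_pser z a : pcv a -> ana (fun w => pser a (w - z)) z a.
Proof. by move=> ha; split=> //; exists 1. Qed.

(** Multiplied by (w - z)^(N + N'), the difference becomes a power series whose zeros accumulate at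
    its centre, hence it is zero. *)
Lemma mform_eqC f g z : mform f z -> mform g z ->
  (forall r : R, 0 < r -> exists w, [/\ w != z, nc (w - z) < r & f w = g w]) -> eqC f g z.
Proof.
move=> [N [a [ha _ hf]]] [N' [b [hb _ hg]]] h.
have := anaD (anaM (ana_monic z N' 1) (ana_pser z ha)) (anaM (ana_monic z N (-1)) (ana_pser z hb)).
set c := (fun k : nat => _ + _) => -[hc ec].
have ed : nearC z (fun w => w != z -> pser c (w - z) = (w - z) ^+ (N + N') * (f w - g w)).
  apply: nearC2 ec (nearC_and hf hg) => w <- [ef eg] wz; rewrite ef// eg// exprD; by ring.
have c0 : forall k, c k = 0.
  apply: pser_zero hc _ => r r0; have [s s0 hs] := ed.
  have [w [wz wr e]] := h (Num.min r s) (ltac:(by rewrite lt_min r0)).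
  move: wr; rewrite lt_min => /andP[wr ws]; exists (w - z); split=> //; first by rewrite subr_eq0.
  by rewrite hs// e subrr mulr0.
apply: nearC_imp ed => w + wz => /(_ wz); rewrite /pser sum0; last by move=> k; rewrite c0 mul0r.
move/esym/eqP; rewrite mulf_eq0 expf_eq0 subr_eq0 (negbTE wz) andbF /= subr_eq0.
by move/eqP.
Qed.

(** A positive pole order of [f] would have a nonzero leading coefficient, yet agreement with an
    analytic function around z forces it to vanish; so the order is 0 and the values at z agree
    too. *)
Lemma eqC_ana f g z b : mform f z -> ana g z b -> eqC f g z -> f z = g z.
Proof.
move=> [N [a [ha a0 hf]]] hg e; rewrite (ana_val hg); case: hg => hb hg.
have := anaD (ana_pser z ha) (anaM (ana_monic z N (-1)) (ana_pser z hb)).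
set c := (fun k : nat => _ + _) => -[hc ec].
have : c 0%N = 0.
  apply: pser_head0 hc _ => r r0; have [s s0 hs] := nearC_and (nearC_and ec e) (nearC_and hf hg).
  pose t := Num.min r s / 2; have t0 : 0 < t by rewrite divr_gt0// lt_min r0.
  have mr : Num.min r s <= r by rewrite ge_min lexx.
  have ms : Num.min r s <= s by rewrite ge_min lexx orbT.
  have tr : t < r by move: t0; rewrite /t; lra.
  have ts : t < s by move: t0; rewrite /t; lra.
  have nt : nc (t%:C : C) = t by rewrite nc_real gtr0_norm.
  have tn0 : (t%:C : C) != 0 by rewrite -nc_gt0 nt.
  exists t%:C; split; rewrite ?nt//.
  have := hs (z + t%:C); rewrite [z + _ - z]addrC addKr nt => /(_ ts)[[h1 h2] [h3 h4]].
  have zt : z + t%:C != z by rewrite -subr_eq0 [z + _]addrC addrK.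
  rewrite -h1 h3// h2// h4; by ring.
rewrite /c /fps_mul big_ord1 subn0 /monic_at eq_sym.
case: (N) a0 => [->|n a0] /=.
  by rewrite mul1r mulN1r => /eqP; rewrite subr_eq0 => /eqP.
by rewrite !mul0r addr0 => e0; rewrite e0 eqxx in a0.
Qed.

Lemma pick_near z y (r : R) : 0 < r -> exists w, [/\ w != z, w != y & nc (w - z) < r].
Proof.
move=> r0; have h (t : R) : 0 < t -> t < r -> (z + t%:C != z) /\ nc (z + t%:C - z) < r.
  move=> t0 tr; rewrite -subr_eq0 [z + _]addrC addrK nc_real gtr0_norm//; split=> //.
  by rewrite -nc_gt0 nc_real gtr0_norm.
have [h1 h1'] := h (r / 2) (ltac:(lra)) (ltac:(lra)).
have [h2 h2'] := h (r / 3) (ltac:(lra)) (ltac:(lra)).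
have [e|ne] := eqVneq (z + (r / 2)%:C) y; last by exists (z + (r / 2)%:C).
exists (z + (r / 3)%:C); split=> //; rewrite -e (inj_eq (addrI z)).
apply/eqP => -[]; lra.
Qed.

(* On a segment from [z0] to [z1], the set of points near which [f = g] is open, and it is closed
   because the zeros of a nonzero Laurent germ are isolated. *)
Lemma identity f g z0 z1 : (forall z, mform f z) -> (forall z, mform g z) ->
  eqC f g z0 -> eqC f g z1.
Proof.
move=> mf mg e0; have [<-//|ne] := eqVneq z0 z1.
pose d := nc (z1 - z0); have d0 : 0 < d by rewrite nc_gt0 subr_eq0 eq_sym.
pose ga (t : R) := z0 + t%:C * (z1 - z0).
have gaB s t : nc (ga s - ga t) = `|s - t| * d.
  by rewrite /ga opprD addrACA subrr add0r -mulrBl -rmorphB ncM nc_real.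
pose S := [set t : R | 0 <= t <= 1 /\ eqC f g (ga t)].
have S0 : S 0 by split; rewrite ?lexx ?ler01// /ga mul0r addr0.
have hS : has_sup S by split; [exists 0|exists 1 => t [/andP[]]].
pose s := sup S.
have s0 : 0 <= s by apply: ub_le_sup S0; case: hS.
have s1 : s <= 1 by apply: ge_sup; [exists 0|move=> t [/andP[]]].
have es : eqC f g (ga s).
  apply: mform_eqC => // r r0.
  have dl0 : 0 < r / (2 * d) by rewrite divr_gt0// mulr_gt0.
  have [t [t01 et] ts] := sup_adherent dl0 hS; have [rho rho0 ht] := et.
  have ts' : t <= s by apply: ub_le_sup; case: hS.
  (* The point must avoid [ga t], where the agreement near [ga t] says nothing, and [ga s], where
     the accumulation is to be shown. *)
  have [w [wt ws wr]] := @pick_near (ga t) (ga s) (Num.min rho (r / 2)) (ltac:(by rewrite lt_min rho0 divr_gt0)).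
  move: wr; rewrite lt_min => /andP[wr1 wr2]; exists w; split=> //; last exact: ht.
  have -> : w - ga s = (w - ga t) + (ga t - ga s) by rewrite addrA subrK.
  apply: le_lt_trans (le_ncD _ _) _; rewrite gaB distrC ger0_norm ?subr_ge0//.
  have : (s - t) * d < r / 2.
    rewrite -ltr_pdivlMr//; have -> : r / 2 / d = r / (2 * d) by field; lra.
    move: ts; rewrite -/s; lra.
  lra.
have [s1'|] := eqVneq s 1; first by move: es; rewrite s1' /ga mul1r [z0 + _]addrC subrK.
move=> sn1; have {sn1}s1' : s < 1 by rewrite lt_neqAle sn1.
have [rho rho0 hr] := es.
pose t := Num.min (1 - s) (rho / (2 * d)).
have t0 : 0 < t by rewrite lt_min subr_gt0 s1' divr_gt0// mulr_gt0.
have t1 : t <= 1 - s by rewrite ge_min lexx.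
have td : t * d < rho.
  have : t <= rho / (2 * d) by rewrite ge_min lexx orbT.
  rewrite ler_pdivlMr ?mulr_gt0//; nra.
suff : s + t <= s by lra.
apply: ub_le_sup; first by case: hS.
split; first by apply/andP; split; lra.
have gt : nc (ga (s + t) - ga s) = t * d by rewrite gaB addrC addKr gtr0_norm.
(* This disc around [ga (s + t)] stays in the disc of agreement around [ga s] and misses its centre,
   where [f] and [g] may differ. *)
exists (Num.min (t * d) (rho - t * d)); first by rewrite lt_min mulr_gt0// subr_gt0.
move=> w; rewrite lt_min => /andP[w1 w2] _; apply: hr.
  have -> : w - ga s = (w - ga (s + t)) + (ga (s + t) - ga s) by rewrite addrA subrK.
  by apply: le_lt_trans (le_ncD _ _) _; rewrite gt; lra.
by apply: contraTneq w1 => ->; rewrite -leNgt -ncN opprB gt.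
Qed.

End Meromorphic.

(** * The rational part of the twisted Weierstrass functions *)

Section Eulerian.
Variable R : realType.
Notation C := (R[i]).
Implicit Types (m j r : nat) (z w x : C).

(* With [h = cexp (z / 2) * p.[(1 - cexp z)^-1]], this recursion is [p_(m+1)] from
   [h_(m+1) = h_m'], so that [h_m] is the m-th derivative of
   [cexp (z / 2) / (1 - cexp z)]. *)
Fixpoint eul m : {poly C} := match m with
  | 0%N => 'X
  | m'.+1 => ('X ^+ 2 - 'X) * (eul m')^`() + (2^-1)%:P * eul m'
  end.

Definition hf m z : C := cexp (z * (2^-1 : R)%:C) * (eul m).[(1 - cexp z)^-1].

Lemma eul_coef0 m : (eul m)`_0 = 0.
Proof.
elim: m => [|m IH]; first by rewrite coefX.
by rewrite /= coefD mulrBl coefB coefXnM coefXM coefCM IH mulr0 subrr addr0.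
Qed.

Lemma eul_coefS m j : (eul m.+1)`_j.+1 =
  j%:R * (eul m)`_j - (j%:R + 2^-1) * (eul m)`_j.+1.
Proof.
rewrite /= coefD mulrBl coefB coefXnM coefXM coefCM /= !coef_deriv.
have h : (j.+1%:R : C) = j%:R + 2^-1 + 2^-1.
  by rewrite -addrA -[2^-1]mul1r -splitr -natr1.
rewrite -[_ *+ j.+1]mulr_natl h; case: j {h} => [|j]; first by rewrite /=; ring.
by rewrite !subSS subn0 /= -[_ *+ j.+1]mulr_natl; ring.
Qed.

Lemma eul_coef_gt m j : (m.+1 < j)%N -> (eul m)`_j = 0.
Proof.
elim: m j => [|m IH] [|j] // h; first by rewrite coefX; case: j h.
by rewrite eul_coefS !IH ?mulr0 ?subr0// ltnW.
Qed.

Lemma eul_coef_lead m : (eul m)`_m.+1 = m`!%:R.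
Proof.
elim: m => [|m IH]; first by rewrite coefX.
by rewrite eul_coefS IH eul_coef_gt// mulr0 subr0 -natrM factS.
Qed.

Lemma eul_horner m x : (eul m).[x] = \sum_(j < m.+1) (eul m)`_j.+1 * x ^+ j.+1.
Proof.
rewrite (@horner_coef_wide _ m.+2); first by rewrite big_ord_recl eul_coef0 mul0r add0r.
by apply/leq_sizeP => j; apply: eul_coef_gt.
Qed.

(** Replacing z by -z turns X = 1 / (1 - e^z) into 1 - X; this polynomial identity is the parity of
    [hf m], proved by differentiating it once per step. *)
Lemma eul_refl m : 'X * (eul m \Po (1 - 'X)) = (-1) ^+ m.+1 * (('X - 1) * eul m).
Proof.
elim: m => [|m IH]; first by rewrite /= comp_polyX expr1; ring.
rewrite /= expr2 comp_polyD !comp_polyM comp_polyB comp_polyM comp_polyX comp_polyC -expr2.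
set W := eul m in IH *; set V := W \Po _ in IH *; set h := (2^-1)%:P.
have hh : h = 1 - h.
  by apply/eqP; rewrite eq_sym subr_eq /h -polyCD -[2^-1]mul1r -splitr.
have dV : V^`() = - (W^`() \Po (1 - 'X)).
  by rewrite /V deriv_comp derivB derivC derivX sub0r mulrN1.
have := congr1 (@deriv C) IH; rewrite derivM derivX mul1r.
have -> : ((-1) ^+ m.+1 * (('X - 1) * W))^`() = (-1) ^+ m.+1 * (W + ('X - 1) * W^`()) :> {poly C}.
  have -> : (-1) ^+ m.+1 = ((-1) ^+ m.+1)%:P :> {poly C} by rewrite rmorphXn rmorphN1.
  by rewrite derivM derivC mul0r add0r derivM derivB derivX derivC subr0 mul1r.
rewrite dV; move: (W^`() \Po _) => V' e2.
transitivity (- ('X ^+ 2 - 'X) * (V + 'X * - V') + ('X - 1) * ('X * V) + h * ('X * V)); first by ring.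
rewrite e2 IH.
transitivity ((-1) ^+ m.+2 * (('X - 1) * (('X ^+ 2 - 'X) * W^`() + (1 - h) * W))).
  by rewrite (exprS _ m.+1); ring.
by rewrite -hh.
Qed.

(** The coefficients of [eul m] express (r + 1/2)^m in the basis of the binomials C(r + j, j), whose
    generating functions are powers of 1 / (1 - x). *)
Lemma uu_poly m r : (uu R r)%:C ^+ m = \sum_(j < m.+1) (eul m)`_j.+1 * 'C(r + j, j)%:R :> C.
Proof.
have uE : (uu R r)%:C = r%:R + 2^-1 :> C by rewrite /uu rmorphD fmorphV !rmorph_nat.
elim: m => [|m IH]; first by rewrite big_ord1 coefX bin0 mul1r.
rewrite exprS IH big_distrr /=.
under [RHS]eq_bigr => j _ do rewrite eul_coefS mulrBl.
rewrite sumrB [X in _ = X - _]big_ord_recl /= !mul0r add0r.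
rewrite [X in _ = _ - X]big_ord_recr /= eul_coef_gt// mulr0 mul0r addr0 -sumrB.
apply: eq_bigr => j _; rewrite /bump /= add1n.
have e : (j.+1%:R * 'C(r + j.+1, j.+1)%:R : C) = (r + j).+1%:R * 'C(r + j, j)%:R.
  by rewrite -!natrM addnS -mul_bin_diag.
have -> : j.+1%:R * (eul m)`_j.+1 * 'C(r + j.+1, j.+1)%:R =
    (eul m)`_j.+1 * (j.+1%:R * 'C(r + j.+1, j.+1)%:R) by ring.
have e2 : ((r + j).+1%:R : C) = r%:R + j%:R + 1 by rewrite -natrD natr1.
rewrite e uE e2.
have : (2^-1 : C) = 1 - 2^-1 by apply/eqP; rewrite eq_sym subr_eq -[2^-1]mul1r -splitr.
move: (2^-1 : C) => h hh; rewrite [in RHS]hh; ring.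
Qed.

Lemma summ_binom j x : nc x < 1 -> summ (fun r : nat => 'C(r + j, j)%:R * x ^+ r).
Proof.
move=> x1; apply: le_lt_trans (@es_binom R j (nc x) _); last by rewrite nc_ge0.
apply: le_es => r; rewrite lee_fin ncM ncX nc_nat addnC; have := bin_sub (leq_addl j r); rewrite addnK => ->; exact: lexx.
Qed.

Lemma sum_binom j x : nc x < 1 ->
  sum (fun r : nat => 'C(r + j, j)%:R * x ^+ r) = (1 - x)^-1 ^+ j.+1.
Proof.
move=> x1; have x0 : 1 - x != 0 by rewrite subr_eq0; apply: contraTneq x1 => <-; rewrite nc1 ltxx.
have key (S T : C) : S = T + x * S -> S = T * (1 - x)^-1.
  by move=> e; rewrite -[LHS](mulfK x0); congr (_ / _); rewrite mulrBr mulr1 {1}e; ring.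
elim: j => [|j IH].
  rewrite expr1 -[RHS]mul1r; apply: key; rewrite {1}(sum_recl (summ_binom 0 x1)) bin0 mul1r expr0; congr (_ + _).
  rewrite -sumZ ?summ_binom//; apply: eq_sum => r; by rewrite !bin0 !mul1r exprS.
rewrite exprSr -IH; apply: key.
have h : summ (fun r : nat => 'C(r + j, j.+1)%:R * x ^+ r).
  apply: summ_le (summ_binom j.+1 x1) => r; rewrite !ncM ler_wpM2r ?nc_ge0//.
  by rewrite !nc_nat ler_nat addnS binS leq_addr.
have e1 : sum (fun r : nat => 'C(r + j.+1, j.+1)%:R * x ^+ r) =
    sum (fun r : nat => 'C(r + j, j)%:R * x ^+ r) + sum (fun r : nat => 'C(r + j, j.+1)%:R * x ^+ r).
  rewrite -sumD ?summ_binom//; apply: eq_sum => r.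
  by rewrite addnS binS natrD addrC mulrDl.
rewrite [LHS]e1; congr (_ + _); rewrite (sum_recl h) bin_small// mul0r add0r.
by rewrite -sumZ ?summ_binom//; apply: eq_sum => r; rewrite addSnnS exprS mulrCA.
Qed.

Lemma cexp_uu z r : cexp (z * (uu R r)%:C) = cexp (z * (2^-1 : R)%:C) * cexp z ^+ r.
Proof.
elim: r => [|r IH]; first by rewrite /uu add0r mulr1.
have -> : z * (uu R r.+1)%:C = z * (uu R r)%:C + z.
  by rewrite /uu -natr1 addrAC rmorphD mulrDr mulr1.
by rewrite cexpD IH exprSr mulrA.
Qed.

Lemma hf_sum m z : complex.Re z < 0 ->
  sum (fun r => (uu R r)%:C ^+ m * cexp (z * (uu R r)%:C)) = hf m z.
Proof.
move=> z0; have x1 : nc (cexp z) < 1 by rewrite nc_cexp expR_lt1.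
rewrite /hf eul_horner.
rewrite (eq_sum (v := fun r => \sum_(j < m.+1)
   (cexp (z * (2^-1 : R)%:C) * (eul m)`_j.+1) * ('C(r + j, j)%:R * cexp z ^+ r))) => [|r].
  rewrite sum_sumr => [|j]; last by apply/summZ/summ_binom.
  by rewrite mulr_sumr; apply: eq_bigr => j _; rewrite sumZ ?summ_binom// sum_binom// mulrA.
by rewrite uu_poly cexp_uu mulr_suml; apply: eq_bigr => j _; ring.
Qed.

Lemma hfN m z : cexp z != 1 -> hf m (- z) = (-1) ^+ m.+1 * hf m z.
Proof.
move=> z1; have D0 : 1 - cexp z != 0 by rewrite subr_eq0 eq_sym.
have ez : cexp z * cexp (- z) = 1 by rewrite -cexpD subrr cexp0.
have e0 : cexp z != 0 by apply: contra_eq_neq ez => ->; rewrite mul0r eq_sym oner_neq0.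
pose X := (1 - cexp z)^-1; have X0 : X != 0 by rewrite invr_eq0.
have eX : (1 - cexp (- z))^-1 = 1 - X.
  have -> : cexp (- z) = (cexp z)^-1 by rewrite -[RHS]mulr1 -ez mulKf.
  by rewrite /X; field; rewrite D0 e0 /= subr_eq0 z1.
have h : X * (eul m).[1 - X] = (-1) ^+ m.+1 * ((X - 1) * (eul m).[X]).
  by have := congr1 (horner^~ X) (eul_refl m); rewrite hornerM hornerX horner_comp !hornerE /= => ->.
have ec : cexp (z * (2^-1 : R)%:C) = cexp z * cexp (- z * (2^-1 : R)%:C).
  rewrite -cexpD; congr cexp; rewrite mulNr -{2}[z]mulr1 -mulrBr; congr (_ * _).
  by apply/eqP; rewrite eq_complex /= subr0 eqxx andbT; apply/eqP; field.
have eX1 : X - 1 = X * cexp z by rewrite /X; field.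
rewrite /hf eX -/X ec; apply: (mulfI X0).
move: (cexp (- z * _)) (eul m).[1 - X] (eul m).[X] (cexp z) eX1 h => c1 W' W e eX1 h.
transitivity (c1 * (X * W')); first by ring.
by rewrite h eX1; ring.
Qed.

End Eulerian.

Section HalfPole.
Variable R : realType.
Notation C := (R[i]).
Implicit Types (m j : nat) (z w : C) (f g : C -> C).

Definition an f z := exists a, ana f z a.

Lemma an_cst z c : an (fun=> c) z. Proof. by eexists; apply: ana_cst. Qed.
Lemma anD f g z : an f z -> an g z -> an (fun w => f w + g w) z.
Proof. by move=> [a ha] [b hb]; eexists; apply: (anaD ha hb). Qed.
Lemma anM f g z : an f z -> an g z -> an (fun w => f w * g w) z.
Proof. by move=> [a ha] [b hb]; eexists; apply: (anaM ha hb). Qed.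
Lemma anV f z : an f z -> f z != 0 -> an (fun w => (f w)^-1) z.
Proof. by move=> [a ha] h; eexists; apply: (anaV ha h). Qed.
Lemma anX f z n : an f z -> an (fun w => f w ^+ n) z.
Proof.
move=> h; elim: n => [|n IH]; first exact: an_cst.
have [a ha] := anM h IH; exists a; apply: ana_eq ha.
by exists 1 => // w _; rewrite exprS.
Qed.
Lemma an_sum (I : Type) (s : seq I) (F : I -> C -> C) z : (forall i, an (F i) z) ->
  an (fun w => \sum_(i <- s) F i w) z.
Proof.
move=> h; elim: s => [|i s IH].
  have [a ha] := an_cst z 0; exists a; apply: ana_eq ha; exists 1 => // w _; by rewrite big_nil.
have [a ha] := anD (h i) IH; exists a; apply: ana_eq ha; exists 1 => // w _; by rewrite big_cons.
Qed.
Lemma an_eq f g z : nearC z (fun w => f w = g w) -> an f z -> an g z.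
Proof. by move=> h [a ha]; exists a; apply: ana_eq ha. Qed.

Lemma an_subX z n : an (fun w => (w - z) ^+ n) z.
Proof.
exists (monic_at n 1); apply: ana_eq (ana_monic z n 1); exists 1 => // w _; by rewrite mul1r.
Qed.

Lemma ana_cexp (s : R) z :
  ana (fun w => cexp (s%:C * w)) z (fun k => cexp (s%:C * z) * (s%:C ^+ k / k`!%:R)).
Proof.
have sm (F : unit -> C) : sum F = F tt by rewrite (@sum_single _ _ tt)// => -[].
have h : summ (fun i : unit => 1 * cexp (s%:C * z) * (expR (1 * `|s|))%:C : C).
  by rewrite /summ /asum (@es_single _ _ tt) ?lee_fin ?nc_ge0 ?ltry// => -[].
have := ana_sum ltr01 h; rewrite /= => -[].
rewrite (_ : (fun k => sum _) = fun k => cexp (s%:C * z) * (s%:C ^+ k / k`!%:R)).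
  move=> ha hf; split=> //; apply: nearC_imp hf => w <-; by rewrite sm mul1r.
by apply/funext => k; rewrite sm mul1r.
Qed.

Lemma an_cexp (s : R) z : an (fun w => cexp (w * s%:C)) z.
Proof.
eexists; apply: ana_eq (ana_cexp s z); exists 1 => // w _; by rewrite mulrC.
Qed.

Lemma ana_cexp1 z : ana (@cexp R) z (fun k => cexp z / k`!%:R).
Proof.
have := ana_cexp 1 z; rewrite (_ : (fun k => _) = fun k => cexp z / k`!%:R) => [h|].
  by apply: ana_eq h; exists 1 => // w _; rewrite mul1r.
by apply/funext => k; rewrite mul1r expr1n mul1r.
Qed.

Lemma an_hf m z : cexp z != 1 -> an (hf m) z.
Proof.
move=> z1; have hD : an (fun w => (1 - cexp w)^-1) z.
  apply: (anV (f := fun w => 1 - cexp w)); last by rewrite subr_eq0 eq_sym.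
  have [a ha] := anD (an_cst z 1) (anM (an_cst z (-1)) (ex_intro _ _ (ana_cexp1 z))).
  by exists a; apply: ana_eq ha; exists 1 => // w _; rewrite mulN1r.
have := anM (an_cexp 2^-1 z) (an_sum (index_enum 'I_m.+1)
  (F := fun (j : 'I_m.+1) w => (eul R m)`_j.+1 * (1 - cexp w)^-1 ^+ j.+1)
  (fun j : 'I_m.+1 => anM (an_cst z _) (anX j.+1 hD))).
by apply: an_eq; exists 1 => // w _; rewrite /hf eul_horner.
Qed.

(** Where e^z = 1 one has 1 - e^w = (w - z) E(w) with E(z) = -1, so the pole has order exactly m + 1
    because the leading coefficient m! of [eul m] is nonzero. *)
Lemma mform_hf m z : mform (hf m) z.
Proof.
have [z1|z1] := eqVneq (cexp z) 1; last first.
  by have [a ha] := an_hf m z1; apply: ana_mform ha.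
pose b : C^nat := fun k => - (cexp z / (k + 1)`!%:R).
have hc := ana_cexp1 z; have pb : pcv b.
  have [[K [A [K0 A0 h]]] _] := hc; exists (K * A), A; split; rewrite ?mulr_gt0// => k.
  by rewrite /b ncN; have := h (k + 1)%N; rewrite addn1 exprS mulrA.
have hE := ana_pser z pb; set E := (fun w => pser b (w - z)) in hE.
have Ez : E z = -1 by rewrite (ana_val hE) /b z1 div1r add0n invr1.
have DE : nearC z (fun w => 1 - cexp w = (w - z) * E w).
  have [pc ec] := hc; apply: nearC2 (nearC_and ec (near_pcv z pc)) (near_pcv z pb) => w [-> h1] h2.
  have h3 : summ (fun k => cexp z / (k + 1)`!%:R * (w - z) ^+ k).
    by apply: summ_le h2 => k; rewrite /b mulNr ncN.
  rewrite pser_recl// {1}z1 divr1 opprD addrA subrr add0r -mulrN; congr (_ * _).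
  by rewrite /E /pser -sumN//; apply: eq_sum => k; rewrite /b mulNr.
have hV : an (fun w => (E w)^-1) z by apply: anV; [exists b|rewrite Ez oppr_eq0 oner_neq0].
have [a ha] := anM (an_cexp 2^-1 z) (an_sum (index_enum 'I_m.+1)
  (F := fun (j : 'I_m.+1) w => (eul R m)`_j.+1 * ((w - z) ^+ (m - j) * (E w)^-1 ^+ j.+1))
  (fun j : 'I_m.+1 => anM (an_cst z _) (anM (an_subX z (m - j)) (anX j.+1 hV)))).
exists m.+1, a; split; first by case: ha.
  rewrite -(ana_val ha) /= mulf_neq0//.
    by rewrite -nc_gt0 nc_cexp expR_gt0.
  rewrite (bigD1 ord_max)//= big1 => [|j jm]; last first.
    rewrite subrr expr0n subn_eq0 leqNgt ltn_neqAle -ltnS ltn_ord andbT.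
    by rewrite -val_eqE /= in jm; rewrite jm mul0r mulr0.
  rewrite subnn mul1r addr0 eul_coef_lead Ez mulf_neq0 ?pnatr_eq0 -?lt0n ?fact_gt0//.
  by rewrite expf_neq0// invr_eq0 oppr_eq0 oner_neq0.
case: ha => _; apply: nearC2 DE => w eD <- wz; rewrite /hf eul_horner eD mulrCA; congr (_ * _).
rewrite mulr_sumr; apply: eq_bigr => j _; rewrite [RHS]mulrCA; congr (_ * _).
have wz0 : w - z != 0 by rewrite subr_eq0.
rewrite invfM exprMn mulrA; congr (_ * _).
rewrite -{2}(subnK (ltn_ord j : (j.+1 <= m.+1)%N)) exprD -mulrA -exprMn mulfV// expr1n mulr1.
by rewrite subSS.
Qed.

Lemma mformD_an f g z : mform f z -> an g z -> mform (fun w => f w + g w) z.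
Proof.
move=> [N [a [ha h0 hf]]] [b hb].
have := anaD (ana_pser z ha) (anaM (ana_monic z N 1) hb).
set c := (fun k : nat => _ + _) => -[hc ec]; exists N, c; split=> //.
  rewrite /c /fps_mul big_ord1 subn0 /monic_at (ana_val hb).
  by case: (N) h0 => [->|n h0] /=; rewrite ?mul1r// !mul0r addr0.
by apply: nearC2 hf ec => w h <- wz; rewrite h// mul1r mulrDr.
Qed.

Lemma mform_comp f z (c k : C) : k != 0 -> mform f (z + c) -> mform (fun w => k * f (w + c)) z.
Proof.
move=> k0 [N [a [ha h0 hf]]].
have := anaM (ana_cst z k) (ana_pser z ha).
set b := fps_mul _ _ => -[hb eb]; exists N, b; split=> //.
  rewrite /b /fps_mul big_ord1 subn0 /monic_at mul1r.
  by case: (N) h0 => [->|n h0] //=; rewrite mulf_neq0.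
apply: nearC2 (nearC_shift hf) eb => w h <- wz.
have e : w + c - (z + c) = w - z by rewrite opprD addrACA subrr addr0.
by rewrite mulrCA -e -h// (inj_eq (addIr c)).
Qed.

Lemma mform_eq f g z : nearC z (fun w => f w = g w) -> mform f z -> mform g z.
Proof.
move=> [r r0 e] [N [a [ha h0 hf]]]; have ez : f z = g z by apply: e; rewrite subrr nc0.
exists N, a; split=> //; first by rewrite -ez.
have e' : nearC z (fun w => f w = g w) by exists r.
by apply: nearC2 e' hf => w <-.
Qed.

End HalfPole.

(** * The twisted functions for the half-integer lattice *)

Section TwistHalf.
Variable R : realType.
Notation C := (R[i]).

Lemma cexp_half : cexp (0 +i* (2 * pi * 2^-1)) = -1 :> C.
Proof.
have -> : 2 * pi * 2^-1 = pi :> R by field.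
rewrite /cexp /= expR0 cospi sinpi.
by apply/eqP; rewrite eq_complex /= !(mul0r, mul1r, mulr0, subr0, addr0) oppr0 !eqxx.
Qed.

(** Only the real part of the equation is needed for uniqueness: cos(2 pi l) = -1 has one solution
    for 2 l in [0, 1] by injectivity of cos, and for larger l the reflection 2 - 2 l reduces to that
    range. *)
Lemma twistN1 : twist (-1 : C) = 2^-1.
Proof.
apply: xget_unique => [|l [/andP[l0 l1]]].
  by split; [lra|rewrite cexp_half].
rewrite /cexp /= expR0 mul1r => /eqP; rewrite eq_complex /= => /andP[/eqP hc _].
have pi0 : 0 < pi :> R by exact: pi_gt0.
have key (x : R) : 0 <= x <= 1 -> cos (x * pi) = -1 -> x = 1.
  move=> /andP[x0 x1] cx; apply: (mulIf (x := pi)); first by rewrite gt_eqF.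
  rewrite mul1r; apply: cos_inj; rewrite ?in_itv/= ?pi_ge0 ?lexx ?cospi//.
  by rewrite mulr_ge0 ?pi_ge0//= ler_piMl ?pi_ge0.
have [h|h] := leP l (1 / 2).
  have := key (2 * l); rewrite -mulrA [l * pi]mulrC mulrA -hc => e; suff : 2 * l = 1 by lra.
  by apply: e => //; lra.
have := key (2 - 2 * l); rewrite mulrBl (_ : 2 * pi = pi *+ 2); last by rewrite mulr_natl.
rewrite cosB cos2pi sin2pi mul0r addr0 mul1r => e; suff : 2 - 2 * l = 1 by lra.
by apply: e; [lra|rewrite -mulrA [l * pi]mulrC mulrA -hc].
Qed.

Lemma halfC : (2^-1 : R)%:C = 2^-1 :> C. Proof. by rewrite fmorphV rmorph_nat. Qed.

Lemma sum_int (u : int -> C) : summ (fun r : nat => u r%:Z) -> summ (fun r : nat => u (Negz r)) ->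
  sum u = sum (fun r : nat => u r%:Z) + sum (fun r : nat => u (Negz r)).
Proof.
move=> hp hn; pose p m := if m is Posz _ then u m else 0; pose n m := if m is Negz _ then u m else 0.
have ip : injective Posz by move=> ? ? [].
have iN : injective Negz by move=> ? ? [].
have sp j : (exists i, Posz i = j) \/ p j = 0 by case: j => i; [left; exists i|right].
have sn j : (exists i, Negz i = j) \/ n j = 0 by case: j => i; [right|left; exists i].
have hp' := summ_injV ip sp hp; have hn' := summ_injV iN sn hn.
rewrite (eq_sum (v := fun m => p m + n m)) => [|[m|m]]; rewrite ?addr0 ?add0r//.
by rewrite sumD// -(sum_inj ip sp hp') -(sum_inj iN sn hn').
Qed.

End TwistHalf.

Section Twisted.
Variables (R : realType) (theta tau : R[i]).
Notation C := (R[i]).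
Hypothesis theta_sq : theta ^+ 2 = 1.
Hypothesis tau_gt0 : 0 < complex.Im tau.
Implicit Types (k l m r : nat) (z w : C).
Notation SA := (sA theta tau).
Notation SB := (sB theta tau).
Notation c := (2 * pi * complex.Im tau).

Let c_gt0 : 0 < c. Proof. by rewrite !mulr_gt0 ?pi_gt0. Qed.

Lemma theta_neq0 : theta != 0.
Proof. by have := oner_neq0 C; rewrite -theta_sq sqrf_eq0. Qed.

Lemma thetaV : theta^-1 = theta.
Proof. by apply: (mulfI theta_neq0); rewrite divff ?theta_neq0// -expr2. Qed.

(** At lambda = 1/2 the exponents r + lambda and r + 1 - lambda coincide, and so do theta and its
    inverse, hence the two series of E are the same up to sign. *)
Lemma Etwisted_half k : Etwisted theta (-1) k tau =
  - expm1_coef 2^-1 (-1) k + (1 + (-1) ^+ k) / (k.-1)`!%:R * sum (SA k.-1 0).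
Proof.
have h : summ (SA k.-1 0) by apply: (summ_sA theta_sq tau_gt0); rewrite raddf0 oppr_lt0.
rewrite /Etwisted twistN1 halfC /bernoulli thetaV -limn_sum//.
have -> : (fun r : nat => (r%:R + 2^-1)%:C ^+ k.-1 * theta * qpow tau (r%:R + 2^-1)
    / (1 - theta * qpow tau (r%:R + 2^-1))) = SA k.-1 0.
  by apply/funext => r; rewrite /sA mul0r oppr0 cexp0 mulr1 /lam -!mulrA.
have -> : (fun r : nat => (r.+1%:R - 2^-1)%:C ^+ k.-1 * theta * qpow tau (r.+1%:R - 2^-1)
    / (1 - theta * qpow tau (r.+1%:R - 2^-1))) = SA k.-1 0.
  apply/funext => r; rewrite /sA mul0r oppr0 cexp0 mulr1 /lam -!mulrA.
  by rewrite (_ : r.+1%:R - 2^-1 = uu R r)// /uu -natr1; lra.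
have f0 : (k`!%:R : C) != 0 by rewrite pnatr_eq0 -lt0n fact_gt0.
rewrite -addrA; congr (_ + _); first by rewrite mulrC -mulrN mulKf.
by ring.
Qed.

Lemma fact_bin k l : (0 < k)%N -> (0 < l)%N ->
  ('C(k + l - 2, k.-1)%:R / ((k + l).-2)`!%:R : C) = ((k.-1)`! * (l.-1)`!)%:R^-1.
Proof.
case: k l => [|k] [|l] // _ _; rewrite /= addSn addnS !subSS subn0 /=.
have := bin_fact (leq_addr l k); rewrite addKn => e.
have f n : (n`!%:R : C) != 0 by rewrite pnatr_eq0 -lt0n fact_gt0.
rewrite -[in LHS]e !natrM; field; rewrite !f /=.
by rewrite pnatr_eq0 -lt0n bin_gt0 leq_addr.
Qed.

Lemma Ctwisted_entC k l : (0 < k)%N -> (0 < l)%N ->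
  Ctwisted theta (-1) k l tau = entC theta tau k l.
Proof.
move=> k0 l0; rewrite /Ctwisted Etwisted_half /entC expm1_pairE//.
have e2 : ((k + l).-1).-1 = (k.-1 + l.-1)%N by case: k l k0 l0 => [|k] [|l] //= _ _; rewrite addnS.
have e1 : (k + l.-1)%N = (k + l).-1 by case: l l0 {e2} => //= l _; rewrite addnS.
have e3 : (k + l.-1).-1 = (k + l - 2)%N by case: k l k0 l0 {e1 e2} => [|k] [|l] //= _ _; rewrite addnS !subSS subn0.
rewrite e3 e1 e2 mulrDr; rewrite [RHS]addrC; congr (_ + _).
  have -> : 'C(k + l - 2, l.-1) = 'C(k + l - 2, k.-1).
    rewrite -[in RHS]bin_sub; first by congr 'C(_, _); lia.
    lia.
  by case: l l0 {e1 e2 e3} => // l _; rewrite exprS /=; ring.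
rewrite -e2 -(fact_bin k0 l0).
case: k l k0 l0 {e1 e2 e3} => [|k] [|l] // _ _; rewrite /= addSn addnS !exprS exprD /=.
have := sqrr_sign C l; rewrite expr2.
move: ('C(_, _)%:R) (sum _) (_`!%:R) ((-1) ^+ k) ((-1) ^+ l) => b S f s t tt.
transitivity ((s * (t * t) - t) * b / f * S); first by ring.
by rewrite tt; ring.
Qed.

(** If k + l is odd the signs are opposite. If it is even, E has odd index and vanishes: its
    Bernoulli part by [expm1_half_odd], its series by the factor 1 + (-1)^n. *)
Lemma entC_anti k l : (0 < k)%N -> (0 < l)%N ->
  Ctwisted theta (-1) k l tau = - Ctwisted theta (-1) l k tau.
Proof.
move=> k0 l0; rewrite /Ctwisted [in RHS]addnC.
have -> : 'C(k + l - 2, l.-1) = 'C(k + l - 2, k.-1).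
  rewrite -[in RHS]bin_sub; first by congr 'C(_, _); lia.
  lia.
have [od|ev] := boolP (odd (k + l)).
  rewrite -!mulNr; congr (_ * _ * _); rewrite -(signr_odd _ l) -(signr_odd _ k).
  by move: od; rewrite oddD; case: (odd k); case: (odd l) => //= _; rewrite ?opprK.
have od : odd (k + l).-1 by case: k k0 ev => //= k _; rewrite negbK.
have -> : Etwisted theta (-1) (k + l).-1 tau = 0.
  by rewrite Etwisted_half expm1_half_odd// -signr_odd od /= expr1 subrr !mul0r oppr0 addr0.
by rewrite !mulr0 oppr0.
Qed.

(** The quasi-period 2 pi i tau, with e^T0 = q. *)
Definition T0 : C := (0 +i* (2 * pi)) * tau.

Lemma Re_T0 : complex.Re T0 = - c.
Proof. by rewrite /T0; case: tau => a b /=; rewrite mul0r sub0r. Qed.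

Lemma cexp_T0 (x : R) : cexp (T0 * x%:C) = qpow tau x.
Proof.
rewrite /qpow /T0; congr cexp; rewrite mulrAC; congr (_ * _).
by apply/eqP; rewrite eq_complex /=; apply/andP; split; apply/eqP; ring.
Qed.

Definition Az m w := sum (SA m w).
(* Up to a constant, [f0 m] is [P_(m+1)] for [`|Re z| < c]: splitting [1 / (1 - theta q ^ n)] as
   [1 + theta q ^ n / (1 - theta q ^ n)] for [0 < n] isolates the polar part [hf m]. *)
Definition f0 m z := hf m z + Az m (- z) + (-1) ^+ m.+1 * Az m z.

Lemma sB_split m z r : SB m z r = (uu R r)%:C ^+ m * cexp (z * (uu R r)%:C) + SA m (- z) r.
Proof.
rewrite /sB /sA (lamBE theta_sq tau_gt0) mulNr opprK mulrDr mulr1 addrC//.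
Qed.

Lemma summ_hf m z : - c < complex.Re z < 0 ->
  summ (fun r => (uu R r)%:C ^+ m * cexp (z * (uu R r)%:C)).
Proof.
move=> /andP[z1 z2]; apply: (summ_eq (v := fun r => SB m z r + - SA m (- z) r)) => [r|].
  by rewrite sB_split addrK.
apply: summD; first exact: (summ_sB theta_sq tau_gt0).
by apply/summN/(summ_sA theta_sq tau_gt0); rewrite raddfN/=; lra.
Qed.

Lemma f0_annulus m z : - c < complex.Re z < 0 ->
  f0 m z = sum (SB m z) + (-1) ^+ m.+1 * sum (SA m z).
Proof.
move=> /[dup] hz /andP[z1 z2]; rewrite /f0; congr (_ + _).
rewrite -hf_sum// -sumD; [|exact: summ_hf|]; last first.
  by apply: (summ_sA theta_sq tau_gt0); rewrite raddfN/=; lra.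
by apply: eq_sum => r; rewrite -sB_split.
Qed.

Lemma cexp_neq1 z : complex.Re z != 0 -> cexp z != 1.
Proof.
apply: contra_neq => e; have := nc_cexp z.
by rewrite e nc1 -[LHS](@expR0 R) => /expR_inj.
Qed.

Lemma f0N m z : complex.Re z != 0 -> f0 m (- z) = (-1) ^+ m.+1 * f0 m z.
Proof.
move=> z0; rewrite /f0 opprK hfN ?cexp_neq1//.
have := sqrr_sign C m.+1; rewrite expr2; move: ((-1) ^+ m.+1) => s ss.
by rewrite !mulrDr [s * (s * _)]mulrA ss mul1r addrAC.
Qed.

(** The shift multiplies each term of the two tails by a power of q, which turns [lam] into theta
    times itself plus a pure exponential term; the exponential series sum to values of [hf], and
    these exchange the polar part at z + T0 for theta times the one at z. *)
Lemma f0_shift m z : 0 < complex.Re z < c -> f0 m (z + T0) = theta * f0 m z.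
Proof.
move=> /andP[z1 z2].
have RzT : complex.Re (z + T0) = complex.Re z - c by rewrite raddfD/= Re_T0.
have q0 r : qpow tau (uu R r) != 0 by rewrite -nc_gt0 nc_qpow expR_gt0.
have dn r := den_neq0 theta_sq tau_gt0 r.
have th2 : theta * theta = 1 by rewrite -expr2.
have e1 r : SA m (- (z + T0)) r =
    theta * SA m (- z) r + - ((uu R r)%:C ^+ m * cexp ((z + T0) * (uu R r)%:C)).
  rewrite /sA !mulNr !opprK mulrDl cexpD cexp_T0 /lam.
  have := dn r; move: (qpow _ _) (cexp _) (_ ^+ m) => q E U d.
  have -> : theta * (U * E * (theta * q / (1 - theta * q))) = (theta * theta) * (U * E * q) / (1 - theta * q) by field.
  by rewrite th2; field.
have e2 r : SA m (z + T0) r = theta * (SA m z r + (uu R r)%:C ^+ m * cexp ((- z) * (uu R r)%:C)).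
  rewrite /sA !mulNr mulrDl opprD cexpD -[- (T0 * _)]mulNr /lam.
  have -> : cexp (- T0 * (uu R r)%:C) = (qpow tau (uu R r))^-1.
    apply: (mulfI (q0 r)); rewrite divff// -cexp_T0 -cexpD -mulrDl subrr mul0r; exact: cexp0.
  have := dn r; have := q0 r; move: (qpow _ _) (cexp _) (_ ^+ m) => q E U qn d.
  by field; rewrite ?qn ?d.
have hA w : - c < complex.Re w -> summ (SA m w) by exact: (summ_sA theta_sq tau_gt0).
have sm1 : summ (fun r => (uu R r)%:C ^+ m * cexp ((z + T0) * (uu R r)%:C)).
  by apply: summ_hf; rewrite RzT; lra.
have sm2 : summ (fun r => (uu R r)%:C ^+ m * cexp ((- z) * (uu R r)%:C)).
  by apply: summ_hf; rewrite raddfN/=; lra.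
have A1 : Az m (- (z + T0)) = theta * Az m (- z) - hf m (z + T0).
  rewrite /Az (eq_sum e1) sumD; [|apply: summZ; apply: hA|exact: summN]; last by rewrite raddfN/=; lra.
  rewrite sumZ ?sumN//; last by apply: hA; rewrite raddfN/=; lra.
  by rewrite hf_sum// RzT; lra.
have A2 : Az m (z + T0) = theta * (Az m z + hf m (- z)).
  have hz : summ (SA m z) by apply: hA; lra.
  rewrite /Az (eq_sum e2) sumZ; last exact: summD.
  by rewrite sumD// hf_sum// raddfN/=; lra.
rewrite /f0 A1 A2 hfN ?cexp_neq1 ?gt_eqF//.
have := sqrr_sign C m.+1; rewrite expr2; move: ((-1) ^+ m.+1) => s ss.
have -> : s * (theta * (Az m z + s * hf m z)) = theta * (s * Az m z) + theta * (s * s * hf m z) by ring.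
rewrite ss; ring.
Qed.

Lemma an_Az m z : - c < complex.Re z -> an (Az m) z.
Proof.
(* Half the distance to the line Re = -c: the terms are still summable at z - d, and there they are
   those at z with the factor exp(d u). *)
move=> hz; pose d := (complex.Re z + c) / 2; have d0 : 0 < d by rewrite /d; lra.
have h : summ (fun r => ((uu R r)%:C ^+ m * lam theta tau r) * cexp ((- uu R r)%:C * z) *
    (expR (d * `|- uu R r|))%:C).
  apply: summ_le (_ : summ (SA m (z - d%:C))) => [r|]; last first.
    by apply: (summ_sA theta_sq tau_gt0); rewrite raddfB/= /d; lra.
  rewrite /sA normrN gtr0_norm ?uu_gt0//.
  have -> : cexp (- ((z - d%:C) * (uu R r)%:C)) = cexp ((- uu R r)%:C * z) * (expR (d * uu R r))%:C.
    have -> : - ((z - d%:C) * (uu R r)%:C) = (- uu R r)%:C * z + (d * uu R r)%:C.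
      have -> : (- uu R r)%:C = - (uu R r)%:C :> C by rewrite rmorphN.
      have -> : (d * uu R r)%:C = d%:C * (uu R r)%:C :> C by rewrite rmorphM.
      by move: d%:C => d'; ring.
    by rewrite cexpD; congr (_ * _); rewrite /cexp /= cos0 sin0 mulr1.
  have -> : forall a b c d : C, a * b * c * d = a * (c * d) * b by move=> *; ring.
  exact: lexx.
have [a ha] : an (fun w => sum (fun r => ((uu R r)%:C ^+ m * lam theta tau r) * cexp ((- uu R r)%:C * w))) z.
  by eexists; apply: (ana_sum d0 h).
exists a; apply: ana_eq ha; exists 1 => // w _; apply: eq_sum => r.
have -> : (- uu R r)%:C * w = - (w * (uu R r)%:C) by rewrite rmorphN mulNr mulrC.
by rewrite /sA mulrAC.
Qed.

Lemma anN (f : C -> C) z : an f (- z) -> an (fun w => f (- w)) z.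
Proof.
move=> [a [[K [A [K0 A0 ha]]] [r r0 hr]]]; exists (fun k => (-1) ^+ k * a k); split.
  by exists K, A; split=> // k; rewrite ncM nc_sign mul1r.
exists r => // w hw; rewrite hr; last by rewrite -opprD ncN.
have -> : - w - - z = - (w - z) by rewrite opprB addrC opprK.
by apply: eq_sum => k; rewrite (exprNn (w - z)) mulrCA mulrA.
Qed.

Let anT m z : - c < complex.Re z < c -> an (fun w => Az m (- w) + (-1) ^+ m.+1 * Az m w) z.
Proof.
move=> /andP[z1 z2]; apply: anD; first by apply: anN; apply: an_Az; rewrite raddfN/=; lra.
by apply: anM; [exact: an_cst|exact: an_Az].
Qed.

Lemma mform_f0 m z : - c < complex.Re z < c -> mform (f0 m) z.
Proof.
move=> hz; apply: mform_eq (mformD_an (mform_hf m z) (anT m hz)).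
by exists 1 => // w _; rewrite /f0 addrA.
Qed.

Lemma an_f0 m z : - c < complex.Re z < c -> complex.Re z != 0 -> an (f0 m) z.
Proof.
move=> hz z0; apply: an_eq (anD (an_hf m (cexp_neq1 z0)) (anT m hz)).
by exists 1 => // w _; rewrite /f0 addrA.
Qed.

(* The continuation of [f0 m] to the plane by [f0_shift]. *)
Definition fT m z := let j := Num.floor (complex.Re z / c) in
  theta ^ j * f0 m (z + j%:~R * T0).

Lemma Re_shift z (j : int) : complex.Re (z + j%:~R * T0) = complex.Re z - j%:~R * c.
Proof.
rewrite raddfD /= -(rmorph_int (@real_complex R)) /=; case: T0 Re_T0 => a b /= ->.
by rewrite mul0r subr0 mulrN.
Qed.

(** Adjacent choices of j agree by [f0_shift], so one j serves on an open strip of width 2 c; with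
    the strip of the floor alone, the continuation would not be controlled near the strip
    boundaries. *)
Lemma fTE m z (j : int) : - c < complex.Re z - j%:~R * c < c ->
  fT m z = theta ^ j * f0 m (z + j%:~R * T0).
Proof.
move=> /andP[h1 h2]; rewrite /fT; have [h|h] := leP 0 (complex.Re z - j%:~R * c).
  suff -> : Num.floor (complex.Re z / c) = j by [].
  apply: floor_def; rewrite ler_pdivlMr// ltr_pdivrMr// intrD mulrDl mul1r.
  by apply/andP; split; lra.
have -> : Num.floor (complex.Re z / c) = j - 1.
  apply: floor_def; rewrite ler_pdivlMr// ltr_pdivrMr// subrK intrB mulrBl mul1r.
  by apply/andP; split; lra.
have -> : z + j%:~R * T0 = (z + (j - 1)%:~R * T0) + T0 by rewrite intrB; ring.
rewrite f0_shift; last by rewrite Re_shift intrB mulrBl mul1r; apply/andP; split; lra.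
by rewrite expfzDr ?theta_neq0// exprN1 thetaV [RHS]mulrA.
Qed.

Lemma fT_near m z (j : int) : - c < complex.Re z - j%:~R * c < c ->
  nearC z (fun w => theta ^ j * f0 m (w + j%:~R * T0) = fT m w).
Proof.
move=> /andP[h1 h2]; set x := complex.Re z - _ in h1 h2.
exists (Num.min (x + c) (c - x)); first by rewrite lt_min; apply/andP; split; lra.
move=> w; rewrite lt_min => /andP[w1 w2]; rewrite (@fTE m w j)//.
have := nc_Re_le (w - z); rewrite raddfB /= ler_norml => /andP[r1 r2].
by rewrite /x in h1 h2 w1 w2; apply/andP; split; lra.
Qed.

Lemma mform_fT m z : mform (fT m) z.
Proof.
pose j := Num.floor (complex.Re z / c).
have hj : - c < complex.Re z - j%:~R * c < c.
  have /andP[] := floor_itv (complex.Re z / c); rewrite -/j.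
  rewrite ler_pdivlMr// ltr_pdivrMr// intrD mulrDl mul1r => h1 h2.
  by apply/andP; split; lra.
apply: mform_eq (fT_near m hj) _; apply: (mform_comp (f := f0 m)).
  by rewrite expfz_neq0 ?theta_neq0.
by apply: mform_f0; rewrite Re_shift.
Qed.

Lemma fT_f0 m z : - c < complex.Re z < c -> fT m z = f0 m z.
Proof. by move=> h; rewrite (@fTE m z 0) ?mul0r ?subr0// expr0z mul1r addr0. Qed.

Lemma annulusE z : (`|qpow tau 1| < `|cexp z| < 1) = (- c < complex.Re z < 0).
Proof.
rewrite !ncE -[1 in X in _ && X]/(1%:C) !ltcR nc_qpow nc_cexp ltr_expR expR_lt1.
by rewrite mulr1 mulNr.
Qed.

Let kn n : C := (-1) ^+ n / (n.-1)`!%:R.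

Lemma Pseries_half n z : (0 < n)%N -> - c < complex.Re z < 0 ->
  Pseries theta (-1) n tau z = kn n * f0 n.-1 z.
Proof.
move=> n0 /[dup] hz /andP[z1 z2]; rewrite /Pseries twistN1 thetaV /kn f0_annulus//; congr (_ * _).
have hB : summ (SB n.-1 z) by exact: (summ_sB theta_sq tau_gt0).
have hA : summ (SA n.-1 z) by apply: (summ_sA theta_sq tau_gt0).
have eP (r : nat) : (r%:Z%:~R + 2^-1)%:C ^+ n.-1 * cexp ((r%:Z%:~R + 2^-1)%:C * z) /
    (1 - theta * qpow tau (r%:Z%:~R + 2^-1)) = SB n.-1 z r.
  by rewrite /sB /lamB mul1r [z * _]mulrC.
have eN (r : nat) : ((Negz r)%:~R + 2^-1)%:C ^+ n.-1 * cexp (((Negz r)%:~R + 2^-1)%:C * z) /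
    (1 - theta * qpow tau ((Negz r)%:~R + 2^-1)) = (-1) ^+ n * SA n.-1 z r.
  have -> : (Negz r)%:~R + 2^-1 = - uu R r.
    have -> : (Negz r)%:~R = - (r%:R + 1) :> R by rewrite NegzE mulrNz natr1.
    by rewrite /uu; lra.
  have eq1 : qpow tau (- uu R r) = (qpow tau (uu R r))^-1.
    have e0 : cexp (T0 * (uu R r)%:C) != 0 by rewrite -nc_gt0 nc_cexp expR_gt0.
    apply: (mulfI e0); rewrite -!cexp_T0 divff// -cexpD rmorphN mulrN subrr; exact: cexp0.
  rewrite eq1 /sA /lam rmorphN /= mulNr [z * _]mulrC (exprNn (uu R r)%:C).
  have := den_neq0 theta_sq tau_gt0 r.
  have : qpow tau (uu R r) != 0 by rewrite -nc_gt0 nc_qpow expR_gt0.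
  have : (-1) ^+ n = - (-1) ^+ n.-1 :> C by case: (n) n0 => // n' _; rewrite exprS mulN1r.
  have th2 : theta * theta = 1 by rewrite -expr2.
  move: (cexp _) (qpow _ _) => E q -> qn d.
  have d2 : 1 - theta / q != 0.
    apply: contra d => /eqP; move/(congr1 (fun x => theta * q * x)); rewrite mulr0 mulrBr mulr1.
    have -> : theta * q * (theta / q) = theta * theta by field.
    by rewrite th2 => /eqP; rewrite subr_eq0 => /eqP ->; rewrite subrr.
  (* A negative exponent is turned into a positive one, and theta^2 = 1 gives back the denominator
     of [lam]. *)
  have -> : (1 - theta / q)^-1 = - (theta * q / (1 - theta * q)).
    apply: (mulfI d2); rewrite divff//; symmetry.
    have -> : (1 - theta / q) * - (theta * q / (1 - theta * q)) = (theta * theta - theta * q) / (1 - theta * q) by field; rewrite ?qn ?d.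
    by rewrite th2 divff.
  by ring.
rewrite sum_int; last 2 first.
- by apply: summ_eq hB => r; rewrite eP.
- by apply: summ_eq (summZ ((-1) ^+ n) hA) => r; rewrite eN.
rewrite (eq_sum eP) (eq_sum eN) sumZ// prednK//.
Qed.

Lemma Ptwisted_spec n : (0 < n)%N -> let P := Ptwisted theta (-1) n tau in
  meromorphic P /\ forall z, `|qpow tau 1| < `|cexp z| < 1 -> P z = Pseries theta (-1) n tau z.
Proof.
move=> n0; apply: (@xgetPex _ (fun=> 0) [set f : C -> C | meromorphic f /\
  forall z, `|qpow tau 1| < `|cexp z| < 1 -> f z = Pseries theta (-1) n tau z]).
have kn0 : kn n != 0.
  by rewrite mulf_neq0 ?signr_eq0// invr_eq0 pnatr_eq0 -lt0n fact_gt0.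
exists (fun z => kn n * fT n.-1 (z + 0)); split.
  by move=> z; apply/mform_mero/(mform_comp kn0); rewrite addr0; apply: mform_fT.
move=> z; rewrite annulusE addr0 => hz; rewrite Pseries_half// fT_f0//.
by have := c_gt0; lra.
Qed.

(** The definition prescribes values in one strip only, and the identity theorem carries them to z.
    As the explicit continuation is analytic at z, [eqC_ana] gives equality at z itself and not only
    around it. *)
Lemma Ptwisted_f0 n z : (0 < n)%N -> - c < complex.Re z < c -> complex.Re z != 0 ->
  Ptwisted theta (-1) n tau z = kn n * f0 n.-1 z.
Proof.
move=> n0 hz z0; have [mP hP] := Ptwisted_spec n0; set P := Ptwisted _ _ _ _ in mP hP *.
have kn0 : kn n != 0.
  by rewrite mulf_neq0 ?signr_eq0// invr_eq0 pnatr_eq0 -lt0n fact_gt0.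
have mg y : mform (fun w => kn n * fT n.-1 (w + 0)) y.
  by apply: mform_comp => //; rewrite addr0; apply: mform_fT.
have mf y : mform P y by apply: mero_mform.
have [b hb] : an (fun w => kn n * fT n.-1 (w + 0)) z.
  apply: an_eq (anM (an_cst z (kn n)) (an_f0 n.-1 hz z0)).
  have := @fT_near n.-1 z 0; rewrite mul0r subr0 => /(_ hz); apply: nearC_imp => w.
  by rewrite expr0z mul1r mul0r !addr0 => ->.
rewrite (eqC_ana (mf z) hb); first by rewrite addr0 fT_f0.
(* -c/2 is the middle of the strip where [Pseries] fixes both functions, and the disc of radius c/2
   stays in that strip. *)
have := c_gt0 => c0; apply: (@identity _ _ _ (- (c / 2))%:C) => //.
exists (c / 2); first by lra.
move=> w hw _; rewrite addr0.
have := nc_Re_le (w - (- (c / 2))%:C); rewrite raddfB /= ler_norml => /andP[r1 r2].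
rewrite hP ?annulusE ?Pseries_half ?fT_f0//; by apply/andP; split; lra.
Qed.

Lemma Dtwisted_entD k l w : (0 < k)%N -> (0 < l)%N -> - c < complex.Re w < 0 ->
  Dtwisted theta (-1) k l tau (- w) = entD theta tau k l w.
Proof.
move=> k0 l0 /[dup] hw /andP[w1 w2].
have n0 : (0 < (k + l).-1)%N by case: k l k0 l0 => [|k] [|l] //= _ _; rewrite addnS.
have e2 : ((k + l).-1).-1 = (k.-1 + l.-1)%N by case: k l k0 l0 {n0} => [|k] [|l] //= _ _; rewrite addnS.
have rw : complex.Re w != 0 by rewrite lt_eqF.
rewrite /Dtwisted Ptwisted_f0 ?raddfN/= ?oppr_eq0//; last by apply/andP; split; lra.
rewrite f0N// f0_annulus// /kn /entD -(fact_bin k0 l0) e2 -e2.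
case: k l k0 l0 {n0 e2} => [|k] [|l] // _ _; rewrite /= addSn addnS /= !exprS exprD.
have := sqrr_sign C k; have := sqrr_sign C l; rewrite !expr2.
move: (sum _) (sum _) ('C(_, _)%:R) (_^-1) ((-1) ^+ k) ((-1) ^+ l) => x y b f s t tt ss.
transitivity (s * (t * t) * (s * s) * b * f * y - (s * s) * (s * s) * (t * t) * t * b * f * x); first by ring.
by rewrite ss tt; ring.
Qed.

Lemma Dtwisted_anti k l w : (0 < k)%N -> (0 < l)%N -> - c < complex.Re w < c ->
  complex.Re w != 0 -> Dtwisted theta (-1) l k tau w = - Dtwisted theta (-1) k l tau (- w).
Proof.
move=> k0 l0 hw w0; rewrite /Dtwisted [(l + k)%N]addnC.
have n0 : (0 < (k + l).-1)%N by case: k l k0 l0 => [|k] [|l] //= _ _; rewrite addnS.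
have -> : 'C(k + l - 2, l.-1) = 'C(k + l - 2, k.-1).
  rewrite -[in RHS]bin_sub; first by congr 'C(_, _); lia.
  lia.
rewrite !Ptwisted_f0 ?raddfN/= ?oppr_eq0//; last by have /andP[] := hw => ? ?; apply/andP; split; lra.
rewrite f0N// prednK// !mulrA -!mulNr; congr (_ * _); rewrite /kn.
case: k l k0 l0 {n0} => [|k] [|l] // _ _; rewrite /= addSn addnS /= !exprS exprD.
have := sqrr_sign C k; have := sqrr_sign C l; rewrite !expr2.
move: ('C(_, _)%:R) (_^-1) ((-1) ^+ k) ((-1) ^+ l) => b f s t tt ss.
transitivity (- (t * t) * s * b * f); first by ring.
transitivity (- (s * s) * (t * t) * s * b * f); last by ring.
by rewrite tt ss; ring.
Qed.

End Twisted.

(** * The Pfaffian formula *)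

Lemma subseq_del (A : eqType) j (s : seq A) : subseq (del j s) s.
Proof.
rewrite -[X in subseq _ X](cat_take_drop j) /del; apply: cat_subseq => //.
by rewrite -add1n -drop_drop; apply: drop_subseq.
Qed.

(** The list Pfaffian reads only entries above the diagonal, and deletion keeps the order of the
    list. *)
Lemma eq_pf_pairwise (K : comPzRingType) (A : eqType) (e e' : A -> A -> K) s :
  pairwise (fun x y => e x y == e' x y) s -> pf e s = pf e' s.
Proof.
rewrite /pf; move: (size s) => n; elim: n s => [|n IH] [|x s] //= /andP[/allP h pw].
apply: eq_bigr => j _; rewrite (eqP (h _ (mem_nth x (ltn_ord j)))) IH//.
exact: subseq_pairwise (subseq_del j s) pw.
Qed.

Section PfaffianFormula.
Variables (R : realType) (theta tau : R[i]).
Notation C := (R[i]).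
Hypothesis theta_sq : theta ^+ 2 = 1.
Hypothesis tau_gt0 : 0 < complex.Im tau.

Definition entry (x y : C * nat) : C :=
  if x.1 == y.1 then Ctwisted theta (-1) x.2 y.2 tau
  else Dtwisted theta (-1) x.2 y.2 tau (x.1 - y.1).

Lemma entry_ent (x y : C * nat) : (0 < x.2)%N -> (0 < y.2)%N -> (x.1 == y.1) || sep tau x.1 y.1 ->
  entry x y = ent theta tau x y.
Proof.
move=> x0 y0; rewrite /entry /ent [y.1 == _]eq_sym; case: eqP => [_ _|_ /= s].
  exact: Ctwisted_entC.
by rewrite -opprB Dtwisted_entD.
Qed.

Lemma pf_entry (L : seq (C * seq nat)) : pairwise (sep tau) (map fst L) -> pos_blocks L ->
  pf entry (lab L) = pf (ent theta tau) (lab L).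
Proof.
move=> pw pos; apply: eq_pf_pairwise.
have labP (L' : seq (C * seq nat)) x : pos_blocks L' -> x \in lab L' ->
    (0 < x.2)%N /\ x.1 \in map fst L'.
  move=> pos' /flattenP[s /mapP[b bL ->] /mapP[k kb ->]] /=.
  by have /allP/(_ _ bL)/allP/(_ _ kb) := pos'; split=> //; apply: map_f.
elim: L pw pos => [|b L IH] //= /andP[/allP sb pw] /andP[/allP posb pos].
rewrite lab_cons pairwise_cat IH// andbT; apply/andP; split.
  apply/allrelP => x y /mapP[k kb ->] /(labP _ _ pos)[y0 yL] /=.
  by rewrite entry_ent//= ?posb// sb ?orbT.
rewrite pairwise_map; elim: (b.2) posb => [|k s IHs] h //=; apply/andP; split.
  apply/allP => l ls /=; rewrite entry_ent//= ?eqxx// h// inE ?eqxx ?ls ?orbT//.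
by apply: IHs => l ls; apply: h; rewrite inE ls orbT.
Qed.

Variables (n : nat) (k : 'I_n -> seq nat) (z : 'rV[C]_n).
Hypothesis k_incr : forall a, path ltn 0%N (k a).
Hypothesis z_dom : npoint_domain z tau.

Lemma nth_pos a (i : 'I_(size (k a))) : (0 < nth 0 (k a) i)%N.
Proof. by apply: (fock_pos (k_incr a)); apply: mem_nth. Qed.

Lemma domain_Re a b : a != b -> complex.Re (z 0 a - z 0 b) != 0 /\
  - (2 * pi * complex.Im tau) < complex.Re (z 0 a - z 0 b) < 2 * pi * complex.Im tau.
Proof.
wlog ab : a b / (b < a)%N.
  move=> h ne; case: (ltngtP a b) => [ab|ab|/val_inj e]; [|exact: h|by rewrite e eqxx in ne].
  have [] := h b a ab; first by rewrite eq_sym.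
  rewrite -[z 0 a - _]opprB raddfN/= oppr_eq0 => -> /andP[h1 h2]; split=> //.
  by apply/andP; split; lra.
move=> _; have := z_dom.2 _ _ ab; rewrite annulusE => /andP[h1 h2].
have c0 : 0 < 2 * pi * complex.Im tau by rewrite !mulr_gt0 ?pi_gt0.
by split; [rewrite lt_eqF|apply/andP; split; lra].
Qed.

(** [pf_matrix] compares block numbers while [entry] compares points; different blocks have
    different points in the domain. *)
Lemma pf_matrixE s t : pf_matrix theta (-1) k z tau s t =
  entry (z 0 (tagnat.sig1 s), nth 0%N (k (tagnat.sig1 s)) (tagnat.sig2 s))
        (z 0 (tagnat.sig1 t), nth 0%N (k (tagnat.sig1 t)) (tagnat.sig2 t)).
Proof.
rewrite /pf_matrix /mxblock !mxE /entry /=; have [e|ne] := eqVneq (tagnat.sig1 s) (tagnat.sig1 t).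
  by rewrite ifT// e.
rewrite ifF//; apply/negbTE; have [+ _] := domain_Re ne; apply: contra => /eqP ->.
by rewrite subrr.
Qed.

Lemma pf_matrix_tr : (pf_matrix theta (-1) k z tau)^T = - pf_matrix theta (-1) k z tau.
Proof.
apply/matrixP => s t; rewrite mxE [RHS]mxE /pf_matrix /mxblock !mxE [tagnat.sig1 t == _]eq_sym.
case: eqVneq => [_|ne]; first by rewrite entC_anti ?nth_pos.
have [h1 h2] := domain_Re ne; rewrite -[z 0 (tagnat.sig1 t) - _]opprB.
have -> : z 0 (tagnat.sig1 s) - z 0 (tagnat.sig1 t) = - (z 0 (tagnat.sig1 t) - z 0 (tagnat.sig1 s)) by rewrite opprB.
rewrite opprK.
by rewrite Dtwisted_anti ?nth_pos// -opprB raddfN/= ?oppr_eq0//; have /andP[? ?] := h2; apply/andP; split; lra.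
Qed.

Lemma Pfaffian_pf_matrix : ~~ odd (\sum_(a < n) size (k a)) ->
  Pfaffian (pf_matrix theta (-1) k z tau) =
  pf (ent theta tau) (lab [seq (z 0 a, k a) | a <- enum 'I_n]).
Proof.
move=> oN; rewrite (Pfaffian_labels pf_matrixE oN) pf_entry//.
  by rewrite -map_comp; apply: domain_sep.
rewrite /pos_blocks all_map; apply/allP => a _ /=; apply/allP => i.
exact: (fock_pos (k_incr a)).
Qed.

End PfaffianFormula.

(** * Power series in several variables *)

Section MultiSeries.
Variable R : realType.
Notation C := (R[i]).

Lemma es_hs (I : choiceType) (f : I -> R) (M : R) : (forall i, 0 <= f i) ->
  hs (fun i => (f i)%:C) M%:C -> (es (fun i => (f i)%:E) <= M%:E)%E.
Proof.
move=> f0 hf; apply: es_ub => A; rewrite sumEFin lee_fin; apply/ler_addgt0Pr => e e0.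
have [B hB] := hf e e0; have := hB (A `|` B)%fset (fsubsetUr _ _).
rewrite -rmorph_sum -rmorphB nc_real => hAB.
apply: le_trans (_ : \sum_(i <- (A `|` B)%fset) f i <= _); last first.
  by rewrite -lerBlDl; apply: le_trans hAB; rewrite ler_norm.
rewrite [leRHS](big_fsetID _ (mem A))/= (_ : [fset x | x in (A `|` B) & x \in A]%fset = A).
  by rewrite lerDl sumr_ge0.
by apply/fsetP => x; rewrite !inE; case: (x \in A); rewrite ?andbF.
Qed.

Definition ffun_cons n (x : nat * {ffun 'I_n -> nat}) : {ffun 'I_n.+1 -> nat} :=
  [ffun i => if unlift ord0 i is Some j then x.2 j else x.1].

Lemma ffun_cons0 n x : @ffun_cons n x ord0 = x.1.
Proof. by rewrite ffunE unlift_none. Qed.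

Lemma ffun_consS n x j : @ffun_cons n x (lift ord0 j) = x.2 j.
Proof. by rewrite ffunE liftK. Qed.

Lemma ffun_cons_bij n : bijective (@ffun_cons n).
Proof.
exists (fun al : {ffun 'I_n.+1 -> nat} => (al ord0, [ffun j => al (lift ord0 j)])) => [[k be]|al].
  by congr (_, _); [rewrite ffun_cons0|apply/ffunP => j; rewrite ffunE ffun_consS].
apply/ffunP => i; case: (unliftP ord0 i) => [j|] ->; first by rewrite ffun_consS ffunE.
by rewrite ffun_cons0.
Qed.

Lemma summ_sum_ffun n (u : 'I_n -> nat -> C) : (forall a, summ (u a)) ->
  summ (fun al : {ffun 'I_n -> nat} => \prod_(a < n) u a (al a)) /\
  sum (fun al : {ffun 'I_n -> nat} => \prod_(a < n) u a (al a)) = \prod_(a < n) sum (u a).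
Proof.
elim: n u => [|n IH] u hu.
  pose e : {ffun 'I_0 -> nat} := [ffun=> 0%N].
  have h al : al = e by apply/ffunP => -[].
  split; last by rewrite (@sum_single _ _ e) ?big_ord0// => al; rewrite (h al) eqxx.
  rewrite /summ /asum (@es_single _ _ e) ?lee_fin ?nc_ge0 ?ltry// => al.
  by rewrite (h al) eqxx.
have [s1 e1] := IH (fun a => u (lift ord0 a)) (fun a => hu _).
have e al : \prod_(a < n.+1) u a (ffun_cons al a) =
    u ord0 al.1 * \prod_(a < n) u (lift ord0 a) (al.2 a).
  by rewrite big_ord_recl ffun_cons0; congr (_ * _); apply: eq_bigr => a _; rewrite ffun_consS.
have s2 := summ_prod (hu ord0) s1.
have s3 : summ (fun al : {ffun 'I_n.+1 -> nat} => \prod_(a < n.+1) u a (al a)).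
  by apply/(summ_bij _ (ffun_cons_bij n)); apply: summ_eq s2 => al; rewrite e.
split=> //; rewrite -(sum_bij (ffun_cons_bij n) s3) (eq_sum e) (sum_prod (hu ord0) s1) e1.
by rewrite big_ord_recl.
Qed.

Definition nearV n (z : 'rV[C]_n) (P : 'rV[C]_n -> Prop) :=
  exists2 d : R, 0 < d & forall w : 'rV[C]_n, (forall a, nc (w 0 a - z 0 a) < d) -> P w.

Lemma nbhs_nearV n (z : 'rV[C]_n) P : nearV z P -> \forall w \near z, P w.
Proof.
move=> [d d0 h]; exists (fun i j => [set w : C | nc (w - z i j) < d]).
  by move=> i j; apply/nbhs_nearC; exists d.
by move=> w hw; apply: h => a; apply: hw.
Qed.

Definition hsan n (f : 'rV[C]_n -> C) z := exists a : {ffun 'I_n -> nat} -> C,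
  nearV z (fun w => hs (fun al : {ffun 'I_n -> nat} => a al * monomial (w - z) al) (f w)).

Lemma hsan_analytic n (f : 'rV[C]_n -> C) z : hsan f z -> analytic_at f z.
Proof.
move=> [a h]; exists a; apply: nbhs_nearV; case: h => d d0 h.
by exists d => // w hw; apply/hs_cvg/h.
Qed.

Lemma nearV2 n (z : 'rV[C]_n) (P Q S : 'rV[C]_n -> Prop) : (forall w, P w -> Q w -> S w) ->
  nearV z P -> nearV z Q -> nearV z S.
Proof.
move=> h [d d0 hd] [e e0 he]; exists (Num.min d e); first by rewrite lt_min d0.
move=> w hw; apply: h; [apply: hd => a|apply: he => a]; have := hw a; rewrite lt_min; by case/andP.
Qed.

Lemma hsan_eq n (f g : 'rV[C]_n -> C) z : nearV z (fun w => f w = g w) -> hsan f z -> hsan g z.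
Proof. by move=> e [a h]; exists a; apply: nearV2 e h => w ->. Qed.

Lemma hsanD n (f g : 'rV[C]_n -> C) z : hsan f z -> hsan g z -> hsan (fun w => f w + g w) z.
Proof.
move=> [a ha] [b hb]; exists (fun al => a al + b al); apply: nearV2 ha hb => w h1 h2.
by apply: hs_eq (hsD h1 h2) => al; rewrite mulrDl.
Qed.

Lemma hsanZ n c (f : 'rV[C]_n -> C) z : hsan f z -> hsan (fun w => c * f w) z.
Proof.
move=> [a [d d0 h]]; exists (fun al => c * a al); exists d => // w /h h1.
by apply: hs_eq (hsZ c h1) => al; rewrite mulrA.
Qed.

Lemma hsan_sum n (I : Type) (s : seq I) (f : I -> 'rV[C]_n -> C) z : (forall i, hsan (f i) z) ->
  hsan (fun w => \sum_(i <- s) f i w) z.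
Proof.
move=> h; elim: s => [|i s IH].
  exists (fun=> 0), 1 => // w _; rewrite big_nil.
  by apply: hs_eq (@hs0 R _) => al; rewrite mul0r.
by apply: hsan_eq (hsanD (h i) IH); exists 1 => // w _; rewrite big_cons.
Qed.

(** The argument of [ana_sum] in several variables: expand every exponential at z and exchange the
    sums over exponents and over [I], the factors with [d] giving absolute convergence. *)
Lemma hsan_exp (I : choiceType) n (c : I -> C) (s : I -> 'I_n -> R) (z : 'rV[C]_n) (d : R) :
  0 < d ->
  summ (fun i => c i * \prod_(a < n) cexp ((s i a)%:C * z 0 a) *
    (\prod_(a < n) expR (d * `|s i a|))%:C) ->
  hsan (fun w => sum (fun i => c i * \prod_(a < n) cexp ((s i a)%:C * w 0 a))) z.
Proof.
move=> d0; have [c' c'E] : exists c', c' = fun i => c i * \prod_(a < n) cexp ((s i a)%:C * z 0 a).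
  by eexists.
move=> h0; have hc : summ (fun i => c' i * (\prod_(a < n) expR (d * `|s i a|))%:C) by rewrite c'E.
pose mu i (al : {ffun 'I_n -> nat}) : C := \prod_(a < n) ((s i a)%:C ^+ al a / (al a)`!%:R).
pose D i := \prod_(a < n) expR (d * `|s i a|).
have D0 i : 0 <= D i by apply: prodr_ge0 => a _; exact: expR_ge0.
have term (k : nat) (x : R) : 0 <= x -> x ^+ k / k`!%:R <= expR x.
  move=> x0; rewrite -lee_fin; apply: le_trans (es_expR x0).
  exact: (es_term (fun k => (x ^+ k / k`!%:R)%:E)).
have nc_prod (F : 'I_n -> C) : nc (\prod_(a < n) F a) = \prod_(a < n) nc (F a).
  by apply: (big_morph (@nc R) (@ncM R)); apply: nc1.
have hk al : summ (fun i => c' i * mu i al).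
  apply: summ_le (summZ (\prod_(a < n) d^-1 ^+ al a)%:C hc) => i.
  rewrite ncM [leRHS]ncM [in leRHS]ncM [leRHS]mulrCA ler_wpM2l ?nc_ge0// !nc_real.
  have := D0 i; rewrite {1}/D => Di; rewrite (ger0_norm Di).
  rewrite ger0_norm; last by apply: prodr_ge0 => a _; rewrite exprn_ge0 ?invr_ge0 ?(ltW d0).
  rewrite nc_prod -big_split /=; apply: ler_prod => a _; rewrite nc_ge0 /=.
  rewrite ncM ncV ncX nc_real nc_nat.
  have := term (al a) (d * `|s i a|); rewrite mulr_ge0 ?(ltW d0)// => /(_ isT).
  move=> /(ler_wpM2l (_ : 0 <= d^-1 ^+ al a)); rewrite exprn_ge0 ?invr_ge0 ?(ltW d0)// => /(_ isT).
  by apply: le_trans; rewrite mulrA -exprMn mulrA mulVf ?mul1r// gt_eqF.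
exists (fun al => sum (fun i => c' i * mu i al)); exists d => // w hw.
pose h := w - z; have hwa a : nc (h 0 a) < d by rewrite /h !mxE.
have E i : summ (fun al : {ffun 'I_n -> nat} => mu i al * monomial h al) /\
   sum (fun al : {ffun 'I_n -> nat} => mu i al * monomial h al) = \prod_(a < n) cexp ((s i a)%:C * h 0 a).
  have [s1 s2] := summ_sum_ffun (fun a : 'I_n => summ_exp ((s i a)%:C * h 0 a)).
  have e (al : {ffun 'I_n -> nat}) : \prod_(a < n) (((s i a)%:C * h 0 a) ^+ al a / (al a)`!%:R) = mu i al * monomial h al.
    by rewrite /mu /monomial -big_split /=; apply: eq_bigr => a _; rewrite exprMn mulrAC.
  split; first by apply: summ_eq s1 => al; rewrite e.
  by rewrite -(eq_sum e) s2; apply: eq_bigr => a _; rewrite sum_cexp.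
have big : summ (fun x : {ffun 'I_n -> nat} * I => c' x.2 * (mu x.2 x.1 * monomial h x.1)).
  have : summ (fun x : I * {ffun 'I_n -> nat} => c' x.1 * (mu x.1 x.2 * monomial h x.2)).
    rewrite /summ asum_pair; apply: le_lt_trans hc; apply: le_es => i.
    rewrite (asumZ (c' i) (fun al : {ffun 'I_n -> nat} => mu i al * monomial h al)) ncM EFinM.
    rewrite lee_wpmul2l ?lee_fin ?nc_ge0// nc_real (ger0_norm (D0 i)).
    have sx a : summ (fun k : nat => (`|s i a| * d)%:C ^+ k / k`!%:R : C) by exact: summ_exp.
    have [t1 t2] := summ_sum_ffun sx.
    have t0 (al : {ffun 'I_n -> nat}) : \prod_(a < n) ((`|s i a| * d)%:C ^+ al a / (al a)`!%:R : C) =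
        (\prod_(a < n) ((`|s i a| * d) ^+ al a / (al a)`!%:R))%:C.
      by rewrite rmorph_prod; apply: eq_bigr => a _; rewrite /= fmorph_div rmorphXn rmorph_nat.
    have p0 (al : {ffun 'I_n -> nat}) : 0 <= \prod_(a < n) ((`|s i a| * d) ^+ al a / (al a)`!%:R).
      by apply: prodr_ge0 => a _; rewrite divr_ge0 ?exprn_ge0 ?mulr_ge0 ?(ltW d0).
    apply: le_trans (_ : asum (fun al : {ffun 'I_n -> nat} => (\prod_(a < n) ((`|s i a| * d)%:C ^+ al a / (al a)`!%:R : C))%R) <= _)%E.
      apply: le_es => al; rewrite lee_fin t0 nc_real ger0_norm//.
      rewrite /mu /monomial -big_split nc_prod; apply: ler_prod => a _; rewrite nc_ge0 /=.
      rewrite !ncM !ncX ncV nc_nat nc_real exprMn mulrAC ler_wpM2r ?invr_ge0//.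
      by rewrite ler_wpM2l ?exprn_ge0// lerXn2r ?nnegrE ?nc_ge0 ?(ltW d0)// ltW.
    rewrite /asum (eq_es (b := fun al : {ffun 'I_n -> nat} => (\prod_(a < n) ((`|s i a| * d) ^+ al a / (al a)`!%:R))%:E)) => [|al].
      apply: es_hs => //; have := summ_sumP t1; rewrite t2.
      have -> : \prod_(a < n) sum (fun k : nat => (`|s i a| * d)%:C ^+ k / k`!%:R : C) = (D i)%:C.
        rewrite /D rmorph_prod; apply: eq_bigr => a _; rewrite sum_cexp mulrC /cexp /=.
        by rewrite cos0 sin0 mulr1.
      by apply: hs_eq => al; rewrite t0.
    by rewrite t0 nc_real ger0_norm.
  by move=> /summ_swap.
have hf : sum (fun i => c i * \prod_(a < n) cexp ((s i a)%:C * w 0 a)) =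
    sum (fun x : {ffun 'I_n -> nat} * I => c' x.2 * (mu x.2 x.1 * monomial h x.1)).
  have big' := summ_swap big; rewrite -(sum_swap big) (sum_fubini big') /=; apply: eq_sum => i.
  have [s1 s2] := E i; rewrite sumZ// s2 c'E -mulrA -big_split /=; congr (_ * _).
  by apply: eq_bigr => a _; rewrite -cexpD -mulrDr /h !mxE [z 0 a + _]addrC subrK.
rewrite hf; apply: hs_eq (hs_fubini big) => al /=.
rewrite [RHS]mulrC -sumZ//; apply: eq_sum => i; by rewrite mulrA mulrC.
Qed.

End MultiSeries.

(** * Local uniform domination *)

Section LocalDomination.
Variables (R : realType) (n : nat).
Notation C := (R[i]).
Implicit Types (I : choiceType) (z : 'rV[C]_n) (tau : C).

(** Domination is joint in z and tau, because the compact sets of the statement lie in their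
    product. *)
Definition locdom I (t : 'rV[C]_n -> C -> I -> C) z0 tau0 := exists d : R, exists B : I -> R,
  [/\ 0 < d, forall i, 0 <= B i, (es (fun i => (B i)%:E) < +oo)%E &
   forall z tau, (forall a, nc (z 0 a - z0 0 a) < d) -> nc (tau - tau0) < d ->
     forall i, nc (t z tau i) <= B i].

Lemma locdom_eq I (t u : 'rV[C]_n -> C -> I -> C) z0 tau0 : (forall z tau i, t z tau i = u z tau i) ->
  locdom t z0 tau0 -> locdom u z0 tau0.
Proof.
by move=> e [d [B [d0 B0 sB h]]]; exists d, B; split=> // z tau hz ht i; rewrite -e; apply: h.
Qed.

Lemma locdomD I (t u : 'rV[C]_n -> C -> I -> C) z0 tau0 : locdom t z0 tau0 -> locdom u z0 tau0 ->
  locdom (fun z tau i => t z tau i + u z tau i) z0 tau0.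
Proof.
move=> [d [B [d0 B0 sB h]]] [e [D [e0 D0 sD h']]].
exists (Num.min d e), (fun i => B i + D i); split.
- by rewrite lt_min d0.
- by move=> i; rewrite addr_ge0.
- rewrite (eq_es (b := fun i => (B i)%:E + (D i)%:E)%E)//.
  by rewrite es_D ?lte_add_pinfty// => i; rewrite lee_fin.
move=> z tau hz; rewrite lt_min => /andP[t1 t2] i; apply: le_trans (le_ncD _ _) _.
by apply: lerD; [apply: h|apply: h'] => // a; have := hz a; rewrite lt_min => /andP[].
Qed.

Lemma locdomZ I c (t : 'rV[C]_n -> C -> I -> C) z0 tau0 : locdom t z0 tau0 ->
  locdom (fun z tau i => c * t z tau i) z0 tau0.
Proof.
move=> [d [B [d0 B0 sB h]]]; exists d, (fun i => nc c * B i); split=> //.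
- by move=> i; rewrite mulr_ge0 ?nc_ge0.
- rewrite (eq_es (b := fun i => (nc c)%:E * (B i)%:E)%E)// es_Zl ?nc_ge0//.
  by rewrite lte_mul_pinfty ?lee_fin ?nc_ge0.
by move=> z tau hz ht i; rewrite ncM ler_wpM2l ?nc_ge0// h.
Qed.

Lemma locdom_sum I (J : Type) (s : seq J) (t : J -> 'rV[C]_n -> C -> I -> C) z0 tau0 :
  (forall j, locdom (t j) z0 tau0) -> locdom (fun z tau i => \sum_(j <- s) t j z tau i) z0 tau0.
Proof.
move=> h; elim: s => [|j s IH].
  exists 1, (fun=> 0); split=> // [|z tau _ _ i]; last by rewrite big_nil nc0.
  by have := @summ0 R I; rewrite /summ /asum nc0.
by apply: locdom_eq (locdomD (h j) IH) => z tau i; rewrite big_cons.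
Qed.

Lemma locdom_summ I (t : 'rV[C]_n -> C -> I -> C) z0 tau0 : locdom t z0 tau0 ->
  nearV z0 (fun z => summ (t z tau0)).
Proof.
move=> [d [B [d0 B0 sB h]]]; exists d => // z hz; apply: le_lt_trans sB; apply: le_es => i.
by rewrite lee_fin; apply: h => //; rewrite subrr nc0.
Qed.

(** Compactness is used in its near-covering form along the filter of finite index sets: locally the
    tail of the dominating series is small, and finitely many localities suffice. *)
Lemma locdom_unif I (t : 'rV[C]_n -> C -> I -> C) (K : set ('rV[C]_n * C)) : compact K ->
  (forall x, K x -> locdom t x.1 x.2) -> abs_unif_summable_on (fun x => t x.1 x.2) K.
Proof.
move=> /compact_near_coveringP hK h e e0.
pose P (A : {fset I}) (x : 'rV[C]_n * C) := forall B : {fset I}, [disjoint A & B]%fset ->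
  partial_sum (fun i => `|t x.1 x.2 i|) B < e.
suff [A _ hA] : \forall A \near totally, K `<=` P A.
  by exists A => B dAB x Kx; apply: (hA A) dAB => //; apply: fsubset_refl.
apply: (hK _ totally P totally_filter) => x Kx; have [d [D [d0 D0 sD hD]]] := h x Kx.
have e1 : 0 < complex.Re e by move: e0; rewrite ltcE => /andP[].
have sD' : summ (fun i => (D i)%:C : C).
  apply: le_lt_trans sD; apply: le_es => i; by rewrite lee_fin nc_real ger0_norm.
have [A hA] := summ_tail sD' (divr_gt0 e1 (ltr0n _ 2)).
exists ([set y : 'rV[C]_n * C | (forall a, nc (y.1 0 a - x.1 0 a) < d) /\ nc (y.2 - x.2) < d],
        [set A' : {fset I} | (A `<=` A')%fset]) => /=.
  split; last by exists A.
  exists ([set z : 'rV[C]_n | forall a, nc (z 0 a - x.1 0 a) < d], [set w : C | nc (w - x.2) < d]).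
    split=> /=; first by apply: nbhs_nearV; exists d.
    by apply/nbhs_nearC; exists d.
  by move=> [z w] [].
move=> [[z w] A'] /= [[hz hw] AA'] B dB.
have dAB : [disjoint A & B]%fset by apply: fdisjointWl dB.
rewrite /= /partial_sum -(big_seq_fsetE _ _ predT (fun i => `|t z w i|))/=.
under eq_bigr do rewrite ncE.
rewrite -rmorph_sum ltcE /= (ger0_Im (ltW e0)) eqxx /=.
apply: le_lt_trans (_ : complex.Re e / 2 < _); last by lra.
apply: le_trans (hA B dAB); apply: ler_sum => i _.
by rewrite nc_real ger0_norm//; apply: (hD z w).
Qed.

End LocalDomination.

Lemma sum_sumr_in (R : realType) (I : choiceType) (J : eqType) (s : seq J) (u : J -> I -> R[i]) :
  (forall j, j \in s -> summ (u j)) ->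
  sum (fun i => \sum_(j <- s) u j i) = \sum_(j <- s) sum (u j).
Proof.
move=> h; have [//] : summ (fun i => \sum_(j <- s) u j i) /\
  sum (fun i => \sum_(j <- s) u j i) = \sum_(j <- s) sum (u j).
elim: s h => [|j s IH] h.
  by split; [apply: summ_eq (@summ0 R I) => i|rewrite sum0 ?big_nil// => i]; rewrite big_nil.
have [s1 e1] := IH (fun i is_ => h i (ltac:(by rewrite inE is_ orbT))).
have sj := h j (mem_head j s).
rewrite big_cons -e1 -sumD//; split; first by apply: summ_eq (summD sj s1) => i; rewrite big_cons.
by apply: eq_sum => i; rewrite big_cons.
Qed.

(** * Analyticity and uniform convergence of the n-point function *)

Section Regularity.
Variables (R : realType) (V : vosa_data R) (psi : V).
Hypothesis fermion : rank_one_fermion psi.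
Notation C := (R[i]).
Variables (theta : C) (g : V -> V) (n : nat).
Hypothesis theta_sq : theta ^+ 2 = 1.
Hypothesis g_theta : g = idfun /\ theta = 1 \/ g = sigma V /\ theta = -1.
Notation fk k := (fock psi (val k)).
Notation coord := (fock_coord psi).
Notation wt k := (fock_weight R (val k)).
Notation idx := ({ffun 'I_n -> int} * fock_index)%type.
Notation term := (npoint_term psi g).
Implicit Types (v : 'I_n -> V) (z : 'rV[C]_n) (J : 'I_n -> fock_index) (x : idx).

Lemma npoint_summ v z tau : npoint_domain z tau -> summ (term v z tau).
Proof.
move=> /[dup] hd [t0 _]; have hs : summ (Tt psi theta tau (slots_of psi v z)).
  have -> : slots_of psi v z = [seq sl psi y.1 y.2 | y <- [seq (z 0 a, v a) | a <- enum 'I_n]].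
    by rewrite /slots_of -map_comp.
  by apply: dom_summ => //; rewrite -map_comp; apply/dom_sep/domain_sep.
apply: summ_eq (npoint_termE fermion tau g_theta v z) _.
exact: (summ_inj (@idx_of_inj n) hs).
Qed.

Lemma expL0_fk y (j : fock_index) : expL0 psi y (fk j) = cexp (y * (wt j)%:C) *: fk j.
Proof.
apply: (coord_ext fermion) => l; rewrite (coord_expL0 fermion) (coordZ fermion) !(coord_fk fermion).
by case: eqP => [->|]; rewrite ?mul1r ?mulr1 ?mul0r ?mulr0.
Qed.

(** For Fock vectors each term is a constant times pure exponentials in the z_a; [kcoef] is the part
    independent of z and tau, and [expo] gives the real exponents. *)
Definition kcoef J x : C := (- theta) ^+ size (val x.2) *
  coord (foldr (fun a w => mode (fk (J a)) (x.1 a) w) (fk x.2) (enum 'I_n)) x.2.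
Definition expo J x a : R := wt (J a) + (- x.1 a - 1)%:~R.

Lemma term_fock J z tau x : term (fun a => fk (J a)) z tau x =
  kcoef J x * \prod_(a < n) cexp ((expo J x a)%:C * z 0 a) * qpow tau (wt x.2 - 48%:R^-1).
Proof.
rewrite /npoint_term (str_termE fermion tau g_theta) /tr /kcoef.
have -> : foldr (fun a w => mode (expL0 psi (z 0 a) (fk (J a))) (x.1 a) w) (fk x.2) (enum 'I_n) =
    (\prod_(a < n) cexp (z 0 a * (wt (J a))%:C)) *:
    foldr (fun a w => mode (fk (J a)) (x.1 a) w) (fk x.2) (enum 'I_n).
  rewrite -big_enum; elim: (enum 'I_n) => [|a s IH] /=; first by rewrite big_nil scale1r.
  by rewrite big_cons IH expL0_fk (modeZl fermion) (modeZr fermion) scalerA.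
rewrite (coordZ fermion).
have -> : \prod_(a < n) cexp ((expo J x a)%:C * z 0 a) =
    \prod_(a < n) cexp (z 0 a * (wt (J a))%:C) * \prod_(a < n) cexp (z 0 a) ^ (- x.1 a - 1).
  rewrite -big_split; apply: eq_bigr => a _ /=; rewrite cexp_exprz -cexpD -mulrDr mulrC.
  by rewrite /expo rmorphD /= rmorph_int.
move: (\prod_(a < n) _) (\prod_(a < n) _) (coord _ _) (qpow _ _) (_ ^+ _) => P P' c Q A.
by ring.
Qed.

Lemma nc_term_fock J z tau x : nc (term (fun a => fk (J a)) z tau x) =
  nc (kcoef J x) * \prod_(a < n) expR (expo J x a * complex.Re (z 0 a)) *
  expR (- (2 * pi * (wt x.2 - 48%:R^-1)) * complex.Im tau).
Proof.
rewrite term_fock ncM ncM nc_qpow; congr (_ * _ * _).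
have -> : nc (\prod_(a < n) cexp ((expo J x a)%:C * z 0 a)) =
    \prod_(a < n) nc (cexp ((expo J x a)%:C * z 0 a)).
  by apply: (big_morph (@nc R) (@ncM R)); apply: nc1.
apply: eq_bigr => a _; rewrite nc_cexp; congr expR.
by case: (z 0 a) => b c /=; rewrite mul0r subr0.
Qed.

(** The corners of a box in the real directions; the modulus of an exponential inside is at most the
    sum of its moduli at the corners. *)
Definition shiftz z (d : R) (e : {ffun 'I_n -> bool}) : 'rV[C]_n :=
  \row_a (z 0 a + (if e a then d else - d)%:C).

Lemma fin_delta (I : finType) (P : I -> R -> Prop) :
  (forall i, exists2 d, 0 < d & forall e, 0 < e <= d -> P i e) ->
  exists2 d, 0 < d & forall i, P i d.
Proof.
move=> h; suff [d d0 hd] : exists2 d, 0 < d & forall e, 0 < e <= d -> forall i, i \in enum I -> P i e.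
  by exists d => // i; apply: (hd d); rewrite ?d0 ?lexx// mem_enum.
elim: (enum I) => [|i s [d d0 hd]]; first by exists 1.
have [e e0 he] := h i; exists (Num.min d e); first by rewrite lt_min d0.
move=> r /andP[r0]; rewrite le_min => /andP[rd re] j; rewrite inE => /orP[/eqP ->|js].
  by apply: he; rewrite r0.
by apply: hd; rewrite ?r0.
Qed.

(** Both points of a difference move by d, and Im tau drops by d, hence the margins 2 d and 2 d + 2
    pi d in the strict inequalities of the domain. *)
Lemma domain_shift z tau : npoint_domain z tau -> exists2 d : R, 0 < d &
  forall e, npoint_domain (shiftz z d e) (0 +i* (complex.Im tau - d)).
Proof.
move=> [t0 hd]; have pi0 := pi_gt0 R.
have [d d0 h] : exists2 d : R, 0 < d & forall ij : option ('I_n * 'I_n), d < complex.Im tau /\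
    forall i j, ij = Some (i, j) -> (j < i)%N ->
    [/\ 2 * d < - complex.Re (z 0 i - z 0 j) &
        2 * d + 2 * pi * d < complex.Re (z 0 i - z 0 j) + 2 * pi * complex.Im tau].
  apply: (@fin_delta (option ('I_n * 'I_n)) (fun ij d => d < complex.Im tau /\ forall i j,
    ij = Some (i, j) -> (j < i)%N -> [/\ 2 * d < - complex.Re (z 0 i - z 0 j) &
    2 * d + 2 * pi * d < complex.Re (z 0 i - z 0 j) + 2 * pi * complex.Im tau])) => -[[i j]|]; last first.
    by exists (complex.Im tau / 2) => [|e /andP[e0 e1]]; [lra|split=> //; lra].
  have [ji|ij] := ltnP j i; last first.
    exists (complex.Im tau / 2) => [|e /andP[e0 e1]]; first by lra.
    split; first by lra.
    by move=> i' j' [<- <-]; rewrite ltnNge ij.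
  have := hd _ _ ji; rewrite annulusE => /andP[h1 h2].
  set u := complex.Re _ in h1 h2; set c := 2 * pi * _ in h1.
  pose m := Num.min (complex.Im tau) (Num.min (- u) (u + c)).
  have m0 : 0 < m by rewrite !lt_min t0 /=; apply/andP; split; lra.
  have m1 : m <= complex.Im tau by rewrite ge_min lexx.
  have m2 : m <= - u by rewrite ge_min; apply/orP; right; rewrite ge_min lexx.
  have m3 : m <= u + c by rewrite ge_min; apply/orP; right; rewrite ge_min lexx orbT.
  have p1 : 0 < 4 + 2 * pi :> R by lra.
  (* [m] is the smallest available margin, and e (4 + 2 pi) <= m leaves strict room for each of e, 2
     e and 2 e + 2 pi e. *)
  exists (m / (4 + 2 * pi)) => [|e /andP[e0 e1]]; first by rewrite divr_gt0.
  have e2 : e * (4 + 2 * pi) <= m by rewrite -ler_pdivlMr.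
  have e3 : 0 < pi * e by rewrite mulr_gt0.
  split; first by nra.
  by move=> i' j' [<- <-] _; rewrite -/u -/c; split; nra.
exists d => // e; split=> /=; first by rewrite subr_gt0; have [] := h None.
move=> i j ij; rewrite annulusE /=.
have [_ /(_ i j erefl ij)[h1 h2]] := h (Some (i, j)).
rewrite !mxE; move: h1 h2; rewrite !raddfB /= !raddfD /=.
by case: (e i); case: (e j) => h1 h2; apply/andP; split; lra.
Qed.

Lemma fock_weight_ge0 (l : fock_index) : 0 <= wt l.
Proof. by rewrite fock_weightE divr_ge0. Qed.

(* Since [expR (d * `|s|) <= expR (d * s) + expR (- d * s)], the terms near a point are dominated
   by the sum of the absolute values of the terms at finitely many shifted points. *)
Lemma locdom_fock J z0 tau0 : npoint_domain z0 tau0 ->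
  locdom (fun z tau => term (fun a => fk (J a)) z tau) z0 tau0.
Proof.
move=> hd; have [d d0 hs] := domain_shift hd.
(* |q^(-1/48)| grows with Im tau, which may exceed that of the comparison point [t'] by up to 2 d;
   [E0] pays for this. *)
pose E0 : R := expR (2 * pi * 48%:R^-1 * (2 * d)).
pose t' : C := 0 +i* (complex.Im tau0 - d).
pose B x : R := E0 * \sum_e nc (term (fun a => fk (J a)) (shiftz z0 d e) t' x).
have S0 x : 0 <= \sum_e nc (term (fun a => fk (J a)) (shiftz z0 d e) t' x).
  by apply: sumr_ge0 => e _; apply: nc_ge0.
exists d, B; split=> //.
- by move=> x; rewrite mulr_ge0 ?expR_ge0.
- rewrite (eq_es (b := fun x => E0%:E * \sum_(e <- enum {ffun 'I_n -> bool})
      (nc (term (fun a => fk (J a)) (shiftz z0 d e) t' x))%:E)%E) => [|x]; last first.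
    by rewrite /B EFinM sumEFin big_enum.
  rewrite es_Zl ?expR_ge0// => [|x]; last by apply: sume_ge0 => e _; rewrite lee_fin nc_ge0.
  rewrite lte_mul_pinfty ?lee_fin ?expR_ge0// es_sum => [|x e]; last by rewrite lee_fin nc_ge0.
  by rewrite lte_sum_pinfty// => e _; apply: (npoint_summ _ (hs e)).
move=> z tau hz ht x; rewrite /B.
under eq_bigr do rewrite nc_term_fock.
rewrite nc_term_fock -mulr_suml -mulr_sumr.
have Re_near a : - d < complex.Re (z 0 a) - complex.Re (z0 0 a) < d.
  have := nc_Re_le (z 0 a - z0 0 a); have := hz a; rewrite raddfB /=.
  by rewrite ler_norml => ? /andP[? ?]; apply/andP; split; lra.
have Im_near : - d < complex.Im tau - complex.Im tau0 < d.
  have := nc_Im_le (tau - tau0); rewrite raddfB /=.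
  by rewrite ler_norml => /andP[? ?]; apply/andP; split; lra.
have h1 : \prod_(a < n) expR (expo J x a * complex.Re (z 0 a)) <=
    \sum_e \prod_(a < n) expR (expo J x a * complex.Re (shiftz z0 d e 0 a)).
  rewrite (eq_bigr (fun e : {ffun 'I_n -> bool} => \prod_(a < n)
     expR (expo J x a * (complex.Re (z0 0 a) + (if e a then d else - d))))) => [|e _]; last first.
    by apply: eq_bigr => a _; rewrite mxE raddfD.
  rewrite -(bigA_distr_bigA (fun (a : 'I_n) (b : bool) =>
     expR (expo J x a * (complex.Re (z0 0 a) + (if b then d else - d))))).
  apply: ler_prod => a _; rewrite expR_ge0 /= big_bool /=.
  have /andP[r1 r2] := Re_near a; have [s0|s0] := leP 0 (expo J x a).
    by apply: ler_wpDr; rewrite ?expR_ge0// ler_expR ler_wpM2l//; lra.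
  by apply: ler_wpDl; rewrite ?expR_ge0// ler_expR ler_wnM2l ?(ltW s0)//; lra.
have h2 : expR (- (2 * pi * (wt x.2 - 48%:R^-1)) * complex.Im tau) <=
    E0 * expR (- (2 * pi * (wt x.2 - 48%:R^-1)) * complex.Im t').
  rewrite /E0 -expRD ler_expR /=; have w0 := fock_weight_ge0 x.2; have pi0 := pi_gt0 R.
  have /andP[i1 i2] := Im_near; move: (wt x.2) w0 => w w0.
  have : 0 <= w * pi * (complex.Im tau - (complex.Im tau0 - d)) by rewrite !mulr_ge0 ?(ltW pi0)//; lra.
  have : 0 <= 48%:R^-1 * pi * (complex.Im tau0 + d - complex.Im tau).
    by rewrite !mulr_ge0 ?(ltW pi0)//; lra.
  move: (48%:R^-1 : R) => k48; lra.
have P0 : 0 <= \prod_(a < n) expR (expo J x a * complex.Re (z 0 a)).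
  by apply: prodr_ge0 => a _; apply: expR_ge0.
rewrite (_ : forall a b c e : R, a * (b * c * e) = b * c * (a * e)); last by move=> *; ring.
apply: ler_pM; rewrite ?mulr_ge0 ?nc_ge0 ?expR_ge0//.
by rewrite ler_wpM2l ?nc_ge0.
Qed.

Lemma hsan_fock J z0 tau0 : npoint_domain z0 tau0 ->
  hsan (fun z => npoint psi g (fun a => fk (J a)) z tau0) z0.
Proof.
move=> hd; have [d [B [d0 B0 sB hB]]] := locdom_fock J hd.
have d2 : 0 < d / 2 by lra.
pose c x := kcoef J x * qpow tau0 (wt x.2 - 48%:R^-1).
have e x z : term (fun a => fk (J a)) z tau0 x = c x * \prod_(a < n) cexp ((expo J x a)%:C * z 0 a).
  by rewrite term_fock mulrAC.
apply: hsan_eq (hsan_exp (c := c) (s := expo J) (d := d / 2) (z := z0) d2 _).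
  by exists 1 => // w _; apply: eq_sum => x; rewrite e.
apply: le_lt_trans sB; apply: le_es => x; rewrite lee_fin.
(* Moving each coordinate by d/2 in the direction of the sign of its exponent produces exactly the
   factor exp(d/2 |s|), so the local bound at this point gives the summability required by
   [hsan_exp]. *)
pose z : 'rV[C]_n := \row_a (z0 0 a + (if 0 <= expo J x a then d / 2 else - (d / 2))%:C).
have hz a : nc (z 0 a - z0 0 a) < d.
  rewrite mxE [z0 0 a + _]addrC addrK nc_real; case: ifP => _; rewrite ?normrN gtr0_norm//; lra.
have := hB z tau0 hz; rewrite subrr nc0 => /(_ d0 x); rewrite e; apply: le_trans.
rewrite -mulrA ncM [leRHS]ncM ler_wpM2l ?nc_ge0// rmorph_prod -big_split /=.
rewrite le_eqVlt; apply/orP; left; apply/eqP; congr nc; apply: eq_bigr => a _.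
rewrite mxE mulrDr cexpD; congr (_ * _); rewrite -rmorphM /cexp /= cos0 sin0 mulr1; congr (expR _)%:C.
by case: leP => s0; [rewrite ger0_norm//|rewrite ltr0_norm//]; ring.
Qed.

Definition upd v a (w : V) : 'I_n -> V := fun b => if b == a then w else v b.

Lemma expL0_sum y (I : Type) (s : seq I) (c : I -> C) (w : I -> V) :
  expL0 psi y (\sum_(j <- s) c j *: w j) = \sum_(j <- s) c j *: expL0 psi y (w j).
Proof.
apply: (coord_ext fermion) => l; rewrite (coord_expL0 fermion) !(coord_sum fermion) mulr_suml.
by apply: eq_bigr => j _; rewrite !(coordZ fermion) (coord_expL0 fermion) [RHS]mulrA.
Qed.

Lemma term_lin (I : Type) (s : seq I) (c : I -> C) (w : I -> V) v a z tau x :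
  v a = \sum_(j <- s) c j *: w j ->
  term v z tau x = \sum_(j <- s) c j * term (upd v a (w j)) z tau x.
Proof.
move=> va; pose F u := foldr (fun b y => mode (expL0 psi (z 0 b) (u b)) (x.1 b) y) (fk x.2).
have tE u : term u z tau x = (- theta) ^+ size (val x.2) * coord (F u (enum 'I_n)) x.2
    * qpow tau (wt x.2 - 48%:R^-1) * \prod_(a < n) cexp (z 0 a) ^ (- x.1 a - 1).
  by rewrite /npoint_term (str_termE fermion tau g_theta
    (fun y => foldr (fun b y => mode (expL0 psi (z 0 b) (u b)) (x.1 b) y) y (enum 'I_n))).
rewrite tE; under [RHS]eq_bigr do rewrite tE.
have Fn u y l : a \notin l -> F (upd u a y) l = F u l.
  elim: l => [|b l IH] //=; rewrite inE negb_or => /andP[ab al]; rewrite /F /= -!/(F _ _) IH//.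
  by rewrite /upd eq_sym (negbTE ab).
have FE l : uniq l -> a \in l -> F v l = \sum_(j <- s) c j *: F (upd v a (w j)) l.
  elim: l => [|b l IH] //= /andP[bl ul]; rewrite inE.
  have [e _|ab /= al] := eqVneq a b.
    subst b; rewrite va expL0_sum (mode_suml fermion); apply: eq_bigr => j _.
    by rewrite (modeZl fermion) Fn// /upd eqxx.
  rewrite IH// (mode_sumr fermion); apply: eq_bigr => j _.
  by rewrite (modeZr fermion) /upd eq_sym (negbTE ab).
rewrite (FE _ (enum_uniq _) (mem_enum _ _)) (coord_sum fermion) mulr_sumr !mulr_suml.
apply: eq_bigr => j _; rewrite (coordZ fermion).
move: (\prod_(b < n) _) (coord _ _) (qpow _ _) (_ ^+ _) => P y Q A.
by ring.
Qed.

(** Multilinearity reduces to basis vectors one slot at a time; [l] in the induction lists the slots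
    that may still hold arbitrary vectors. *)
Lemma regular v z0 tau0 : npoint_domain z0 tau0 ->
  locdom (fun z tau => term v z tau) z0 tau0 /\ hsan (fun z => npoint psi g v z tau0) z0.
Proof.
move=> hd; suff h (l : seq 'I_n) u : (forall a, a \notin l -> exists j : fock_index, u a = fk j) ->
    locdom (fun z tau => term u z tau) z0 tau0 /\ hsan (fun z => npoint psi g u z tau0) z0.
  by apply: (h (enum 'I_n)) => a; rewrite mem_enum.
elim: l u => [|a l IH] u hu.
  have [J uJ] : exists J, u = fun a => fk (J a).
    by have /choice[J hJ] := fun a => hu a isT; exists J; apply/funext.
  by rewrite uJ; split; [exact: locdom_fock|exact: hsan_fock].
have [s [_ ua]] := coordE fermion (u a).
have hj (j : fock_index) := IH (upd u a (fk j)) (ltac:(move=> b bl; rewrite /upd;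
  case: eqVneq => [_|ba]; [by exists j|by apply: hu; rewrite inE negb_or ba])).
have t1 : locdom (fun z tau => term u z tau) z0 tau0.
  apply: locdom_eq (locdom_sum s (fun j => locdomZ (coord (u a) j) (hj j).1)) => z tau x /=.
  by rewrite (term_lin _ _ _ ua).
split=> //; apply: hsan_eq (hsan_sum s (fun j => hsanZ (coord (u a) j) (hj j).2)).
have near_j : nearV z0 (fun z => forall j, j \in enum_fset s -> summ (term (upd u a (fk j)) z tau0)).
  elim: (enum_fset s) => [|j s' IHs]; first by exists 1.
  apply: nearV2 (locdom_summ (hj j).1) IHs => z h1 h2 i; rewrite inE => /orP[/eqP ->|] //.
  exact: h2.
case: near_j => d d0 h; exists d => // z /h hz; rewrite /npoint.
rewrite (eq_sum (v := fun x => \sum_(j <- s) coord (u a) j * term (upd u a (fk j)) z tau0 x)) => [|x].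
  rewrite (sum_sumr_in (fun j js => summZ (coord (u a) j) (hz j js))).
  by apply: eq_big_seq => j js; rewrite sumZ//; apply: hz.
exact: (term_lin _ _ _ ua).
Qed.

End Regularity.

Theorem proposition5p3 (R : realType) (V : vosa_data R) (psi : V)
    (fermion : rank_one_fermion psi)
    (g : V -> V) (theta : R[i])
    (g_theta : g = idfun /\ theta = 1 \/ g = sigma V /\ theta = -1)
    (n : nat) (k : 'I_n -> seq nat) (k_incr : forall a, path ltn 0%N (k a)) :
  let Psi a := sqfock psi (k a) in
  let F z tau := npoint psi g Psi z tau in
  let M z tau := pf_matrix theta (-1) k z tau in
  [/\ forall z tau, npoint_domain z tau -> (M z tau)^T = - M z tau,
      forall z tau, npoint_domain z tau -> F z tau =
        if odd (\sum_(a < n) size (k a)) then 0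
        else Pfaffian (M z tau) * Zfun psi g tau,
      forall z tau, npoint_domain z tau -> analytic_at (fun z' => F z' tau) z
    & forall K : set ('rV[R[i]]_n * R[i]), compact K -> K `<=` [set x | npoint_domain x.1 x.2] ->
        abs_unif_summable_on (fun x => npoint_term psi g Psi x.1 x.2) K].
Proof.
have theta_sq : theta ^+ 2 = 1 by case: g_theta => -[_ ->]; rewrite ?sqrrN expr1n.
move=> Psi F M; split.
- move=> z tau hd; exact: (pf_matrix_tr theta_sq hd.1 k_incr hd).
- move=> z tau hd; rewrite /F (npoint_pf fermion theta_sq hd.1 g_theta k_incr hd).
  by case: ifP => // /negbT od; rewrite (Pfaffian_pf_matrix theta_sq hd.1 k_incr hd od).
- move=> z tau hd; apply: hsan_analytic.
  exact: (regular fermion theta_sq g_theta Psi hd).2.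
- move=> K cK KD; apply: (locdom_unif (t := fun z tau => npoint_term psi g Psi z tau)) => // x /KD hd.
  exact: (regular fermion theta_sq g_theta Psi hd).1.
Qed.
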